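(* Consider the optimal stopping problem and standing assumptions described in the context, including the local regularity Assumption (A). Let $T_1\in(0,T)$. If the optimal boundary $t\mapsto b(t)$ is Lipschitz continuous on $[0,T_1]$, then it is continuously differentiable on $[0,T_1)$.
   Context: **Problem.** Let $(\Omega,\mathcal F,\mathsf P)$ be a complete probability space carrying a standard one-dimensional Brownian motion $(B_t)_{t\ge 0}$, let $T\in(0,\infty]$ (if $T=\infty$, the intervals $[0,T]$, $[t,T]$ are read as $[0,\infty)$, $[t,\infty)$), and let $\mathcal I\subseteq\mathbb R$ be an open, possibly unbounded interval. Given $\mu:[0,T]\times\mathcal I\to\mathbb R$ and $\sigma:\mathcal I\to(0,\infty)$, for every $(t,x)\in[0,T]\times\mathcal I$ the process $X=X^{t,x}$ is the (assumed) unique strong solution of $$X_s=x+\int_t^s\mu(u,X_u)\,du+\int_t^s\sigma(X_u)\,dB_u,\quad s\in[t,T];$$ the behaviour of $X$ at the endpoints of $\mathcal I$ is not specified. Write $\mathsf E_{t,x}[\cdot]=\mathsf E[\cdot\,|X_t=x]$. Let $r,g:[0,T]\times\mathbb R\to\mathbb R$ be continuous and $$v(t,x)=\sup_{0\le\tau\le T-t}\mathsf E_{t,x}\Big[e^{-\int_0^\tau r(t+s,X_{t+s})ds}g(t+\tau,X_{t+\tau})\Big],$$ the supremum being over stopping times of the filtration of $(X_{t+s})_{s\in[0,T-t]}$. The problem is assumed well posed with $v$ continuous, and there is a continuous function $b:[0,T]\to\mathcal I$ such that $\tau_*^{t,x}=\inf\{s\in[0,T-t):X^{t,x}_{t+s}\le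 b(t+s)\}\wedge(T-t)$ is optimal and the continuation set is $\mathcal C:=\{(t,x)\in[0,T)\times\mathcal I:v(t,x)>g(t,x)\}=\{(t,x)\in[0,T)\times\mathcal I:x>b(t)\}$. **Notation.** $(\mathcal L\varphi)(t,x)=\tfrac12\sigma^2(x)\varphi_{xx}(t,x)+\mu(t,x)\varphi_x(t,x)$; a dot denotes the time derivative. $\overline A$ is the closure of $A$ relative to $[0,T]\times\mathcal I$; $C^{j,k}(\overline A)$ is the set of functions that are $j$ times continuously differentiable in $t$ and $k$ times in $x$ in $A$, with all these derivatives extending continuously to $\overline A$. **Assumption (A).** For each $t_0\in[0,T)$ there is a rectangle $\mathcal R=\mathcal R(t_0)$, open relative to $[0,T)\times\mathcal I$, with $\overline{\mathcal R}\subset[0,T)\times\mathcal I$ and $(t_0,b(t_0))\in\mathcal R$, such that: (i) $v$ is continuously differentiable in time and space in $\overline{\mathcal R}$ (also across the boundary $b$); (ii) $g\in C^{1,2}(\overline{\mathcal R})$, $\dot g\in C^{1,2}(\overline{\mathcal R})$ and $h(t,x):=\dot g(t,x)+(\mathcal Lg)(t,x)-r(t,x)g(t,x)<0$ for $(t,x)\in\overline{\mathcal R}$; (iii) in $\overline{\mathcal R}$ the functions $\mu$ and $r$ are continuously differentiable with $\alpha$-Hölder continuous derivatives for some $\alpha\in(0,1)$; (iv) in $\overline{\mathcal R}$ the function $\sigma$ is continuously differentiable with $\sigma_x$ Lipschitz continuous, and $\sigma(x)\ge c_{\mathcal R}>0$ for $(t,x)\in\overline{\mathcal R}$. *)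

(* Defs.v *)
From HB Require Import structures.
From mathcomp Require Import all_boot all_order all_algebra.
From mathcomp Require Import all_classical all_reals all_analysis.
From mathcomp Require Import measurable_realfun.

Set Implicit Arguments.
Unset Strict Implicit.
Unset Printing Implicit Defensive.

Import Order.TTheory GRing.Theory Num.Theory.
Import numFieldNormedType.Exports.

Local Open Scope classical_set_scope.
Local Open Scope ring_scope.

(* For T = +oo both sets are [0, +oo[. *)
Definition times (R : realType) (T : \bar R) : set R :=
  [set t | 0 <= t /\ (t%:E <= T)%E].

Definition times_before (R : realType) (T : \bar R) : set R :=
  [set t | 0 <= t /\ (t%:E < T)%E].

(** * Filtrations, Brownian motion, stopping times *)

(* The natural filtration of (Z_u)_{u >= t0}, augmented with the null sets. *)
Definition natural_filtration d (Omega : measurableType d) (R : realType)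
    (P : probability Omega R) (Z : R -> Omega -> R) (t0 s : R) :
    set (set Omega) :=
  <<s [set E | (exists u (A : set R),
                  [/\ t0 <= u, u <= s, measurable A & E = Z u @^-1` A])
               \/ (measurable E /\ P E = 0%E)] >>.

Definition rv_wrt (Omega : Type) (R : realType) (G : set (set Omega))
    (Y : Omega -> R) : Prop :=
  forall A : set R, measurable A -> G (Y @^-1` A).

Definition brownian_motion d (Omega : measurableType d) (R : realType)
    (P : probability Omega R) (B : R -> Omega -> R) : Prop :=
  [/\ (forall t, 0 <= t -> measurable_fun setT (B t)),
      {ae P, forall w, B 0 w = 0},
      (forall w, {within `[0, +oo[, continuous (fun t => B t w)}),
      (forall s t (A : set R), 0 <= s -> s < t -> measurable A ->
         P ((fun w => B t w - B s w) @^-1` A)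
         = normal_prob 0 (Num.sqrt (t - s)) A)
    & (forall s t (E : set Omega) (A : set R), 0 <= s -> s < t ->
         natural_filtration P B 0 s E -> measurable A ->
         P (E `&` (fun w => B t w - B s w) @^-1` A)
         = (P E * P ((fun w => (B t w - B s w)%R) @^-1` A))%E)].

(* [G s] is the information available s time units after the starting date;
   only the values of s in [D] are meaningful. *)
Definition stopping_time (Omega : Type) (R : realType)
    (G : R -> set (set Omega)) (D : set R) (tau : Omega -> \bar R) : Prop :=
  forall s, D s -> G s [set w | (tau w <= s%:E)%E].

(** * The Itô integral with respect to Brownian motion *)

Definition cvg_in_prob0 d (Omega : measurableType d) (R : realType)
    (P : probability Omega R) (Y : nat -> Omega -> \bar R) : Prop :=
  forall e : R, 0 < e ->
    (fun n => P [set w | (e%:E <= Y n w)%E]) @ \oo --> 0%E.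

(* The simple process
     H_u = \sum_(k < n) xi_k 1_{tau_k < u <= tau_(k+1)}   on [t, s]. *)
Record simple_process (Omega : Type) (R : realType) := SimpleProcess {
  sp_size : nat;
  sp_time : nat -> R;
  sp_coef : nat -> Omega -> R }.

Definition simple_adapted (Omega : Type) (R : realType)
    (F : R -> set (set Omega)) (t s : R) (S : simple_process Omega R) : Prop :=
  [/\ sp_time S 0%N = t,
      sp_time S (sp_size S) = s,
      (forall k, (k < sp_size S)%N -> sp_time S k <= sp_time S k.+1),
      (forall k, (k < sp_size S)%N -> rv_wrt (F (sp_time S k)) (sp_coef S k))
    & (forall k, (k < sp_size S)%N ->
         exists M : R, forall w, `|sp_coef S k w| <= M)].

Definition simple_val (Omega : Type) (R : realType)
    (S : simple_process Omega R) (u : R) (w : Omega) : R :=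
  \sum_(k < sp_size S)
    sp_coef S k w * \1_(`]sp_time S k, sp_time S k.+1]) u.

Definition simple_int (Omega : Type) (R : realType) (B : R -> Omega -> R)
    (S : simple_process Omega R) (w : Omega) : R :=
  \sum_(k < sp_size S) sp_coef S k w * (B (sp_time S k.+1) w - B (sp_time S k) w).

(* The random variable [J] is (a version of) \int_t^s H_u dB_u, for H
   measurable, adapted, with \int_t^s H_u^2 du < +oo almost surely. *)
Definition is_ito_integral d (Omega : measurableType d) (R : realType)
    (P : probability Omega R) (B : R -> Omega -> R) (t s : R)
    (H : R -> Omega -> R) (J : Omega -> R) : Prop :=
  let F := natural_filtration P B 0 in
  [/\ measurable_fun (`[t, s] `*` [set: Omega])
        (fun p : R * Omega => H p.1 p.2),
      (forall u, t <= u <= s -> rv_wrt (F u) (H u)),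
      {ae P, forall w,
        (\int[lebesgue_measure]_(u in `[t, s]) (H u w ^+ 2)%:E < +oo)%E}
    & exists S : nat -> simple_process Omega R,
        [/\ (forall n, simple_adapted F t s (S n)),
            cvg_in_prob0 P (fun n w =>
              \int[lebesgue_measure]_(u in `[t, s])
                 ((simple_val (S n) u w - H u w) ^+ 2)%:E)%E
          & cvg_in_prob0 P (fun n w => `|simple_int B (S n) w - J w|%:E)]].

(** * The stochastic differential equation *)

(* First exit time of Y from ]a, c[ after t, capped at s. *)
Definition exit_time (Omega : Type) (R : realType) (Y : R -> Omega -> R)
    (a c t s : R) (w : Omega) : R :=
  inf [set u | u = s \/ (t <= u <= s /\ ~ (a < Y u w < c))].

(* [Y] is a strong solution on [t, T] of
     dY = mu(s, Y) ds + sigma(Y) dB,  Y_t = x.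
   The coefficients only make sense on I, so the equation is required up to the
   exit time from each ]a, c[ with [a, c] included in I; if Y never leaves I
   this is the equation on [t, T], otherwise nothing is imposed on Y, beyond
   continuity and adaptedness, once it has reached an endpoint of I. *)
Definition strong_solution d (Omega : measurableType d) (R : realType)
    (P : probability Omega R) (B : R -> Omega -> R) (T : \bar R) (I : set R)
    (mu : R * R -> R) (sigma : R -> R) (t x : R) (Y : R -> Omega -> R) : Prop :=
  [/\ (forall w, {within [set s | t <= s /\ (s%:E <= T)%E],
                    continuous (fun s => Y s w)}),
      (forall s, t <= s -> (s%:E <= T)%E ->
         rv_wrt (natural_filtration P B 0 s) (Y s)),
      {ae P, forall w, Y t w = x}
    & forall a c s, I a -> I c -> a < x < c -> t <= s -> (s%:E <= T)%E ->
        let zeta := exit_time Y a c t s in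
        {ae P, forall w, lebesgue_measure.-integrable `[t, zeta w]
                           (fun u => (mu (u, Y u w))%:E)} /\
        is_ito_integral P B t s
          (fun u w => if u < zeta w then sigma (Y u w) else 0)
          (fun w => Y (zeta w) w - x
             - \int[lebesgue_measure]_(u in `[t, zeta w]) mu (u, Y u w))].

Definition unique_strong_solution d (Omega : measurableType d) (R : realType)
    (P : probability Omega R) (B : R -> Omega -> R) (T : \bar R) (I : set R)
    (mu : R * R -> R) (sigma : R -> R) (t x : R) (Y : R -> Omega -> R) : Prop :=
  strong_solution P B T I mu sigma t x Y /\
  forall Z, strong_solution P B T I mu sigma t x Z ->
    {ae P, forall w, forall s, t <= s -> (s%:E <= T)%E ->
       (forall u, t <= u < s -> I (Y u w)) -> Z s w = Y s w}.

(* [X t x s w] is X^{t,x}_s(w).  The family satisfies the Markov property as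
   long as it is in I: given the past up to u, on {X^{t,x}_u = y} with y in I,
   the future is distributed as X^{u,y}.  (Stated on finite-dimensional
   cylinders [/\_i X_{s_i} \in A_i].) *)
Definition cylinder (Omega : Type) (R : realType) (Y : R -> Omega -> R)
    (n : nat) (s : 'I_n -> R) (A : 'I_n -> set R) : set Omega :=
  [set w | forall i, A i (Y (s i) w)].

Definition markov_family d (Omega : measurableType d) (R : realType)
    (P : probability Omega R) (T : \bar R) (I : set R)
    (X : R -> R -> R -> Omega -> R) : Prop :=
  forall (u : R) (n : nat) (s : 'I_n -> R) (A : 'I_n -> set R),
    times T u -> (forall i, u <= s i /\ ((s i)%:E <= T)%E) ->
    (forall i, measurable (A i)) ->
    measurable_fun I (fun y => P (cylinder (X u y) s A)) /\
    forall t x (E : set Omega), 0 <= t -> t <= u -> I x ->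
      natural_filtration P (X t x) t u E ->
      P (E `&` (X t x u @^-1` I) `&` cylinder (X t x) s A)
      = (\int[P]_(w in E `&` (X t x u @^-1` I))
           P (cylinder (X u (X t x u w)) s A))%E.

(** * The optimal stopping problem *)

(* [tau] is measured from the starting date t.  When T = +oo the horizon
   [0, T - t] is [0, +oo[, so that admissible times are finite. *)
Definition admissible d (Omega : measurableType d) (R : realType)
    (P : probability Omega R) (T : \bar R) (X : R -> R -> R -> Omega -> R)
    (t x : R) (tau : Omega -> \bar R) : Prop :=
  stopping_time (fun s => natural_filtration P (X t x) t (t + s))
    [set s | 0 <= s /\ ((t + s)%:E <= T)%E] tau /\
  {ae P, forall w, [/\ (0 <= tau w)%E, (tau w <= T - t%:E)%E
                     & (tau w < +oo)%E]}.

Definition payoff (Omega : Type) (R : realType) (r g : R * R -> R)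
    (X : R -> R -> R -> Omega -> R) (t x : R) (tau : Omega -> \bar R)
    (w : Omega) : R :=
  let s := fine (tau w) in
  expR (- \int[lebesgue_measure]_(u in `[0, s]) r (t + u, X t x (t + u) w))
  * g (t + s, X t x (t + s) w).

Definition evalue d (Omega : measurableType d) (R : realType)
    (P : probability Omega R) (T : \bar R) (r g : R * R -> R)
    (X : R -> R -> R -> Omega -> R) (t x : R) : \bar R :=
  ereal_sup [set ('E_P[payoff r g X t x tau])%E | tau in admissible P T X t x].

Definition value d (Omega : measurableType d) (R : realType)
    (P : probability Omega R) (T : \bar R) (r g : R * R -> R)
    (X : R -> R -> R -> Omega -> R) (p : R * R) : R :=
  fine (evalue P T r g X p.1 p.2).

(* All expectations are meaningful and their supremum is finite. *)
Definition well_posed d (Omega : measurableType d) (R : realType)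
    (P : probability Omega R) (T : \bar R) (I : set R) (r g : R * R -> R)
    (X : R -> R -> R -> Omega -> R) : Prop :=
  forall t x, times T t -> I x ->
    evalue P T r g X t x \is a fin_num /\
    forall tau, admissible P T X t x tau ->
      (\int[P]_w (Num.max (payoff r g X t x tau w) 0)%:E < +oo)%E \/
      (\int[P]_w (Num.max (- payoff r g X t x tau w) 0)%:E < +oo)%E.

Definition optimal d (Omega : measurableType d) (R : realType)
    (P : probability Omega R) (T : \bar R) (r g : R * R -> R)
    (X : R -> R -> R -> Omega -> R) (t x : R) (tau : Omega -> \bar R) : Prop :=
  admissible P T X t x tau /\
  ('E_P[payoff r g X t x tau] = evalue P T r g X t x)%E.

Definition tau_star (Omega : Type) (R : realType) (T : \bar R) (b : R -> R)
    (X : R -> R -> R -> Omega -> R) (t x : R) (w : Omega) : \bar R :=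
  mine (ereal_inf [set s%:E | s in [set s | [/\ 0 <= s, ((t + s)%:E < T)%E
                                             & X t x (t + s) w <= b (t + s)]]])
       (T - t%:E)%E.

(** * Regularity *)

(* l is the derivative of f at x relative to D (one-sided if D is so at x). *)
Definition is_derive_within (R : realType) (D : set R) (f : R -> R)
    (x l : R) : Prop :=
  (fun h : R => h^-1 * (f (x + h) - f x))
    @ within [set h | D (x + h)] (0 : R)^' --> l.

Definition is_dt (R : realType) (A : set (R * R)) (f : R * R -> R)
    (p : R * R) (l : R) : Prop :=
  is_derive_within [set t | A (t, p.2)] (fun t => f (t, p.2)) p.1 l.

Definition is_dx (R : realType) (A : set (R * R)) (f : R * R -> R)
    (p : R * R) (l : R) : Prop :=
  is_derive_within [set x | A (p.1, x)] (fun x => f (p.1, x)) p.2 l.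

Definition rel_closure (R : realType) (T : \bar R) (I : set R)
    (A : set (R * R)) : set (R * R) :=
  closure A `&` (times T `*` I).

(* f is in C^{j,k} of the relative closure of A; there, [ft i] and [fx i] are
   the continuous extensions of the i-th derivatives of f in t and in x. *)
Definition Cjk (R : realType) (T : \bar R) (I : set R) (A : set (R * R))
    (j k : nat) (f : R * R -> R) (ft fx : nat -> R * R -> R) : Prop :=
  let cA := rel_closure T I A in
  [/\ (forall p, cA p -> ft 0%N p = f p /\ fx 0%N p = f p),
      (forall i p, (i < j)%N -> A p -> is_dt A (ft i) p (ft i.+1 p)),
      (forall i p, (i < k)%N -> A p -> is_dx A (fx i) p (fx i.+1 p)),
      (forall i, (i <= j)%N -> {within cA, continuous (ft i)})
    & (forall i, (i <= k)%N -> {within cA, continuous (fx i)})].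

Definition holder_on (R : realType) (alpha : R) (A : set (R * R))
    (f : R * R -> R) : Prop :=
  exists C : R, forall p q, A p -> A q -> `|f p - f q| <= C * `|p - q| `^ alpha.

Definition rel_open_rectangle (R : realType) (T : \bar R) (I : set R)
    (A : set (R * R)) : Prop :=
  (exists J K : set R, [/\ is_interval J, is_interval K & A = J `*` K]) /\
  (exists U : set (R * R), open U /\ A = U `&` (times_before T `*` I)).

Definition assumption_A (R : realType) (T : \bar R) (I : set R)
    (mu : R * R -> R) (sigma : R -> R) (r g v : R * R -> R) (b : R -> R) : Prop :=
  forall t0, times_before T t0 ->
  exists A : set (R * R),
    let cA := rel_closure T I A in
    [/\ rel_open_rectangle T I A, cA `<=` times_before T `*` I & A (t0, b t0)] /\
    [/\ (exists vt vx, Cjk T I A 1 1 v vt vx),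
        (exists gt gx,
           [/\ Cjk T I A 1 2 g gt gx,
               (exists gtt gtx, Cjk T I A 1 2 (gt 1%N) gtt gtx)
             & forall p, cA p ->
                 gt 1%N p + (2^-1 * sigma p.2 ^+ 2 * gx 2%N p + mu p * gx 1%N p)
                 - r p * g p < 0]),
        (exists (alpha : R) mut mux rt rx,
           [/\ 0 < alpha < 1,
               Cjk T I A 1 1 mu mut mux, Cjk T I A 1 1 r rt rx
             & [/\ holder_on alpha cA (mut 1%N), holder_on alpha cA (mux 1%N),
                   holder_on alpha cA (rt 1%N) & holder_on alpha cA (rx 1%N)]])
      & (exists st sx,
           [/\ Cjk T I A 1 1 (fun p => sigma p.2) st sx,
               (exists L : R, L.-lipschitz_cA (sx 1%N))
             & exists c : R, 0 < c /\ forall p, cA p -> c <= sigma p.2])].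

Definition C1_on (R : realType) (D : set R) (f : R -> R) : Prop :=
  exists f' : R -> R,
    (forall t, D t -> is_derive_within D f t (f' t)) /\
    {within D, continuous f'}.

(* Main.v *)
Require Import Defs.
From mathcomp Require Import all_boot all_order all_algebra.
From mathcomp Require Import all_classical all_reals all_analysis.
From mathcomp Require Import measurable_realfun.
From mathcomp Require Import ring lra.
Import Order.TTheory GRing.Theory Num.Theory.
Import numFieldNormedType.Exports.
Import HBNNSimple.
Local Open Scope classical_set_scope.
Local Open Scope ring_scope.
Set Implicit Arguments.
Unset Strict Implicit.
Unset Printing Implicit Defensive.

(** Optional stopping along [tau_star] and Ito's formula show that the value function,
    wherever it is touched by a second-order parabola above the boundary, satisfies the
    backward equation in the viscosity sense; since its first derivatives are
    continuous, v_xx exists there and is the continuous function that the equation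
    prescribes. So U = v - g solves U_t + L U - r U = - h above the boundary, and U_x,
    U_t vanish on it.

    The scale S(x) = int dx / sigma turns the equation into Y_t + Y_yy / 2 + m Y_y = - k.
    Test it against the time derivative of the space derivative of a heat kernel
    whose pole lies at distance eps below (t, b(t)). Only one term sees the motion of
    the boundary: h(t, b(t)) times an integral of the increments S(b(t + s)) - S(b(t))
    concentrated on s of order eps^2. The other terms are continuous in t up to an error
    that is small uniformly in eps, since b is Lipschitz and U, U_x are of parabolic
    size near the boundary. As h < 0, slopes of b over short intervals near t are
    therefore close to one another, and a function all of whose short slopes are
    uniformly close is continuously differentiable. *)

(** * Processes with measurable versions *)

(** The kernel weighs increments of b with a total mass of order one whatever eps is, so every other
    term must be small uniformly in eps, not merely bounded relative to it. Three choices achieve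
    this. The unknown is multiplied by an exponential of the scale that cancels the drift at the
    pole, so that the drift left over multiplies U_x by a coefficient vanishing there. The pairing
    is compensated by an integral of h against the kernel over a fixed interval, which removes the
    most singular part of the source. And the square root q of time is the variable: a Lipschitz
    boundary moves by q^2 while the kernel lives on the scale q, and the dominating functions become
    derivatives of arctangents, whose increments are at most pi for every eps. On the probabilistic
    side parabolas are the only test functions, so Ito's formula is needed for quadratic polynomials
    alone. There it reduces to the first two moments of a stochastic integral, and these are read
    off the expansion of exponential martingales. *)

Definition step (R : realType) (n : nat) (u : R) : R :=
  (Num.floor (u * n.+1%:R))%:~R / n.+1%:R.

Lemma step_cvg (R : realType) (u : R) : step n u @[n --> \oo] --> u.
Proof.
apply/cvgrPdist_le => e e0.
have [N hN] : exists N : nat, e^-1 <= N%:R.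
  by exists (Num.truncn e^-1).+1; apply/ltW; rewrite truncnS_gt.
near=> n.
have n0 : (0 : R) < n.+1%:R by rewrite ltr0n.
have := floor_itv (u * n.+1%:R) => /andP[f1 f2].
rewrite /step ler_norml.
have -> : u - (Num.floor (u * n.+1%:R))%:~R / n.+1%:R = (u * n.+1%:R - (Num.floor (u * n.+1%:R))%:~R) / n.+1%:R.
  by field; rewrite gt_eqF.
have en : 1 / n.+1%:R <= e.
  rewrite div1r -[leRHS]invrK lef_pV2 ?posrE ?invr_gt0//.
  apply: (le_trans hN); rewrite ler_nat; apply: (@leq_trans n) => //; near: n; exact: nbhs_infty_ge.
apply/andP; split.
  apply: (@le_trans _ _ 0); first lra.
  by apply: divr_ge0 => //; rewrite subr_ge0.
apply: le_trans en; rewrite ler_pM2r ?invr_gt0//.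
by rewrite lerBlDr addrC; rewrite intrD in f2; apply: ltW.
Unshelve. all: by end_near. Qed.

(** Rounded times form a countable set, so a preimage is a countable union of measurable
    rectangles. *)
Lemma measurable_step_process d (T : measurableType d) (R : realType)
    (Z : R -> T -> R) n :
  (forall u, measurable_fun setT (Z u)) ->
  measurable_fun setT (fun p : R * T => Z (step n p.1) p.2).
Proof.
move=> mZ _ A mA; rewrite setTI.
rewrite (_ : _ @^-1` _ = \bigcup_(k in [set: int])
   ([set u | Num.floor (u * n.+1%:R) = k] `*` (Z (k%:~R / n.+1%:R) @^-1` A))); last first.
  apply/seteqP; split=> [[u w] /= h|[u w] [k _ /= [<- h]]] //.
  by exists (Num.floor (u * n.+1%:R)).
apply: countable_bigcupT_measurable => [|k]; first exact: countableP.
apply: measurableX; last by rewrite -[X in measurable X]setTI; exact: mZ.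
rewrite (_ : [set _ | _] = `[k%:~R / n.+1%:R, (k + 1)%:~R / n.+1%:R[%classic).
  exact: measurable_itv.
apply/seteqP; split=> u /=; rewrite in_itv/=.
  by move=> /eqP; rewrite floor_eq ler_pdivrMr ?ltr0n// ltr_pdivlMr ?ltr0n.
rewrite ler_pdivrMr ?ltr0n// ltr_pdivlMr ?ltr0n// => h.
by apply/eqP; rewrite floor_eq.
Qed.

(* [Z] itself need not be jointly measurable, since the paths of [Z] may be
   arbitrary off the continuity points. *)
Lemma joint_version d (T : measurableType d) (R : realType) (Z : R -> T -> R) :
  (forall u, measurable_fun setT (Z u)) ->
  exists Zh : R * T -> R, measurable_fun setT Zh /\
    forall u w, {for u, continuous (fun v => Z v w)} -> Zh (u, w) = Z u w.
Proof.
move=> mZ.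
(* An upper limit is measurable whether or not the sampled values converge; at a continuity point of
   the path it is the limit. *)
exists (fun p => fine (limn_esup (fun n => (Z (step n p.1) p.2)%:E))).
split.
  apply: measurableT_comp => //.
  apply: measurable_fun_limn_esup => n; apply/measurable_EFinP.
  exact: measurable_step_process.
move=> u w cZ /=.
have h : (Z (step n u) w)%:E @[n --> \oo] --> (Z u w)%:E.
  apply: cvg_EFin; first exact: nearW.
  have := cvg_comp (fun n => step n u) (fun v => Z v w) (@step_cvg R u) cZ; exact.
by rewrite is_cvg_limn_esupE; [rewrite (cvg_lim _ h)|apply/cvg_ex; eexists; exact: h].
Qed.

Lemma within_continuous_comp (S T U : topologicalType) (D : set T) (g : S -> T)
    (f : T -> U) :
  continuous g -> (forall v, D (g v)) -> {within D, continuous f} ->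
  continuous (f \o g).
Proof.
move=> cg Dg /subspace_continuousP cf x.
have := cf _ (Dg x).
apply: cvg_trans.
move=> A /=; rewrite /nbhs/= => hA.
have := cg x _ hA; rewrite /nbhs /= /within/=.
by apply: filterS => y /=; apply; exact: Dg.
Qed.

(** * The Markov property on path space *)

(** A pi-system generating the product sigma-algebra on paths. Coordinates outside [D] are left
    free, since the process means nothing there. *)
Definition path_cylinders (R : realType) (D : set R) : set (set (R -> R)) :=
  [set C | exists n (s : 'I_n -> R) (A : 'I_n -> set R),
     [/\ forall i, D (s i), forall i, measurable (A i)
       & C = [set z | forall i, A i (z (s i))]]].

Notation paths D := (g_sigma_algebraType (path_cylinders D)).

Lemma path_cylindersI (R : realType) (D : set R) : setI_closed (path_cylinders D).
Proof.
move=> _ _ [n [s [A [hs hA ->]]]] [m [s' [A' [hs' hA' ->]]]].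
pose sp := @fintype.split n m.
exists (n + m)%N, (fun i => match sp i with inl j => s j | inr k => s' k end),
  (fun i => match sp i with inl j => A j | inr k => A' k end).
split; [by move=> i; case: sp..|].
apply/seteqP; split=> [z [h1 h2] i|z h]; first by case: sp.
split=> i; first by have := h (unsplit (inl i)); rewrite /sp unsplitK.
by have := h (unsplit (inr i)); rewrite /sp unsplitK.
Qed.

Lemma measurable_coord (R : realType) (D : set R) u :
  D u -> measurable_fun setT (fun z : paths D => z u).
Proof.
move=> Du _ A mA; rewrite setTI; apply: sub_sigma_algebra.
exists 1%N, (fun=> u), (fun=> A); split=> //.
by apply/seteqP; split=> z /= h; [move=> _|exact: (h ord0)].
Qed.

Lemma measurable_to_paths d (T : measurableType d) (R : realType) (D : set R)
    (Z : R -> T -> R) :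
  (forall u, D u -> measurable_fun setT (Z u)) ->
  measurable_fun setT (fun w => (fun v => Z v w) : paths D).
Proof.
move=> mZ; apply: (@measurability _ _ _ _ _ _ (path_cylinders D : set (set (paths D)))) => //.
move=> _ [C [n [s [A [hs hA ->]]]] <-].
rewrite setTI (_ : _ @^-1` _ = \bigcap_(i in [set: 'I_n]) (Z (s i) @^-1` A i)).
  apply: fin_bigcap_measurable => // i _.
  by rewrite -[X in measurable X]setTI; exact: mZ.
by apply/seteqP; split=> w /= h i; [move=> _; exact: h|exact: h].
Qed.

Lemma trivIset_comp_preim (S U : Type) (f : S -> U) (F : (set U)^nat) :
  trivIset setT F -> trivIset setT (fun n => f @^-1` F n).
Proof.
move=> tF i j _ _ [z [h1 h2]]; apply: tF => //.
by exists (f z).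
Qed.

Section markov.
Variables (R : realType) (d : measure_display) (Omega : measurableType d)
  (P : probability Omega R) (T : \bar R) (I : set R) (X : R -> R -> R -> Omega -> R).
Hypothesis mI : measurable I.
Hypothesis mX : forall t x v, 0 <= t -> I x -> t <= v -> (v%:E <= T)%E ->
  measurable_fun setT (X t x v).
Hypothesis hM : markov_family P T I X.
Variables (u : R) (hu : times T u).
Let D : set R := [set v | u <= v /\ (v%:E <= T)%E].
Let u0 : 0 <= u. Proof. by case: hu. Qed.

Definition path_of (t x : R) (w : Omega) : paths D := fun v => X t x v w.

Lemma measurable_path_of t x : 0 <= t -> I x -> t <= u ->
  measurable_fun setT (path_of t x).
Proof.
move=> t0 Ix tu; apply: measurable_to_paths => v [uv vT].
by apply: mX => //; exact: le_trans uv.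
Qed.

(* [E] ranges over the past of [u] on the event that the process is in [I]. *)
Definition past (t x : R) (E : set Omega) :=
  [/\ 0 <= t, t <= u, I x, measurable E /\ E `<=` X t x u @^-1` I
    & natural_filtration P (X t x) t u E].

Lemma past_comp d' (S : measurableType d') (q : R -> S) t x E : past t x E ->
  measurable_fun I q -> measurable_fun E (fun w => q (X t x u w)).
Proof.
move=> [t0 tu Ix [mE EI] nE] mq.
apply: (measurable_comp mI) => //.
  by move=> _ [w Ew <-]; exact: EI.
by apply: measurable_funTS; apply: mX => //; case: hu.
Qed.

(** [markov_family] covers cylinders, which are stable under intersection. Measurability in the
    starting point and the integral identity both pass to complements and disjoint countable unions,
    so the pi-lambda theorem applies. *)
Lemma markov_path_set (C : set (paths D)) : measurable C ->
  measurable_fun I (fun y => P (path_of u y @^-1` C)) /\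
  forall t x E, past t x E ->
   P (E `&` path_of t x @^-1` C) = (\int[P]_(w in E) P (path_of u (X t x u w) @^-1` C))%E.
Proof.
move: C; apply: (@dynkin_induction _ (paths D) (path_cylinders D)) => //.
- exact: path_cylindersI.
- split; first by under eq_fun do rewrite preimage_setT; exact: measurable_cst.
  move=> t x E [_ _ _ [mE _] _]; rewrite preimage_setT setIT.
  under eq_integral do rewrite preimage_setT probability_setT.
  by rewrite integral_cst// mul1e.
- move=> C [n [s [A [hs hA ->]]]].
  have [h1 h2] := hM hu hs hA.
  split; first exact: h1.
  move=> t x E [t0 tu Ix [mE EI] nE].
  have := h2 t x E t0 tu Ix nE.
  by rewrite (setIidl EI).
- move=> C mC [h1 h2]; split.
    apply: (eq_measurable_fun (fun y => 1 - P (path_of u y @^-1` C))%E).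
      move=> y /set_mem Iy; rewrite preimage_setC probability_setC//.
      by rewrite -[X in measurable X]setTI; exact: measurable_path_of.
    exact: emeasurable_funB.
  move=> t x E hE; have [t0 tu Ix [mE EI] nE] := hE.
  have mq := past_comp hE h1.
  have mCx : measurable (path_of t x @^-1` C).
    by rewrite -[X in measurable X]setTI; exact: measurable_path_of.
  have -> : (\int[P]_(w in E) P (path_of u (X t x u w) @^-1` (~` C)) =
     \int[P]_(w in E) (1 - P (path_of u (X t x u w) @^-1` C)))%E.
    apply: eq_integral => w /set_mem Ew; rewrite preimage_setC probability_setC//.
    rewrite -[X in measurable X]setTI; apply: measurable_path_of => //.
    exact: EI.
  rewrite integralB//; last 2 first.
  + by apply/integrableP; split => //; under eq_integral do rewrite abse1;
      rewrite integral_cst// mul1e; apply: (le_lt_trans (probability_le1 _ mE)); rewrite ltry.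
  + apply: (@le_integrable _ _ _ P _ mE _ (cst 1%E)) => //.
    * move=> w Ew; rewrite /= gee0_abs// normr1; apply: probability_le1.
      rewrite -[X in measurable X]setTI; apply: measurable_path_of => //.
      exact: EI.
    * apply/integrableP; split => //; under eq_integral do rewrite abse1.
      by rewrite integral_cst// mul1e; apply: (le_lt_trans (probability_le1 _ mE)); rewrite ltry.
  rewrite integral_cst// mul1e -(h2 _ _ _ hE).
  rewrite preimage_setC -setDE measureD//.
  by apply: (le_lt_trans (probability_le1 _ mE)); rewrite ltry.
- move=> F mF tF hF; split.
    apply: (eq_measurable_fun (fun y => \sum_(0 <= n <oo) P (path_of u y @^-1` F n))%E).
      move=> y /set_mem Iy; rewrite preimage_bigcup measure_bigcup//.
        by apply/esym/eq_eseriesl => n; rewrite in_setT.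
        by move=> n _; rewrite -[X in measurable X]setTI; exact: measurable_path_of.
      exact: (trivIset_comp_preim tF).
    apply: ge0_emeasurable_sum => [n y _ _|n _]; first exact: measure_ge0.
    exact: (hF n).1.
  move=> t x E hE; have [t0 tu Ix [mE EI] nE] := hE.
  rewrite preimage_bigcup setI_bigcupr measure_bigcup//; last 2 first.
    move=> n _; apply: measurableI => //.
    by rewrite -[X in measurable X]setTI; exact: measurable_path_of.
    apply: trivIset_setIl; exact: (trivIset_comp_preim tF).
  transitivity (\sum_(0 <= n <oo) \int[P]_(w in E) P (path_of u (X t x u w) @^-1` F n))%E.
    under eq_eseriesl do rewrite in_setT.
    by apply: eq_eseriesr => n _; exact: (hF n).2.
  rewrite -integral_nneseries//; last first.
    move=> n; exact: past_comp hE (hF n).1.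
  apply: eq_integral => w /set_mem Ew; rewrite preimage_bigcup measure_bigcup//.
    by apply: eq_eseriesl => n; rewrite in_setT.
    move=> n _; rewrite -[X in measurable X]setTI; apply: measurable_path_of => //.
    exact: EI.
  exact: (trivIset_comp_preim tF).
Qed.

Definition good (Phi : paths D -> \bar R) :=
  measurable_fun I (fun y => \int[P]_w Phi (path_of u y w))%E /\
  forall t x E, past t x E ->
   (\int[P]_(w in E) Phi (path_of t x w)
    = \int[P]_(w in E) (\int[P]_w' Phi (path_of u (X t x u w) w')))%E.

Lemma markov_nnsfun (f : {nnsfun (paths D) >-> R}) : good (EFin \o f).
Proof.
have fE (z : paths D) : ((f z)%:E = \sum_(r \in range f) (r%:E * (\1_(f @^-1` [set r]) z)%:E))%E.
  by rewrite fimfunE -fsumEFin//; apply: eq_fsbigr => r _; rewrite EFinM.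
have mset r : measurable (f @^-1` [set r]) by [].
have r0 r : r \in range f -> (0 <= r%:E)%E.
  by rewrite inE => -[z _ <-]; rewrite lee_fin.
have mind t x r : 0 <= t -> I x -> t <= u ->
    measurable_fun setT (fun w => (\1_(f @^-1` [set r]) (path_of t x w) : R)%:E).
  move=> t0 Ix tu; apply/measurable_EFinP.
  have mp := measurable_path_of t0 Ix tu.
  apply: (eq_measurable_fun (\1_(path_of t x @^-1` (f @^-1` [set r])) : Omega -> R)) => //.
  by apply: measurable_indic; rewrite -[X in measurable X]setTI; exact: mp.
have intE t x E : 0 <= t -> I x -> t <= u -> measurable E ->
   (\int[P]_(w in E) (f (path_of t x w))%:E =
    \sum_(r \in range f) (r%:E * P (E `&` path_of t x @^-1` (f @^-1` [set r]))))%E.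
  move=> t0 Ix tu mE; under eq_integral do rewrite fE.
  rewrite ge0_integral_fsum//.
  - apply: eq_fsbigr => r rf; rewrite ge0_integralZl//.
    + rewrite setIC -(@integral_indic _ _ _ P E mE) //.
        by rewrite -[X in measurable X]setTI; exact: measurable_path_of.
    + by apply: measurable_funTS; exact: mind.
    + exact: r0.
  - by move=> r; apply: measurable_funTS; apply: emeasurable_funM => //; exact: mind.
  - move=> r w Ew; have [rf|rf] := boolP (r \in range f).
      by rewrite mule_ge0// r0.
    rewrite indicE; case: (boolP (_ \in _)) => [|_]; last by rewrite mule0.
    by rewrite inE/= => h; case/negP: rf; rewrite inE; exists (path_of t x w).
split.
  apply: (eq_measurable_fun (fun y =>
     \sum_(r \in range f) (r%:E * P (path_of u y @^-1` (f @^-1` [set r]))))%E).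
    by move=> y /set_mem Iy; rewrite intE//; apply: eq_fsbigr => r _; rewrite setTI.
  apply: emeasurable_fsum => // r; apply: emeasurable_funM => //.
  exact: (markov_path_set (mset r)).1.
move=> t x E hE; have [t0 tu Ix [mE EI] nE] := hE.
rewrite intE//.
under [RHS]eq_integral => w /set_mem Ew.
  rewrite intE//; last exact: EI.
  over.
rewrite ge0_integral_fsum//.
- apply: eq_fsbigr => r rf; rewrite ge0_integralZl//.
  + congr (_ * _)%E; rewrite (markov_path_set (mset r)).2//.
    by under [RHS]eq_integral do rewrite setTI.
  + apply: (@past_comp _ _ (fun y => P ([set: Omega] `&` path_of u y @^-1` (f @^-1` [set r]))) t x E hE).
    by under eq_fun do rewrite setTI; exact: (markov_path_set (mset r)).1.
  + exact: r0.
- move=> r; apply: emeasurable_funM => //.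
  apply: (@past_comp _ _ (fun y => P ([set: Omega] `&` path_of u y @^-1` (f @^-1` [set r]))) t x E hE).
  by under eq_fun do rewrite setTI; exact: (markov_path_set (mset r)).1.
- move=> r w Ew; have [rf|rf] := boolP (r \in range f).
    by rewrite mule_ge0// r0.
  rewrite (_ : f @^-1` [set r] = set0) ?preimage_set0 ?setI0 ?measure0 ?mule0//.
  by apply/seteqP; split => z //= h; case/negP: rf; rewrite inE; exists z.
Qed.

(** Monotone convergence along simple approximations is used three times: for the path from [t], for
    the path restarted at [u], and for the integral over the restarting point. *)
Lemma markov_path (Phi : paths D -> \bar R) :
  measurable_fun setT Phi -> (forall z, 0 <= Phi z)%E -> good Phi.
Proof.
move=> mPhi Phi0.
pose g := nnsfun_approx measurableT mPhi.
have gcvg z : EFin \o g^~ z @ \oo --> Phi z by exact: cvg_nnsfun_approx.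
have mg n t x : 0 <= t -> I x -> t <= u -> measurable_fun setT (fun w => (g n (path_of t x w))%:E).
  by move=> *; apply/measurable_EFinP; apply: measurableT_comp => //; exact: measurable_path_of.
have cvgI t x E : 0 <= t -> I x -> t <= u -> measurable E ->
  (\int[P]_(w in E) (g n (path_of t x w))%:E)%E @[n --> \oo] -->
  (\int[P]_(w in E) Phi (path_of t x w))%E.
  move=> t0 Ix tu mE.
  rewrite [X in _ --> X](_ : _ = \int[P]_(w in E) limn (fun n => (g n (path_of t x w))%:E))%E.
    apply: cvg_monotone_convergence => //.
    - by move=> n; apply: measurable_funTS; exact: mg.
    - by move=> n w _; rewrite lee_fin.
    - by move=> w _ a b ab; rewrite lee_fin; exact/lefP/nd_nnsfun_approx.
  by apply: eq_integral => w _; apply/esym/cvg_lim => //; exact: gcvg.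
split.
  apply: (emeasurable_fun_cvg (fun n y => \int[P]_w (g n (path_of u y w))%:E)%E).
    by move=> n; exact: (markov_nnsfun (g n)).1.
  by move=> y Iy; exact: cvgI.
move=> t x E hE; have [t0 tu Ix [mE EI] nE] := hE.
have := cvgI t x E t0 Ix tu mE.
move/cvg_lim => <- //.
under eq_fun do rewrite (markov_nnsfun (g _)).2//.
apply/cvg_lim => //.
rewrite [X in _ --> X](_ : _ = \int[P]_(w in E) limn (fun n => \int[P]_w' (g n (path_of u (X t x u w) w'))%:E))%E.
  apply: cvg_monotone_convergence => //.
  - move=> n; apply: (@past_comp _ _ (fun y => \int[P]_w' (g n (path_of u y w'))%:E)%E t x E hE).
    exact: (markov_nnsfun (g n)).1.
  - by move=> n w _; apply: integral_ge0 => w' _; rewrite lee_fin.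
  - move=> w Ew a b ab; apply: ge0_le_integral => //.
    + by move=> w' _; rewrite lee_fin.
    + by apply: mg => //; exact: EI.
    + by apply: mg => //; exact: EI.
    + by move=> w' _; rewrite lee_fin; exact/lefP/nd_nnsfun_approx.
apply: eq_integral => w /set_mem Ew; apply/esym/cvg_lim => //.
by apply: cvgI => //; exact: EI.
Qed.

End markov.

(** Tonelli handles the positive and negative parts; [fine] is measurable, so their difference may
    take any value. *)
Lemma measurable_param_Rintegral d (T : measurableType d) (R : realType)
    (f : R * T -> R) :
  measurable_fun setT f ->
  measurable_fun setT (fun y => \int[lebesgue_measure]_x f (x, y)).
Proof.
move=> mf; apply: measurableT_comp => //.
under eq_fun do rewrite integralE.
have mfE : measurable_fun setT (EFin \o f) by exact/measurable_EFinP.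
apply: emeasurable_funB.
- apply: (eq_measurable_fun (fubini_G (@lebesgue_measure R) (fun p : R * T => ((EFin \o f)^\+ p)%E))).
    move=> y _; by apply: eq_integral => x _; rewrite !funeposE.
  by apply: measurable_fun_fubini_tonelli_G => //; exact: measurable_funepos.
- apply: (eq_measurable_fun (fubini_G (@lebesgue_measure R) (fun p : R * T => ((EFin \o f)^\- p)%E))).
    by move=> y _; apply: eq_integral => x _; rewrite !funenegE.
  by apply: measurable_fun_fubini_tonelli_G => //; exact: measurable_funeneg.
Qed.

(** An enumeration of the rationals inside [R], codes of nothing going to 0. It turns conditions at
    rational times into countable intersections. *)
Definition ratn (R : realType) (k : nat) : R := ratr (odflt 0%Q (unpickle k)).

Lemma ratn_dense (R : realType) (x y : R) : x < y -> exists k, x < ratn R k < y.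
Proof.
move=> /rat_in_itvoo[q hq]; exists (pickle q); rewrite /ratn pickleK /=.
by move: hq; rewrite in_itv.
Qed.

Lemma ratn0 (R : realType) : exists k, ratn R k = 0.
Proof. by exists (pickle (0%Q : rat)); rewrite /ratn pickleK /= rmorph0. Qed.

Lemma subspace_cvg (R : realType) (D : set R) (f : R -> R) x e :
  {within D, continuous f} -> D x -> 0 < e ->
  exists2 dl, 0 < dl & forall y, D y -> `|y - x| < dl -> `|f y - f x| < e.
Proof.
move=> /subspace_continuousP cf Dx e0.
have /cvgrPdist_lt /(_ _ e0) := cf _ Dx.
rewrite near_withinE => -[dl /= dl0 h]; exists dl => // y Dy xy.
by rewrite distrC; apply: h => //=; rewrite distrC.
Qed.

Lemma subspace_continuousPe (R : realType) (D : set R) (f : R -> R) :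
  (forall x, D x -> forall e, 0 < e ->
    exists2 dl, 0 < dl & forall y, D y -> `|y - x| < dl -> `|f y - f x| < e) ->
  {within D, continuous f}.
Proof.
move=> h; apply/subspace_continuousP => x Dx; apply/cvgrPdist_lt => e e0.
have [dl dl0 hdl] := h x Dx e e0.
rewrite near_withinE; exists dl => // y /= xy Dy.
by rewrite distrC; apply: hdl => //; rewrite distrC.
Qed.

Lemma continuous_pair (S T U : topologicalType) (f : S -> T) (g : S -> U) :
  continuous f -> continuous g -> continuous (fun x => (f x, g x)).
Proof. by move=> cf cg x; exact: (cvg_pair (cf x) (cg x)). Qed.

(** A continuous function of two variables, seen as a process in its first one, is its own joint
    version. *)
Lemma continuous_measurable2 (R : realType) (f : R * R -> R) :
  continuous f -> measurable_fun setT f.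
Proof.
move=> cf.
have [|fh [mfh fhE]] := @joint_version _ R R (fun u w => f (u, w)).
  move=> u; apply: continuous_measurable_fun => w.
  apply: (continuous_comp (f := fun w => (u, w))); last exact: cf.
  by apply: continuous_pair => v; [exact: cvg_cst|exact: cvg_id].
rewrite (_ : f = fh)//; apply/funext => -[u w]; rewrite fhE// => v.
apply: (continuous_comp (f := fun w' => (w', w))); last exact: cf.
by apply: continuous_pair => v'; [exact: cvg_id|exact: cvg_cst].
Qed.

(** * The stopped payoff as a functional of the path *)

Section payoff_path.
Variables (R : realType) (T : \bar R) (b : R -> R) (u : R) (r g : R * R -> R).
Hypothesis u0 : 0 <= u.
Hypothesis uT : (u%:E < T)%E.
Hypothesis hb : {within times T, continuous b}.
Let D : set R := [set v | u <= v /\ (v%:E <= T)%E].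

Implicit Types (z : R -> R) (s v : R).

(** The retraction of the line onto the times between [u] and [T], which gives every real time a
    meaning; for infinite [T] only the lower bound acts. *)
Definition clampT (v : R) := Num.max u (fine (mine v%:E T)).

Lemma clampTD v : D (clampT v).
Proof.
rewrite /D /clampT /=; split; first by rewrite le_max lexx.
move: uT; case: T => [q| |]//; last by rewrite leey.
rewrite lte_fin => uq; rewrite -EFin_min /= lee_fin ge_max (ltW uq)/=.
by rewrite ge_min lexx orbT.
Qed.

Lemma clampT_id v : D v -> clampT v = v.
Proof.
move=> [uv vT]; rewrite /clampT (min_idPl vT)/=; exact: max_r.
Qed.

Lemma continuous_clampT : continuous clampT.
Proof.
change (continuous (cst u \max (fun v : R => fine (mine v%:E T)))).
move=> v; apply: continuous_max; first exact: cst_continuous.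
move: uT; case: T => [q| |]// _.
- rewrite (_ : (fun x => _) = id \min cst q); last by apply/funext => x; rewrite -EFin_min.
  by have /= := @continuous_min _ _ id (cst q) v (fun A hA => hA) (@cst_continuous _ _ q v).
- rewrite (_ : (fun x => _) = id); last by apply/funext => x; rewrite miney.
  exact: cvg_id.
Qed.

(** [tau_star], and below it the payoff that it earns, read off a path after time [u]: the Markov
    property restarts such functionals. *)
Definition tau_path (z : R -> R) : \bar R :=
  mine (ereal_inf [set s%:E | s in [set s | [/\ 0 <= s, ((u + s)%:E < T)%E
                                             & z (u + s) <= b (u + s)]]])
       (T - u%:E)%E.

Definition pay_path (z : R -> R) : R :=
  let s := fine (tau_path z) in
  expR (- \int[lebesgue_measure]_(v in `[0, s]) r (u + v, z (u + v)))
  * g (u + s, z (u + s)).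

Lemma uv_D s v : ((u + s)%:E <= T)%E -> 0 <= v <= s -> D (u + v).
Proof.
move=> usT /andP[v0 vs]; split; first by rewrite lerDl.
by apply: le_trans usT; rewrite lee_fin lerD2l.
Qed.

Lemma D_times v : D v -> times T v.
Proof. by move=> [uv vT]; split => //; exact: le_trans uv. Qed.

Lemma tau_path_ge0 z : (0 <= tau_path z)%E.
Proof.
rewrite /tau_path le_min; apply/andP; split.
  by apply/le_ereal_inf_tmp => _ [s [s0 _ _] <-]; rewrite lee_fin.
by rewrite sube_ge0 ?fin_numE//; apply/ltW.
Qed.

Lemma tau_path_leT z : (tau_path z <= T - u%:E)%E.
Proof. by rewrite /tau_path ge_min lexx orbT. Qed.

Lemma gap_continuous z s : {within D, continuous z} -> ((u + s)%:E <= T)%E ->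
  {within `[0, s], continuous (fun v => z (u + v) - b (u + v))}.
Proof.
move=> cz usT; apply: subspace_continuousPe => v /= vs e e0.
have Dv := uv_D usT; have Dv' := Dv v; rewrite in_itv/= in vs.
have {Dv'} Dv0 := Dv' vs.
have e20 : 0 < e / 2 by rewrite divr_gt0.
have [d1 d10 h1] := subspace_cvg cz Dv0 e20.
have [d2 d20 h2] := subspace_cvg hb (D_times Dv0) e20.
exists (Num.min d1 d2); first by rewrite lt_min d10.
move=> y /=; rewrite in_itv/= => ys yv.
have Dy := Dv y ys.
have yv' : `|u + y - (u + v)| < Num.min d1 d2.
  by rewrite opprD addrACA subrr add0r.
move: yv'; rewrite lt_min => /andP[y1 y2].
have := h1 _ Dy y1; have := h2 _ (D_times Dy) y2.
by rewrite !ltr_norml => /andP[? ?] /andP[? ?]; apply/andP; split; lra.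
Qed.

Lemma tau_path_gt z s : {within D, continuous z} -> 0 <= s -> ((u + s)%:E < T)%E ->
  (s%:E < tau_path z)%E <-> (forall v, 0 <= v <= s -> b (u + v) < z (u + v)).
Proof.
move=> cz s0 usT; split.
  move=> h v /andP[v0 vs]; rewrite ltNge; apply/negP => zb.
  have := lt_le_trans h (_ : tau_path z <= v%:E)%E; rewrite lte_fin => H.
  have {}H := H _; suff : s < v by rewrite ltNge vs.
  apply: H; rewrite /tau_path ge_min; apply/orP; left.
  apply: ereal_inf_lbound; exists v => //; split => //.
  by apply: le_lt_trans usT; rewrite lee_fin lerD2l.
move=> h.
have [s' ss' us'T] : exists2 s', s < s' & ((u + s')%:E < T)%E.
  move: usT; case: T => [q| |]//; last by move=> _; exists (s + 1); rewrite ?ltry// ltrDl.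
  rewrite lte_fin => usq; exists ((s + (q - u)) / 2); first lra.
  rewrite lte_fin; lra.
have cf := gap_continuous cz (ltW us'T).
have sin : s \in `[0, s'] by rewrite in_itv/= s0 ltW.
have fs : 0 < z (u + s) - b (u + s) by rewrite subr_gt0 h// s0 lexx.
(* The gap is positive at [s] and continuous, hence positive a little longer; this makes the
   inequality strict. *)
have [d1 d10 h1] := subspace_cvg cf sin fs.
pose s2 := Num.min s' (s + d1 / 2).
have ss2 : s < s2 by rewrite lt_min ss' ltrDl divr_gt0.
have us2T : ((u + s2)%:E < T)%E.
  by apply: le_lt_trans us'T; rewrite lee_fin lerD2l ge_min lexx.
apply: (@lt_le_trans _ _ s2%:E); first by rewrite lte_fin.
rewrite /tau_path le_min; apply/andP; split.
  apply/le_ereal_inf_tmp => _ [v [v0 uvT zb] <-]; rewrite lee_fin leNgt; apply/negP => vs2.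
  have [vs|sv] := leP v s; first by have := h v; rewrite v0 vs ltNge zb => /(_ isT).
  have : `|v - s| < d1.
    rewrite ger0_norm ?subr_ge0 ?ltW//.
    by move: vs2; rewrite lt_min => /andP[_ ?]; lra.
  have vin : v \in `[0, s'].
    rewrite in_itv/= v0/=; by move: vs2; rewrite lt_min => /andP[/ltW].
  move=> /(h1 _ vin); rewrite ltr_norml => /andP[H _]; lra.
by rewrite leeBrDr// addrC -EFinD; exact: ltW.
Qed.

(* Along continuous paths, staying above [b] on [u, u + s] is a condition at rational
   times, hence measurable for the product sigma-algebra. *)
Definition no_hit (s : R) : set (R -> R) :=
  \bigcup_m \bigcap_k [set z | 0 <= ratn R k <= s ->
     b (u + ratn R k) + m.+1%:R^-1 <= z (u + ratn R k)].

Lemma no_hitP z s : {within D, continuous z} -> 0 <= s -> ((u + s)%:E < T)%E ->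
  no_hit s z <-> (forall v, 0 <= v <= s -> b (u + v) < z (u + v)).
Proof.
move=> cz s0 usT.
have cf := gap_continuous cz (ltW usT); split.
  move=> [m _ hm] v vs.
  have m0 : (0 : R) < m.+1%:R^-1 by rewrite invr_gt0 ltr0n.
  rewrite -subr_gt0 ltNge; apply/negP => fv.
  have vin : v \in `[0, s] by rewrite in_itv.
  have [d1 d10 h1] := subspace_cvg cf vin m0.
  have [k kv ks] : exists2 k, `|ratn R k - v| < d1 & 0 <= ratn R k <= s.
    (* Density needs an interval of positive length; for [s = 0] the only time is 0, itself
       rational. *)
    have [s00|sn0] := eqVneq s 0.
      have [k hk] := ratn0 R; exists k; last by rewrite hk s0 lexx.
      by move: vs; rewrite s00 -eq_le => /eqP <-; rewrite hk subrr normr0.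
    have sp : 0 < s by rewrite lt_neqAle eq_sym sn0.
    have [k /andP[k1 k2]] : exists k, Num.max 0 (v - d1) < ratn R k < Num.min s (v + d1).
      apply: ratn_dense; rewrite gt_max !lt_min sp/=.
      by move/andP : vs => [? ?]; apply/and3P; split; lra.
    move: k1 k2; rewrite gt_max lt_min => /andP[k1 k2] /andP[k3 k4].
    by exists k; [rewrite ltr_norml; apply/andP; split; lra|rewrite !ltW].
  have := hm k I ks => hk.
  have := h1 _ _ kv; rewrite /= in_itv/= => /(_ ks).
  rewrite ltr_norml => /andP[_ H].
  have {}H : z (u + ratn R k) - b (u + ratn R k) - (z (u + v) - b (u + v)) < m.+1%:R^-1 := H.
  move: (m.+1%:R^-1) (z (u + ratn R k)) (b (u + ratn R k)) hk H fv => a x y hk H fv.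
  lra.
move=> h.
(* By compactness the gap has a positive minimum, whose inverse gives the uniform margin. *)
have [c cs hc] := EVT_min s0 cf.
have fc : 0 < z (u + c) - b (u + c) by rewrite subr_gt0 h//; move: cs; rewrite in_itv.
exists (Num.truncn (z (u + c) - b (u + c))^-1) => // k _ /= ks.
have /hc hk : ratn R k \in `[0, s] by rewrite in_itv.
rewrite -lerBrDl; apply: le_trans hk.
rewrite invf_ple ?posrE ?ltr0n//.
by apply/ltW; rewrite truncnS_gt.
Qed.

Lemma measurable_no_hit s : ((u + s)%:E < T)%E -> measurable (no_hit s : set (paths D)).
Proof.
move=> usT; apply: bigcup_measurable => m _; apply: bigcapT_measurable => k.
have [ks|ks] := boolP (0 <= ratn R k <= s); last first.
  rewrite [X in measurable X](_ : _ = setT)//.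
  by apply/seteqP; split => z // _ h; rewrite h in ks.
have Dk : D (u + ratn R k) by apply: uv_D ks; exact: ltW.
rewrite [X in measurable X](_ : _ =
   (fun z : paths D => z (u + ratn R k)) @^-1` `[b (u + ratn R k) + m.+1%:R^-1, +oo[).
  by rewrite -[X in measurable X]setTI; exact: measurable_coord.
by apply/seteqP; split => z /=; rewrite in_itv/= andbT // => h; exact: h.
Qed.

(** The supremum of the rational times up to which the path has not met [b]. Being countable it is
    measurable, and on continuous paths it is the hitting time. *)
Definition tau_hat (z : paths D) : \bar R :=
  esups (fun k => if (0 <= ratn R k) && ((u + ratn R k)%:E < T)%E
                  then (ratn R k * \1_(no_hit (ratn R k)) z)%:E else 0%E) 0%N.

Lemma measurable_tau_hat : measurable_fun setT tau_hat.
Proof.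
apply: measurable_fun_esups => k.
case: (boolP (_ && _)) => [/andP[_ kT]|_]; last exact: measurable_cst.
apply/measurable_EFinP; apply: measurable_funM => //.
by apply: measurable_indic; exact: measurable_no_hit.
Qed.

Lemma tau_hatE z : {within D, continuous z} -> tau_hat z = tau_path z.
Proof.
move=> cz.
have h0 : (0 <= tau_hat z)%E.
  have [k hk] := ratn0 R.
  apply: le_ereal_sup_tmp.
  by exists 0%E => //; exists k => //=; rewrite hk mul0r; case: ifP.
apply/eqP; rewrite eq_le; apply/andP; split.
  apply: ge_ereal_sup => _ [k _ <-]; case: ifPn => [/andP[k0 kT]|_]; last exact: tau_path_ge0.
  rewrite indicE; case: (boolP (_ \in _)) => [|_]; last by rewrite mulr0 tau_path_ge0.
  by rewrite inE mulr1 => /(no_hitP cz k0 kT)/(tau_path_gt cz k0 kT)/ltW.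
rewrite leNgt; apply/negP => lt.
have [k k1 k2] : exists2 k, (tau_hat z < (ratn R k)%:E)%E & ((ratn R k)%:E < tau_path z)%E.
  move: h0 lt; case: tau_hat => [x| |]//= x0; last by rewrite ltNge leey.
  case: tau_path => [y| |]//=; last first.
    move=> _; have [k /andP[h1 h2]] := @ratn_dense R x (x + 1) (ltac:(by rewrite ltrDl)).
    by exists k; rewrite ?ltry// lte_fin.
  by rewrite lte_fin => /ratn_dense[k /andP[h1 h2]]; exists k; rewrite lte_fin.
have k0 : 0 <= ratn R k by rewrite -lee_fin; apply: ltW; apply: le_lt_trans k1.
have kT : ((u + ratn R k)%:E < T)%E.
  have := lt_le_trans k2 (tau_path_leT z).
  by rewrite lteBrDr// addrC -EFinD.
have : ((ratn R k)%:E <= tau_hat z)%E.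
  apply: ereal_sup_ubound; exists k => //=.
  rewrite k0 kT/= indicE mem_set ?mulr1//.
  by apply/(no_hitP cz k0 kT)/(tau_path_gt cz k0 kT).
by rewrite leNgt k1.
Qed.

Hypothesis hr : {within times T `*` setT, continuous r}.
Hypothesis hg : {within times T `*` setT, continuous g}.

Let rh (p : R * R) := r (clampT p.1, p.2).
Let gh (p : R * R) := g (clampT p.1, p.2).

Lemma continuous_clamp2 (f : R * R -> R) : {within times T `*` setT, continuous f} ->
  continuous (fun p => f (clampT p.1, p.2)).
Proof.
move=> cf.
apply: (@within_continuous_comp _ _ _ (times T `*` setT) (fun p => (clampT p.1, p.2)) f) => //.
  apply: (@continuous_pair _ _ _ (clampT \o fst) snd) => p; last exact: cvg_snd.
  by apply: continuous_comp; [exact: cvg_fst|exact: continuous_clampT].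
by move=> p; split => //=; apply: D_times; exact: clampTD.
Qed.

(** The product sigma-algebra does not see continuity of paths, so the payoff is replaced by a
    functional measurable on all paths that agrees with it on the continuous ones. *)
Lemma measurable_pay_path : exists Phi : paths D -> R, measurable_fun setT Phi /\
  forall z, {within D, continuous z} -> Phi z = pay_path z.
Proof.
have [zh [mzh zhE]] := @joint_version _ (paths D) R (fun v z => z (clampT v))
  (fun v => measurable_coord (clampTD v)).
have zhE' (z : paths D) v : {within D, continuous (z : R -> R)} -> D v -> zh (v, z) = z v.
  move=> cz Dv; rewrite zhE ?clampT_id//.
  exact: (within_continuous_comp continuous_clampT clampTD cz).
have mtau : measurable_fun setT (fun z : paths D => fine (tau_hat z)).
  by apply: measurableT_comp => //; exact: measurable_tau_hat.
have mrh : measurable_fun setT rh by apply: continuous_measurable2; exact: continuous_clamp2.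
have mgh : measurable_fun setT gh by apply: continuous_measurable2; exact: continuous_clamp2.
pose F (p : R * paths D) := rh (u + p.1, zh (u + p.1, p.2)) *
  \1_([set p : R * paths D | 0 <= p.1 <= fine (tau_hat p.2)]) p.
exists (fun z => expR (- \int[lebesgue_measure]_v F (v, z)) *
   gh (u + fine (tau_hat z), zh (u + fine (tau_hat z), z))).
have mshift : measurable_fun setT (fun p : R * paths D => (u + p.1, zh (u + p.1, p.2))).
  have m1 : measurable_fun setT (fun p : R * paths D => u + p.1).
    by apply: measurable_funD => //; exact: measurable_fst.
  apply: measurable_fun_pair => //.
  apply: (measurableT_comp mzh); apply: measurable_fun_pair => //.
split.
  apply: measurable_funM.
    apply: measurableT_comp => //; apply: measurable_funN.
    apply: measurable_param_Rintegral; apply: measurable_funM.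
      exact: (measurableT_comp mrh).
    apply: measurable_indic.
    rewrite (_ : [set p | _] = [set p : R * paths D | 0 <= p.1] `&`
       [set p : R * paths D | p.1 <= fine (tau_hat p.2)]); last first.
      by apply/seteqP; split => p /=; [move=> /andP[]|case=> -> ->].
    apply: measurableI; rewrite -[X in measurable X]setTI.
      by apply: measurable_fun_le => //; exact: measurable_fst.
    by apply: measurable_fun_le => //; exact: (measurableT_comp mtau).
  apply: (measurableT_comp mgh).
  have m1 : measurable_fun setT (fun z : paths D => u + fine (tau_hat z)).
    exact: measurable_funD.
  apply: measurable_fun_pair => //.
  by apply: (measurableT_comp mzh); apply: measurable_fun_pair.
move=> z cz; rewrite /pay_path tau_hatE//.
have t0 := tau_path_ge0 z; have tT := tau_path_leT z.
set s := fine _.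
have usT : ((u + s)%:E <= T)%E.
  rewrite /s; move: t0 tT; case: tau_path => [q| |]//= _; last by rewrite addr0 => _; exact: ltW.
  by rewrite EFinN leeBrDr// addrC -EFinD.
have s0 : 0 <= s by rewrite fine_ge0.
congr (_ * _).
  congr (expR (- _)); rewrite [RHS]Rintegral_mkcond; apply: eq_Rintegral => v _.
  rewrite /F /patch indicE; have th : tau_hat z = tau_path z by exact: tau_hatE.
  have [vs|vs] := boolP (0 <= v <= s).
    rewrite !mem_set//= ?in_itv//= ?th -/s// mulr1 /rh/=.
    have Dv := uv_D usT vs.
    by rewrite clampT_id// zhE'.
  rewrite !memNset ?mulr0//= ?th -/s; first exact/negP.
  exact/negP.
have Dv : D (u + s) by apply: uv_D usT _; rewrite s0 lexx.
by rewrite /gh /= clampT_id// zhE'.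
Qed.

End payoff_path.

(** Taking out what is known, phrased without conditional expectations: true on the level sets of
    simple approximations of [W], it passes to the limit by dominated convergence under
    [K * |phi|]. *)
Lemma weighted_integral0 d (Omega : measurableType d) (R : realType)
    (P : probability Omega R) (GG : set (set Omega)) (A : set Omega)
    (phi W : Omega -> R) (K : R) :
  (forall E, <<s GG >> E -> measurable E) -> <<s GG >> A ->
  P.-integrable A (EFin \o phi) ->
  (forall E, <<s GG >> E -> E `<=` A -> (\int[P]_(w in E) (phi w)%:E = 0)%E) ->
  measurable_fun setT (W : g_sigma_algebraType GG -> R) ->
  (forall w, 0 <= W w) -> (forall w, A w -> W w <= K) ->
  (\int[P]_(w in A) (W w * phi w)%:E = 0)%E.
Proof.
move=> GGm GA iphi phi0 mW W0 WK.
have mA := GGm _ GA.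
have mWE : measurable_fun setT (EFin \o (W : g_sigma_algebraType GG -> R)).
  exact/measurable_EFinP.
have mWO : measurable_fun setT W.
  by move=> _ B mB; apply: GGm; exact: mW.
pose h := nnsfun_approx measurableT mWE.
have hW w : (h n w)%:E @[n --> \oo] --> (W w)%:E.
  by apply: (cvg_nnsfun_approx measurableT mWE) => // x _; rewrite lee_fin.
have hle n w : h n w <= W w.
  have := nondecreasing_cvgn_le (u_ := fun n => h n w).
  have c : h n w @[n --> \oo] --> W w by have /fine_cvgP[_] := hW w.
  move=> /(_ _ _ n); rewrite (cvg_lim _ c)//; apply.
    by move=> a b ab; exact/lefP/nd_nnsfun_approx.
  exact: c.
have mh n : measurable_fun setT (h n : Omega -> R).
  move=> _ B mB; apply: GGm; exact: (measurable_funPT (h n)).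
have [mphi phioo] := (integrableP _ _ _ iphi).
have mphi' : measurable_fun A phi by exact/measurable_EFinP.
have h0 n : (\int[P]_(w in A) (h n w * phi w)%:E = 0)%E.
  have hE w : ((h n w * phi w)%:E =
     \sum_(r <- finmap.enum_fset (fset_set (range (h n)))) (r%:E * (EFin \o (phi \_ (h n @^-1` [set r]))) w))%E.
    rewrite {1}(fimfunE (h n) w) fsbig_finite//= sumEFin mulr_suml; congr EFin.
    apply: eq_bigr => r _; rewrite patchE indicE; case: ifPn => _; first by rewrite mulr1.
    by rewrite mulr0n mulr0 mul0r -(mulr0 r).
  have ir r : P.-integrable A (EFin \o (phi \_ (h n @^-1` [set r]))).
    have mS : d.-measurable (h n @^-1` [set r] : set Omega).
      apply: GGm; exact: (measurable_funPTI (h n) (measurable_set1 r)).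
    rewrite -restrict_EFin; apply/integrable_restrict => //.
    by apply: (integrableS mA) => //; exact: measurableI.
  under eq_integral do rewrite hE.
  rewrite integral_sum//; last by move=> r; exact: integrableZl.
  rewrite big1// => r _; rewrite integralZl//.
  under eq_integral do rewrite -restrict_EFin.
  rewrite -integral_mkcondr phi0 ?mule0//.
  apply: (@measurableI _ (g_sigma_algebraType GG)) => //.
have : (\int[P]_(w in A) (h n w * phi w)%:E)%E @[n --> \oo] -->
       (\int[P]_(w in A) (W w * phi w)%:E)%E.
  apply: (@dominated_cvg _ _ _ P _ mA _ _ (fun w => (K * `|phi w|)%:E)).
  - move=> n; apply/measurable_EFinP; apply: measurable_funM => //.
    exact: measurable_funTS.
  - move=> w _; apply: cvg_EFin; first exact: nearW.
    by apply: cvgMr_tmp; have /fine_cvgP[_] := hW w.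
  - by [].
  - apply: (eq_integrable mA (fun w => K%:E * (`|phi w|)%:E)%E).
      by move=> w _; rewrite EFinM.
    by apply: integrableZl => //; exact: integrable_abse iphi.
  - move=> n w Aw; rewrite lee_fin normrM ler_wpM2r// ger0_norm//.
    by rewrite (le_trans (hle n w))// WK.
under eq_fun do rewrite h0.
by move=> /cvg_lim <- //; rewrite lim_cst.
Qed.

Lemma Rintegral_split_shift (R : realType) (f : R -> R) (a s : R) :
  0 <= a -> 0 <= s -> {within `[0, a + s], continuous f} ->
  \int[lebesgue_measure]_(v in `[0, a + s]) f v =
  \int[lebesgue_measure]_(v in `[0, a]) f v +
  \int[lebesgue_measure]_(v in `[0, s]) f (a + v).
Proof.
move=> a0 s0 cf.
have fi : lebesgue_measure.-integrable `[0, a + s] (EFin \o f).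
  by apply: continuous_compact_integrable => //; exact: segment_compact.
have := @Rintegral_itvB _ f (BLeft 0) (BRight (a + s)) a fi.
rewrite !bnd_simp => /(_ a0) /(_ (ltac:(by rewrite lerDl))) h.
rewrite -[LHS](subrK (\int[lebesgue_measure]_(v in `[0, a]) f v)) h addrC; congr (_ + _).
rewrite Rintegral_itv_obnd_cbnd; last first.
  by apply: integrableS fi => //; apply: subset_itv; rewrite bnd_simp.
move: s0; rewrite le_eqVlt => /predU1P[<-|s0].
  by rewrite addr0 !set_itv1 !Rintegral_set1.
rewrite /Rintegral; congr fine.
pose F (v : R) := a + v.
have d (v : R) : is_derive v 1 F 1.
  rewrite (_ : F = (cst a + id)) //.
  by apply: is_derive_eq; rewrite add0r.
have dE : derive1 F = cst 1 by apply/funext => v; rewrite derive1E; exact: derive_val.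
have cF : continuous F by move=> v; apply: cvgD; [exact: cvg_cst|exact: cvg_id].
have := @integration_by_substitution_increasing R F f 0 s (ltW s0).
have F0 : F 0 = a by rewrite /F addr0.
rewrite dE F0 => ->.
- by apply: eq_integral => v _ /=; rewrite mulr1.
- by move=> x y _ _ xy; rewrite /F ltrD2l.
- by move=> x _; exact: cst_continuous.
- exact: is_cvg_cst.
- exact: is_cvg_cst.
- split.
  + by move=> v _; exact: (@ex_derive _ _ _ _ _ _ _ (d v)).
  + by apply: cvg_at_right_filter; exact: cF.
  + by apply: cvg_at_left_filter; exact: cF.
- by apply: continuous_subspaceW cf; apply: subset_itv; rewrite bnd_simp.
Qed.

(** The generators inside [natural_filtration], named so that [g_sigma_algebraType] can carry the
    filtration as a measurable structure. *)
Definition nf_gen d (Omega : measurableType d) (R : realType)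
    (P : probability Omega R) (Z : R -> Omega -> R) (t0 s : R) : set (set Omega) :=
  [set E | (exists u (A : set R), [/\ t0 <= u, u <= s, measurable A & E = Z u @^-1` A])
           \/ (measurable E /\ P E = 0%E)].

Lemma natural_filtration_measurable d (Omega : measurableType d) (R : realType)
    (P : probability Omega R) (Z : R -> Omega -> R) (t0 s : R) E :
  (forall u, t0 <= u -> u <= s -> measurable_fun setT (Z u)) ->
  natural_filtration P Z t0 s E -> measurable E.
Proof.
move=> mZ; apply: smallest_sub; first exact: sigma_algebra_measurable.
move=> _ [[u [A [tu us mA ->]]]|[]//].
by rewrite -[X in measurable X]setTI; exact: mZ.
Qed.

Lemma natural_filtration_coord d (Omega : measurableType d) (R : realType)
    (P : probability Omega R) (Z : R -> Omega -> R) (t0 s u : R) (A : set R) :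
  t0 <= u -> u <= s -> measurable A -> natural_filtration P Z t0 s (Z u @^-1` A).
Proof. by move=> tu us mA; apply: sub_sigma_algebra; left; exists u, A. Qed.

Lemma natural_filtrationS d (Omega : measurableType d) (R : realType)
    (P : probability Omega R) (Z : R -> Omega -> R) (t0 s s' : R) :
  s <= s' -> natural_filtration P Z t0 s `<=` natural_filtration P Z t0 s'.
Proof.
move=> ss'; apply: smallest_sub; first exact: smallest_sigma_algebra.
move=> E [[u [A [tu us mA ->]]]|h]; apply: sub_sigma_algebra; last by right.
by left; exists u, A; split => //; exact: le_trans ss'.
Qed.

(** * Optional stopping of the discounted value *)

Lemma box_bounded (R : realType) (D : set (R * R)) (f : R * R -> R) (t u al ar : R) :
  {within D, continuous f} -> `[t, u] `*` `[al, ar] `<=` D ->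
  exists2 K, 0 < K & forall v y, t <= v <= u -> al <= y <= ar -> `|f (v, y)| <= K.
Proof.
move=> cf sub.
have cK : compact (`[t, u] `*` `[al, ar] : set (R * R)).
  by apply: compact_setX; exact: segment_compact.
have cf' : {within `[t, u] `*` `[al, ar], continuous f} by exact: continuous_subspaceW cf.
have := compact_bounded (continuous_compact cf' cK).
rewrite /bounded_set /globally => -[M [_ hM]].
exists (Num.max (M + 1) 1); first by rewrite lt_max ltr01 orbT.
move=> v y hv hy.
have /hM h : M < Num.max (M + 1) 1 by rewrite lt_max ltrDl ltr01.
by apply: h; exists (v, y) => //; split; rewrite /= in_itv.
Qed.

(** [well_posed] makes one of the two parts finite; a finite difference then forces the other. *)
Lemma integrable_posneg d (T : measurableType d) (R : realType)
    (mu : {measure set T -> \bar R}) (f : T -> R) : measurable_fun setT f ->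
  (\int[mu]_w (f w)%:E)%E \is a fin_num ->
  (\int[mu]_w (Num.max (f w) 0)%:E < +oo)%E \/
  (\int[mu]_w (Num.max (- f w) 0)%:E < +oo)%E ->
  mu.-integrable setT (EFin \o f).
Proof.
move=> mf; rewrite integralE.
have mfE : measurable_fun setT (EFin \o f) by exact/measurable_EFinP.
have -> : (\int[mu]_w (Num.max (f w) 0)%:E = \int[mu]_w ((EFin \o f)^\+ w))%E.
  by apply: eq_integral => w _; rewrite funeposE -EFin_max.
have -> : (\int[mu]_w (Num.max (- f w) 0)%:E = \int[mu]_w ((EFin \o f)^\- w))%E.
  by apply: eq_integral => w _; rewrite funenegE -EFin_max.
have p0 : (0 <= \int[mu]_w ((EFin \o f)^\+ w))%E by apply: integral_ge0 => w _; exact: funepos_ge0.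
have n0 : (0 <= \int[mu]_w ((EFin \o f)^\- w))%E by apply: integral_ge0 => w _; exact: funeneg_ge0.
move=> fin h.
have [pf nf] : (\int[mu]_w ((EFin \o f)^\+ w) < +oo)%E /\ (\int[mu]_w ((EFin \o f)^\- w) < +oo)%E.
  move: fin h p0 n0; case: (integral _ _ _) => [p| |]; case: (integral _ _ _) => [n| |]//=;
    rewrite ?ltry//; by [|case].
apply/integrableP; split => //.
rewrite (eq_integral (fun w => (EFin \o f)^\+ w + (EFin \o f)^\- w)%E); last first.
  by move=> w _; have /(congr1 (fun h => h w)) := fune_abse (EFin \o f).
rewrite ge0_integralD//; [by rewrite lte_add_pinfty|exact: measurable_funepos|exact: measurable_funeneg].
Qed.

Section dp.
Variables (R : realType) (d : measure_display) (Omega : measurableType d)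
  (P : probability Omega R) (T : \bar R) (I : set R)
  (X : R -> R -> R -> Omega -> R) (r g : R * R -> R) (b : R -> R).
Let Dt (t : R) : set R := [set v | t <= v /\ (v%:E <= T)%E].
Hypothesis mI : measurable I.
Hypothesis mX : forall t x v, 0 <= t -> I x -> t <= v -> (v%:E <= T)%E ->
  measurable_fun setT (X t x v).
Hypothesis cX : forall t x w, times T t -> I x ->
  {within Dt t, continuous (fun v => X t x v w)}.
Hypothesis hM : markov_family P T I X.
Hypothesis hr : {within times T `*` setT, continuous r}.
Hypothesis hg : {within times T `*` setT, continuous g}.
Hypothesis hwp : well_posed P T I r g X.
Hypothesis hb : {within times T, continuous b}.
Hypothesis hopt : forall t x, times T t -> I x ->
  optimal P T r g X t x (tau_star T b X t x).

Local Notation V := (value P T r g X).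
Local Notation payp u t x w := (pay_path T b u r g (fun v => X t x v w)).

Lemma pay_Phi u : times_before T u -> exists Phi : paths (Dt u) -> R,
  measurable_fun setT Phi /\ forall t x w, 0 <= t -> t <= u -> I x ->
  Phi (path_of T X u t x w) = payp u t x w.
Proof.
move=> [u0 uT]; have [Phi [mPhi PhiE]] := measurable_pay_path u0 uT hb hr hg.
exists Phi; split=> // t x w t0 tu Ix; rewrite PhiE//.
have tT : times T t by split=> //; apply: le_trans (ltW uT); rewrite lee_fin.
apply: continuous_subspaceW (@cX t x w tT Ix) => v [uv vT]; split=> //.
exact: le_trans uv.
Qed.

Lemma measurable_payp u t x : times_before T u -> 0 <= t -> t <= u -> I x ->
  measurable_fun setT (fun w => payp u t x w).
Proof.
move=> hu t0 tu Ix; have [Phi [mPhi PhiE]] := pay_Phi hu.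
apply: (eq_measurable_fun (Phi \o path_of T X u t x)).
  by move=> w _; rewrite /= PhiE.
by apply: measurableT_comp => //; exact: (measurable_path_of mX).
Qed.

Lemma pay_value t x : times_before T t -> I x ->
  P.-integrable setT (fun w => (payp t t x w)%:E) /\
  (V (t, x))%:E = (\int[P]_w (payp t t x w)%:E)%E.
Proof.
move=> ht Ix; have [t0 tT] := ht.
have tT' : times T t by split=> //; exact: ltW.
have [adm E] := hopt tT' Ix; have [fin pn] := hwp tT' Ix.
have {}E : (\int[P]_w (payp t t x w)%:E)%E = evalue P T r g X t x.
  by rewrite -E unlock.
have /= := pn _ adm => {}pn.
split.
  by apply: integrable_posneg => //; [exact: measurable_payp|rewrite E].
by rewrite E /value /= fineK.
Qed.

(** Dynamic programming on an event of the past: the payoff restarted at [u] integrates like the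
    value at the point reached. [markov_path] takes nonnegative functionals, hence the separate
    treatment of the two parts of [Phi]. *)
Lemma dp_set u t x E : times_before T u -> past P I X u t x E ->
  P.-integrable E (fun w => (payp u t x w)%:E) ->
  P.-integrable E (fun w => (V (u, X t x u w))%:E) /\
  (\int[P]_(w in E) (payp u t x w)%:E = \int[P]_(w in E) (V (u, X t x u w))%:E)%E.
Proof.
move=> hu hE iE; have [t0 tu Ix [mE EI] nE] := hE.
have uT' : times T u by case: hu => ? ?; split => //; exact: ltW.
have [Phi [mPhi PhiE]] := pay_Phi hu.
have Phip0 z : (0 <= (EFin \o Phi)^\+ z)%E by exact: funepos_ge0.
have Phin0 z : (0 <= (EFin \o Phi)^\- z)%E by exact: funeneg_ge0.
have mPhiE : measurable_fun setT (EFin \o Phi) by exact/measurable_EFinP.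
have [mp gp] := markov_path mI mX hM uT' (measurable_funepos mPhiE) Phip0.
have [mn gn] := markov_path mI mX hM uT' (measurable_funeneg mPhiE) Phin0.
have {}gp := gp _ _ _ hE; have {}gn := gn _ _ _ hE.
have PE s y w : 0 <= s -> s <= u -> I y ->
    ((EFin \o Phi)^\+ (path_of T X u s y w) = (EFin \o (fun w => payp u s y w))^\+ w)%E.
  by move=> s0 su Iy; rewrite !funeposE /= PhiE.
have NE s y w : 0 <= s -> s <= u -> I y ->
    ((EFin \o Phi)^\- (path_of T X u s y w) = (EFin \o (fun w => payp u s y w))^\- w)%E.
  by move=> s0 su Iy; rewrite !funenegE /= PhiE.
have gpE : (\int[P]_(w in E) ((EFin \o Phi)^\+ (path_of T X u t x w)) =
   \int[P]_(w in E) ((EFin \o (fun w => payp u t x w))^\+ w))%E.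
  by apply: eq_integral => w _; exact: PE.
have gnE : (\int[P]_(w in E) ((EFin \o Phi)^\- (path_of T X u t x w)) =
   \int[P]_(w in E) ((EFin \o (fun w => payp u t x w))^\- w))%E.
  by apply: eq_integral => w _; exact: NE.
have u0 : 0 <= u by case: hu.
pose Ap y := (\int[P]_w' ((EFin \o Phi)^\+ (path_of T X u u y w')))%E.
pose An y := (\int[P]_w' ((EFin \o Phi)^\- (path_of T X u u y w')))%E.
have VE w : E w -> (V (u, X t x u w))%:E = (Ap (X t x u w) - An (X t x u w))%E.
  move=> /EI Iy; have [iy ->] := pay_value hu Iy.
  rewrite integralE; congr (_ - _)%E; apply: eq_integral => w' _.
    by rewrite PE.
  by rewrite NE.
have ip : P.-integrable E (fun w => Ap (X t x u w)).
  apply/integrableP; split; first exact: (past_comp mI mX uT' hE mp).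
  have -> : (\int[P]_(w in E) `|Ap (X t x u w)| = \int[P]_(w in E) Ap (X t x u w))%E.
    by apply: eq_integral => w _; rewrite gee0_abs//; apply: integral_ge0.
  by rewrite -gp gpE; have /integrable_funepos/integrableP[] // := iE;
    under eq_integral do rewrite gee0_abs//.
have in_ : P.-integrable E (fun w => An (X t x u w)).
  apply/integrableP; split; first exact: (past_comp mI mX uT' hE mn).
  have -> : (\int[P]_(w in E) `|An (X t x u w)| = \int[P]_(w in E) An (X t x u w))%E.
    by apply: eq_integral => w _; rewrite gee0_abs//; apply: integral_ge0.
  by rewrite -gn gnE; have /integrable_funeneg/integrableP[] // := iE;
    under eq_integral do rewrite gee0_abs//.
split.
  apply: (eq_integrable mE (fun w => Ap (X t x u w) - An (X t x u w))%E).
    by move=> w /set_mem Ew; rewrite VE.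
  exact: integrableB.
rewrite (eq_integral (fun w => Ap (X t x u w) - An (X t x u w))%E (fun w => (V (u, X t x u w))%:E)); last first.
  by move=> w /set_mem Ew; rewrite VE.
by rewrite integralB// -gp -gn gpE gnE -integralE.
Qed.

Definition disc t x u w :=
  expR (- \int[lebesgue_measure]_(v in `[0, u - t]) r (t + v, X t x (t + v) w)).

Lemma tau_path_split t u z : 0 <= t -> t <= u -> (u%:E < T)%E ->
  (forall v, t <= v <= u -> b v < z v) ->
  tau_path T b t z = ((u - t)%:E + tau_path T b u z)%E.
Proof.
move=> t0 tu uT h.
have fT : (T - t%:E = (u - t)%:E + (T - u%:E))%E.
  by rewrite [RHS]addeC -addeA -EFinN -EFinN -EFinD; congr (_ + _%:E)%E; ring.
apply/eqP; rewrite eq_le; apply/andP; split.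
  rewrite addeC -leeBlDr// /tau_path le_min; apply/andP; split.
    apply: le_ereal_inf_tmp => _ [s [s0 usT zs] <-].
    rewrite leeBlDr// -EFinD ge_min; apply/orP; left.
    apply: ereal_inf_lbound; exists (s + (u - t)) => //; split.
    - by rewrite addr_ge0// subr_ge0.
    - by rewrite (_ : t + (s + (u - t)) = u + s)//; ring.
    - by rewrite (_ : t + (s + (u - t)) = u + s)//; ring.
  by rewrite leeBlDr// [leRHS]addeC -fT ge_min lexx orbT.
rewrite /tau_path le_min; apply/andP; split.
  apply: le_ereal_inf_tmp => _ [s [s0 tsT zs] <-].
  have us : u - t <= s.
    rewrite leNgt; apply/negP => su; have := h (t + s).
    rewrite lerDl s0/= -lerBrDl ltW// => /(_ isT).
    by rewrite ltNge zs.
  rewrite addeC -leeBrDr// -EFinB ge_min; apply/orP; left.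
  apply: ereal_inf_lbound; exists (s - (u - t)) => //; split.
  - by rewrite subr_ge0.
  - by rewrite (_ : u + (s - (u - t)) = t + s)//; ring.
  - by rewrite (_ : u + (s - (u - t)) = t + s)//; ring.
by rewrite fT leeD2l// ge_min lexx orbT.
Qed.

Lemma pay_split t u x w : 0 <= t -> t <= u -> (u%:E < T)%E -> I x ->
  (forall v, t <= v <= u -> b v < X t x v w) ->
  (tau_path T b t (fun v => X t x v w) < +oo)%E ->
  payp t t x w = disc t x u w * payp u t x w.
Proof.
move=> t0 tu uT Ix h.
have tT : (t%:E < T)%E by apply: le_lt_trans uT; rewrite lee_fin.
have u0 : 0 <= u by exact: le_trans tu.
have tau0 := tau_path_ge0 b (u := u) uT (fun v => X t x v w).
have tauT := tau_path_leT T b u (fun v => X t x v w).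
rewrite /pay_path (tau_path_split t0 tu uT h).
(* At an infinite hitting time [fine] returns 0 and the two sides would stop at unrelated instants;
   the finiteness hypothesis excludes this. *)
move: tau0 tauT; case: tau_path => [s| |]// s0 sT _.
rewrite /disc -EFinD /= [RHS]mulrA -expRD -opprD.
have ut0 : 0 <= u - t by rewrite subr_ge0.
congr (expR (- _) * g (_, _)); last 2 first.
- by ring.
- by congr (X t x _ w); ring.
rewrite (Rintegral_split_shift ut0 (s := s)) ?lee_fin//.
  congr (_ + _); apply: eq_Rintegral => v _.
  by congr r; congr (_, X t x _ w); ring.
have usT : ((u + s)%:E <= T)%E.
  by move: sT; rewrite leeBrDr// addrC -EFinD.
apply/subspace_continuousP => v; rewrite /= in_itv/= => /andP[v0 vs].
have hv y : y \in `[0, u - t + s] -> Dt t (t + y).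
  rewrite in_itv/= => /andP[y0 ys]; split; first by rewrite lerDl.
  by apply: le_trans usT; rewrite lee_fin; lra.
have ttT : times T t by split=> //; exact: ltW.
have cXv := @cX t x w ttT Ix.
apply/cvgrPdist_lt => e e0.
have Dv : Dt t (t + v) by apply: hv; rewrite in_itv/= v0.
have := hr; move=> /subspace_continuousP /(_ (t + v, X t x (t + v) w)).
have Tv y : Dt t y -> times T y by case=> ty yT; split=> //; exact: le_trans ty.
move=> /(_ (conj (Tv _ Dv) Logic.I)) /cvgrPdist_lt /(_ _ e0).
rewrite near_withinE => -[[U1 U2] /= [[d1 /= d10 U1s] [d2 /= d20 U2s]] hU].
have [d3 d30 h3] := subspace_cvg cXv Dv d20.
rewrite near_withinE; exists (Num.min d1 d3); first by rewrite /= lt_min d10.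
move=> y /= yv ys.
have Dy := hv y ys.
have yv' : `|t + v - (t + y)| < Num.min d1 d3.
  by rewrite opprD addrACA subrr add0r.
move: yv'; rewrite lt_min => /andP[y1 y3].
apply: (hU (t + y, X t x (t + y) w)) => /=; last by split => //; exact: Tv.
split; first exact: U1s.
by apply: U2s => /=; rewrite distrC; apply: h3 => //; rewrite distrC.
Qed.

End dp.

Section dp2.
Variables (R : realType) (d : measure_display) (Omega : measurableType d)
  (P : probability Omega R) (T : \bar R) (I : set R)
  (X : R -> R -> R -> Omega -> R) (r g : R * R -> R) (b : R -> R).
Let Dt (t : R) : set R := [set v | t <= v /\ (v%:E <= T)%E].
Hypothesis mI : measurable I.
Hypothesis mX : forall t x v, 0 <= t -> I x -> t <= v -> (v%:E <= T)%E ->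
  measurable_fun setT (X t x v).
Hypothesis cX : forall t x w, times T t -> I x ->
  {within Dt t, continuous (fun v => X t x v w)}.
Hypothesis hM : markov_family P T I X.
Hypothesis hr : {within times T `*` setT, continuous r}.
Hypothesis hg : {within times T `*` setT, continuous g}.
Hypothesis hwp : well_posed P T I r g X.
Hypothesis hb : {within times T, continuous b}.
Hypothesis hopt : forall t x, times T t -> I x ->
  optimal P T r g X t x (tau_star T b X t x).

Local Notation V := (value P T r g X).
Local Notation payp u t x w := (pay_path T b u r g (fun v => X t x v w)).

Section fixed.
Variables (t x u : R).
Hypothesis t0 : 0 <= t.
Hypothesis tu : t <= u.
Hypothesis uT : (u%:E < T)%E.
Hypothesis Ix : I x.

Let tT : (t%:E < T)%E. Proof. by apply: le_lt_trans uT; rewrite lee_fin. Qed.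
Let ttT : times T t. Proof. by split => //; exact: ltW. Qed.

Lemma nf_measurable E : natural_filtration P (X t x) t u E -> measurable E.
Proof.
apply: natural_filtration_measurable => v tv vu; apply: mX => //.
by apply: le_trans (ltW uT); rewrite lee_fin.
Qed.

(** The process is sampled at times clamped to [t, u], so its joint version is measurable for the
    past of [u] and not only for the whole sigma-algebra. *)
Lemma disc_measurable :
  measurable_fun setT (disc X r t x u : g_sigma_algebraType (nf_gen P (X t x) t u) -> R).
Proof.
pose cl (v : R) := Num.max t (Num.min v u).
have clP v : t <= cl v /\ cl v <= u.
  by rewrite /cl le_max lexx ge_max tu ge_min lexx orbT.
have clid v : t <= v -> v <= u -> cl v = v.
  by move=> tv vu; rewrite /cl (min_idPl vu); exact: max_r.
have ccl : continuous cl.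
  change (continuous (cst t \max (id \min cst u))) => v.
  apply: continuous_max; first exact: cst_continuous.
  apply: continuous_min; [exact: cvg_id|exact: cst_continuous].
have mZ v : measurable_fun setT
    ((fun w => X t x (cl v) w) : g_sigma_algebraType (nf_gen P (X t x) t u) -> R).
  move=> _ A mA; rewrite setTI; have [h1 h2] := clP v.
  exact: natural_filtration_coord.
have [zh [mzh zhE]] := joint_version mZ.
have zhE' w v : zh (v, w) = X t x (cl v) w.
  apply: zhE; apply: (@within_continuous_comp _ _ _ (Dt t) cl (fun v => X t x v w)) => //.
    move=> v'; have [h1 h2] := clP v'; split=> //.
    by apply: le_trans (ltW uT); rewrite lee_fin.
  exact: cX.
have mrh := continuous_measurable2 (continuous_clamp2 t0 tT hr).
pose F (p : R * g_sigma_algebraType (nf_gen P (X t x) t u)) :=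
  r (clampT T t (t + p.1), zh (t + p.1, p.2)) * \1_(`[0, u - t]%classic) p.1.
apply: (eq_measurable_fun (fun w => expR (- \int[lebesgue_measure]_v F (v, w)))).
  move=> w _; rewrite /disc; congr (expR (- _)).
  rewrite [RHS]Rintegral_mkcond; apply: eq_Rintegral => v _.
  rewrite /F /patch indicE /=.
  have [vs|vs] := boolP (v \in `[0, u - t]%classic); last by rewrite mulr0.
  rewrite mulr1; move: vs; rewrite inE/= in_itv/= => /andP[v0 vu].
  have tv : t <= t + v by rewrite lerDl.
  have vu' : t + v <= u by lra.
  rewrite zhE' clid// clampT_id//; split=> //.
  by apply: le_trans (ltW uT); rewrite lee_fin.
apply: measurableT_comp => //; apply: measurable_funN.
apply: measurable_param_Rintegral; apply: measurable_funM.
  have m1 : measurable_fun setT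
     (fun p : R * g_sigma_algebraType (nf_gen P (X t x) t u) => t + p.1).
    exact: measurable_funD.
  apply: (measurableT_comp mrh (g := fun p : R * g_sigma_algebraType (nf_gen P (X t x) t u) =>
     (t + p.1, zh (t + p.1, p.2)))).
  apply: measurable_fun_pair => //.
  by apply: (measurableT_comp mzh); exact: measurable_fun_pair.
apply: (measurableT_comp (f := \1_(`[0, u - t]%classic) : R -> R)) => //.
Qed.

Lemma rate_path_continuous w :
  {within `[0, u - t], continuous (fun v => r (t + v, X t x (t + v) w))}.
Proof.
have sub v : v \in `[0, u - t] -> Dt t (t + v).
  rewrite in_itv/= => /andP[v0 vu]; split; first by rewrite lerDl.
  by apply: le_trans (ltW uT); rewrite lee_fin; lra.
apply: subspace_continuousPe => v /= vin e e0.
have Tv y : Dt t y -> times T y by case=> ty yT; split=> //; exact: le_trans ty.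
have := hr; move=> /subspace_continuousP /(_ (t + v, X t x (t + v) w)).
move=> /(_ (conj (Tv _ (sub _ vin)) Logic.I)) /cvgrPdist_lt /(_ _ e0).
rewrite near_withinE => -[[U1 U2] /= [[d1 /= d10 U1s] [d2 /= d20 U2s]] hU].
have [d3 d30 h3] := subspace_cvg (@cX t x w ttT Ix) (sub _ vin) d20.
exists (Num.min d1 d3); first by rewrite lt_min d10.
move=> y ys yv; have Dy := sub y ys.
have yv' : `|t + y - (t + v)| < Num.min d1 d3.
  by rewrite opprD addrACA subrr add0r.
move: yv'; rewrite lt_min => /andP[y1 y3].
rewrite distrC; apply: (hU (t + y, X t x (t + y) w)) => /=; last by split => //; exact: Tv.
split; first by apply: U1s => /=; rewrite distrC.
by apply: U2s => /=; rewrite distrC; exact: h3.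
Qed.

Lemma disc_bounds K w : 0 <= K ->
  (forall v, t <= v <= u -> `|r (v, X t x v w)| <= K) ->
  `|\int[lebesgue_measure]_(v in `[0, u - t]) r (t + v, X t x (t + v) w)| <= K * (u - t).
Proof.
move=> K0 hK.
have ut0 : 0 <= u - t by rewrite subr_ge0.
have cf := @rate_path_continuous w.
have fi : lebesgue_measure.-integrable `[0, u - t]
    (EFin \o (fun v => r (t + v, X t x (t + v) w))).
  by apply: continuous_compact_integrable => //; exact: segment_compact.
apply: (le_trans (le_normr_Rintegral _ fi)) => //.
have -> : K * (u - t) = \int[lebesgue_measure]_(v in `[0, u - t]) K.
  rewrite Rintegral_cst//= lebesgue_measure_itv/= lte_fin.
  by case: ltP => [_|]; [rewrite -EFinD/= subr0|move=> h; have -> : u - t = 0 by apply/eqP; rewrite eq_le h].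
apply: le_Rintegral => //.
- exact: integrable_norm.
- by apply: continuous_compact_integrable; [exact: segment_compact|move=> ?; exact: cst_continuous].
- move=> v; rewrite /= in_itv/= => /andP[v0 vu].
  by apply: hK; rewrite lerDl v0/=; lra.
Qed.

(** On [A] the path stays in a compact box above [b], so the payoff is the discount times the payoff
    restarted at [u]. The discount is bounded there and known at [u]: [weighted_integral0] lets it
    multiply the identity of [dp_set]. *)
Lemma dp_main A al ar : natural_filtration P (X t x) t u A ->
  (forall y, al <= y <= ar -> I y) ->
  (forall v, t <= v <= u -> b v < al) ->
  (forall w, A w -> forall v, t <= v <= u -> al <= X t x v w <= ar) ->
  P.-integrable A (fun w => (disc X r t x u w * V (u, X t x u w))%:E) /\
  (\int[P]_(w in A) (payp t t x w)%:E =
   \int[P]_(w in A) (disc X r t x u w * V (u, X t x u w))%:E)%E.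
Proof.
move=> nA alI bal hA.
have u0 : 0 <= u by exact: le_trans tu.
have htb : times_before T t by [].
have hub : times_before T u by [].
have [iP _] := pay_value mX cX hr hg hwp hb hopt htb Ix.
have mA := nf_measurable nA.
have [K K0 hK] : exists2 K, 0 < K &
    forall v y, t <= v <= u -> al <= y <= ar -> `|r (v, y)| <= K.
  apply: (box_bounded hr) => -[v y] /= [/itvP hv _]; split=> //; split.
    by apply: (le_trans t0); rewrite hv.
  by apply: le_trans (ltW uT); rewrite lee_fin hv.
pose M := K * (u - t).
have M0 : 0 <= M by apply: mulr_ge0; [exact: ltW|rewrite subr_ge0].
have hd w : A w -> expR (- M) <= disc X r t x u w <= expR M.
  move=> Aw; rewrite /disc !ler_expR -ler_norml normrN.
  by apply: disc_bounds; [exact: ltW|move=> v hv; apply: hK => //; exact: hA].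
have tfin : {ae P, forall w, (tau_path T b t (fun v => X t x v w) < +oo)%E}.
  have [[_ adm] _] := hopt ttT Ix.
  by apply: filterS adm => w [].
have [N [mN PN hN]] := tfin.
pose GG := nf_gen P (X t x) t u.
have nN : natural_filtration P (X t x) t u N by apply: sub_sigma_algebra; right.
(* The factorisation needs a finite stopping time. The null set where it may fail lies in the
   augmented filtration, so [A'] is still an event of the past. *)
pose A' := A `\` N.
have nA' : natural_filtration P (X t x) t u A'.
  exact: (@measurableD _ (g_sigma_algebraType GG)).
have mA' := nf_measurable nA'.
have A'A : A' `<=` A by exact: subIsetl.
have splitA' w : A' w -> payp t t x w = disc X r t x u w * payp u t x w.
  move=> [Aw nNw].
  apply: (@pay_split _ _ _ T I X r g b cX hr t u x w t0 tu uT Ix).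
    by move=> v hv; apply: (lt_le_trans (bal v hv)); have /andP[] := hA w Aw v hv.
  by apply: contrapT => h; apply: nNw; exact: hN.
have mdisc : measurable_fun setT (disc X r t x u).
  by move=> _ B mB; apply: nf_measurable; exact: disc_measurable.
have mpayp := measurable_payp mX cX hr hg hb hub t0 tu Ix.
have ipu : P.-integrable A' (fun w => (payp u t x w)%:E).
  apply: (@le_integrable _ _ _ P _ mA' _ (fun w => (expR M * payp t t x w)%:E)).
  - by apply: measurable_funTS; exact/measurable_EFinP.
  - move=> w A'w; rewrite /= lee_fin (splitA' w A'w) !normrM mulrA ler_peMl//.
    have /andP[h1 h2] := hd w (A'A _ A'w).
    rewrite ger0_norm ?expR_ge0// ger0_norm; last by apply: expR_ge0.
    by rewrite -(expR0 R) -(subrr M) expRD ler_wpM2l ?expR_ge0.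
  - apply: (eq_integrable mA' (fun w => (expR M)%:E * (payp t t x w)%:E)%E).
      by move=> w _; rewrite EFinM.
    by apply: integrableZl => //; apply: (integrableS measurableT).
have hpast E : natural_filtration P (X t x) t u E -> E `<=` A' -> past P I X u t x E.
  move=> nE EA'; split=> //; split; first exact: nf_measurable.
  move=> w Ew; apply: alI; apply: hA; first by apply: A'A; exact: EA'.
  by rewrite tu lexx.
have [iV EV] := dp_set mI mX cX hM hr hg hwp hb hopt hub (hpast _ nA' (@subset_refl _ A')) ipu.
pose phi w := payp u t x w - V (u, X t x u w).
have iphi : P.-integrable A' (EFin \o phi).
  apply: (eq_integrable mA' (fun w => (payp u t x w)%:E - (V (u, X t x u w))%:E)%E).
    by move=> w _; rewrite /phi /= EFinB.
  exact: integrableB.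
have := @weighted_integral0 _ Omega R P GG A' phi (disc X r t x u) (expR M).
move=> /(_ nf_measurable nA' iphi _ disc_measurable) wi0.
have hphi : forall E, natural_filtration P (X t x) t u E -> E `<=` A' ->
    (\int[P]_(w in E) (phi w)%:E = 0)%E.
  move=> E nE EA'.
  have mE := nf_measurable nE.
  have iE : P.-integrable E (fun w => (payp u t x w)%:E) by exact: integrableS ipu.
  have [iVE EVE] := dp_set mI mX cX hM hr hg hwp hb hopt hub (hpast _ nE EA') iE.
  under eq_integral do rewrite EFinB.
  by rewrite integralB// EVE subee// fin_num_abs; have /integrable_fin_num := iVE;
    move=> /(_ mE); rewrite fin_num_abs.
have dv w : 0 <= disc X r t x u w by exact: expR_ge0.
have {wi0} := wi0 hphi dv (fun w A'w => proj2 (andP (hd w (A'A _ A'w)))).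
have -> : (\int[P]_(w in A') (disc X r t x u w * phi w)%:E =
    \int[P]_(w in A') ((payp t t x w)%:E - (disc X r t x u w * V (u, X t x u w))%:E))%E.
  by apply: eq_integral => w /set_mem A'w; rewrite (splitA' w A'w) /phi mulrBr EFinB.
have iPA' : P.-integrable A' (fun w => (payp t t x w)%:E) by apply: (integrableS measurableT).
have hpastA : past P I X u t x A.
  split=> //; split=> // w Aw; apply: alI; apply: hA => //.
  by rewrite tu lexx.
have ipuA : P.-integrable A (fun w => (payp u t x w)%:E).
  apply/(negligible_integrable mN mA _ PN) => //.
  by apply/measurable_EFinP; exact: measurable_funTS.
have [iVA _] := dp_set mI mX cX hM hr hg hwp hb hopt hub hpastA ipuA.
have idVA : P.-integrable A (fun w => (disc X r t x u w * V (u, X t x u w))%:E).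
  apply: (eq_integrable mA ((EFin \o disc X r t x u) \* (fun w => (V (u, X t x u w))%:E))%E).
    by move=> w _ /=; rewrite EFinM.
  apply: integrableMr => //; first exact: measurable_funTS.
  exists (expR M); split; first exact: num_real.
  move=> c Mc w /= Aw; apply: le_trans (ltW Mc).
  by rewrite ger0_norm ?expR_ge0//; have /andP[] := hd w Aw.
have idV : P.-integrable A' (fun w => (disc X r t x u w * V (u, X t x u w))%:E).
  exact: integrableS idVA.
rewrite integralB// => /eqP.
rewrite sube_eq ?integrable_fin_num// add0e => /eqP h.
split=> //.
rewrite (negligible_integral mN mA _ PN)//; last by apply: (integrableS measurableT).
by rewrite [RHS](negligible_integral mN mA _ PN).
Qed.

End fixed.
End dp2.

(** * Exit times of continuous paths *)

Section exit.
Variables (Omega : Type) (R : realType) (Y : R -> Omega -> R) (a c t s : R) (w : Omega).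
Hypothesis ts : t <= s.
Hypothesis cY : {within `[t, s], continuous (fun u => Y u w)}.
Let zeta := exit_time Y a c t s w.

Lemma exit_bounds : t <= zeta <= s.
Proof.
have lb : lbound [set u | u = s \/ (t <= u <= s /\ ~ (a < Y u w < c))] t.
  by move=> u [->//|[/andP[]]].
apply/andP; split; first by apply: lb_le_inf => //; exists s; left.
by apply: ge_inf; [exists t|left].
Qed.

Lemma exit_le u : t <= u <= s -> ~ (a < Y u w < c) -> zeta <= u.
Proof.
move=> tus h; apply: ge_inf; last by right.
by exists t => v [->//|[/andP[]]].
Qed.

Lemma exit_ge u : u <= s -> (forall v, t <= v <= s -> v < u -> a < Y v w < c) -> u <= zeta.
Proof.
move=> us h; apply: lb_le_inf; first by exists s; left.
move=> v [->//|[tvs hv]]; rewrite leNgt; apply/negP => vu.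
by apply: hv; exact: h.
Qed.

Lemma exit_inside u : t <= u -> u < zeta -> a < Y u w < c.
Proof.
move=> tu uz; apply: contrapT => h; move: uz.
have /andP[_ zs] := exit_bounds.
by move=> uz; move: (uz); rewrite ltNge exit_le// tu (le_trans (ltW uz) zs).
Qed.

Lemma exit_ltP u : t <= u -> u < s ->
  u < zeta <-> (forall v, t <= v <= u -> a < Y v w < c).
Proof.
move=> tu us; split=> [uz v /andP[tv vu]|h]; first by apply: exit_inside => //; exact: le_lt_trans uz.
have uin : u \in `[t, s] by rewrite in_itv/= tu ltW.
have /andP[a0 c0] : a < Y u w < c by apply: h; rewrite tu lexx.
have e0 : 0 < Num.min (Y u w - a) (c - Y u w) by rewrite lt_min !subr_gt0 a0.
have [dl dl0 hd] := subspace_cvg cY uin e0.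
apply: (@lt_le_trans _ _ (Num.min s (u + dl))); first by rewrite lt_min us ltrDl.
apply: exit_ge; first by rewrite ge_min lexx.
move=> v /andP[tv vs]; rewrite lt_min => /andP[vs' vd].
have [vu|uv] := leP v u; first by apply: h; rewrite tv.
have : `|Y v w - Y u w| < Num.min (Y u w - a) (c - Y u w).
  apply: hd; first by rewrite /= in_itv/= tv.
  by rewrite ltr_norml; apply/andP; split; lra.
rewrite ltr_norml lt_min => /andP[h1 /andP[h2 h3]].
move: h1; rewrite ltrNl lt_min => /andP[h4 h5].
by apply/andP; split; lra.
Qed.

Lemma exit_start : t < s -> a < Y t w < c -> t < zeta.
Proof.
move=> ts' h; apply/exit_ltP => // v; rewrite -eq_le => /eqP <-//.
Qed.

Lemma exit_closed u : a < Y t w < c -> t <= u <= zeta -> a <= Y u w <= c.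
Proof.
move=> h /andP[tu uz]; have /andP[_ zs] := exit_bounds.
have [->|ut] := eqVneq u t; first by move/andP: h => [/ltW-> /ltW].
have tu' : t < u by rewrite lt_neqAle eq_sym ut.
have uin : u \in `[t, s] by rewrite in_itv/= tu (le_trans uz).
have key e : 0 < e -> exists v, [/\ a < Y v w < c & `|Y v w - Y u w| < e].
  move=> e0; have [dl dl0 hd] := subspace_cvg cY uin e0.
  pose v := Num.max t (u - dl / 2).
  have vu : v < u by rewrite gt_max tu'/=; lra.
  have tv : t <= v by rewrite le_max lexx.
  exists v; split; first by apply: exit_inside => //; exact: lt_le_trans uz.
  apply: hd; first by rewrite /= in_itv/= tv ltW//; apply: (lt_le_trans vu); exact: le_trans zs.
  have : u - dl / 2 <= v by rewrite le_max lexx orbT.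
  by move=> h'; rewrite ltr_norml; apply/andP; split; lra.
apply/andP; split; rewrite leNgt; apply/negP => hu.
  have [|v [/andP[h1 h2]]] := key (a - Y u w); first by rewrite subr_gt0.
  by rewrite ltr_norml => /andP[h3 h4]; lra.
have [|v [/andP[h1 h2]]] := key (Y u w - c); first by rewrite subr_gt0.
by rewrite ltr_norml => /andP[h3 h4]; lra.
Qed.

(** The gap between the two intervals buys a time [dl] after the exit; a grid time just after the
    exit falls within it. *)
Lemma exit_after a' c' : a' < a -> c < c' -> a < Y t w < c ->
  exists2 dl, 0 < dl & forall u, t <= u <= s -> u <= zeta + dl -> a' <= Y u w <= c'.
Proof.
move=> a'a cc' h; have /andP[tz zs] := exit_bounds.
have zin : zeta \in `[t, s] by rewrite in_itv/= tz.
have /andP[h1 h2] : a <= Y zeta w <= c by apply: exit_closed => //; rewrite tz lexx.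
have e0 : 0 < Num.min (a - a') (c' - c) by rewrite lt_min !subr_gt0 a'a.
have [dl dl0 hd] := subspace_cvg cY zin e0.
exists (dl / 2); first by rewrite divr_gt0.
move=> u /andP[tu us] uz; have [uz'|zu] := leP u zeta.
  have /andP[h3 h4] : a <= Y u w <= c by apply: exit_closed => //; rewrite tu.
  by apply/andP; split; lra.
have : `|Y u w - Y zeta w| < Num.min (a - a') (c' - c).
  apply: hd; first by rewrite /= in_itv/= tu.
  by rewrite ltr_norml; apply/andP; split; lra.
rewrite ltr_norml lt_min => /andP[h3 /andP[h4 h5]].
move: h3; rewrite ltrNl lt_min => /andP[h6 h7].
by apply/andP; split; lra.
Qed.

End exit.

Section confined.
Variables (R : realType) (d : measure_display) (Omega : measurableType d)
  (P : probability Omega R) (Y : R -> Omega -> R) (t u : R).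
Hypothesis tu : t <= u.
Hypothesis cY : forall w, {within `[t, u], continuous (fun v => Y v w)}.

Definition within_closed lo hi := [set w | forall v, t <= v <= u -> lo <= Y v w <= hi].
Definition within_open lo hi := [set w | forall v, t <= v <= u -> lo < Y v w < hi].

(** A closed condition on a continuous path is decided at rational times, here clamped so that every
    index names a time of [t, u]. *)
Lemma within_closed_nf lo hi : natural_filtration P Y t u (within_closed lo hi).
Proof.
pose cl (v : R) := Num.max t (Num.min v u).
have clP v : t <= cl v /\ cl v <= u.
  by rewrite /cl le_max lexx ge_max tu ge_min lexx orbT.
have clL v v' : t <= v' <= u -> `|cl v - v'| <= `|v - v'|.
  move=> /andP[h1 h2]; rewrite /cl /Num.max /Num.min.
  have [vu|uv] := ltP v u; have [tv|vt] := ltP t _ => //.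
  - by rewrite !ler0_norm; lra.
  - by rewrite ger0_norm ?subr_ge0// ger0_norm; lra.
  - by have -> : v' = t; [lra|rewrite subrr normr0].
rewrite (_ : within_closed lo hi = \bigcap_k (Y (cl (ratn R k)) @^-1` `[lo, hi])); last first.
  apply/seteqP; split=> [w h k _ /=|w h v vtu].
    by rewrite in_itv/=; apply: h; apply/andP; exact: clP.
  have vin : v \in `[t, u] by rewrite in_itv.
  have key e : 0 < e -> exists v', [/\ lo <= Y v' w <= hi & `|Y v' w - Y v w| < e].
    move=> e0; have [dl dl0 hd] := subspace_cvg (@cY w) vin e0.
    have [k /andP[k1 k2]] : exists k, v - dl < ratn R k < v + dl by apply: ratn_dense; lra.
    exists (cl (ratn R k)); split; first by have := h k Logic.I; rewrite /= in_itv.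
    apply: hd; first by rewrite /= in_itv/=; apply/andP; exact: clP.
    by apply: (le_lt_trans (clL _ _ vtu)); rewrite ltr_norml; apply/andP; split; lra.
  apply/andP; split; rewrite leNgt; apply/negP => hu.
    have [|v' [/andP[h1 h2]]] := key (lo - Y v w); first by rewrite subr_gt0.
    by rewrite ltr_norml => /andP[h3 h4]; lra.
  have [|v' [/andP[h1 h2]]] := key (Y v w - hi); first by rewrite subr_gt0.
  by rewrite ltr_norml => /andP[h3 h4]; lra.
apply: (@bigcapT_measurable _ (g_sigma_algebraType (nf_gen P Y t u))) => k; have [h1 h2] := clP (ratn R k).
exact: natural_filtration_coord.
Qed.

(** On a compact interval the path attains its extrema, so an open condition holds with a margin
    1/(m+1) and is a countable union of closed ones. *)
Lemma within_open_nf lo hi : natural_filtration P Y t u (within_open lo hi).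
Proof.
rewrite (_ : within_open lo hi =
    \bigcup_m within_closed (lo + m.+1%:R^-1) (hi - m.+1%:R^-1)); last first.
  apply/seteqP; split=> [w h|w [m _ h] v hv]; last first.
    have m0 : (0 : R) < m.+1%:R^-1 by rewrite invr_gt0 ltr0n.
    have /andP[h1 h2] := h v hv; apply/andP.
    by move: (m.+1%:R^-1) m0 h1 h2 => q *; split; lra.
  have [v1 hv1 m1] := EVT_min tu (@cY w).
  have [v2 hv2 m2] := EVT_max tu (@cY w).
  have /andP[l1 _] : lo < Y v1 w < hi by apply: h; rewrite in_itv/= in hv1.
  have /andP[_ l2] : lo < Y v2 w < hi by apply: h; rewrite in_itv/= in hv2.
  pose e := Num.min (Y v1 w - lo) (hi - Y v2 w).
  have e0 : 0 < e by rewrite lt_min !subr_gt0 l1.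
  have [e1 e2] : e <= Y v1 w - lo /\ e <= hi - Y v2 w.
    by rewrite /e !ge_min !lexx orbT.
  exists (Num.truncn e^-1) => // v hv.
  have hm : (Num.truncn e^-1).+1%:R^-1 <= e.
    by rewrite invf_ple ?posrE ?ltr0n//; apply/ltW; rewrite truncnS_gt.
  have vin : v \in `[t, u] by rewrite in_itv.
  have := m1 v vin; have := m2 v vin.
  move: hm; move: (_^-1) => q qe h1 h2; apply/andP; split.
    by move: (Y v1 w) (Y v2 w) (Y v w) e1 e2 h1 h2 => p1 p2 p3 *; lra.
  by move: (Y v1 w) (Y v2 w) (Y v w) e1 e2 h1 h2 => p1 p2 p3 *; lra.
apply: (@bigcupT_measurable _ (g_sigma_algebraType (nf_gen P Y t u))) => //.
by move=> m; exact: within_closed_nf.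
Qed.

End confined.

Lemma within_cvg_seq (S U : topologicalType) (D : set S) (f : S -> U)
    (u : nat -> S) (l : S) :
  {within D, continuous f} -> D l -> (\forall n \near \oo, D (u n)) ->
  u n @[n --> \oo] --> l -> f (u n) @[n --> \oo] --> f l.
Proof.
move=> /subspace_continuousP cf Dl Du ul A /(cf l Dl) hA.
by apply: (@filterS2 nat \oo _ _ _ (fun n => A (f (u n))) _ Du (ul _ hA)) => n Dn; apply.
Qed.

(** * Discretisation of the exit time *)

Section stopping.
Variables (R : realType) (d : measure_display) (Omega : measurableType d)
  (P : probability Omega R) (T : \bar R) (I : set R)
  (X : R -> R -> R -> Omega -> R) (r g : R * R -> R) (b : R -> R).
Let Dt (t : R) : set R := [set v | t <= v /\ (v%:E <= T)%E].
Hypothesis mI : measurable I.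
Hypothesis mX : forall t x v, 0 <= t -> I x -> t <= v -> (v%:E <= T)%E ->
  measurable_fun setT (X t x v).
Hypothesis cX : forall t x w, times T t -> I x ->
  {within Dt t, continuous (fun v => X t x v w)}.
Hypothesis hM : markov_family P T I X.
Hypothesis hr : {within times T `*` setT, continuous r}.
Hypothesis hg : {within times T `*` setT, continuous g}.
Hypothesis hwp : well_posed P T I r g X.
Hypothesis hv : {within times T `*` I, continuous (value P T r g X)}.
Hypothesis hb : {within times T, continuous b}.
Hypothesis hopt : forall t x, times T t -> I x ->
  optimal P T r g X t x (tau_star T b X t x).

Local Notation V := (value P T r g X).
Local Notation payp u t x w := (pay_path T b u r g (fun v => X t x v w)).

Variables (t x s a' a c c' : R).
Hypotheses (t0 : 0 <= t) (ts : t < s) (sT : (s%:E < T)%E) (Ix : I x).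
Hypotheses (a'a : a' < a) (cc' : c < c') (boxI : forall y, a' <= y <= c' -> I y).
Hypothesis b_lt : forall v, t <= v <= s -> b v < a'.

Let Y := X t x.
Let zeta := exit_time Y a c t s.
Let htb : times_before T t.
Proof. by split=> //; apply: lt_trans sT; rewrite lte_fin. Qed.
Let htt : times T t.
Proof. by split=> //; apply: ltW; case: htb. Qed.
Let cYu u w : u <= s -> {within `[t, u], continuous (fun v => Y v w)}.
Proof.
move=> us; apply: continuous_subspaceW (@cX t x w htt Ix) => v /=.
rewrite in_itv/= => /andP[tv vu]; split=> //.
by apply: le_trans (ltW sT); rewrite lee_fin; exact: le_trans us.
Qed.

Definition started := [set w | a < Y t w < c].

Definition grid n j := t + j%:R * ((s - t) / n.+1%:R).

Let dn n : 0 < (s - t) / n.+1%:R.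
Proof. by rewrite divr_gt0 ?subr_gt0 ?ltr0n. Qed.

Lemma grid_bounds n j : (j <= n.+1)%N -> t <= grid n j <= s.
Proof.
move=> jn; apply/andP; split; first by rewrite /grid lerDl mulr_ge0// ltW.
rewrite /grid -lerBrDl mulrCA ger_pMr ?subr_gt0// ler_pdivrMr ?ltr0n// mul1r.
by rewrite ler_nat.
Qed.

Lemma grid_last n : grid n n.+1 = s.
Proof. by rewrite /grid mulrCA mulfV ?pnatr_eq0// mulr1 addrC subrK. Qed.

Lemma grid_mono n i j : (i <= j)%N -> grid n i <= grid n j.
Proof. by move=> ij; rewrite /grid lerD2l (ler_wpM2r (ltW (dn n)))// ler_nat. Qed.

(* The part of {s_(j-1) < zeta <= s_j} on which the path has not left [a', c']. *)
Definition slot n j : set Omega :=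
  started `&` within_closed Y t (grid n j) a' c' `&`
  ([set w | j = 0%N \/ within_open Y t (grid n j.-1) a c w] `&`
   [set w | j = n.+1 \/ ~ within_open Y t (grid n j) a c w]).

Lemma started_nf u : t <= u -> natural_filtration P Y t u started.
Proof.
move=> tu; rewrite (_ : started = Y t @^-1` `]a, c[).
  exact: natural_filtration_coord.
by apply/seteqP; split=> w; rewrite /started /= in_itv.
Qed.

Lemma slot_nf n j : (j <= n.+1)%N -> natural_filtration P Y t (grid n j) (slot n j).
Proof.
move=> jn; have /andP[h1 h2] := grid_bounds jn.
have cY1 w : {within `[t, grid n j], continuous (fun v => Y v w)} by exact: cYu.
pose S := g_sigma_algebraType (nf_gen P Y t (grid n j)).
apply: (@measurableI _ S); apply: (@measurableI _ S).
- exact: started_nf.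
- exact: within_closed_nf.
- have [j0|j0] := eqVneq j 0%N.
    have -> : [set w | j = 0%N \/ within_open Y t (grid n j.-1) a c w] = setT.
      by apply/seteqP; split => // w _; left.
    exact: (@measurableT _ S).
  have -> : [set w | j = 0%N \/ within_open Y t (grid n j.-1) a c w] =
    within_open Y t (grid n j.-1) a c.
    by apply/seteqP; split => // w; [case=> // /eqP; rewrite (negbTE j0)|right].
  have jj : grid n j.-1 <= grid n j by apply: grid_mono; exact: leq_pred.
  apply: (natural_filtrationS jj).
  have /andP[h3 h4] : t <= grid n j.-1 <= s.
    by apply: grid_bounds; exact: leq_trans (leq_pred _) jn.
  by apply: within_open_nf => // w; exact: cYu.
- have [j0|j0] := eqVneq j n.+1.
    have -> : [set w | j = n.+1 \/ ~ within_open Y t (grid n j) a c w] = setT.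
      by apply/seteqP; split => // w _; left.
    exact: (@measurableT _ S).
  have -> : [set w | j = n.+1 \/ ~ within_open Y t (grid n j) a c w] =
      ~` within_open Y t (grid n j) a c.
    by apply/seteqP; split => // w; [case=> // /eqP; rewrite (negbTE j0)|right].
  by apply: (@measurableC _ S); exact: within_open_nf.
Qed.

Lemma slot_uniq n i j w : slot n i w -> slot n j w -> (i <= n.+1)%N -> (j <= n.+1)%N -> i = j.
Proof.
have key k l : (k < l)%N -> slot n k w -> slot n l w -> (l <= n.+1)%N -> False.
  move=> kl [_ [_ /= ok]] [_ [/= ol _]] ln.
  case: ok => [kn|]; first by move: (leq_trans kl ln); rewrite kn ltnn.
  apply; case: ol => [l0|ol]; first by move: kl; rewrite l0.
  move=> v /andP[tv vk]; apply: ol; rewrite tv/= (le_trans vk)//.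
  by apply: grid_mono; rewrite -ltnS prednK//; exact: leq_ltn_trans kl.
move=> si sj li lj; case: (ltngtP i j) => // h; exfalso.
  exact: key h si sj lj.
exact: key h sj si li.
Qed.

(** [j] is the first grid index by which the path has left ]a, c[, or the last index of the grid;
    its time exceeds the exit time by at most one mesh. *)
Lemma slot_near n w : started w -> exists2 j, (j <= n.+1)%N &
  zeta w <= grid n j <= zeta w + (s - t) / n.+1%:R /\
  (within_closed Y t (grid n j) a' c' w -> slot n j w).
Proof.
move=> sw; have cY := @cYu s w (lexx s).
pose Q j := (j == n.+1) || ~~ `[< within_open Y t (grid n j) a c w >].
have exQ : exists j, Q j by exists n.+1; rewrite /Q eqxx.
case: (ex_minnP exQ) => j Qj jmin.
have jn : (j <= n.+1)%N by apply: jmin; rewrite /Q eqxx.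
have o1 : j = 0%N \/ within_open Y t (grid n j.-1) a c w.
  case: (posnP j) => [|j0]; [by left|right].
  apply: contrapT => h; have : (j <= j.-1)%N.
    by apply: jmin; rewrite /Q; apply/orP; right; apply/asboolP.
  by rewrite leqNgt prednK// leqnn.
have o2 : j = n.+1 \/ ~ within_open Y t (grid n j) a c w.
  by move: Qj => /orP[/eqP|/asboolP]; [left|right].
have /andP[tg gs] := grid_bounds jn.
have /andP[tz zs] := exit_bounds Y a c w (ltW ts).
exists j => //; split; last by move=> h; split.
apply/andP; split.
  case: o2 => [->|h]; first by rewrite grid_last.
  rewrite leNgt; apply/negP => gz; apply: h => v /andP[tv vg].
  by apply: (exit_inside (ltW ts)) => //; exact: le_lt_trans gz.
case: o1 => [->|h]; first by rewrite /grid mul0r addr0; apply: (le_trans tz); rewrite lerDl ltW.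
case: (posnP j) => [->|j0]; first by rewrite /grid mul0r addr0; apply: (le_trans tz); rewrite lerDl ltW.
have -> : grid n j = grid n j.-1 + (s - t) / n.+1%:R.
  by rewrite /grid -addrA; congr (_ + _); rewrite -{1}(prednK j0) -natr1 mulrDl mul1r.
rewrite lerD2r; apply: exit_ge.
  have /andP[] // : t <= grid n j.-1 <= s.
  by apply: grid_bounds; exact: leq_trans (leq_pred _) jn.
by move=> v /andP[tv vs] vg; apply: h; rewrite tv ltW.
Qed.

Lemma sum_slot n (f : nat -> Omega -> R) w j : (j <= n.+1)%N -> slot n j w ->
  (\sum_(i < n.+2) ((EFin \o f i) \_ (slot n i)) w = (f j w)%:E)%E.
Proof.
move=> jn sj; have jn' : (j < n.+2)%N by [].
rewrite (bigD1 (Ordinal jn'))//= [X in (X + _)%E]patchE mem_set// big1 ?adde0//.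
move=> i ij; rewrite patchE memNset// => si.
move/eqP: ij; apply; apply/val_inj => /=.
by apply: slot_uniq si sj _ _ => //; rewrite -ltnS.
Qed.

Lemma sum_slot0 n (f : nat -> Omega -> R) w : (forall j, (j <= n.+1)%N -> ~ slot n j w) ->
  (\sum_(i < n.+2) ((EFin \o f i) \_ (slot n i)) w = 0)%E.
Proof.
by move=> h; rewrite big1// => i _; rewrite patchE memNset//; apply: h; rewrite -ltnS.
Qed.

Lemma disc_path_continuous w : {within `[t, s], continuous (fun u => disc X r t x u w)}.
Proof.
have cf := @rate_path_continuous _ _ _ T I X r cX hr t x s t0 (ltW ts) sT Ix w.
have st0 : 0 <= s - t by rewrite subr_ge0 ltW.
have fi : lebesgue_measure.-integrable `[0, s - t]
    (EFin \o (fun v => r (t + v, X t x (t + v) w))).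
  by apply: continuous_compact_integrable => //; exact: segment_compact.
have cp := parameterized_integral_continuous st0 fi.
have sub v : v \in `[t, s] -> v - t \in `[0, s - t].
  by rewrite !in_itv/= => /andP[? ?]; apply/andP; split; lra.
apply: subspace_continuousPe => v vin e e0.
have /cvgrPdist_lt /(_ _ e0) [d1 /= d10 h1] := @continuous_expR R
  (- parameterized_integral lebesgue_measure 0 (v - t)
       (fun v => r (t + v, X t x (t + v) w))).
have [dl dl0 hd] := subspace_cvg cp (sub _ vin) d10.
exists dl => // y yin yv; rewrite distrC; apply: h1.
rewrite /= opprK addrC; apply: hd; first exact: sub.
by rewrite opprB addrA subrK.
Qed.

(** On each slot the exit time is replaced by a deterministic grid time, where [dp_main] applies. A
    path that leaves the larger box within one mesh lies in no slot and contributes 0, but by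
    [exit_after] every started path lies in a slot once the mesh is fine. The payoff dominates one
    side of the limit, the bounds of [r] and [V] on the box dominate the other. *)
Lemma optional_stopping :
  P.-integrable started
    (fun w => (disc X r t x (zeta w) w * V (zeta w, Y (zeta w) w))%:E) /\
  (\int[P]_(w in started) (payp t t x w)%:E =
   \int[P]_(w in started) (disc X r t x (zeta w) w * V (zeta w, Y (zeta w) w))%:E)%E.
Proof.
have [iP _] := pay_value mX cX hr hg hwp hb hopt htb Ix.
pose D n j w := disc X r t x (grid n j) w * V (grid n j, Y (grid n j) w).
have gT n j : (j <= n.+1)%N -> ((grid n j)%:E < T)%E.
  by move=> /grid_bounds /andP[_ h]; apply: le_lt_trans sT; rewrite lee_fin.
have dpj n j : (j <= n.+1)%N ->
    P.-integrable (slot n j) (EFin \o D n j) /\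
    (\int[P]_(w in slot n j) (payp t t x w)%:E = \int[P]_(w in slot n j) (D n j w)%:E)%E.
  move=> jn; have /andP[tg gs] := grid_bounds jn.
  apply: (dp_main mI mX cX hM hr hg hwp hb hopt t0 tg (gT n j jn) Ix (slot_nf jn) boxI).
    by move=> v /andP[tv vg]; apply: b_lt; rewrite tv (le_trans vg).
  by move=> w [[_ h] _] v; exact: h.
have mslot n j : (j <= n.+1)%N -> measurable (slot n j).
  move=> jn; have /andP[tg gs] := grid_bounds jn.
  exact: (nf_measurable mX t0 (gT n j jn) Ix (slot_nf jn)).
pose S n w := (\sum_(i < n.+2) ((fun w => (payp t t x w)%:E) \_ (slot n i)) w)%E.
pose Z n w := (\sum_(i < n.+2) ((EFin \o D n i) \_ (slot n i)) w)%E.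
have iSi n (i : 'I_n.+2) : P.-integrable setT ((fun w => (payp t t x w)%:E) \_ (slot n i)).
  have ni : (i <= n.+1)%N by rewrite -ltnS.
  by apply/(integrable_mkcond _ (mslot n i ni)); apply: (integrableS measurableT) => //; exact: mslot.
have iZi n (i : 'I_n.+2) : P.-integrable setT ((EFin \o D n i) \_ (slot n i)).
  have ni : (i <= n.+1)%N by rewrite -ltnS.
  by apply/(integrable_mkcond _ (mslot n i ni)); have [] := dpj n i ni.
have ESZ n : (\int[P]_w S n w = \int[P]_w Z n w)%E.
  rewrite !integral_sum//; apply: eq_bigr => i _; rewrite -!integral_mkcond.
  by have [] // := dpj n i; rewrite -ltnS.
have near_slot w : started w -> exists j : nat -> nat,
    [/\ (forall n, (j n <= n.+1)%N), grid n (j n) @[n --> \oo] --> zeta w,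
        (\forall n \near \oo, a' <= Y (grid n (j n)) w <= c')
      & \forall n \near \oo, slot n (j n) w].
  move=> sw; have h n := slot_near n sw.
  have /choice[j hj] : forall n, exists j, [/\ (j <= n.+1)%N,
      zeta w <= grid n j <= zeta w + (s - t) / n.+1%:R &
      within_closed Y t (grid n j) a' c' w -> slot n j w].
    by move=> n; have [j ? [? ?]] := h n; exists j; split.
  have jn n : (j n <= n.+1)%N by have [] := hj n.
  have dn0 : (fun n => (s - t) / n.+1%:R) @ \oo --> 0.
    by rewrite -(mulr0 (s - t)); apply: cvgM; [exact: cvg_cst|exact: cvg_harmonic].
  have [dl dl0 hd] := exit_after (ltW ts) (@cYu s w (lexx s)) a'a cc' sw.
  have clo : \forall n \near \oo, within_closed Y t (grid n (j n)) a' c' w.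
    have /cvgrPdist_lt /(_ _ dl0) := dn0; apply: filterS => n /=.
    rewrite sub0r normrN => /(le_lt_trans (ler_norm _)) hn.
    have [_ /andP[_ h2] _] := hj n; have /andP[tg gs] := grid_bounds (jn n).
    move=> v /andP[tv vg]; apply: hd; first by rewrite tv (le_trans vg).
    by apply: (le_trans vg); apply: (le_trans h2); rewrite lerD2l ltW.
  exists j; split => //.
  - apply: (@squeeze_cvgr _ _ _ _ (cst (zeta w)) (fun n => zeta w + (s - t) / n.+1%:R)).
    + by apply: nearW => n; have [] := hj n.
    + exact: cvg_cst.
    + by rewrite -[X in _ --> X]addr0; apply: cvgD => //; exact: cvg_cst.
  - apply: filterS clo => n; apply.
    by have /andP[-> _] := grid_bounds (jn n); rewrite lexx.
  - by apply: filterS clo => n hn; have [_ _] := hj n; apply.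
have off n w : ~ started w -> forall j, (j <= n.+1)%N -> ~ slot n j w.
  by move=> nw j _ [[]].
have mst : measurable started.
  exact: (nf_measurable mX t0 sT Ix (started_nf (ltW ts))).
have Scvg w : S n w @[n --> \oo] --> ((fun w => (payp t t x w)%:E) \_ started) w.
  have [sw|nw] := pselect (started w); last first.
    rewrite patchE memNset//; apply: (@cvg_trans _ ((fun=> 0%E) @ \oo)); last exact: cvg_cst.
    by apply: near_eq_cvg; near=> n; rewrite /S (sum_slot0 (fun=> fun w => payp t t x w) (off n w nw)).
  have [j [jn _ _ js]] := near_slot w sw.
  rewrite patchE mem_set//.
  apply: (@cvg_trans _ ((fun=> (payp t t x w)%:E) @ \oo)); last exact: cvg_cst.
  apply: near_eq_cvg; near=> n.
  rewrite /S (sum_slot (fun=> fun w => payp t t x w) (jn n))//.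
  by near: n.
have Zcvg w : Z n w @[n --> \oo] -->
    ((fun w => (disc X r t x (zeta w) w * V (zeta w, Y (zeta w) w))%:E) \_ started) w.
  have [sw|nw] := pselect (started w); last first.
    rewrite patchE memNset//; apply: (@cvg_trans _ ((fun=> 0%E) @ \oo)); last exact: cvg_cst.
    by apply: near_eq_cvg; near=> n; rewrite /Z (sum_slot0 (D n) (off n w nw)).
  have [j [jn gz jb js]] := near_slot w sw.
  rewrite patchE mem_set//.
  apply: (@cvg_trans _ ((fun n => (D n (j n) w)%:E) @ \oo)).
    by apply: near_eq_cvg; near=> n; rewrite /Z (sum_slot (D n) (jn n))//; near: n.
  apply: cvg_EFin; first by near=> n.
  have /andP[tz zs] := exit_bounds Y a c w (ltW ts).
  have zin : `[t, s]%classic (zeta w) by rewrite /= in_itv/= tz.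
  have gin n : `[t, s]%classic (grid n (j n)) by rewrite /= in_itv/=; exact: grid_bounds.
  have gin' : \forall n \near \oo, `[t, s]%classic (grid n (j n)) by exact: nearW.
  rewrite /comp /D /=; apply: cvgM.
    exact: (within_cvg_seq (@disc_path_continuous w) zin gin' gz).
  have gY := within_cvg_seq (@cYu s w (lexx s)) zin gin' gz.
  have Tin v : `[t, s]%classic v -> times T v.
    rewrite /= in_itv/= => /andP[tv vs]; split; first exact: le_trans tv.
    by apply: (le_trans _ (ltW sT)); rewrite lee_fin.
  apply: (within_cvg_seq (u := fun n => (grid n (j n), Y (grid n (j n)) w)) hv).
  - split; first exact: Tin.
    apply: boxI; have /andP[h1 h2] : a <= Y (zeta w) w <= c.
      by apply: (exit_closed (ltW ts) (@cYu s w (lexx s)) sw); rewrite tz lexx.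
    by rewrite (le_trans (ltW a'a))// (le_trans h2)// ltW.
  - by apply: filterS jb => n hn; split; [exact: Tin (gin n)|exact: boxI].
  - exact: (cvg_pair gz gY).
have iS n : P.-integrable setT (S n) by apply: integrable_sum.
have iZ n : P.-integrable setT (Z n) by apply: integrable_sum.
have [Kr Kr0 hKr] : exists2 K, 0 < K &
    forall v y, t <= v <= s -> a' <= y <= c' -> `|r (v, y)| <= K.
  apply: (box_bounded hr) => -[v y] /= [/itvP hv' _]; split=> //; split.
    by apply: (le_trans t0); rewrite hv'.
  by apply: le_trans (ltW sT); rewrite lee_fin hv'.
have [Kv Kv0 hKv] : exists2 K, 0 < K &
    forall v y, t <= v <= s -> a' <= y <= c' -> `|V (v, y)| <= K.
  apply: (box_bounded hv) => -[v y] /= [/itvP hv' yin]; split; last first.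
    by apply: boxI; move: yin; rewrite /= in_itv.
  split; first by apply: (le_trans t0); rewrite hv'.
  by apply: le_trans (ltW sT); rewrite lee_fin hv'.
have ZB n w : (`|Z n w| <= (expR (Kr * (s - t)) * Kv)%:E)%E.
  have [[j jn sj]|h] := pselect (exists2 j, (j <= n.+1)%N & slot n j w); last first.
    rewrite /Z (sum_slot0 (D n)); last by move=> j jn sj; apply: h; exists j.
    by rewrite abse0 lee_fin mulr_ge0 ?expR_ge0// ltW.
  rewrite /Z (sum_slot (D n) jn sj) lee_fin /D normrM.
  have /andP[tg gs] := grid_bounds jn.
  have box v : t <= v <= grid n j -> a' <= Y v w <= c' by case: sj => [[_ h] _]; exact: h.
  apply: ler_pM => //; last first.
    by apply: hKv; [rewrite tg|apply: box; rewrite tg lexx].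
  rewrite ger0_norm ?expR_ge0// ler_expR.
  apply: (@le_trans _ _ (Kr * (grid n j - t))); last by rewrite ler_pM2l// lerD2r.
  apply: (le_trans (ler_norm _)); rewrite normrN.
  apply: (disc_bounds cX hr t0 tg (gT n j jn) Ix (ltW Kr0)) => v hv'.
  by apply: hKr; [move/andP: hv' => [-> /le_trans->]|exact: box].
have c1 : (\int[P]_w S n w)%E @[n --> \oo] -->
    (\int[P]_w ((fun w => (payp t t x w)%:E) \_ started) w)%E.
  apply: (@dominated_cvg _ _ _ P _ measurableT _ _ (fun w => `|(payp t t x w)%:E|%E)) => //.
  - by move=> n; have /integrableP[] := iS n.
  - exact: integrable_abse.
  - move=> n w _; have [[j jn sj]|h] := pselect (exists2 j, (j <= n.+1)%N & slot n j w).
      by rewrite /S (sum_slot (fun=> fun w => payp t t x w) jn sj).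
    rewrite /S (sum_slot0 (fun=> fun w => payp t t x w)); last first.
      by move=> j jn sj; apply: h; exists j.
    by rewrite abse0 abse_ge0.
have mlim : measurable_fun setT
    ((fun w => (disc X r t x (zeta w) w * V (zeta w, Y (zeta w) w))%:E) \_ started).
  apply: (emeasurable_fun_cvg Z); last by move=> w _; exact: Zcvg.
  by move=> n; have /integrableP[] := iZ n.
have mZ n : measurable_fun setT (Z n) by have /integrableP[] := iZ n.
have icst : P.-integrable setT (cst (expR (Kr * (s - t)) * Kv)%:E).
  exact: finite_measure_integrable_cst.
have [ilim _ c2] := @dominated_convergence _ _ _ P _ measurableT Z _
  (cst (expR (Kr * (s - t)) * Kv)%:E) mZ mlim
  (aeW P (fun w _ => Zcvg w)) icst
  (aeW P (fun w n _ => ZB n w)).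
split; first exact/(integrable_mkcond _ mst).
rewrite integral_mkcond [RHS]integral_mkcond.
apply: (@cvg_unique _ (@ereal_hausdorff R) _ _ _ _ c1).
rewrite /= (_ : (fun n => \int[P]_w S n w)%E = (fun n => \int[P]_w Z n w)%E) //; apply/funext => n; exact: ESZ.
Unshelve. all: by end_near. Qed.

End stopping.

(** * Exponential moments of stochastic integrals *)

Lemma integral_density d (T : measurableType d) (R : realType)
    (mu nu : {measure set T -> \bar R}) (p : T -> R) (f : T -> \bar R) :
  measurable_fun setT p -> (forall y, 0 <= p y) ->
  (forall A, measurable A -> nu A = \int[mu]_(y in A) (p y)%:E)%E ->
  measurable_fun setT f -> (forall y, 0 <= f y)%E ->
  (\int[nu]_y f y = \int[mu]_y (f y * (p y)%:E))%E.
Proof.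
move=> mp p0 nuE mf f0.
have mpE : measurable_fun setT (EFin \o p) by exact/measurable_EFinP.
have simple (g : {nnsfun T >-> R}) :
    (\int[nu]_y (g y)%:E = \int[mu]_y ((g y)%:E * (p y)%:E))%E.
  have gE y : ((g y)%:E = \sum_(r \in range g) (r%:E * (\1_(g @^-1` [set r]) y)%:E))%E.
    by rewrite fimfunE -fsumEFin//; apply: eq_fsbigr => r _; rewrite EFinM.
  have mset r : measurable (g @^-1` [set r]) by [].
  have pos r y : (0 <= r%:E * (\1_(g @^-1` [set r]) y)%:E)%E.
    rewrite indicE; case: (boolP (_ \in _)) => [|_]; last by rewrite mule0.
    by rewrite inE/= => <-; rewrite mule1 lee_fin.
  under eq_integral do rewrite gE.
  rewrite ge0_integral_fsum//; last by move=> r; apply: emeasurable_funM => //; exact/measurable_EFinP.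
  under [RHS]eq_integral => y _.
    rewrite gE ge0_mule_fsuml//.
    over.
  rewrite ge0_integral_fsum//; last 2 first.
  - move=> r; apply: emeasurable_funM => //; apply: emeasurable_funM => //.
    exact/measurable_EFinP.
  - by move=> r y _; apply: mule_ge0; [exact: pos|rewrite lee_fin].
  apply: eq_fsbigr => r /set_mem [y0 _ ry]; have r0 : 0 <= r by rewrite -ry.
  rewrite ge0_integralZl ?lee_fin//; last exact/measurable_EFinP.
  under [RHS]eq_integral do rewrite -muleA.
  rewrite ge0_integralZl ?lee_fin//; last 2 first.
  - by apply: emeasurable_funM => //; exact/measurable_EFinP.
  - by move=> y _; rewrite mule_ge0 ?lee_fin ?indicE.
  rewrite integral_indic// setIT nuE// [in LHS]integral_mkcond.
  congr (_ * _)%E; apply: eq_integral => y _; rewrite patchE indicE.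
  by case: ifP => _; rewrite ?mul1e ?mul0e.
pose g := nnsfun_approx measurableT mf.
have gcvg y : EFin \o g^~ y @ \oo --> f y by exact: cvg_nnsfun_approx.
have c1 : (\int[nu]_y (g n y)%:E)%E @[n --> \oo] --> (\int[nu]_y f y)%E.
  rewrite [X in _ --> X](_ : _ = \int[nu]_y limn (fun n => (g n y)%:E))%E.
    apply: cvg_monotone_convergence => //.
    - by move=> n; exact/measurable_EFinP.
    - by move=> n y _; rewrite lee_fin.
    - by move=> y _ a b ab; rewrite lee_fin; exact/lefP/nd_nnsfun_approx.
  by apply: eq_integral => y _; apply/esym/cvg_lim => //; exact: gcvg.
have c2 : (\int[mu]_y ((g n y)%:E * (p y)%:E))%E @[n --> \oo] -->
    (\int[mu]_y (f y * (p y)%:E))%E.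
  rewrite [X in _ --> X](_ : _ = \int[mu]_y limn (fun n => (g n y)%:E * (p y)%:E))%E.
    apply: cvg_monotone_convergence => //.
    - by move=> n; apply: emeasurable_funM => //; exact/measurable_EFinP.
    - by move=> n y _; rewrite mule_ge0 ?lee_fin.
    - move=> y _ a b ab; rewrite lee_wpmul2r ?lee_fin//.
      exact/lefP/nd_nnsfun_approx.
  apply: eq_integral => y _; apply/esym/cvg_lim => //.
  by apply: cvgeMr => //; exact: gcvg.
apply: (@cvg_unique _ (@ereal_hausdorff R) _ _ _ _ c1).
rewrite /= (_ : (fun n => \int[nu]_y (g n y)%:E)%E = (fun n => \int[mu]_y ((g n y)%:E * (p y)%:E))%E)//.
by apply/funext => n; exact: simple.
Qed.

(** Completing the square turns the tilted density into that of the normal law with mean c s^2. *)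
Lemma normal_mgf (R : realType) (s c : R) : 0 < s ->
  (\int[normal_prob 0 s]_y (expR (c * y - c ^+ 2 * s ^+ 2 / 2))%:E = 1)%E.
Proof.
move=> s0; have sn0 : s != 0 by rewrite gt_eqF.
rewrite (@integral_density _ _ _ lebesgue_measure _ (normal_pdf 0 s)) //.
- rewrite -[RHS](@integral_normal_pdf R (c * s ^+ 2) s).
  apply: eq_integral => y _; rewrite -EFinM !normal_pdfE// mulrCA; congr (_ * _)%:E.
  rewrite /normal_fun -expRD; congr expR.
  by field.
- exact: measurable_normal_pdf.
- by move=> y; exact: normal_pdf_ge0.
- apply/measurable_EFinP; apply: measurableT_comp => //.
  by apply: measurable_funB => //; exact: measurable_funM.
Qed.

(** * Exponential martingales of simple integrals *)

Section brownian.
Variables (R : realType) (d : measure_display) (Omega : measurableType d)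
  (P : probability Omega R) (B : R -> Omega -> R).
Hypothesis hB : brownian_motion P B.
Local Notation F := (natural_filtration P B 0).

Lemma bm_measurable u : 0 <= u -> measurable_fun setT (B u).
Proof. by case: hB => h _ _ _ _; exact: h. Qed.

Lemma bm_filtration_measurable u E : F u E -> measurable E.
Proof. by apply: natural_filtration_measurable => v v0 _; exact: bm_measurable. Qed.

(** The identity map into Omega with the past sigma-algebra is independent of the increment, so the
    pair has a product law. Tonelli integrates the increment first with [xi] frozen, and
    [normal_mgf] gives 1. *)
Lemma exp_martingale_step u v (G xi : Omega -> R) (l : R) : 0 <= u -> u < v ->
  rv_wrt (F u) G -> (forall w, 0 <= G w) -> rv_wrt (F u) xi ->
  (\int[P]_w (G w * expR (l * (xi w * (B v w - B u w)) - l ^+ 2 * (xi w ^+ 2 * (v - u)) / 2))%:E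
   = \int[P]_w (G w)%:E)%E.
Proof.
move=> u0 uv mG G0 mxi.
pose S := g_sigma_algebraType (nf_gen P B 0 u).
have mid : measurable_fun setT (id : Omega -> S).
  by move=> _ A mA; rewrite setTI; exact: (bm_filtration_measurable mA).
have mD : measurable_fun setT (fun w => B v w - B u w).
  by apply: measurable_funB; apply: bm_measurable => //; exact: le_trans (ltW uv).
pose Psi (w : Omega) : S * measurableTypeR R := (w, B v w - B u w).
have mPsi : measurable_fun setT Psi by apply: measurable_fun_pair.
pose idS : {mfun Omega >-> S} := mfun_Sub (mem_set mid).
pose PsiS : {mfun Omega >-> (S * measurableTypeR R)%type} := mfun_Sub (mem_set mPsi).
have vu0 : 0 < v - u by rewrite subr_gt0.
pose s := Num.sqrt (v - u).
have s0 : 0 < s by rewrite sqrtr_gt0.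
have s2 : s ^+ 2 = v - u by rewrite sqr_sqrtr// ltW.
have law : forall X, measurable X ->
    (distribution P idS \x normal_prob 0 s)%E X = distribution P PsiS X.
  have hh := @product_measure_unique _ _ S (measurableTypeR R) R (distribution P idS) (normal_prob 0 s) (distribution P PsiS).
  apply: hh => A C mA mC.
  have [_ _ _ hN hI] := hB.
  by apply: (etrans (hI u v A C u0 uv mA mC)); congr (_ * _)%E; exact: hN.
pose f (p : S * measurableTypeR R) := (G p.1 * expR (l * (xi p.1 * p.2) - l ^+ 2 * (xi p.1 ^+ 2 * (v - u)) / 2))%:E.
have mG' : measurable_fun setT (G : S -> R).
  by move=> _ A mA; rewrite setTI; exact: mG.
have mxi' : measurable_fun setT (xi : S -> R).
  by move=> _ A mA; rewrite setTI; exact: mxi.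
have mG1 : measurable_fun setT (fun p : S * measurableTypeR R => G p.1) by exact: (measurableT_comp mG').
have mxi1 : measurable_fun setT (fun p : S * measurableTypeR R => xi p.1) by exact: (measurableT_comp mxi').
have mf : measurable_fun setT f.
  apply/measurable_EFinP; apply: measurable_funM => //.
  apply: measurableT_comp => //; apply: measurable_funB.
    by apply: measurable_funM => //; exact: measurable_funM.
  do 2 apply: measurable_funM => //.
  by apply: measurable_funM => //; exact: measurable_funX.
have f0 p : (0 <= f p)%E by rewrite lee_fin mulr_ge0 ?expR_ge0.
transitivity (\int[distribution P PsiS]_p f p)%E.
  by rewrite ge0_integral_distribution.
rewrite (eq_measure_integral (distribution P idS \x normal_prob 0 s)%E); last first.
  by move=> A mA _; apply/esym/law.
rewrite fubini_tonelli1// /fubini_F.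
transitivity (\int[distribution P idS]_w (G w)%:E)%E.
  apply: eq_integral => w _; rewrite /f /=.
  under eq_integral do rewrite EFinM.
  rewrite ge0_integralZl ?lee_fin//.
  - rewrite (_ : (\int[_]_y _ = 1)%E) ?mule1//.
    rewrite -[RHS](normal_mgf (l * xi w) s0); apply: eq_integral => y _.
    congr (expR _)%:E; rewrite s2; ring.
  - apply/measurable_EFinP; apply: measurableT_comp => //.
    by apply: measurable_funB => //; do 2 apply: measurable_funM => //.
rewrite ge0_integral_distribution//.
exact/measurable_EFinP.
Qed.

End brownian.

Lemma rv_wrtP d (Omega : measurableType d) (R : realType) (P : probability Omega R)
    (Z : R -> Omega -> R) (t u : R) (Y : Omega -> R) :
  rv_wrt (natural_filtration P Z t u) Y <->
  measurable_fun setT (Y : g_sigma_algebraType (nf_gen P Z t u) -> R).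
Proof.
split=> [h _ A mA|h A mA]; first by rewrite setTI; exact: h.
by rewrite -[X in natural_filtration _ _ _ _ X]setTI; exact: h.
Qed.

Lemma rv_wrtS d (Omega : measurableType d) (R : realType) (P : probability Omega R)
    (Z : R -> Omega -> R) (t u v : R) (Y : Omega -> R) : u <= v ->
  rv_wrt (natural_filtration P Z t u) Y -> rv_wrt (natural_filtration P Z t v) Y.
Proof. by move=> uv h A mA; apply: (natural_filtrationS uv); exact: h. Qed.

Section simple.
Variables (R : realType) (d : measure_display) (Omega : measurableType d)
  (P : probability Omega R) (B : R -> Omega -> R).
Hypothesis hB : brownian_motion P B.
Local Notation F := (natural_filtration P B 0).
Variables (n : nat) (tau : nat -> R).
Hypothesis tau0 : 0 <= tau 0%N.
Hypothesis tauS : forall k, (k < n)%N -> tau k <= tau k.+1.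

Lemma tau_mono i j : (i <= j)%N -> (j <= n)%N -> tau i <= tau j.
Proof.
move=> /subnKC <-; elim: (j - i)%N => [|k IH]; first by rewrite addn0.
by rewrite addnS => h; apply: (le_trans (IH (ltnW h))); exact: tauS.
Qed.

Lemma tau_ge0 k : (k <= n)%N -> 0 <= tau k.
Proof. by move=> kn; apply: (le_trans tau0); exact: tau_mono. Qed.

Definition sint (c : nat -> Omega -> R) k w :=
  \sum_(i < k) c i w * (B (tau i.+1) w - B (tau i) w).
Definition sqv (c : nat -> Omega -> R) k w :=
  \sum_(i < k) c i w ^+ 2 * (tau i.+1 - tau i).

Lemma bm_adapted u v : 0 <= u -> u <= v -> rv_wrt (F v) (B u).
Proof. by move=> u0 uv A mA; exact: natural_filtration_coord. Qed.

Variable c : nat -> Omega -> R.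
Hypothesis mc : forall k, (k < n)%N -> rv_wrt (F (tau k)) (c k).

(** The sum up to [k.+1] involves the coefficients up to [c k] and deterministic lengths, so it is
    known one step earlier, at [tau k]. This makes truncation at a level adapted. *)
Lemma sqv_adapted k : (k < n)%N -> rv_wrt (F (tau k)) (sqv c k.+1).
Proof.
move=> kn; apply/rv_wrtP; apply: measurable_sum => i; apply: measurable_funM => //.
apply: measurable_funX; apply/rv_wrtP; apply: rv_wrtS (mc _).
  by apply: tau_mono (ltnW kn); rewrite -ltnS.
by apply: leq_ltn_trans kn; rewrite -ltnS.
Qed.

Lemma sint_adapted k : (k <= n)%N -> rv_wrt (F (tau k)) (sint c k).
Proof.
move=> kn; apply/rv_wrtP; apply: measurable_sum => i.
have ik : (i < n)%N by exact: leq_trans kn.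
apply: measurable_funM; apply/rv_wrtP.
  by apply: rv_wrtS (mc ik); apply: tau_mono => //; exact: ltnW.
apply/rv_wrtP; apply: measurable_funB; apply/rv_wrtP; apply: bm_adapted.
- by apply: tau_ge0; exact: leq_trans kn.
- exact: tau_mono.
- by apply: tau_ge0; exact: ltnW.
- by apply: tau_mono => //; exact: ltnW.
Qed.

Lemma exp_martingale l k : (k <= n)%N ->
  (\int[P]_w (expR (l * sint c k w - l ^+ 2 * sqv c k w / 2))%:E = 1)%E.
Proof.
elim: k => [_|k IH kn].
  under eq_integral => w _ do rewrite /sint /sqv !big_ord0 !mulr0 mul0r subrr expR0.
  by rewrite integral_cst// mul1e; exact: probability_setT.
rewrite -(IH (ltnW kn)).
have := tauS kn; rewrite le_eqVlt => /orP[/eqP tk|tk].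
  apply: eq_integral => w _; rewrite /sint /sqv !big_ord_recr/= tk !subrr !mulr0.
  by rewrite !addr0.
have kn' := ltnW kn.
rewrite -(exp_martingale_step hB (G := fun w => expR (l * sint c k w - l ^+ 2 * sqv c k w / 2))
  (xi := c k) l (tau_ge0 kn') tk).
- apply: eq_integral => w _; rewrite -expRD; congr (expR _)%:E.
  rewrite /sint /sqv !big_ord_recr/= -/(sint c k w) -/(sqv c k w); ring.
- apply/rv_wrtP; apply: measurableT_comp => //; apply: measurable_funB.
    by apply: measurable_funM => //; apply/rv_wrtP; exact: sint_adapted.
  do 2 apply: measurable_funM => //.
  case: k kn tk kn' {IH} => [|k] kn tk kn'.
    rewrite (_ : sqv c 0 = cst 0)//.
    by apply/funext => w; rewrite /sqv big_ord0.
  by apply/rv_wrtP; apply: rv_wrtS (sqv_adapted kn'); exact: tauS.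
- by move=> w; exact: expR_ge0.
- exact: mc.
Qed.

End simple.

Section truncation.
Variables (R : realType) (d : measure_display) (Omega : measurableType d)
  (P : probability Omega R) (B : R -> Omega -> R).
Local Notation F := (natural_filtration P B 0).
Variables (n : nat) (tau : nat -> R) (c : nat -> Omega -> R) (N : R).
Hypothesis tauS : forall k, (k < n)%N -> tau k <= tau k.+1.
Hypothesis mc : forall k, (k < n)%N -> rv_wrt (F (tau k)) (c k).

(* Stopping the coefficients once the quadratic variation exceeds [N] keeps the
   exponential moments of the simple integrals bounded. *)
Definition trunc k w := if sqv tau c k.+1 w <= N then c k w else 0.

Lemma trunc_adapted k : (k < n)%N -> rv_wrt (F (tau k)) (trunc k).
Proof.
move=> kn; apply/rv_wrtP; apply: measurable_fun_if => //.
- apply: measurable_fun_ler => //; apply/rv_wrtP.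
  exact: (sqv_adapted tauS mc kn).
- by apply: measurable_funTS; apply/rv_wrtP; exact: mc.
Qed.

Lemma sqv_mono i j w : (i <= j)%N -> (j <= n)%N -> sqv tau c i w <= sqv tau c j w.
Proof.
move=> /subnKC <-; elim: (j - i)%N => [|k IH]; first by rewrite addn0.
rewrite addnS => h; apply: (le_trans (IH (ltnW h))).
rewrite /sqv [leRHS]big_ord_recr/= lerDl mulr_ge0 ?sqr_ge0// subr_ge0.
exact: tauS.
Qed.

Lemma sqv_trunc_le w k : 0 <= N -> (k <= n)%N -> sqv tau trunc k w <= N.
Proof.
move=> N0.
(* A stronger bound for the induction: once the running sum exceeds [N] the truncated one stops
   growing, and before that it is dominated by the untruncated one. *)
suff : (k <= n)%N -> sqv tau trunc k w <= Num.min N (sqv tau c k w).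
  by move=> h /h /le_trans -> //; rewrite ge_min lexx.
elim: k => [_|k IH kn]; first by rewrite /sqv !big_ord0 le_min N0 lexx.
move: (IH (ltnW kn)); rewrite !le_min => /andP[h1 h2].
have d0 : 0 <= tau k.+1 - tau k by rewrite subr_ge0; exact: tauS.
have cE : sqv tau c k.+1 w = sqv tau c k w + c k w ^+ 2 * (tau k.+1 - tau k).
  by rewrite /sqv big_ord_recr.
have q0 : 0 <= c k w ^+ 2 * (tau k.+1 - tau k) by rewrite mulr_ge0 ?sqr_ge0.
rewrite {1 2}/sqv !big_ord_recr/= -/(sqv tau trunc k w) /trunc.
case: ifPn => hN; last first.
  by rewrite expr0n/= mul0r addr0 h1 cE (le_trans h2)// lerDl.
have h3 : sqv tau trunc k w + c k w ^+ 2 * (tau k.+1 - tau k) <= sqv tau c k.+1 w.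
  by rewrite cE lerD2r.
by rewrite h3 (le_trans h3).
Qed.

Lemma trunc_id w k : sqv tau c n w <= N -> (k < n)%N -> trunc k w = c k w.
Proof. by move=> h kn; rewrite /trunc (le_trans (sqv_mono w _ _) h). Qed.

End truncation.

(** The time intervals are disjoint, so at most one term of the sum is nonzero and no cross terms
    appear. *)
Lemma simple_val_sqr (R : realType) (Omega : Type) (S : simple_process Omega R) u w :
  (forall k, (k < sp_size S)%N -> sp_time S k <= sp_time S k.+1) ->
  simple_val S u w ^+ 2 = \sum_(k < sp_size S)
    sp_coef S k w ^+ 2 * \1_(`]sp_time S k, sp_time S k.+1]) u.
Proof.
move=> tS; rewrite /simple_val.
have [[k hk]|h] := pselect (exists k : 'I_(sp_size S), u \in `]sp_time S k, sp_time S k.+1]).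
  have off (j : 'I_(sp_size S)) : j != k -> \1_(`]sp_time S j, sp_time S j.+1]) u = 0 :> R.
    move=> jk; rewrite indicE memNset// /= => hj.
    move: hk hj; rewrite !in_itv/= => /andP[k1 k2] /andP[j1 j2].
    case: (ltngtP j k) => jk'.
    - have : sp_time S j.+1 <= sp_time S k.
        by apply: (@tau_mono R (sp_size S)) => //; exact: ltnW.
      by lra.
    - have : sp_time S k.+1 <= sp_time S j.
        by apply: (@tau_mono R (sp_size S)) => //; exact: ltnW.
      by lra.
    - by move/eqP: jk; apply; exact/val_inj.
  rewrite (bigD1 k)//= [in RHS](bigD1 k)//= !big1.
  - by rewrite !addr0 indicE mem_set ?mulr1//.
  - by move=> j jk; rewrite off// mulr0.
  - by move=> j jk; rewrite off// mulr0.
have off (j : 'I_(sp_size S)) : \1_(`]sp_time S j, sp_time S j.+1]) u = 0 :> R.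
  by rewrite indicE memNset// => hj; apply: h; exists j.
rewrite !big1 ?expr0n// => j _; by rewrite off mulr0.
Qed.

Lemma expR_near0 (R : realType) (x : R) : `|x| <= 2^-1 -> `|expR x - 1| <= 2 * `|x|.
Proof.
move=> hx; have h1 := expR_ge1Dx x; have h2 := expR_ge1Dx (- x).
have x1 : `|x| <= 1 / 2 by rewrite div1r.
have px : 0 < 1 - x by move: x1; rewrite ler_norml => /andP[]; lra.
have h3 : expR x <= (1 - x)^-1.
  by rewrite -[expR x]invrK -expRN lef_pV2 ?posrE ?expR_gt0.
have h4 : (1 - x)^-1 <= 1 + 2 * `|x|.
  rewrite -[leLHS]div1r ler_pdivrMr//; move: x1; case: (ger0P x) => x0 x1.
    have : 0 <= x * (1 / 2 - x) by rewrite mulr_ge0// subr_ge0.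
    by lra.
  have : 0 <= x ^+ 2 by exact: sqr_ge0.
  by lra.
rewrite ler_norml; apply/andP; split; last by lra.
have : - `|x| <= x by rewrite lerNl -normrN ler_norm.
by move: (normr_ge0 x); lra.
Qed.

Section integrableR.
Variables (d : measure_display) (T : measurableType d) (R : realType)
  (mu : {measure set T -> \bar R}) (D : set T).
Hypothesis mD : measurable D.

Lemma integrableR_Z (k : R) (f : T -> R) : mu.-integrable D (EFin \o f) ->
  mu.-integrable D (EFin \o (fun x => k * f x)).
Proof.
move=> h; apply: (eq_integrable mD (fun x => k%:E * (f x)%:E)%E).
  by move=> x _; rewrite /= EFinM.
exact: integrableZl.
Qed.

Lemma integrableR_D (f g : T -> R) : mu.-integrable D (EFin \o f) ->
  mu.-integrable D (EFin \o g) -> mu.-integrable D (EFin \o (fun x => f x + g x)).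
Proof.
by move=> hf hg; apply: (eq_integrable mD _) (integrableD mD hf hg).
Qed.

Lemma integrableR_B (f g : T -> R) : mu.-integrable D (EFin \o f) ->
  mu.-integrable D (EFin \o g) -> mu.-integrable D (EFin \o (fun x => f x - g x)).
Proof.
by move=> hf hg; apply: (eq_integrable mD _) (integrableB mD hf hg).
Qed.

End integrableR.

(** * Passage to the limit in the exponential identity *)

Section limit.
Variables (R : realType) (d : measure_display) (Omega : measurableType d)
  (P : probability Omega R) (B : R -> Omega -> R).
Hypothesis hB : brownian_motion P B.
Local Notation F := (natural_filtration P B 0).
Local Notation leb := (@lebesgue_measure R).
Variables (t s K M l : R) (H : R -> Omega -> R) (J : Omega -> R).
Hypotheses (t0 : 0 <= t) (ts : t <= s) (K0 : 0 <= K) (M0 : 0 <= M).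
Hypothesis hJ : is_ito_integral P B t s H J.
Hypothesis HK : forall u w, t <= u <= s -> `|H u w| <= K.
Hypothesis mJ : measurable_fun setT J.
Hypothesis JM : {ae P, forall w, `|J w| <= M}.

Definition qvar w := \int[leb]_(u in `[t, s]) (H u w ^+ 2).

(** [H] is measurable on the strip only; its extension by 0 is measurable everywhere, as Tonelli's
    theorem requires. *)
Let Hh := (fun p : R * Omega => H p.1 p.2) \_ (`[t, s] `*` [set: Omega]).
Let mHh : measurable_fun setT Hh.
Proof.
case: hJ => mH _ _ _.
by apply/(measurable_restrictT _ (measurableX _ _)).
Qed.
Let HhE u w : t <= u <= s -> Hh (u, w) = H u w.
Proof. by move=> h; rewrite /Hh patchE mem_set//; split => //=; rewrite in_itv. Qed.

Let mHw w : measurable_fun `[t, s] (H ^~ w).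
Proof.
apply: (eq_measurable_fun (fun u => Hh (u, w))).
  by move=> u; rewrite inE/= in_itv/= => h; rewrite HhE.
by apply: measurable_funTS; apply: (measurableT_comp mHh); exact: measurable_fun_pair.
Qed.

Let fin_itv : (leb `[t, s] < +oo)%E.
Proof. by rewrite lebesgue_measure_itv/=; case: ifP => _; rewrite -?EFinB ltry. Qed.

Let itv_bounded_integrable (f : R -> R) C : measurable_fun `[t, s] f ->
  (forall u, t <= u <= s -> `|f u| <= C) -> leb.-integrable `[t, s] (EFin \o f).
Proof.
move=> mf hf; apply: measurable_bounded_integrable => //.
exists C; split; first exact: num_real.
move=> x Cx u /=; rewrite in_itv/= => hu; exact: le_trans (hf u hu) (ltW Cx).
Qed.

Let iH2 w : leb.-integrable `[t, s] (fun u => (H u w ^+ 2)%:E).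
Proof.
apply: (@itv_bounded_integrable _ (K ^+ 2)); first exact: measurable_funX.
by move=> u hu; rewrite normrX ler_sqr ?nnegrE ?HK.
Qed.

Lemma qvar_bounds w : 0 <= qvar w <= K ^+ 2 * (s - t).
Proof.
apply/andP; split; first by apply: Rintegral_ge0 => u _; exact: sqr_ge0.
have -> : K ^+ 2 * (s - t) = \int[leb]_(u in `[t, s]) (K ^+ 2).
  rewrite Rintegral_cst//= lebesgue_measure_itv/= lte_fin.
  case: ltP => [_//|h]; have -> : s = t by apply/eqP; rewrite eq_le h.
  by rewrite subrr.
apply: le_Rintegral => //; first exact: iH2.
  apply: (@itv_bounded_integrable _ (K ^+ 2)) => // u _; by rewrite ger0_norm// sqr_ge0.
by move=> u; rewrite /= in_itv/= => hu; rewrite -[H u w ^+ 2]real_normK ?num_real// ler_sqr ?nnegrE// HK.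
Qed.

Lemma qvar_measurable : measurable_fun setT qvar.
Proof.
apply: (eq_measurable_fun (fun w => \int[leb]_u (Hh (u, w) ^+ 2))).
  move=> w _; rewrite /qvar [RHS]Rintegral_mkcond; apply: eq_Rintegral => u _.
  rewrite patchE; case: ifPn => [|hu].
    by rewrite inE/= in_itv/= => hu; rewrite HhE.
  rewrite /Hh patchE memNset ?expr0n// => -[/= h _].
  by move/negP: hu; apply; rewrite inE.
apply: (@measurable_param_Rintegral _ _ _ (fun p => Hh p ^+ 2)).
exact: measurable_funX.
Qed.

Section one.
Variable S : simple_process Omega R.
Hypothesis adS : simple_adapted F t s S.
Let n := sp_size S.
Let tau := sp_time S.
Let c := sp_coef S.
Let tauS k : (k < n)%N -> tau k <= tau k.+1.
Proof. by case: adS => _ _ h _ _; exact: h. Qed.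
Let tau00 : tau 0%N = t. Proof. by case: adS. Qed.
Let taun : tau n = s. Proof. by case: adS. Qed.
Let mc k : (k < n)%N -> rv_wrt (F (tau k)) (c k).
Proof. by case: adS => _ _ _ h _; exact: h. Qed.
Let tau0 : 0 <= tau 0%N. Proof. by rewrite tau00. Qed.
Let mcT (k : 'I_n) : measurable_fun setT (c k).
Proof.
by move=> _ A mA; rewrite setTI; apply: (bm_filtration_measurable hB); exact: mc.
Qed.

Lemma simple_val_measurable : measurable_fun setT (fun p : R * Omega => simple_val S p.1 p.2).
Proof.
apply: measurable_sum => i; apply: measurable_funM.
  by apply: (measurableT_comp (mcT i)).
exact: (measurableT_comp (f := \1_(`]sp_time S i, sp_time S i.+1]) : R -> R)).
Qed.

Let gap (p : R * Omega) := ((simple_val S p.1 p.2 - Hh p) ^+ 2) * \1_(`[t, s]%classic) p.1.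

Let mgap : measurable_fun setT gap.
Proof.
apply: measurable_funM.
  by apply: measurable_funX; apply: measurable_funB => //; exact: simple_val_measurable.
exact: (measurableT_comp (f := \1_(`[t, s]%classic) : R -> R)).
Qed.

Definition err w := (\int[leb]_(u in `[t, s]) ((simple_val S u w - H u w) ^+ 2)%:E)%E.

Lemma err_measurable : measurable_fun setT err.
Proof.
apply: (eq_measurable_fun (fubini_G leb (EFin \o gap))).
  move=> w _; rewrite /err [RHS]integral_mkcond; apply: eq_integral => u _.
  rewrite /gap /= patchE indicE; case: ifPn => [|hu].
    by rewrite mulr1 inE/= in_itv/= => hu; rewrite HhE.
  by rewrite mulr0.
apply: measurable_fun_fubini_tonelli_G; first exact/measurable_EFinP.
by move=> p; rewrite lee_fin mulr_ge0 ?sqr_ge0// indicE.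
Qed.

Lemma simple_int_measurable : measurable_fun setT (simple_int B S).
Proof.
apply: measurable_sum => i; apply: measurable_funM; first exact: mcT.
have i1 : (i < n)%N by [].
by apply: measurable_funB; apply: (bm_measurable hB); apply: (tau_ge0 (n := n)) => //; exact: ltnW.
Qed.

Lemma simple_quad w : \int[leb]_(u in `[t, s]) (simple_val S u w ^+ 2) = sqv tau c n w.
Proof.
have tb (k : 'I_n) : t <= tau k <= s /\ t <= tau k.+1 <= s.
  have k1 : (k < n)%N by [].
  rewrite -taun -tau00; split; apply/andP; split; apply: (tau_mono tauS) => //; exact: ltnW.
rewrite /Rintegral; under eq_integral => u _ do rewrite (simple_val_sqr _ _ tauS) -sumEFin.
rewrite ge0_integral_sum//; last 2 first.
- move=> k; apply/measurable_EFinP; apply: measurable_funM => //.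
- by move=> k u _; rewrite lee_fin mulr_ge0 ?sqr_ge0// indicE.
rewrite (eq_bigr (fun k : 'I_n => (c k w ^+ 2 * (tau k.+1 - tau k))%:E)) ?sumEFin//.
move=> k _; have [/andP[k1 k2] /andP[k3 k4]] := tb k.
under eq_integral => u _ do rewrite EFinM.
rewrite ge0_integralZl//; [|exact/measurable_EFinP|by rewrite lee_fin sqr_ge0].
rewrite integral_indic// setIidl; last first.
  move=> u; rewrite /= !in_itv/= => /andP[u1 u2].
  by rewrite (le_trans k1 (ltW u1)) (le_trans u2 k4).
rewrite /= lebesgue_measure_itv/= lte_fin [RHS]EFinM; congr (_ * _)%E.
have := tauS (ltn_ord k); rewrite le_eqVlt => /orP[/eqP tk|tk].
  by rewrite -/tau tk ltxx subrr.
by rewrite -/tau tk -EFinB.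
Qed.

(** From |p^2 - q^2| <= (1 + 1/rho) (p - q)^2 + rho q^2, a weighting that balances a squared error
    below rho^2 against the bounded [H]. *)
Lemma quad_close rho w : 0 < rho -> (err w < (rho ^+ 2)%:E)%E -> rho <= 1 ->
  `|sqv tau c n w - qvar w| <= rho * (2 + K ^+ 2 * (s - t)).
Proof.
move=> rho0 herr rho1.
pose v u := simple_val S u w.
have [C hC] : exists C, forall u, `|v u| <= C.
  exists (\sum_(k < n) `|c k w|) => u; rewrite /v /simple_val.
  apply: (le_trans (ler_norm_sum _ _ _)); apply: ler_sum => k _.
  by rewrite normrM ler_piMr// indicE; case: (_ \in _); rewrite ?normr1// normr0 ler01.
have C0 : 0 <= C by apply: le_trans (hC 0).
have mv : measurable_fun `[t, s] v.
  apply: measurable_funTS; apply: (measurableT_comp simple_val_measurable (g := fun u => (u, w))).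
  exact: measurable_fun_pair.
have iv2 : leb.-integrable `[t, s] (EFin \o (fun u => v u ^+ 2)).
  apply: (@itv_bounded_integrable _ (C ^+ 2)); first exact: measurable_funX.
  by move=> u hu; rewrite normrX ler_sqr ?nnegrE.
have ih2 : leb.-integrable `[t, s] (EFin \o (fun u => H u w ^+ 2)) by exact: iH2.
have ie : leb.-integrable `[t, s] (EFin \o (fun u => (v u - H u w) ^+ 2)).
  apply: (@itv_bounded_integrable _ ((C + K) ^+ 2)).
    by apply: measurable_funX; exact: measurable_funB.
  move=> u hu; rewrite normrX ler_sqr ?nnegrE ?addr_ge0//.
  by apply: (le_trans (ler_normB _ _)); apply: lerD => //; exact: HK.
have hE : \int[leb]_(u in `[t, s]) ((v u - H u w) ^+ 2) <= rho ^+ 2.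
  have := ltW herr; rewrite /err -lee_fin /Rintegral fineK//.
  by rewrite integrable_fin_num.
have [q0 qK] := andP (qvar_bounds w).
have i1 : leb.-integrable `[t, s] (EFin \o (fun u => (1 + rho^-1) * (v u - H u w) ^+ 2)).
  exact: integrableR_Z.
have i2 : leb.-integrable `[t, s] (EFin \o (fun u => rho * H u w ^+ 2)).
  exact: integrableR_Z.
have i3 : leb.-integrable `[t, s] (EFin \o (fun u => v u ^+ 2 - H u w ^+ 2)).
  exact: integrableR_B.
rewrite -simple_quad /qvar -RintegralB//.
apply: (le_trans (le_normr_Rintegral _ i3)) => //.
apply: (@le_trans _ _ (\int[leb]_(u in `[t, s])
   ((1 + rho^-1) * (v u - H u w) ^+ 2 + rho * H u w ^+ 2))).
  apply: le_Rintegral => //.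
  - exact: (integrable_norm i3).
  - exact: integrableR_D.
  - move=> u _; move: (v u) (H u w) => p q.
    have -> : p ^+ 2 - q ^+ 2 = (p - q) ^+ 2 + 2 * (q * (p - q)) by ring.
    apply: (le_trans (ler_normD _ _)); rewrite [`|(p - q) ^+ 2|]ger0_norm ?sqr_ge0// [(1 + rho^-1) * _]mulrDl mul1r -addrA lerD2l.
    have r1 : 0 <= (`|p - q| - rho * `|q|) ^+ 2 / rho by rewrite divr_ge0 ?sqr_ge0// ltW.
    have -> : rho^-1 * (p - q) ^+ 2 + rho * q ^+ 2 = (`|p - q| - rho * `|q|) ^+ 2 / rho + 2 * (`|q| * `|p - q|).
      rewrite -(real_normK (num_real (p - q))) -(real_normK (num_real q)).
      by field; rewrite gt_eqF.
    by rewrite !normrM normr_nat lerDr.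
rewrite RintegralD// !RintegralZl// -/(qvar w).
have r0 : 0 < 1 + rho^-1 by rewrite addr_gt0// invr_gt0.
apply: (@le_trans _ _ ((1 + rho^-1) * rho ^+ 2 + rho * (K ^+ 2 * (s - t)))).
  apply: lerD; first by rewrite ler_pM2l.
  by rewrite ler_pM2l.
have -> : (1 + rho^-1) * rho ^+ 2 = rho ^+ 2 + rho by field; rewrite gt_eqF.
have : rho ^+ 2 <= rho by rewrite expr2 ler_piMr// ltW.
by move: (K ^+ 2 * (s - t)) => q h; lra.
Qed.

End one.

(** [C1] is the factor in [quad_close], and [C2] carries it to the exponent. [N] exceeds every
    quadratic variation met on good paths, so truncation is invisible there. [C0] bounds the limit
    variable and [C3] the second moment of its approximations. *)
Let C1 := 2 + K ^+ 2 * (s - t).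
Let C2 := `|l| + l ^+ 2 * C1 / 2.
Let N := K ^+ 2 * (s - t) + C1.
Let C0 := expR (`|l| * M).
Let C3 := expR (l ^+ 2 * N).
Let Y w := expR (l * J w - l ^+ 2 * qvar w / 2).

Let C10 : 0 <= C1.
Proof. by rewrite addr_ge0// mulr_ge0 ?sqr_ge0// subr_ge0. Qed.
Let C20 : 0 <= C2.
Proof. by rewrite addr_ge0// divr_ge0// mulr_ge0// sqr_ge0. Qed.
Let N0 : 0 <= N.
Proof. by rewrite addr_ge0// mulr_ge0 ?sqr_ge0// subr_ge0. Qed.

Let mY : measurable_fun setT Y.
Proof.
apply: measurableT_comp => //; apply: measurable_funB; first exact: measurable_funM.
by do 2 apply: measurable_funM => //; exact: qvar_measurable.
Qed.

Let Y_le : {ae P, forall w, Y w <= C0}.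
Proof.
apply: filterS JM => w Jw; rewrite ler_expR.
have /andP[q0 _] := qvar_bounds w.
have h1 : l * J w <= `|l| * M.
  by apply: (le_trans (ler_norm _)); rewrite normrM ler_wpM2l.
have h2 : 0 <= l ^+ 2 * qvar w / 2 by rewrite divr_ge0// mulr_ge0// sqr_ge0.
by apply: le_trans h1; rewrite gerBl.
Qed.

Section approx.
Variable S : simple_process Omega R.
Hypothesis adS : simple_adapted F t s S.
Let n := sp_size S.
Let tau := sp_time S.
Let c := trunc tau (sp_coef S) N.
Let tauS k : (k < n)%N -> tau k <= tau k.+1.
Proof. by case: adS => _ _ h _ _; exact: h. Qed.
Let tau00 : tau 0%N = t. Proof. by case: adS. Qed.
Let mc0 k : (k < n)%N -> rv_wrt (F (tau k)) (sp_coef S k).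
Proof. by case: adS => _ _ _ h _; exact: h. Qed.
Let mc k : (k < n)%N -> rv_wrt (F (tau k)) (c k).
Proof. by move=> kn; exact: (trunc_adapted N tauS mc0). Qed.
Let tau0 : 0 <= tau 0%N. Proof. by rewrite tau00. Qed.

Let Yn w := expR (l * sint B tau c n w - l ^+ 2 * sqv tau c n w / 2).

Let EYn : (\int[P]_w (Yn w)%:E = 1)%E.
Proof. exact: (exp_martingale hB tau0 tauS mc l (leqnn n)). Qed.

Let mYn (l' : R) : measurable_fun setT (fun w => expR (l' * sint B tau c n w - l' ^+ 2 * sqv tau c n w / 2)).
Proof.
have mcT (k : 'I_n) : measurable_fun setT (c k).
  by move=> _ A mA; rewrite setTI; apply: (bm_filtration_measurable hB); exact: mc.
have mB (k : nat) : (k <= n)%N -> measurable_fun setT (B (tau k)).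
  by move=> kn; apply: (bm_measurable hB); exact: (tau_ge0 tau0 tauS kn).
apply: measurableT_comp => //; apply: measurable_funB.
  apply: measurable_funM => //; apply: measurable_sum => i; apply: measurable_funM => //.
  by apply: measurable_funB; apply: mB => //; exact: ltnW.
do 2 apply: measurable_funM => //.
by apply: measurable_sum => i; apply: measurable_funM => //; exact: measurable_funX.
Qed.

(** The squared exponential of parameter l is the one of parameter 2l times exp(l^2 sqv), and
    truncation bounds the last factor. *)
Let EYn2 : (\int[P]_w (Yn w ^+ 2)%:E <= C3%:E)%E.
Proof.
have := exp_martingale hB tau0 tauS mc (2 * l) (leqnn n).
move=> E2; rewrite -[leRHS]mule1 -E2 -ge0_integralZl ?lee_fin ?expR_ge0//; last first.
  by apply/measurable_EFinP; exact: (mYn (2 * l)).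
apply: ge0_le_integral => //.
- by move=> w _; rewrite lee_fin sqr_ge0.
- by apply/measurable_EFinP; apply: measurable_funX; exact: (mYn l).
- by apply: emeasurable_funM => //; apply/measurable_EFinP; exact: (mYn (2 * l)).
move=> w _; rewrite -EFinM lee_fin -expRM_natl -expRD ler_expR.
have h := @sqv_trunc_le _ _ _ n tau (sp_coef S) N tauS w n N0 (leqnn n).
have : l ^+ 2 * sqv tau c n w <= l ^+ 2 * N by rewrite ler_wpM2l// sqr_ge0.
move: (l ^+ 2 * N) (sqv tau c n w) => p q; rewrite exprMn; nra.
Qed.

Definition bad1 rho := [set w | ((rho ^+ 2)%:E <= err S w)%E].
Definition bad2 rho := [set w | (rho%:E <= `|simple_int B S w - J w|%:E)%E].

Let mbad1 rho : measurable (bad1 rho).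
Proof.
by rewrite -[bad1 rho]setTI; apply: emeasurable_fun_c_infty => //; exact: err_measurable.
Qed.

Let mbad2 rho : measurable (bad2 rho).
Proof.
rewrite -[bad2 rho]setTI; apply: emeasurable_fun_c_infty => //.
apply/measurable_EFinP; apply: measurableT_comp => //.
by apply: measurable_funB => //; exact: simple_int_measurable.
Qed.

Let good rho w : 0 < rho -> rho <= 1 -> C2 * rho <= 2^-1 -> ~ bad1 rho w -> ~ bad2 rho w ->
  Y w <= C0 -> `|Yn w - Y w| <= 2 * C0 * C2 * rho.
Proof.
move=> rho0 rho1 rho2 /negP; rewrite -ltNge => e1 /negP; rewrite -ltNge lte_fin => e2 YC.
have q := quad_close adS rho0 e1 rho1.
have [q0 qK] := andP (qvar_bounds w).
have vN : sqv tau (sp_coef S) n w <= N.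
  have := ler_norm (sqv tau (sp_coef S) n w - qvar w).
  have : rho * C1 <= C1 by rewrite ler_piMl.
  by rewrite /N; move: q; rewrite -/C1 -/tau -/n; move: (sqv _ _ _ _) => v *; lra.
have cE k : (k < n)%N -> c k w = sp_coef S k w by move=> kn; exact: (trunc_id tauS vN kn).
have sE : sint B tau c n w = simple_int B S w by apply: eq_bigr => i _; rewrite cE.
have vE : sqv tau c n w = sqv tau (sp_coef S) n w by apply: eq_bigr => i _; rewrite cE.
pose x := l * (simple_int B S w - J w) - l ^+ 2 * (sqv tau (sp_coef S) n w - qvar w) / 2.
have -> : Yn w = Y w * expR x by rewrite /Yn /Y -expRD sE vE; congr expR; rewrite /x; ring.
have hx : `|x| <= C2 * rho.
  rewrite /x; apply: (le_trans (ler_normB _ _)); rewrite /C2 mulrDl; apply: lerD.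
    by rewrite normrM ler_wpM2l// ltW.
  rewrite normrM normfV normr_nat normrM (ger0_norm (sqr_ge0 l)).
  have -> : l ^+ 2 * C1 / 2 * rho = l ^+ 2 * (rho * C1) / 2 by ring.
  by rewrite ler_wpM2r ?invr_ge0// ler_wpM2l ?sqr_ge0.
have := expR_near0 (le_trans hx rho2) => hex.
rewrite -{2}[Y w]mulr1 -mulrBr normrM ger0_norm ?expR_ge0//.
have -> : 2 * C0 * C2 * rho = C0 * (2 * (C2 * rho)) by ring.
apply: ler_pM; rewrite ?expR_ge0//.
by apply: (le_trans hex); rewrite ler_pM2l.
Qed.

Let ind (A : set Omega) w : R := \1_A w.

(** Off the bad events the exponents are close. On them z <= delta z^2 + 1/delta leaves the error to
    the second moments, up to 1/delta times the indicators: a uniform integrability argument in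
    explicit form. *)
Let all_good rho delta : 0 < rho -> rho <= 1 -> C2 * rho <= 2^-1 -> 0 < delta ->
  {ae P, forall w, `|Yn w - Y w| <=
    (2 * C0 * C2 * rho + 2 * delta * C0 ^+ 2) + 2 * delta * Yn w ^+ 2
     + delta^-1 * (ind (bad1 rho) w + ind (bad2 rho) w)}.
Proof.
move=> rho0 rho1 rho2 d0; apply: filterS Y_le => w YC.
have C0p : 0 <= C0 by exact: expR_ge0.
have a1 : 0 <= 2 * C0 * C2 * rho by rewrite !mulr_ge0// ltW.
have a2 : 0 <= 2 * delta * C0 ^+ 2 by rewrite !mulr_ge0 ?sqr_ge0// ltW.
have a3 : 0 <= 2 * delta * Yn w ^+ 2 by apply: mulr_ge0; [rewrite mulr_ge0// ltW|exact: sqr_ge0].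
have i1 A : 0 <= ind A w by rewrite /ind indicE.
have [b|nb] := pselect (bad1 rho w \/ bad2 rho w).
  have h1 : 1 <= ind (bad1 rho) w + ind (bad2 rho) w.
    case: b => b.
      have -> : ind (bad1 rho) w = 1 by rewrite /ind indicE mem_set.
      by rewrite lerDl.
    have -> : ind (bad2 rho) w = 1 by rewrite /ind indicE mem_set.
    by rewrite lerDr.
  have h2 : delta^-1 <= delta^-1 * (ind (bad1 rho) w + ind (bad2 rho) w).
    by rewrite ler_peMr// invr_ge0 ltW.
  have h3 : `|Yn w - Y w| <= delta * (Yn w - Y w) ^+ 2 + delta^-1.
    have : 0 <= (delta * `|Yn w - Y w| - 1) ^+ 2 / delta by rewrite divr_ge0 ?sqr_ge0// ltW.
    have -> : (delta * `|Yn w - Y w| - 1) ^+ 2 / delta =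
       delta * (Yn w - Y w) ^+ 2 - 2 * `|Yn w - Y w| + delta^-1.
      rewrite -(real_normK (num_real (Yn w - Y w))); field; rewrite gt_eqF//.
    by move: (normr_ge0 (Yn w - Y w)); move: (`|_|) (delta^-1) (delta * _) => p q z *; lra.
  have h4 : (Yn w - Y w) ^+ 2 <= 2 * Yn w ^+ 2 + 2 * C0 ^+ 2.
    have : Y w ^+ 2 <= C0 ^+ 2 by rewrite ler_sqr ?nnegrE ?expR_ge0.
    have := sqr_ge0 (Yn w + Y w).
    by move: (Yn w) (Y w) (C0 ^+ 2) => p q z; nra.
  have h5 : delta * (Yn w - Y w) ^+ 2 <= 2 * delta * Yn w ^+ 2 + 2 * delta * C0 ^+ 2.
    apply: (le_trans (ler_wpM2l (ltW d0) h4)).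
    by rewrite le_eqVlt; apply/orP; left; apply/eqP; ring.
  apply: (le_trans h3); move: h2 h5 a1; move: (delta * _ ^+ 2) (delta^-1) (delta^-1 * _).
  by move: (2 * C0 * C2 * rho) (2 * delta * Yn w ^+ 2) (2 * delta * C0 ^+ 2) => ? ? ? ? ? ? ? ? ?; lra.
have nb1 : ~ bad1 rho w by move=> b; apply: nb; left.
have nb2 : ~ bad2 rho w by move=> b; apply: nb; right.
apply: (le_trans (good rho0 rho1 rho2 nb1 nb2 YC)).
have : 0 <= delta^-1 * (ind (bad1 rho) w + ind (bad2 rho) w).
  by rewrite mulr_ge0 ?invr_ge0 ?addr_ge0// ltW.
by move: (delta^-1 * _) => ? ?; lra.
Qed.

Let rem rho delta : \bar R :=
  ((2 * C0 * C2 * rho + delta * (2 * C0 ^+ 2 + 2 * C3))%:E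
   + (delta^-1)%:E * (P (bad1 rho) + P (bad2 rho)))%E.

Lemma approx_bound rho delta : 0 < rho -> rho <= 1 -> C2 * rho <= 2^-1 -> 0 < delta ->
  (1 <= (\int[P]_w (Y w)%:E) + rem rho delta)%E /\
  ((\int[P]_w (Y w)%:E) <= 1 + rem rho delta)%E.
Proof.
move=> rho0 rho1 rho2 d0.
have ag := all_good rho0 rho1 rho2 d0.
pose Rn w := (2 * C0 * C2 * rho + 2 * delta * C0 ^+ 2) + 2 * delta * Yn w ^+ 2
     + delta^-1 * (ind (bad1 rho) w + ind (bad2 rho) w).
have C0p : 0 <= C0 by exact: expR_ge0.
have mind A : measurable A -> measurable_fun setT (ind A).
  by move=> mA; exact: measurable_indic.
have mYn1 : measurable_fun setT Yn by exact: (mYn l).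
have mYn2 : measurable_fun setT (fun w => Yn w ^+ 2) by exact: measurable_funX.
have mRn : measurable_fun setT Rn.
  apply: measurable_funD; first by apply: measurable_funD => //; exact: measurable_funM.
  by apply: measurable_funM => //; apply: measurable_funD; exact: mind.
have k1 : 0 <= 2 * delta by rewrite mulr_ge0// ltW.
have k2 : 0 <= delta^-1 by rewrite invr_ge0 ltW.
have k0 : 0 <= 2 * C0 * C2 * rho + 2 * delta * C0 ^+ 2.
  by rewrite addr_ge0// !mulr_ge0 ?sqr_ge0// ltW.
have Rn0 w : 0 <= Rn w.
  apply: addr_ge0; first by apply: addr_ge0 => //; apply: mulr_ge0 => //; exact: sqr_ge0.
  by apply: mulr_ge0 => //; apply: addr_ge0; rewrite /ind indicE.
have ERn : (\int[P]_w (Rn w)%:E <= rem rho delta)%E.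
  have -> : (\int[P]_w (Rn w)%:E = (2 * C0 * C2 * rho + 2 * delta * C0 ^+ 2)%:E
     + (2 * delta)%:E * \int[P]_w (Yn w ^+ 2)%:E + (delta^-1)%:E * (P (bad1 rho) + P (bad2 rho)))%E.
    under eq_integral => w _ do rewrite /Rn EFinD [X in (X + _)%E]EFinD.
    rewrite ge0_integralD//; last 4 first.
    - by move=> w _; rewrite -EFinD lee_fin addr_ge0// mulr_ge0// sqr_ge0.
    - by apply: emeasurable_funD => //; apply/measurable_EFinP; exact: measurable_funM.
    - by move=> w _; rewrite lee_fin mulr_ge0// addr_ge0// indicE.
    - apply/measurable_EFinP; apply: measurable_funM => //.
      by apply: measurable_funD; exact: mind.
    congr (_ + _)%E.
      rewrite ge0_integralD//; last 2 first.
      - by move=> w _; rewrite lee_fin mulr_ge0// sqr_ge0.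
      - by apply/measurable_EFinP; exact: measurable_funM.
      rewrite integral_cst//; congr (_ + _)%E.
        by rewrite -[RHS]mule1; congr (_ * _)%E; exact: probability_setT.
      under eq_integral => w _ do rewrite EFinM.
      rewrite ge0_integralZl//; [exact/measurable_EFinP|].
      by move=> w _; rewrite lee_fin sqr_ge0.
    under eq_integral => w _ do rewrite EFinM.
    rewrite ge0_integralZl//; last 2 first.
    - by apply/measurable_EFinP; apply: measurable_funD; exact: mind.
    - by move=> w _; rewrite lee_fin addr_ge0// /ind indicE.
    congr (_ * _)%E.
    under eq_integral => w _ do rewrite EFinD.
    rewrite ge0_integralD//; last 4 first.
    - by move=> w _; rewrite lee_fin /ind indicE.
    - by apply/measurable_EFinP; exact: mind.
    - by move=> w _; rewrite lee_fin /ind indicE.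
    - by apply/measurable_EFinP; exact: mind.
    by rewrite !integral_indic// !setIT.
  rewrite /rem; apply: leeD2r.
  apply: (@le_trans _ _ ((2 * C0 * C2 * rho + 2 * delta * C0 ^+ 2)%:E + (2 * delta)%:E * C3%:E)%E).
    by apply: leeD2l; apply: lee_wpmul2l; rewrite ?lee_fin.
  rewrite -EFinM -EFinD lee_fin le_eqVlt; apply/orP; left; apply/eqP; ring.
have mYE : measurable_fun setT (EFin \o Y) by exact/measurable_EFinP.
have mYnE : measurable_fun setT (EFin \o Yn) by exact/measurable_EFinP.
have mRnE : measurable_fun setT (EFin \o Rn) by exact/measurable_EFinP.
have Y0 w : (0 <= (Y w)%:E)%E by rewrite lee_fin expR_ge0.
have Yn0 w : (0 <= (Yn w)%:E)%E by rewrite lee_fin expR_ge0.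
have RnE0 w : (0 <= (Rn w)%:E)%E by rewrite lee_fin.
split.
  rewrite -[leLHS]EYn; apply: (@le_trans _ _ (\int[P]_w ((Y w)%:E + (Rn w)%:E))%E).
    apply: ae_ge0_le_integral => //; first by move=> w _; exact: adde_ge0.
      exact: emeasurable_funD.
    apply: filterS ag => w hw _; rewrite -EFinD lee_fin -lerBlDl.
    exact: le_trans (ler_norm _) hw.
  by rewrite ge0_integralD//; apply: leeD2l.
rewrite -[X in (_ <= X + _)%E]EYn; apply: (@le_trans _ _ (\int[P]_w ((Yn w)%:E + (Rn w)%:E))%E).
  apply: ae_ge0_le_integral => //; first by move=> w _; exact: adde_ge0.
    exact: emeasurable_funD.
  apply: filterS ag => w hw _; rewrite -EFinD lee_fin -lerBlDl.
  by apply: le_trans hw; rewrite distrC; exact: ler_norm.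
by rewrite ge0_integralD//; apply: leeD2l.
Qed.

End approx.

Let prob_small (A : nat -> set Omega) k : 0 < k -> (fun n => P (A n)) @ \oo --> 0%E ->
  \forall n \near \oo, (P (A n) <= k%:E)%E.
Proof.
move=> k0 /fine_cvgP[fin /cvgrPdist_lt /(_ _ k0) h].
near=> n; have fn : P (A n) \is a fin_num by near: n.
rewrite -(fineK fn) lee_fin.
have : `|0 - fine (P (A n))| < k by near: n.
by rewrite sub0r normrN => /ltW; apply: le_trans; exact: ler_norm.
Unshelve. all: by end_near. Qed.

Lemma ito_exp : (\int[P]_w (expR (l * J w - l ^+ 2 * qvar w / 2))%:E = 1)%E.
Proof.
have [_ _ _ [S [adS cv1 cv2]]] := hJ.
have C0p : 0 <= C0 by exact: expR_ge0.
have C3p : 0 <= C3 by exact: expR_ge0.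
suff key e : 0 < e -> (1 <= (\int[P]_w (Y w)%:E) + e%:E)%E /\
  ((\int[P]_w (Y w)%:E) <= 1 + e%:E)%E.
  apply/eqP; rewrite eq_le; apply/andP; split; apply/lee_addgt0Pr => e e0.
    by have [] := key e e0.
  by have [] := key e e0.
move=> e0.
have e4 : 0 <= e / 4 by rewrite divr_ge0// ltW.
pose a := 2 * C0 ^+ 2 + 2 * C3.
have a0 : 0 <= a by rewrite addr_ge0 ?mulr_ge0 ?sqr_ge0.
(* Order of choice: [delta] against the second moments, [rho] against the error in the exponent, and
   last an index at which the bad events are rare compared with [delta]. *)
pose delta := e / (4 * (a + 1)).
have d0 : 0 < delta by rewrite divr_gt0// mulr_gt0// ltr_wpDl.
have da : delta * a <= e / 4.
  have -> : delta * a = e / 4 * (a / (a + 1)).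
    by rewrite /delta; field; rewrite gt_eqF// ltr_wpDl.
  by rewrite ler_piMr// ler_pdivrMr ?mul1r ?lerDl// ltr_wpDl.
pose q := C0 * C2.
have q0 : 0 <= q by exact: mulr_ge0.
pose rho := Num.min 1 (Num.min (2 * (C2 + 1))^-1 (e / (8 * (q + 1)))).
have rho0 : 0 < rho.
  have h1 : 0 < C2 + 1 by rewrite ltr_wpDl.
  have h2 : 0 < q + 1 by rewrite ltr_wpDl.
  by rewrite !lt_min ltr01 invr_gt0 mulr_gt0// divr_gt0// mulr_gt0.
have rho1 : rho <= 1 by rewrite ge_min lexx.
have rho2 : C2 * rho <= 2^-1.
  apply: (@le_trans _ _ (C2 * (2 * (C2 + 1))^-1)).
    by rewrite ler_wpM2l// !ge_min lexx orbT.
  rewrite invfM mulrCA ler_piMr ?invr_ge0//.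
  by rewrite ler_pdivrMr ?mul1r ?lerDl// ltr_wpDl.
have rho3 : 2 * C0 * C2 * rho <= e / 4.
  apply: (@le_trans _ _ (2 * q * (e / (8 * (q + 1))))).
    have -> : 2 * C0 * C2 * rho = 2 * q * rho by rewrite /q; ring.
    by rewrite ler_wpM2l ?mulr_ge0// !ge_min lexx !orbT.
  have -> : 2 * q * (e / (8 * (q + 1))) = e / 4 * (q / (q + 1)).
    by field; rewrite gt_eqF// ltr_wpDl.
  by rewrite ler_piMr// ler_pdivrMr ?mul1r ?lerDl// ltr_wpDl.
have k0 : 0 < delta * e / 4 by rewrite divr_gt0// mulr_gt0.
have p1 := prob_small k0 (cv1 _ (exprn_gt0 2 rho0)).
have p2 := prob_small k0 (cv2 _ rho0).
have [n [b1 b2]] : exists n, (P (bad1 (S n) rho) <= (delta * e / 4)%:E)%E /\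
   (P (bad2 (S n) rho) <= (delta * e / 4)%:E)%E.
  have [n0 _ h] : \forall n \near \oo, (P (bad1 (S n) rho) <= (delta * e / 4)%:E)%E /\
   (P (bad2 (S n) rho) <= (delta * e / 4)%:E)%E by apply: filterS2 p1 p2 => n ? ?; split.
  by exists n0; exact: h (leqnn _).
have [h1 h2] := approx_bound (adS n) rho0 rho1 rho2 d0.
have rem_le : ((2 * C0 * C2 * rho + delta * (2 * C0 ^+ 2 + 2 * C3))%:E
   + (delta^-1)%:E * (P (bad1 (S n) rho) + P (bad2 (S n) rho)) <= e%:E)%E.
  apply: (@le_trans _ _ ((e / 4 + e / 4)%:E + (delta^-1)%:E * (delta * e / 4 + delta * e / 4)%:E)%E).
    apply: leeD; first by rewrite lee_fin lerD.
    by apply: lee_wpmul2l; [rewrite lee_fin invr_ge0 ltW|rewrite EFinD leeD].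
  rewrite -EFinM -EFinD lee_fin le_eqVlt; apply/orP; left; apply/eqP; field.
  by rewrite gt_eqF.
split; first by apply: (le_trans h1); apply: leeD2l.
by apply: (le_trans h2); apply: leeD2l.
Qed.

End limit.

(** A polynomial that is of third order at 0 has vanishing lower coefficients: divide by l, let l
    tend to 0, and repeat. *)
Lemma small_poly_zero (R : realType) (a b C l0 : R) : 0 < l0 ->
  (forall l, 0 < l -> l <= l0 -> `|l * a + l ^+ 2 * b / 2| <= l ^+ 3 * C) ->
  a = 0 /\ b = 0.
Proof.
move=> l00 h.
have C0 : 0 <= C.
  have := h l0 l00 (lexx _) => /(le_trans (normr_ge0 _)).
  by rewrite pmulr_rge0// exprn_gt0.
have hh l : 0 < l -> l <= l0 -> `|a + l * b / 2| <= l ^+ 2 * C.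
  move=> l1 l2; have := h l l1 l2.
  have -> : l * a + l ^+ 2 * b / 2 = l * (a + l * b / 2) by ring.
  have -> : l ^+ 3 * C = l * (l ^+ 2 * C) by ring.
  by rewrite normrM gtr0_norm// ler_pM2l.
have a0 : a = 0.
  apply/eqP; rewrite -normr_le0; apply/ler_addgt0Pr => e e0; rewrite add0r.
  pose D := `|b| + C + 1.
  have D0 : 0 < D by rewrite ltr_wpDl// addr_ge0.
  pose l := Num.min (Num.min 1 l0) (e / D).
  have l1 : 0 < l by rewrite !lt_min ltr01 l00 divr_gt0.
  have l2 : l <= l0 by rewrite !ge_min lexx !orbT.
  have l3 : l <= 1 by rewrite !ge_min lexx.
  have l4 : l * D <= e by rewrite -ler_pdivlMr// !ge_min lexx !orbT.
  have h1 := hh l l1 l2.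
  have h2 : `|a| <= `|a + l * b / 2| + `|l * b / 2|.
    by rewrite -{1}[a](addrK (l * b / 2)); apply: ler_normB.
  have h3 : `|l * b / 2| <= l * `|b|.
    rewrite !normrM (gtr0_norm l1) normfV normr_nat ler_piMr ?invf_le1 ?ler1n//.
    by rewrite mulr_ge0// ltW.
  have h4 : l ^+ 2 * C <= l * C by rewrite ler_wpM2r// expr2 ler_piMl// ltW.
  apply: (le_trans h2); apply: (le_trans (lerD (le_trans h1 h4) h3)).
  by apply: le_trans l4; rewrite /D !mulrDr mulr1 addrC lerDl ltW.
split=> //; subst a.
apply/eqP; rewrite -normr_le0; apply/ler_addgt0Pr => e e0; rewrite add0r.
pose l := Num.min l0 (e / (2 * C + 1)).
have D0 : 0 < 2 * C + 1 by rewrite ltr_wpDl// mulr_ge0.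
have l1 : 0 < l by rewrite lt_min l00 divr_gt0.
have l2 : l <= l0 by rewrite ge_min lexx.
have l4 : l * (2 * C + 1) <= e by rewrite -ler_pdivlMr// ge_min lexx orbT.
have := hh l l1 l2; rewrite add0r !normrM (gtr0_norm l1) normfV normr_nat expr2 -!mulrA ler_pM2l//.
rewrite ler_pdivrMr// => h1; apply: (le_trans h1); apply: le_trans l4.
have -> : l * C * 2 = l * (2 * C) by ring.
by rewrite ler_pM2l// lerDl.
Qed.

Lemma MVT_bound (R : realType) (f df : R -> R) (x K : R) :
  (forall y : R, is_derive y 1 f (df y)) -> f 0 = 0 ->
  (forall y, `|y| <= `|x| -> `|df y| <= K) -> `|f x| <= K * `|x|.
Proof.
move=> fd f0 hK.
have cf (a b : R) : {within `[a, b], continuous f}.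
  apply: continuous_subspaceT => y; apply: differentiable_continuous.
  by apply/derivable1_diffP; have [] := fd y.
have [x0|x0|->] := ltgtP x 0; last by rewrite f0 !normr0 mulr0.
  have [c cin E] := MVT x0 (fun y _ => fd y) (cf x 0).
  move: E; rewrite f0 !sub0r => /(congr1 Num.norm); rewrite normrM !normrN => ->.
  move: cin; rewrite in_itv/= => /andP[c1 c2].
  by rewrite ler_wpM2r// hK// !ler0_norm ?ltW//; lra.
have [c cin E] := MVT x0 (fun y _ => fd y) (cf 0 x).
move: E; rewrite f0 !subr0 => ->; rewrite normrM.
move: cin; rewrite in_itv/= => /andP[c1 c2].
by rewrite ler_wpM2r// hK// !ger0_norm ?ltW//; lra.
Qed.

Lemma expR_taylor1 (R : realType) (x : R) : `|x| <= 2^-1 ->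
  `|expR x - 1 - x| <= 2 * `|x| * `|x|.
Proof.
move=> hx.
have d1 (y : R) : is_derive y 1 (fun z : R => expR z - 1 - z) (expR y - 1).
  by apply: is_derive_eq; rewrite subr0.
apply: (MVT_bound d1); first by rewrite expR0 subrr subr0.
move=> z zx; apply: (le_trans (expR_near0 (le_trans zx hx))).
by rewrite ler_pM2l.
Qed.

Lemma expR_taylor2 (R : realType) (x : R) : `|x| <= 2^-1 ->
  `|expR x - 1 - x - x ^+ 2 / 2| <= 2 * `|x| ^+ 3.
Proof.
move=> hx.
have d2 (y : R) : is_derive y 1 (fun z : R => expR z - 1 - z - z ^+ 2 / 2) (expR y - 1 - y).
  by apply: is_derive_eq; rewrite !scaler0 add0r -[y%:A]/(y * 1) -[2^-1 *: _]/(2^-1 * _); field.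
have : `|expR x - 1 - x - x ^+ 2 / 2| <= (2 * `|x| * `|x|) * `|x|.
  apply: (MVT_bound d2); first by rewrite expR0 expr0n/= mul0r !subr0 subrr.
  move=> z zx; apply: (le_trans (expR_taylor1 (le_trans zx hx))).
  by apply: ler_pM; rewrite ?mulr_ge0// ler_pM2l.
by move/le_trans; apply; rewrite le_eqVlt; apply/orP; left; apply/eqP; ring.
Qed.

(** Expand E exp(l J - l^2 Q / 2) = 1 in l: the coefficients of l and l^2 are E J and E (J^2 - Q) /
    2, and the remainder is of order l^3 because [J] and [Q] are bounded. So both vanish. *)
Lemma ito_moments d (Omega : measurableType d) (R : realType)
    (P : probability Omega R) (B : R -> Omega -> R) (t s K M : R)
    (H : R -> Omega -> R) (J : Omega -> R) :
  brownian_motion P B -> 0 <= t -> t <= s -> 0 <= K -> 0 <= M ->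
  is_ito_integral P B t s H J ->
  (forall u w, t <= u <= s -> `|H u w| <= K) ->
  measurable_fun setT J -> {ae P, forall w, `|J w| <= M} ->
  (\int[P]_w (J w)%:E = 0)%E /\
  (\int[P]_w (J w ^+ 2)%:E = \int[P]_w (qvar t s H w)%:E)%E.
Proof.
move=> hB t0 ts K0 M0 hJ HK mJ JM.
pose Q := qvar t s H.
have mQ : measurable_fun setT Q by exact: (qvar_measurable hJ).
pose N := K ^+ 2 * (s - t).
have N0 : 0 <= N by rewrite mulr_ge0 ?sqr_ge0// subr_ge0.
have QN w : 0 <= Q w <= N by exact: (qvar_bounds ts K0 hJ HK).
pose J' w := if `|J w| <= M then J w else 0.
have mJ' : measurable_fun setT J'.
  apply: measurable_fun_if => //.
    by apply: measurable_fun_ler => //; exact: measurableT_comp.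
  exact: measurable_funTS.
have J'M w : `|J' w| <= M by rewrite /J'; case: ifP => //; rewrite normr0.
have J'J : {ae P, forall w, J' w = J w} by apply: filterS JM => w h; rewrite /J' h.
have ex l : (\int[P]_w (expR (l * J' w - l ^+ 2 * Q w / 2))%:E = 1)%E.
  rewrite -(ito_exp hB l t0 ts K0 hJ HK mJ JM).
  apply: ae_eq_integral => //.
  - apply/measurable_EFinP; apply: measurableT_comp => //; apply: measurable_funB.
      exact: measurable_funM.
    by do 2 apply: measurable_funM => //.
  - apply/measurable_EFinP; apply: measurableT_comp => //; apply: measurable_funB.
      exact: measurable_funM.
    by do 2 apply: measurable_funM => //.
  - by apply: filterS J'J => w -> _.
have bi (f : Omega -> R) C : measurable_fun setT f -> (forall w, `|f w| <= C) ->
    P.-integrable setT (EFin \o f).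
  move=> mf hf; apply: measurable_bounded_integrable => //.
    by rewrite [X in (X < _)%E](_ : _ = 1%E) ?ltry//; exact: probability_setT.
  exists C; split; first exact: num_real.
  by move=> x Cx w _; exact: le_trans (hf w) (ltW Cx).
have iJ : P.-integrable setT (EFin \o J') by exact: (bi _ M).
have iJ2 : P.-integrable setT (EFin \o (fun w => J' w ^+ 2)).
  apply: (bi _ (M ^+ 2)); first exact: measurable_funX.
  by move=> w; rewrite normrX ler_sqr ?nnegrE.
have iQ : P.-integrable setT (EFin \o Q).
  by apply: (bi _ N) => // w; have /andP[q0 qN] := QN w; rewrite ger0_norm.
have iD : P.-integrable setT (EFin \o (fun w => J' w ^+ 2 - Q w)) by exact: integrableR_B.
pose a := \int[P]_w J' w.
pose b := \int[P]_w (J' w ^+ 2 - Q w).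
pose C := M + N.
have C0 : 0 <= C by exact: addr_ge0.
pose C' := 2 * C ^+ 3 + M * N / 2 + N ^+ 2 / 8.
pose l0 := (2 * (C + 1))^-1.
have C1 : 0 < C + 1 by rewrite ltr_wpDl.
have l00 : 0 < l0 by rewrite invr_gt0 mulr_gt0.
have [aE bE] : a = 0 /\ b = 0.
  apply: (@small_poly_zero _ a b C' l0) => // l l1 l2.
  have l3 : l <= 1.
    by apply: (le_trans l2); rewrite invf_le1 ?mulr_gt0//; lra.
  pose x w := l * J' w - l ^+ 2 * Q w / 2.
  have hx w : `|x w| <= l * C.
    have /andP[q0 qN] := QN w.
    rewrite /x /C mulrDr; apply: (le_trans (ler_normB _ _)); apply: lerD.
      by rewrite normrM gtr0_norm// ler_pM2l.
    rewrite ger0_norm; last by rewrite divr_ge0// mulr_ge0// sqr_ge0.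
    have : l ^+ 2 * Q w <= l * N by apply: ler_pM => //; rewrite ?sqr_ge0// expr2 ler_piMl// ltW.
    have : 0 <= l * N by rewrite mulr_ge0// ltW.
    by move: (l ^+ 2 * Q w) (l * N) => p q; lra.
  have lC : l * C <= 2^-1.
    have : l * (C + 1) <= 2^-1.
      rewrite -ler_pdivlMr//; apply: (le_trans l2); rewrite /l0 invfM//.
    by rewrite mulrDr mulr1; move: l1 (l * C) => ? z; lra.
  pose G w := expR (x w) - 1 - (l * J' w + l ^+ 2 / 2 * (J' w ^+ 2 - Q w)).
  have GC w : `|G w| <= l ^+ 3 * C'.
    have -> : G w = (expR (x w) - 1 - x w - x w ^+ 2 / 2) + (- (l ^+ 3 * (J' w * Q w) / 2) + l ^+ 4 * Q w ^+ 2 / 8).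
      by rewrite /G /x; field.
    have /andP[q0 qN] := QN w.
    have t1 := expR_taylor2 (le_trans (hx w) lC).
    have t2 : `|x w| ^+ 3 <= (l * C) ^+ 3 by rewrite lerXn2r ?nnegrE// mulr_ge0// ltW.
    have l30 : 0 <= l ^+ 3 by rewrite exprn_ge0// ltW.
    have t3 : `|- (l ^+ 3 * (J' w * Q w) / 2)| <= l ^+ 3 * (M * N / 2).
      rewrite normrN -mulrA normrM (ger0_norm l30) ler_wpM2l// normrM normfV normr_nat.
      by rewrite ler_wpM2r ?invr_ge0// normrM (ger0_norm q0) ler_pM.
    have t4 : `|l ^+ 4 * Q w ^+ 2 / 8| <= l ^+ 3 * (N ^+ 2 / 8).
      have q20 : 0 <= Q w ^+ 2 by exact: sqr_ge0.
      have l40 : 0 <= l ^+ 4 by rewrite exprn_ge0// ltW.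
      have -> : l ^+ 4 * Q w ^+ 2 / 8 = l ^+ 4 * (Q w ^+ 2 / 8) by ring.
      have q8 : 0 <= Q w ^+ 2 / 8 by rewrite divr_ge0.
      rewrite (ger0_norm (mulr_ge0 l40 q8)); apply: ler_pM => //.
      - by rewrite exprSr ler_piMr.
      - by rewrite ler_wpM2r ?invr_ge0// ler_sqr ?nnegrE.
    apply: (le_trans (ler_normD _ _)).
    apply: (le_trans (lerD t1 (le_trans (ler_normD _ _) (lerD t3 t4)))).
    rewrite exprMn in t2; rewrite /C' !mulrDr addrA.
    move: t2; move: (`|x w| ^+ 3) (l ^+ 3) (C ^+ 3) (M * N / 2) (N ^+ 2 / 8) => ? ? ? ? ?; nra.
  have iexp : P.-integrable setT (EFin \o (fun w => expR (x w))).
    apply/integrableP; split.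
      apply/measurable_EFinP; apply: measurableT_comp => //; apply: measurable_funB.
        exact: measurable_funM.
      by do 2 apply: measurable_funM => //.
    under eq_integral => w _ do rewrite /= ger0_norm ?expR_ge0//.
    by rewrite ex ltry.
  have i1 : P.-integrable setT (EFin \o (fun _ : Omega => 1 : R)).
    by apply: (bi _ 1) => // w; rewrite normr1.
  have i2 : P.-integrable setT (EFin \o (fun w => expR (x w) - 1)) by exact: integrableR_B.
  have i3 : P.-integrable setT (EFin \o (fun w => l * J' w)) by exact: integrableR_Z.
  have i4 : P.-integrable setT (EFin \o (fun w => l ^+ 2 / 2 * (J' w ^+ 2 - Q w))) by exact: integrableR_Z.
  have i5 : P.-integrable setT (EFin \o (fun w => l * J' w + l ^+ 2 / 2 * (J' w ^+ 2 - Q w))).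
    exact: integrableR_D.
  have iG : P.-integrable setT (EFin \o G) by exact: integrableR_B.
  have P1 : \int[P]_(w in setT) (1 : R) = 1.
    by rewrite Rintegral_cst// mul1r -[RHS]/(fine 1%E); congr fine; exact: probability_setT.
  have : \int[P]_w G w = - (l * a + l ^+ 2 * b / 2).
    rewrite RintegralB// RintegralB// RintegralD// !RintegralZl// P1.
    rewrite {1}/Rintegral ex /= subrr sub0r -/a -/b; congr (- (_ + _)); ring.
  move=> /(congr1 Num.norm); rewrite normrN => <-.
  apply: (le_trans (le_normr_Rintegral _ iG)) => //.
  have -> : l ^+ 3 * C' = \int[P]_(w in setT) (l ^+ 3 * C' * 1).
    by rewrite RintegralZl// P1 mulr1.
  apply: le_Rintegral => //.
  - exact: (integrable_norm iG).
  - exact: integrableR_Z.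
  - by move=> w _; rewrite mulr1.
have fJ : (\int[P]_w (J' w)%:E = (a : R)%:E)%E.
  by rewrite /a /Rintegral fineK//; exact: integrable_fin_num.
have fD : (\int[P]_w (J' w ^+ 2 - Q w)%:E = (b : R)%:E)%E.
  by rewrite /b /Rintegral fineK//; exact: integrable_fin_num.
split.
  transitivity (\int[P]_w (J' w)%:E)%E; last by rewrite fJ aE.
  apply: ae_eq_integral => //; [exact/measurable_EFinP|exact/measurable_EFinP|].
  by apply: filterS J'J => w -> _.
transitivity (\int[P]_w (J' w ^+ 2)%:E)%E.
  apply: ae_eq_integral => //.
  - by apply/measurable_EFinP; exact: measurable_funX.
  - by apply/measurable_EFinP; exact: measurable_funX.
  - by apply: filterS J'J => w -> _.
have : (\int[P]_w (J' w ^+ 2 - Q w)%:E = 0)%E by rewrite fD bE.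
under eq_integral => w _ do rewrite EFinB.
rewrite integralB// => /eqP; rewrite sube_eq ?add0e; first by move/eqP.
  exact: (integrable_fin_num _ iJ2).
by have := integrable_fin_num measurableT iQ; case: (\int[P]_w _)%E.
Qed.

(** * The equation for the value function in the viscosity sense *)

Definition clamp (R : realType) (lo hi v : R) := Num.max lo (Num.min v hi).

Lemma clamp_in (R : realType) (lo hi v : R) : lo <= hi -> lo <= clamp lo hi v <= hi.
Proof. by move=> h; rewrite /clamp le_max lexx ge_max h ge_min lexx orbT. Qed.

Lemma clamp_id (R : realType) (lo hi v : R) : lo <= v <= hi -> clamp lo hi v = v.
Proof. by move=> /andP[h1 h2]; rewrite /clamp (min_idPl h2); exact: max_r. Qed.

Lemma continuous_clamp (R : realType) (lo hi : R) : continuous (clamp lo hi).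
Proof.
change (continuous (cst lo \max (id \min cst hi))) => v.
apply: continuous_max; first exact: cst_continuous.
by apply: continuous_min; [exact: cvg_id|exact: cst_continuous].
Qed.

Lemma continuous_clamp_box (R : realType) (f : R * R -> R) (t s a c : R) :
  t <= s -> a <= c -> {within `[t, s] `*` `[a, c], continuous f} ->
  continuous (fun p => f (clamp t s p.1, clamp a c p.2)).
Proof.
move=> ts ac cf p.
apply: (@within_continuous_comp _ _ _ (`[t, s] `*` `[a, c]) (fun p : R * R => (clamp t s p.1, clamp a c p.2)) f).
- apply: continuous_pair => q.
    by apply: continuous_comp; [exact: cvg_fst|exact: continuous_clamp].
  by apply: continuous_comp; [exact: cvg_snd|exact: continuous_clamp].
- by move=> q; split; rewrite /= in_itv/=; apply: clamp_in.
- exact: cf.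
Qed.

Lemma Rintegral_near_const (R : realType) (f : R -> R) (p q k e : R) : p <= q ->
  {within `[p, q], continuous f} -> (forall u, p <= u <= q -> `|f u - k| <= e) ->
  `|\int[lebesgue_measure]_(u in `[p, q]) f u - k * (q - p)| <= e * (q - p).
Proof.
move=> pq cf fk.
have cst_int z : \int[lebesgue_measure]_(u in `[p, q]) z = z * (q - p).
  rewrite Rintegral_cst//= lebesgue_measure_itv/= lte_fin.
  by case: ltP => [_//|h]; have -> : q = p; [apply/eqP; rewrite eq_le h|rewrite subrr].
have ci (z : R) : lebesgue_measure.-integrable `[p, q] (EFin \o (fun=> z)).
  by apply: continuous_compact_integrable; [exact: segment_compact|move=> ?; exact: cst_continuous].
have fi : lebesgue_measure.-integrable `[p, q] (EFin \o f).
  by apply: continuous_compact_integrable => //; exact: segment_compact.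
have di : lebesgue_measure.-integrable `[p, q] (EFin \o (fun u => f u - k)) by exact: integrableR_B.
rewrite -cst_int -RintegralB//.
apply: (le_trans (le_normr_Rintegral _ di)) => //.
rewrite -cst_int; apply: le_Rintegral => //; first exact: (integrable_norm di).
Qed.

Section exit_measurable.
Variables (R : realType) (d : measure_display) (Omega : measurableType d)
  (P : probability Omega R) (Y : R -> Omega -> R) (a c t s : R).
Hypothesis ts : t < s.
Hypothesis cY : forall w, {within `[t, s], continuous (fun u => Y u w)}.
Hypothesis mY : forall u, t <= u <= s -> measurable_fun setT (Y u).
Let zeta := exit_time Y a c t s.

Lemma measurable_exit : measurable_fun setT zeta.
Proof.
move=> mT; apply: (measurability _ (RGenOInfty.measurableE R)) => //.
move=> _ [_ [u ->] <-]; rewrite setTI; have [ut|tu] := ltP u t.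
  rewrite (_ : _ @^-1` _ = setT)//; apply/seteqP; split => // w _ /=.
  rewrite in_itv/= andbT; have /andP[h _] := exit_bounds Y a c w (ltW ts).
  exact: lt_le_trans ut h.
have [us|su] := ltP u s; last first.
  rewrite (_ : _ @^-1` _ = set0)//; apply/seteqP; split => // w /=.
  rewrite in_itv/= andbT; have /andP[_ h] := exit_bounds Y a c w (ltW ts).
  by move=> /lt_le_trans /(_ h); rewrite ltNge su.
rewrite (_ : _ @^-1` _ = within_open Y t u a c); last first.
  by apply/seteqP; split => w /=; rewrite in_itv/= andbT; move/(exit_ltP a c (ltW ts) (@cY w) tu us).
apply: (@natural_filtration_measurable _ _ _ P Y t u).
  by move=> v tv vu; apply: mY; rewrite tv (le_trans vu (ltW us)).
apply: within_open_nf => // w; apply: continuous_subspaceW (@cY w) => v /=.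
by rewrite !in_itv/= => /andP[-> vu]; rewrite (le_trans vu (ltW us)).
Qed.

Lemma joint_path : exists Zh : R * Omega -> R, measurable_fun setT Zh /\
  forall u w, t <= u <= s -> Zh (u, w) = Y u w.
Proof.
have [|Zh [mZh ZhE]] := @joint_version _ Omega R (fun u w => Y (clamp t s u) w).
  by move=> u; apply: mY; apply: clamp_in; exact: ltW.
exists Zh; split=> // u w hu; rewrite ZhE ?clamp_id//.
apply: (@within_continuous_comp _ _ _ `[t, s] (clamp t s) (fun v => Y v w)).
- exact: continuous_clamp.
- by move=> v; rewrite /= in_itv/=; apply: clamp_in; exact: ltW.
- exact: cY.
Qed.

Lemma measurable_at_exit : measurable_fun setT (fun w => Y (zeta w) w).
Proof.
have [Zh [mZh ZhE]] := joint_path.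
apply: (eq_measurable_fun (fun w => Zh (zeta w, w))).
  by move=> w _; rewrite ZhE//; exact: exit_bounds (ltW ts).
apply: (measurableT_comp mZh (g := fun w => (zeta w, w))).
by apply: measurable_fun_pair => //; exact: measurable_exit.
Qed.

Lemma measurable_int_exit (f : R * R -> R) : a <= c ->
  {within `[t, s] `*` `[a, c], continuous f} ->
  measurable_fun setT (fun w => \int[lebesgue_measure]_(u in `[t, zeta w]) f (u, Y u w)).
Proof.
move=> ac cf; have [Zh [mZh ZhE]] := joint_path.
have mfc := continuous_measurable2 (continuous_clamp_box (ltW ts) ac cf).
pose F (p : R * Omega) := f (clamp t s p.1, clamp a c (Zh p)) *
  (\1_(`[t, +oo[%classic) p.1 * (if p.1 < zeta p.2 then 1 else 0)).
have mF : measurable_fun setT F.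
  apply: measurable_funM.
    apply: (measurableT_comp mfc (g := fun p => (p.1, Zh p))).
    exact: measurable_fun_pair.
  apply: measurable_funM.
    exact: (measurableT_comp (f := \1_(`[t, +oo[%classic) : R -> R)).
  apply: measurable_fun_ifT => //; apply: measurable_fun_ltr => //.
  by apply: (measurableT_comp measurable_exit).
apply: (eq_measurable_fun (fun w => \int[lebesgue_measure]_u F (u, w))).
  move=> w _; have /andP[tz zs] := exit_bounds Y a c w (ltW ts).
  have FE u : t <= u -> u < zeta w -> F (u, w) = f (u, Y u w).
    move=> tu uz; have tus : t <= u <= s by rewrite tu (le_trans (ltW uz)).
    have /andP[/ltW h1 /ltW h2] := exit_inside (ltW ts) tu uz.
    by rewrite /F /= ZhE// !clamp_id ?h1// uz indicE mem_set ?mulr1//= in_itv/= tu.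
  (* Dropping the endpoint does not change the integral, and strictly before [zeta] the path is
     inside ]a, c[, where clamping is the identity. *)
  rewrite /Rintegral -integral_itv_bndo_bndc; last first.
    apply: (eq_measurable_fun (fun u => (F (u, w))%:E)).
      by move=> u; rewrite inE/= in_itv/= => /andP[tu uz]; rewrite FE.
    apply: measurable_funTS; apply/measurable_EFinP.
    by apply: (measurableT_comp mF (g := fun u => (u, w))); exact: measurable_fun_pair.
  rewrite [in RHS]integral_mkcond; congr fine; apply: eq_integral => u _.
  rewrite patchE; case: ifPn => [|hu].
    by rewrite inE/= in_itv/= => /andP[tu uz]; rewrite FE.
  rewrite /F /= indicE; case: (boolP (u \in _)) => [|_]; last by rewrite mul0r mulr0.
  rewrite inE/= in_itv/= andbT => tu; rewrite ifF ?mulr0//.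
  by apply/negP => uz; move/negP: hu; apply; rewrite inE/= in_itv/= tu uz.
exact: measurable_param_Rintegral.
Qed.
End exit_measurable.

Lemma box_near (R : realType) (D : set (R * R)) (f : R * R -> R) (t xi e : R) :
  {within D, continuous f} -> D (t, xi) -> 0 < e ->
  exists2 dl, 0 < dl & forall u y, t <= u <= t + dl -> `|y - xi| <= dl -> D (u, y) ->
    `|f (u, y) - f (t, xi)| <= e.
Proof.
move=> /subspace_continuousP /(_ (t, xi)) cf Dt e0.
move: (cf Dt) => /cvgrPdist_le /(_ _ e0).
rewrite near_withinE => -[[U1 U2] /= [[d1 /= d10 U1s] [d2 /= d20 U2s]] hU].
exists (Num.min (d1 / 2) (d2 / 2)); first by rewrite lt_min !divr_gt0.
move=> u y /andP[tu]; rewrite -lerBlDl le_min => /andP[h1 _].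
rewrite le_min => /andP[_ h2] Duy; rewrite distrC.
apply: (hU (u, y)) => //; split => /=.
  apply: U1s => /=; rewrite distrC ger0_norm ?subr_ge0//.
  by apply: (le_lt_trans h1); rewrite ltr_pdivrMr// ltr_pMr// ltr1n.
apply: U2s => /=; rewrite distrC; apply: (le_lt_trans h2).
by rewrite ltr_pdivrMr// ltr_pMr// ltr1n.
Qed.

Lemma path_comp_continuous (R : realType) (D : set (R * R)) (E : set R) (f : R * R -> R) (z : R -> R) :
  {within D, continuous f} -> {within E, continuous z} -> (forall u, E u -> D (u, z u)) ->
  {within E, continuous (fun u => f (u, z u))}.
Proof.
move=> /subspace_continuousP cf cz DE.
apply: subspace_continuousPe => u Eu e e0.
have /cvgrPdist_lt /(_ _ e0) := cf _ (DE _ Eu).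
rewrite near_withinE => -[[U1 U2] /= [[d1 /= d10 U1s] [d2 /= d20 U2s]] hU].
have [d3 d30 h3] := subspace_cvg cz Eu d20.
exists (Num.min d1 d3); first by rewrite lt_min d10.
move=> y Ey; rewrite lt_min => /andP[y1 y3]; rewrite distrC.
apply: (hU (y, z y)); last exact: DE.
split; first by apply: U1s => /=; rewrite distrC.
by apply: U2s => /=; rewrite distrC; exact: h3.
Qed.

Lemma signed_lower_bound (R : realType) (theta A E K : R) : theta = 1 \/ theta = -1 ->
  0 <= theta * E -> `|A - E| <= K -> - K <= theta * A.
Proof. by case=> ->; rewrite ?mul1r ?mulN1r ler_norml => h /andP[h3 h4]; lra. Qed.

Lemma norm_le_sqr1 (R : realType) (z : R) : `|z| <= z ^+ 2 + 1.
Proof.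
rewrite -(real_normK (num_real z)); have := sqr_ge0 (`|z| - 1).
by move: (`|z|) (normr_ge0 z) => y y0 y1; nra.
Qed.

(** * Parabolas touching the value function *)

Section visc.
Variables (R : realType) (d : measure_display) (Omega : measurableType d)
  (P : probability Omega R) (B : R -> Omega -> R) (T : \bar R) (I : set R)
  (mu : R * R -> R) (sigma : R -> R)
  (X : R -> R -> R -> Omega -> R) (r g : R * R -> R) (b : R -> R).
Let Dt (t : R) : set R := [set v | t <= v /\ (v%:E <= T)%E].
Hypothesis hB : brownian_motion P B.
Hypothesis mI : measurable I.
Hypothesis hX : forall t x, times T t -> I x ->
  strong_solution P B T I mu sigma t x (X t x).
Hypothesis hM : markov_family P T I X.
Hypothesis hr : {within times T `*` setT, continuous r}.
Hypothesis hg : {within times T `*` setT, continuous g}.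
Hypothesis hwp : well_posed P T I r g X.
Hypothesis hv : {within times T `*` I, continuous (value P T r g X)}.
Hypothesis hb : {within times T, continuous b}.
Hypothesis hopt : forall t x, times T t -> I x ->
  optimal P T r g X t x (tau_star T b X t x).
Local Notation V := (value P T r g X).

Let mX t x v : 0 <= t -> I x -> t <= v -> (v%:E <= T)%E -> measurable_fun setT (X t x v).
Proof.
move=> t0 Ix tv vT.
have tT : times T t by split=> //; apply: le_trans vT; rewrite lee_fin.
have [_ ad _ _] := hX tT Ix; move=> _ A mA; rewrite setTI.
by apply: (bm_filtration_measurable hB); exact: ad.
Qed.

Let cX t x w : times T t -> I x -> {within Dt t, continuous (fun v => X t x v w)}.
Proof. by move=> tT Ix; have [h _ _ _] := hX tT Ix; exact: h. Qed.

Variables (t xi d0 vt0 p M theta : R).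
Hypotheses (t0 : 0 <= t) (d00 : 0 < d0) (dT : ((t + d0)%:E < T)%E).
Hypothesis boxI : forall y, `|y - xi| <= d0 -> I y.
Hypothesis b_lt : forall v, t <= v <= t + d0 -> b v < xi - d0.
Hypothesis cmu : {within `[t, t + d0] `*` `[xi - d0, xi + d0], continuous mu}.
Hypothesis csig : {within `[t, t + d0] `*` `[xi - d0, xi + d0], continuous (fun q => sigma q.2)}.
Hypothesis Vt : forall e, 0 < e -> exists2 dl, 0 < dl & forall u y,
  t <= u <= t + dl -> `|y - xi| <= dl ->
  `|V (u, y) - V (t, y) - vt0 * (u - t)| <= e * (u - t).
(* [theta = 1]: the parabola touches from below; [theta = -1]: from above. *)
Hypothesis th : theta = 1 \/ theta = -1.
Hypothesis touch : exists2 dl, 0 < dl & forall y, `|y - xi| <= dl ->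
  0 <= theta * (V (t, y) - V (t, xi) - p * (y - xi) - M / 2 * (y - xi) ^+ 2).

Let mu0 := mu (t, xi).
Let s20 := sigma xi ^+ 2.
Let r0 := r (t, xi).
Let V0 := V (t, xi).
(** The backward operator applied to the touching parabola at (t, xi), with [vt0] as time
    derivative. Below, [k] and [k'] bound the rates of discount and drift up to an error 1, and [C]
    sums the constants of [error_bound]. *)
Let L := s20 / 2 * M + mu0 * p + vt0 - r0 * V0.
Let k := `|r0| + 1.
Let k' := `|mu0| + 1.
Let C := 2 * k ^+ 2 * (`|V0| + 1) + (`|V0| + 1) + `|r0| + 1 + `|p| + `|M| +
  `|M| * (1 + k') * k' + `|M| * k' ^+ 2.

Let Ixi : I xi. Proof. by apply: boxI; rewrite subrr normr0 ltW. Qed.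
Let htb : times_before T t.
Proof. by split=> //; apply: lt_trans dT; rewrite lte_fin ltrDl. Qed.
Let htt : times T t. Proof. by split=> //; apply: ltW; case: htb. Qed.

(** A pathwise form of Ito's formula. Expanding the parabola at y = J + m leaves, up to order e tau,
    only [L * tau] and the terms [p * J] and [M / 2 * (J ^+ 2 - Q)], whose means vanish. *)
Let error_bound (e tau D Rr Vz Vy m Q y J : R) : 0 < e -> e <= 1 -> e * k <= 2^-1 ->
  0 <= tau -> tau <= e -> `|y| <= e -> J = y - m ->
  D = expR (- Rr) -> `|Rr - r0 * tau| <= e * tau ->
  `|Vz - Vy - vt0 * tau| <= e * tau -> `|Vz - V0| <= e ->
  `|m - mu0 * tau| <= e * tau -> `|Q - s20 * tau| <= e * tau ->
  `|D * Vz - V0 - p * J - M / 2 * (J ^+ 2 - Q) - L * tau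
    - (Vy - V0 - p * y - M / 2 * y ^+ 2)| <= C * (e * tau).
Proof.
move=> e0 e1 ek tau0 te ye JE DE hR hV hV0 hm hQ.
have et0 : 0 <= e * tau by rewrite mulr_ge0// ltW.
have k1 : 1 <= k by rewrite lerDr.
have k0 : 0 <= k by exact: le_trans k1.
have k'1 : 1 <= k' by rewrite lerDr.
have k'0 : 0 <= k' by exact: le_trans k'1.
have bnd z0 z : `|z - z0 * tau| <= e * tau -> `|z| <= (`|z0| + 1) * tau.
  move=> h; have -> : z = (z - z0 * tau) + z0 * tau by ring.
  apply: (le_trans (ler_normD _ _)); rewrite [`|z0 * tau|]normrM (ger0_norm tau0) mulrDl mul1r addrC.
  by rewrite lerD2l (le_trans h)// ler_piMl.
have Rk : `|Rr| <= k * tau by exact: bnd.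
have mk : `|m| <= k' * tau by exact: bnd.
have ktau : k * tau <= e * k by rewrite mulrC ler_wpM2r.
have Jk : `|J| <= (1 + k') * e.
  rewrite JE; apply: (le_trans (ler_normB _ _)); rewrite mulrDl mul1r; apply: lerD => //.
  by apply: (le_trans mk); rewrite ler_wpM2l.
have Vk : `|Vz| <= `|V0| + 1.
  have -> : Vz = (Vz - V0) + V0 by ring.
  apply: (le_trans (ler_normD _ _)); rewrite addrC lerD2l; exact: le_trans hV0 e1.
have e2 : `|D - 1 + Rr| <= 2 * k ^+ 2 * (e * tau).
  have hRr : `|- Rr| <= 2^-1 by rewrite normrN; exact: le_trans Rk (le_trans ktau ek).
  have := expR_taylor1 hRr; rewrite opprK -DE normrN => /le_trans; apply.
  have -> : 2 * k ^+ 2 * (e * tau) = 2 * (k * e) * (k * tau) by ring.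
  apply: ler_pM; rewrite ?mulr_ge0// ler_pM2l// (le_trans Rk)// ler_wpM2l//.
have q1 : `|(D - 1 + Rr) * Vz| <= 2 * k ^+ 2 * (`|V0| + 1) * (e * tau).
  rewrite normrM mulrAC; apply: ler_pM => //.
have q2 : `|(Rr - r0 * tau) * Vz| <= (`|V0| + 1) * (e * tau).
  by rewrite normrM mulrC; apply: ler_pM.
have q3 : `|r0 * tau * (Vz - V0)| <= `|r0| * (e * tau).
  rewrite !normrM (ger0_norm tau0) -mulrA ler_wpM2l// mulrC.
  by rewrite ler_wpM2r.
have q4 : `|p * (m - mu0 * tau)| <= `|p| * (e * tau) by rewrite normrM ler_wpM2l.
have M2 : `|M / 2| <= `|M|.
  by rewrite normrM normfV normr_nat ler_piMr// invf_le1 ?ler1n.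
have q5 : `|M / 2 * (Q - s20 * tau)| <= `|M| * (e * tau) by rewrite normrM ler_pM.
have q6 : `|M * (J * m)| <= `|M| * (1 + k') * k' * (e * tau).
  have -> : `|M| * (1 + k') * k' * (e * tau) = `|M| * (((1 + k') * e) * (k' * tau)) by ring.
  by rewrite !normrM ler_wpM2l// ler_pM.
have q7 : `|M / 2 * m ^+ 2| <= `|M| * k' ^+ 2 * (e * tau).
  have -> : `|M| * k' ^+ 2 * (e * tau) = `|M| * ((k' * e) * (k' * tau)) by ring.
  rewrite normrM ler_pM// expr2 normrM ler_pM// (le_trans mk)// ler_wpM2l//.
have -> : D * Vz - V0 - p * J - M / 2 * (J ^+ 2 - Q) - L * tau
    - (Vy - V0 - p * y - M / 2 * y ^+ 2) =
  (D - 1 + Rr) * Vz - (Rr - r0 * tau) * Vz - r0 * tau * (Vz - V0)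
  + (Vz - Vy - vt0 * tau) + p * (m - mu0 * tau) + M / 2 * (Q - s20 * tau)
  + M * (J * m) + M / 2 * m ^+ 2.
  by rewrite JE /L; field.
have -> : C * (e * tau) = 2 * k ^+ 2 * (`|V0| + 1) * (e * tau) + (`|V0| + 1) * (e * tau)
    + `|r0| * (e * tau) + e * tau + `|p| * (e * tau) + `|M| * (e * tau)
    + `|M| * (1 + k') * k' * (e * tau) + `|M| * k' ^+ 2 * (e * tau).
  by rewrite /C; ring.
apply: (le_trans (ler_normD _ _)); apply: lerD; last exact: q7.
apply: (le_trans (ler_normD _ _)); apply: lerD; last exact: q6.
apply: (le_trans (ler_normD _ _)); apply: lerD; last exact: q5.
apply: (le_trans (ler_normD _ _)); apply: lerD; last exact: q4.
apply: (le_trans (ler_normD _ _)); apply: lerD; last exact: hV.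
apply: (le_trans (ler_normB _ _)); apply: lerD; last exact: q3.
by apply: (le_trans (ler_normB _ _)); apply: lerD; [exact: q1|exact: q2].
Qed.

Let C0 : 0 <= C.
Proof.
have k0 : 0 <= k by rewrite addr_ge0.
have k'0 : 0 <= k' by rewrite addr_ge0.
by rewrite !addr_ge0 ?mulr_ge0 ?addr_ge0 ?sqr_ge0.
Qed.

(** Expectations are taken in a pathwise inequality: optional stopping turns the discounted value
    into [V0], [ito_moments] removes the martingale terms, and division by the mean exit time
    compares [L] with [C * e]. *)
Let viscosity_eps e : 0 < e -> e <= 1 -> e * k <= 2^-1 -> theta * L <= C * e.
Proof.
move=> e0 e1 ek.
have xin : `[xi - d0, xi + d0]%classic xi by rewrite /= in_itv/= gerBl lerDl (ltW d00).
have tin : `[t, t + d0]%classic t by rewrite /= in_itv/= lexx lerDl ltW.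
have Dbox : (`[t, t + d0] `*` `[xi - d0, xi + d0]) (t, xi) by split.
have DT : (times T `*` [set: R]) (t, xi) by split.
have DI : (times T `*` I) (t, xi) by split.
have [dm dm0 hm] := box_near cmu Dbox e0.
have csig2 : {within `[t, t + d0] `*` `[xi - d0, xi + d0], continuous (fun q => sigma q.2 ^+ 2)}.
  move=> q; apply: (@continuous_comp _ _ _ (fun q : subspace (`[t, t + d0] `*` `[xi - d0, xi + d0]) => sigma q.2) (fun z => z ^+ 2)).
    exact: csig.
  exact: exprn_continuous.
have [ds ds0 hs] := box_near csig2 Dbox e0.
have [dr dr0 hrr] := box_near hr DT e0.
have [dv dv0 hvv] := box_near hv DI e0.
have [dt dt0 htt'] := Vt e0.
have [dh dh0 hto] := touch.
(* A radius on which every continuity estimate holds with error [e]; being at most [e], it also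
   bounds the duration and the displacement by [e]. *)
pose del := Num.min d0 (Num.min e (Num.min dm (Num.min ds (Num.min dr (Num.min dv (Num.min dt dh)))))).
have del0 : 0 < del by rewrite !lt_min; apply/and5P; split => //; apply/and4P.
have [l0 [le_ [lm [ls [lr [lv [lt_ lh]]]]]]] : del <= d0 /\ del <= e /\ del <= dm /\ del <= ds /\
    del <= dr /\ del <= dv /\ del <= dt /\ del <= dh.
  by rewrite /del !ge_min !lexx !orbT.
pose s := t + del; pose a := xi - del / 2; pose c := xi + del / 2.
pose a' := xi - del; pose c' := xi + del.
have h2 : 0 < del / 2 by rewrite divr_gt0.
have h2' : del / 2 < del by rewrite ltr_pdivrMr// ltr_pMr// ltr1n.
have ts : t < s by rewrite ltrDl.
have sT : (s%:E < T)%E by apply: le_lt_trans dT; rewrite lee_fin lerD2l.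
have a'a : a' < a by rewrite ltrD2l ltrN2.
have cc' : c < c' by rewrite ltrD2l.
have ax : a < xi by rewrite gtrBl.
have xc : xi < c by rewrite ltrDl.
have ac : a <= c by apply: ltW; exact: lt_trans xc.
have nearP y : (`|y - xi| <= del) = (a' <= y <= c').
  by rewrite ler_distl.
have inner y : a <= y <= c -> `|y - xi| <= del.
  by rewrite nearP => /andP[y1 y2]; rewrite (le_trans (ltW a'a) y1) (le_trans y2 (ltW cc')).
have bI y : a' <= y <= c' -> I y by rewrite -nearP => h; apply: boxI; exact: le_trans l0.
have bI' y : a <= y <= c -> I y by move/inner; rewrite nearP; exact: bI.
have bl v : t <= v <= s -> b v < a'.
  move=> /andP[tv vs]; apply: (@lt_le_trans _ _ (xi - d0)).
    by apply: b_lt; rewrite tv (le_trans vs)// lerD2l.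
  by rewrite lerD2l lerN2.
have [_ _ Yx sol] := hX htt Ixi.
pose Y := X t xi.
pose zeta := exit_time Y a c t s.
have cYs w : {within `[t, s], continuous (fun u => Y u w)}.
  apply: continuous_subspaceW (@cX t xi w htt Ixi) => v /=.
  rewrite in_itv/= => /andP[tv vs]; split=> //.
  by apply: le_trans (ltW sT); rewrite lee_fin.
have mYs u : t <= u <= s -> measurable_fun setT (Y u).
  move=> /andP[tu us]; apply: mX => //.
  by apply: le_trans (ltW sT); rewrite lee_fin.
have zb w : t <= zeta w <= s by exact: exit_bounds (ltW ts).
pose S := started X t xi a c.
have mS : measurable S.
  apply: (@natural_filtration_measurable _ _ _ P Y t t).
    by move=> v tv vt; apply: mYs; rewrite tv (le_trans vt (ltW ts)).
  exact: started_nf.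
have PS : P (~` S) = 0%E.
  have [N [mN PN hN]] := Yx.
  apply: (subset_measure0 (measurableC mS) mN _ PN) => w nS; apply: hN => /= Yw.
  by apply: nS; rewrite /S /started /= Yw ax.
have PS1 : P S = 1%E.
  by rewrite -[S]setCK probability_setC; [rewrite PS sube0|exact: measurableC].
have [iDV EDV] := optional_stopping mI mX cX hM hr hg hwp hv hb hopt t0 ts sT Ixi a'a cc' bI bl.
have [iP EP] := pay_value mX cX hr hg hwp hb hopt htb Ixi.
have acI : I a /\ I c by split; apply: bI'; rewrite ac lexx.
have [_ ito] := sol a c s acI.1 acI.2 (introT andP (conj ax xc)) (ltW ts) (ltW sT).
pose tau w := zeta w - t.
pose D w := disc X r t xi (zeta w) w.
pose m w := \int[lebesgue_measure]_(u in `[t, zeta w]) mu (u, Y u w).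
pose J w := Y (zeta w) w - xi - m w.
pose H u w := if u < zeta w then sigma (Y u w) else 0.
pose Q := qvar t s H.
have inb w u : S w -> t <= u <= zeta w -> a <= Y u w <= c.
  by move=> Sw hu; exact: (exit_closed (ltW ts) (@cYs w) Sw).
have uts w u : t <= u <= zeta w -> t <= u <= s.
  by move=> /andP[-> uz]; rewrite (le_trans uz)//; have /andP[] := zb w.
have boxW u y : t <= u <= s -> a <= y <= c ->
    (`[t, t + d0] `*` `[xi - d0, xi + d0]) (u, y).
  move=> /andP[tu us] /inner h; split; rewrite /= in_itv/=.
    by rewrite tu (le_trans us)// lerD2l.
  by move: (le_trans h l0); rewrite ler_distl.
have cYz w : {within `[t, zeta w], continuous (fun u => Y u w)}.
  apply: continuous_subspaceW (@cYs w) => u /=; rewrite !in_itv/= => h; exact: uts h.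
have tau0 w : 0 <= tau w by rewrite subr_ge0; have /andP[] := zb w.
have taue w : tau w <= e.
  by rewrite lerBlDl; have /andP[_ h] := zb w; apply: (le_trans h); rewrite lerD2l.
have taud w : tau w <= del by rewrite lerBlDl; have /andP[_ h] := zb w.
have zd w u : t <= u <= zeta w -> t <= u <= t + del by exact: uts.
have weak (x y z z' : R) : x <= y <= x + z -> z <= z' -> x <= y <= x + z'.
  by move=> /andP[-> h] zz; rewrite (le_trans h)// lerD2l.
have fmS w : S w -> `|m w - mu0 * tau w| <= e * tau w.
  move=> Sw; apply: Rintegral_near_const; first by have /andP[] := zb w.
    apply: (path_comp_continuous cmu (@cYz w)) => u /=; rewrite in_itv/= => hu.
    by apply: boxW; [exact: uts hu|exact: inb].
  move=> u hu; apply: hm; first exact: weak (zd w u hu) lm.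
    by apply: le_trans lm; apply: inner; exact: inb.
  by apply: boxW; [exact: uts hu|exact: inb].
(* At time [t] the value lies on the prescribed side of the parabola at the exit point;
   [error_bound] carries this over to the value at the exit time. *)
have main w : S w -> - (C * e * tau w) <= theta * (D w * V (zeta w, Y (zeta w) w) - V0
      - p * J w - M / 2 * (J w ^+ 2 - Q w) - L * tau w).
  move=> Sw; have zin : t <= zeta w <= zeta w by have /andP[-> _] := zb w; rewrite lexx.
  have Yz := inb w _ Sw zin.
  have yn : `|Y (zeta w) w - xi| <= del by exact: inner.
  have fm := fmS w Sw.
  have fQ : `|Q w - s20 * tau w| <= e * tau w.
    have -> : Q w = \int[lebesgue_measure]_(u in `[t, zeta w]) sigma (Y u w) ^+ 2.
      have ic : lebesgue_measure.-integrable `[t, zeta w]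
          (EFin \o (fun u => sigma (Y u w) ^+ 2)).
        apply: continuous_compact_integrable; first exact: segment_compact.
        apply: (path_comp_continuous csig2 (@cYz w)) => u /=; rewrite in_itv/= => hu.
        by apply: boxW; [exact: uts hu|exact: inb].
      rewrite -Rintegral_itv_bndo_bndc; last first.
        apply: integrableS ic => //.
        by move=> u; rewrite /= !in_itv/= => /andP[-> /ltW].
      rewrite /Q /qvar [LHS]Rintegral_mkcond [RHS]Rintegral_mkcond; apply: eq_Rintegral => u _.
      rewrite !patchE /H; have [uz|zu] := ltP u (zeta w).
        have [tu|ut] := leP t u.
          have /andP[_ us] : t <= u <= s by apply: (@uts w); rewrite tu ltW.
          by rewrite !mem_set//= in_itv/= tu.
        by rewrite !memNset// /= in_itv/= leNgt ut.
      rewrite [X in _ = X]ifF; last by apply/negP; rewrite inE/= in_itv/= ltNge zu andbF.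
      by case: ifP => // _; rewrite expr0n.
    apply: Rintegral_near_const; first by have /andP[] := zb w.
      apply: (path_comp_continuous csig2 (@cYz w)) => u /=; rewrite in_itv/= => hu.
      by apply: boxW; [exact: uts hu|exact: inb].
    move=> u hu; apply: (hs u); first exact: weak (zd w u hu) ls.
      by apply: le_trans ls; apply: inner; exact: inb.
    by apply: boxW; [exact: uts hu|exact: inb].
  pose Rr := \int[lebesgue_measure]_(v in `[0, zeta w - t]) r (t + v, Y (t + v) w).
  have zT : ((zeta w)%:E < T)%E.
    by apply: le_lt_trans sT; rewrite lee_fin; have /andP[] := zb w.
  have fR : `|Rr - r0 * tau w| <= e * tau w.
    have := @Rintegral_near_const R (fun v => r (t + v, Y (t + v) w)) 0 (tau w) r0 e (tau0 w).
    rewrite subr0; apply.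
      exact: (rate_path_continuous cX hr t0 (proj1 (andP (zb w))) zT Ixi).
    move=> v /andP[v0 vt]; have hu : t <= t + v <= zeta w.
      by rewrite lerDl v0 -lerBrDl.
    apply: hrr; first exact: weak (zd w _ hu) lr.
      by apply: le_trans lr; apply: inner; exact: inb.
    split=> //; split; first by apply: (le_trans t0); rewrite lerDl.
    apply: le_trans (ltW zT); rewrite lee_fin; by have /andP[] := hu.
  have zt : t <= zeta w <= t + dt by exact: weak (zd w _ zin) lt_.
  have fV := htt' (zeta w) (Y (zeta w) w) zt (le_trans yn lt_).
  have zTt : times T (zeta w).
    by split; [apply: (le_trans t0); have /andP[] := zb w|exact: ltW].
  have fV0 : `|V (zeta w, Y (zeta w) w) - V0| <= e.
    apply: hvv; first exact: weak (zd w _ zin) lv.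
      exact: le_trans yn lv.
    by split => //; exact: bI'.
  have := @error_bound e (tau w) (D w) Rr (V (zeta w, Y (zeta w) w)) (V (t, Y (zeta w) w))
    (m w) (Q w) (Y (zeta w) w - xi) (J w) e0 e1 ek (tau0 w) (taue w) (le_trans yn le_)
    erefl erefl fR fV fV0 fm fQ.
  have := hto _ (le_trans yn lh).
  rewrite -[C * e * tau w]mulrA -/V0; set A := _ - _ * tau w; set E := (V (t, _) - V0 - _ - _).
  exact: (signed_lower_bound th).
have boxac : `[t, s] `*` `[a, c] `<=` `[t, t + d0] `*` `[xi - d0, xi + d0].
  by move=> [u y] [/= hu hy]; apply: boxW; [move: hu|move: hy]; rewrite in_itv.
have mm : measurable_fun setT m.
  apply: (measurable_int_exit P ts cYs mYs ac).
  exact: continuous_subspaceW cmu.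
have mzeta : measurable_fun setT zeta by exact: (measurable_exit P a c ts cYs mYs).
have mJ : measurable_fun setT J.
  apply: measurable_funB => //; apply: measurable_funB => //.
  exact: (measurable_at_exit P a c ts cYs mYs).
have k'0 : 0 <= k' by rewrite addr_ge0.
pose KJ := e + k' * e.
have JS w : S w -> `|J w| <= KJ.
  move=> Sw; have zin : t <= zeta w <= zeta w by have /andP[-> _] := zb w; rewrite lexx.
  apply: (le_trans (ler_normB _ _)); apply: lerD.
    by apply: (le_trans (inner _ (inb w _ Sw zin))).
  have -> : m w = (m w - mu0 * tau w) + mu0 * tau w by ring.
  apply: (le_trans (ler_normD _ _)); rewrite /k' mulrDl mul1r addrC; apply: lerD.
    by rewrite normrM (ger0_norm (tau0 w)) ler_wpM2l.
  by apply: (le_trans (fmS w Sw)); rewrite -[leRHS]mul1r; apply: ler_pM; rewrite // ltW.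
have KJ0 : 0 <= KJ by rewrite addr_ge0 ?mulr_ge0// ltW.
have aeS : {ae P, forall w, S w}.
  by exists (~` S); split => //; exact: measurableC.
have JM : {ae P, forall w, `|J w| <= KJ} by apply: filterS aeS.
pose KH := s20 + 2.
have KH0 : 0 <= KH by rewrite addr_ge0 ?sqr_ge0.
have HK u w : t <= u <= s -> `|H u w| <= KH.
  move=> /andP[tu us]; rewrite /H; case: ifPn => [uz|_]; last by rewrite normr0.
  have /andP[y1 y2] := exit_inside (ltW ts) tu uz.
  have yac : a <= Y u w <= c by rewrite !ltW.
  have hu : t <= u <= t + ds by apply: (weak _ _ del) => //; rewrite tu.
  have hbx : (`[t, t + d0] `*` `[xi - d0, xi + d0]) (u, Y u w) by apply: boxW => //; rewrite tu.
  have := hs u (Y u w) hu (le_trans (inner _ yac) ls) hbx.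
  rewrite -/s20 /= => /(le_trans (ler_norm _)) h.
  have : `|sigma (Y u w)| <= sigma (Y u w) ^+ 2 + 1.
    exact: norm_le_sqr1.
  move/le_trans; apply; rewrite /KH -[X in _ <= _ + X]/(1 + 1) addrA lerD2r.
  by rewrite -lerBlDl; exact: le_trans h e1.
have [EJ EJ2] := ito_moments hB t0 (ltW ts) KH0 KJ0 ito HK mJ JM.
have mQ : measurable_fun setT Q by exact: (qvar_measurable ito).
have QN w : 0 <= Q w <= KH ^+ 2 * (s - t) by exact: (qvar_bounds (ltW ts) KH0 ito HK).
have mtau : measurable_fun setT tau by exact: measurable_funB.
have bi (f : Omega -> R) K : measurable_fun setT f -> (forall w, S w -> `|f w| <= K) ->
    P.-integrable S (EFin \o f).
  move=> mf hf; apply: measurable_bounded_integrable => //.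
  - by apply: (le_lt_trans (probability_le1 P mS)); rewrite ltry.
  - exact: measurable_funTS.
  - exists K; split; first exact: num_real.
    by move=> x Kx w Sw; exact: le_trans (hf w Sw) (ltW Kx).
have TS : [set: Omega] `\` ~` S = S by rewrite setDE setCK setTI.
have full (f : Omega -> R) : measurable_fun setT f -> P.-integrable S (EFin \o f) ->
    (\int[P]_w (f w)%:E = (\int[P]_(w in S) f w)%:E)%E.
  move=> mf iS; rewrite /Rintegral fineK; last exact: integrable_fin_num.
  rewrite (negligible_integral (measurableC mS) measurableT _ PS) ?TS//.
  apply/(negligible_integrable (measurableC mS) measurableT _ PS); last by rewrite TS.
  exact/measurable_EFinP.
have iJ : P.-integrable S (EFin \o J) by exact: (bi _ KJ).
have iJ2 : P.-integrable S (EFin \o (fun w => J w ^+ 2)).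
  apply: (bi _ (KJ ^+ 2)); first exact: measurable_funX.
  by move=> w Sw; rewrite normrX ler_sqr ?nnegrE ?JS.
have iQ : P.-integrable S (EFin \o Q).
  by apply: (bi _ (KH ^+ 2 * (s - t))) => // w _; have /andP[q0 qN] := QN w; rewrite ger0_norm.
have itau : P.-integrable S (EFin \o tau).
  by apply: (bi _ e) => // w _; rewrite ger0_norm.
have icst (z : R) : P.-integrable S (EFin \o (fun=> z)) by exact: (bi _ `|z|).
(* The mean exit time, positive because almost every path starts strictly inside the interval. *)
pose kap := \int[P]_(w in S) tau w.
have kap0 : 0 < kap.
  rewrite lt_neqAle Rintegral_ge0// andbT; apply/negP => /eqP E0.
  have : (\int[P]_(w in S) `|(EFin \o tau) w| = 0)%E.
    under eq_integral => w _ do rewrite gee0_abs ?lee_fin//.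
    have fin : (\int[P]_(w in S) (tau w)%:E)%E \is a fin_num by exact: integrable_fin_num.
    by rewrite -(fineK fin) -[fine _]/kap -E0.
  have mtS : measurable_fun S (EFin \o tau) by apply: measurable_funTS; exact/measurable_EFinP.
  move/(ae_eq_integral_abs P mS mtS) => [N [mN PN hN]].
  have : (P S <= P N)%E.
    apply: le_measure; rewrite ?inE// => w Sw; apply: hN => /= h.
    have := h Sw; rewrite /= => -[tw].
    by have := exit_start (ltW ts) (@cYs w) ts Sw; rewrite -/(zeta w) -subr_gt0 -/(tau w) tw ltxx.
  by rewrite PN PS1 lee_fin ler10.
have IJ : \int[P]_(w in S) J w = 0.
  by apply/EFin_inj; rewrite -full.
have IJQ : \int[P]_(w in S) (J w ^+ 2 - Q w) = 0.
  rewrite RintegralB//; apply/eqP; rewrite subr_eq0; apply/eqP/EFin_inj.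
  by rewrite -!full//; exact: measurable_funX.
have IDV : \int[P]_(w in S) (D w * V (zeta w, Y (zeta w) w)) = V0.
  rewrite /Rintegral -EDV; apply/EFin_inj; rewrite fineK; last first.
    by apply: integrable_fin_num => //; exact: (integrableS measurableT).
  by apply: etrans (esym EP); rewrite [RHS](negligible_integral (measurableC mS) measurableT _ PS) ?TS.
have IV0 : \int[P]_(w in S) V0 = V0.
  rewrite Rintegral_cst// -[RHS]mulr1; congr (_ * _).
  by rewrite -[RHS]/(fine 1%E); congr fine; exact: PS1.
have iDV' : P.-integrable S (EFin \o (fun w => D w * V (zeta w, Y (zeta w) w))) by exact: iDV.
have j1 : P.-integrable S (EFin \o (fun w => D w * V (zeta w, Y (zeta w) w) - V0)).
  exact: integrableR_B.
have j2 : P.-integrable S (EFin \o (fun w => p * J w)) by exact: integrableR_Z.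
have j3 : P.-integrable S (EFin \o (fun w => D w * V (zeta w, Y (zeta w) w) - V0 - p * J w)).
  exact: integrableR_B.
have j4 : P.-integrable S (EFin \o (fun w => J w ^+ 2 - Q w)) by exact: integrableR_B.
have j5 : P.-integrable S (EFin \o (fun w => M / 2 * (J w ^+ 2 - Q w))) by exact: integrableR_Z.
have j6 : P.-integrable S (EFin \o (fun w => D w * V (zeta w, Y (zeta w) w) - V0 - p * J w
    - M / 2 * (J w ^+ 2 - Q w))) by exact: integrableR_B.
have j7 : P.-integrable S (EFin \o (fun w => L * tau w)) by exact: integrableR_Z.
have j8 : P.-integrable S (EFin \o (fun w => D w * V (zeta w, Y (zeta w) w) - V0 - p * J w
    - M / 2 * (J w ^+ 2 - Q w) - L * tau w)) by exact: integrableR_B.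
have IG : \int[P]_(w in S) (D w * V (zeta w, Y (zeta w) w) - V0 - p * J w
    - M / 2 * (J w ^+ 2 - Q w) - L * tau w) = - (L * kap).
  rewrite RintegralB// RintegralB// RintegralB// RintegralB// !RintegralZl// IDV IV0 IJ IJQ -/kap.
  by ring.
have fin : - (C * e) * kap <= theta * - (L * kap).
  rewrite -IG -!RintegralZl//; apply: le_Rintegral => //.
  - exact: integrableR_Z.
  - exact: integrableR_Z.
  - by move=> w Sw; rewrite mulNr; exact: main.
rewrite -(ler_pM2r kap0); move: fin; rewrite mulrN mulNr lerN2 mulrA; exact.
Qed.

Lemma viscosity : theta * L <= 0.
Proof.
apply/ler_addgt0Pr => z z0; rewrite add0r.
have k0 : 0 < k by rewrite ltr_wpDl.
have C10 : 0 < C + 1 by rewrite ltr_wpDl.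
pose e := Num.min 1 (Num.min (2 * k)^-1 (z / (C + 1))).
have e0 : 0 < e by rewrite !lt_min ltr01 invr_gt0 mulr_gt0// divr_gt0.
have e1 : e <= 1 by rewrite ge_min lexx.
have ek : e * k <= 2^-1.
  by rewrite -ler_pdivlMr// -invfM !ge_min lexx orbT.
apply: (le_trans (viscosity_eps e0 e1 ek)).
apply: (@le_trans _ _ ((C + 1) * e)); first by rewrite ler_pM2r// lerDl.
by rewrite mulrC -ler_pdivlMr// !ge_min lexx !orbT.
Qed.

End visc.

(** * Kernels in the square root of time *)

Section kernel.
Variable R : realType.
Implicit Types (q u s : R) (p : {poly R}) (n m : nat).

Definition gauss s : R := expR (- (s ^+ 2 / 2)).
(** The derivatives of the heat kernel all have this form, [q] being the square root of time. The
    class is stable under both derivatives: each raises [n] by one and acts on the polynomial, by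
    [pdu] or [pdq]. *)
Definition kern n p q u : R := p.[u / q] * gauss (u / q) / q ^+ n.

Definition pdu p : {poly R} := p^`() - 'X * p.
Definition pdq n p : {poly R} := 'X^2 * p - 'X * p^`() - n%:R *: p.

Lemma is_derive_gauss s : is_derive s 1 gauss (- s * gauss s).
Proof.
rewrite /gauss; apply: is_derive_eq.
by rewrite /GRing.scale /=; field.
Qed.

Lemma kern_du n p q u : q != 0 -> is_derive u 1 (kern n p q) (kern n.+1 (pdu p) q u).
Proof.
move=> q0.
have d1 : is_derive u 1 (fun z : R => z / q) q^-1.
  by apply: is_derive_eq; rewrite /GRing.scale /= !mulr0 add0r mulr1.
have dp := @is_derive1_comp R (fun s => p.[s]) (fun z : R => z / q) u _ _ (is_derive_poly p (u / q)) d1.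
have dg := @is_derive1_comp R gauss (fun z : R => z / q) u _ _ (is_derive_gauss (u / q)) d1.
have := is_deriveM (is_deriveM dp dg) (is_derive_cst (q ^+ n)^-1 u 1).
move/is_derive_eq; apply.
rewrite /kern /pdu !hornerE /GRing.scale /= exprS; field.
by rewrite q0 expf_neq0.
Qed.

Lemma kern_dq n p q u : q != 0 -> is_derive q 1 (kern n p ^~ u) (kern n.+1 (pdq n p) q u).
Proof.
move=> q0.
have d1 : is_derive q 1 (fun z : R => u / z) (- u / q ^+ 2).
  have := is_deriveM (is_derive_cst u q 1) (is_deriveV q0 (is_derive_id q 1)).
  by move/is_derive_eq; apply; rewrite /GRing.scale /=; field.
have dp := @is_derive1_comp R (fun s => p.[s]) (fun z : R => u / z) q _ _ (is_derive_poly p (u / q)) d1.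
have dg := @is_derive1_comp R gauss (fun z : R => u / z) q _ _ (is_derive_gauss (u / q)) d1.
have qn0 : q ^+ n != 0 by rewrite expf_neq0.
have dX : is_derive q 1 (fun z : R => z ^+ n) (n%:R * q ^+ n.-1).
  rewrite (_ : (fun z : R => z ^+ n) = horner 'X^n); last by apply/funext => z; rewrite hornerXn.
  by move/is_derive_eq: (is_derive_poly 'X^n q); apply; rewrite derivXn hornerMn hornerXn mulr_natl.
have dn : is_derive q 1 (fun z : R => (z ^+ n)^-1) (- (n%:R * (q^-1 * (q ^+ n)^-1))).
  move/is_derive_eq: (@is_deriveV R (fun z : R => z ^+ n) q _ 1 qn0 dX); apply.
  rewrite /GRing.scale /=; case: n {dX} qn0 => [|n] qn0; first by rewrite !mul0r mulr0 oppr0.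
  have Q0 : q ^+ n != 0 by rewrite expf_neq0.
  have E1 : q ^+ n.+1 = q * q ^+ n by rewrite exprS.
  rewrite E1 /=; move: (q ^+ n) Q0 (n.+1%:R : R) => Q Q0 N; field.
  by rewrite q0 Q0.
have := is_deriveM (is_deriveM dp dg) dn.
move/is_derive_eq; apply.
rewrite /kern /pdq !hornerE /GRing.scale /= [q ^+ n.+1]exprS.
rewrite -[(_ * _) q]/(p.[u / q] * gauss (u / q)).
move: (q ^+ n) qn0 (n%:R : R) => Q Q0 N; field.
by rewrite q0 Q0.
Qed.

(** With k = 2n, (1 + x) / k <= 1 + x / k <= exp(x / k) for x = s^2; the n-th power gives exp(x /
    2), the inverse of [gauss s]. *)
Lemma expR_poly_bound n s : (1 + s ^+ 2) ^+ n * gauss s <= (2 * n)%:R ^+ n.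
Proof.
case: n => [|n].
  rewrite !expr0 mul1r /gauss -[leRHS]expR0 ler_expR oppr_le0.
  by rewrite divr_ge0// sqr_ge0.
set x := s ^+ 2; have x0 : 0 <= x by exact: sqr_ge0.
pose k : R := (2 * n.+1)%:R.
have k0 : 0 < k by rewrite ltr0n.
have h1 : (1 + x) / k <= expR (x / k).
  apply: le_trans (expR_ge1Dx _); rewrite mulrDl lerD2r mul1r invf_le1// /k ler1n.
  by rewrite muln_gt0.
have h2 : ((1 + x) / k) ^+ n.+1 <= expR (x / 2).
  have -> : x / 2 = (x / k) *+ n.+1.
    by rewrite -[RHS]mulr_natr /k natrM invfM mulrA mulfVK// pnatr_eq0.
  by rewrite -mulr_natl expRM_natl lerXn2r// ?nnegrE ?expR_ge0// divr_ge0 ?addr_ge0// ltW.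
rewrite /gauss expRN -/x ler_pdivrMr ?expR_gt0//.
by rewrite mulrC -ler_pdivrMr ?exprn_gt0// -expr_div_n.
Qed.

Lemma poly_abs_bound p : exists2 K, 0 <= K & forall s, `|p.[s]| <= K * (1 + s ^+ 2) ^+ size p.
Proof.
exists (\sum_(i < size p) `|p`_i|); first exact: sumr_ge0.
move=> s; rewrite horner_coef; apply: (le_trans (ler_norm_sum _ _ _)).
rewrite mulr_suml; apply: ler_sum => i _; rewrite normrM ler_wpM2l// normrX.
have s1 : 1 <= 1 + s ^+ 2 by rewrite lerDl sqr_ge0.
have : `|s| <= 1 + s ^+ 2.
  rewrite -(real_normK (num_real s)); have := sqr_ge0 (`|s| - 1); have := normr_ge0 s.
  by move: (`|s|) => z z0 h; nra.
move=> h; apply: (@le_trans _ _ ((1 + s ^+ 2) ^+ i)).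
  by apply: lerXn2r; rewrite ?nnegrE// (le_trans ler01).
by apply: ler_weXn2l => //; exact: ltnW.
Qed.

Lemma kern_bound n p m : exists2 K, 0 <= K & forall q u, 0 < q ->
  `|kern n p q u| <= K / (q ^+ n * (1 + (u / q) ^+ 2) ^+ m).
Proof.
have [K K0 hK] := poly_abs_bound p.
exists (K * (2 * (size p + m))%:R ^+ (size p + m)); first by rewrite mulr_ge0.
move=> q u q0; set s := u / q.
have s1 : 0 < 1 + s ^+ 2 by rewrite ltr_pwDl// sqr_ge0.
have qn : 0 < q ^+ n by exact: exprn_gt0.
rewrite invfM mulrA normrM normfV (gtr0_norm qn) [leRHS]mulrAC ler_pM2r ?invr_gt0//.
rewrite ler_pdivlMr ?exprn_gt0// normrM (ger0_norm (expR_ge0 _)) -/s.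
apply: (@le_trans _ _ (K * ((1 + s ^+ 2) ^+ (size p + m) * gauss s))).
  rewrite exprD mulrAC !mulrA ler_wpM2r ?expR_ge0// ler_wpM2r ?exprn_ge0//.
  exact: ltW.
by rewrite ler_wpM2l// expR_poly_bound.
Qed.

End kernel.

(** * One-variable calculus on closed intervals *)

Section calculus.
Variable R : realType.
Local Notation leb := (@lebesgue_measure R).
Implicit Types (f g F G : R -> R) (a b x : R).

Lemma is_derive1_continuous f x (l : R) : is_derive x 1 f l -> {for x, continuous f}.
Proof. by move=> [fd _]; apply: differentiable_continuous; apply/derivable1_diffP. Qed.

Lemma is_derive_within_continuous f (df : R -> R) a b :
  (forall x, a <= x <= b -> is_derive x 1 f (df x)) -> {within `[a, b], continuous f}.
Proof.
move=> h; apply: continuous_in_subspaceT => x; rewrite inE/= in_itv/= => hx.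
exact: is_derive1_continuous (h x hx).
Qed.

Lemma within_itv_for f a b x : {within `[a, b], continuous f} -> a < x < b ->
  {for x, continuous f}.
Proof.
move=> cf /andP[ax xb]; have ab := lt_trans ax xb.
have [h _ _] := (continuous_within_itvP f ab).1 cf.
by apply: h; rewrite in_itv/= ax.
Qed.

Lemma derive_le_increment F G (F' G' : R -> R) a b : a <= b ->
  {within `[a, b], continuous F} -> {within `[a, b], continuous G} ->
  (forall x, a < x < b -> is_derive x 1 F (F' x)) ->
  (forall x, a < x < b -> is_derive x 1 G (G' x)) ->
  (forall x, a < x < b -> `|F' x| <= G' x) -> `|F b - F a| <= G b - G a.
Proof.
rewrite le_eqVlt => /orP[/eqP->|ab] cF cG dF dG FG; first by rewrite !subrr normr0.
have key (s : R) : `|s| = 1 -> s * (F b - F a) <= G b - G a.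
  move=> s1; pose D z := G z - s * F z.
  have dD z : z \in `]a, b[ -> is_derive z 1 D (G' z - s * F' z).
    rewrite in_itv/= => hz.
    have := is_deriveB (dG z hz) (is_deriveM (is_derive_cst s z 1) (dF z hz)).
    by move/is_derive_eq; apply; rewrite scaler0 addr0.
  have cD : {within `[a, b], continuous D}.
    move=> z; apply: cvgB; first exact: cG.
    by apply: cvgM; [exact: cvg_cst|exact: cF].
  have [z zab E] := MVT ab dD cD.
  have : 0 <= D b - D a.
    rewrite E; apply: mulr_ge0; last by rewrite subr_ge0 ltW.
    move: zab; rewrite in_itv/= subr_ge0 => /FG h.
    by apply: (le_trans (ler_norm _)); rewrite normrM s1 mul1r.
  by rewrite /D; lra.
rewrite ler_norml lerNl -mulN1r key ?normrN1//=.
by rewrite -[leLHS]mul1r key ?normr1.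
Qed.

Lemma primitive_continuous f a b : a <= b -> {within `[a, b], continuous f} ->
  {within `[a, b], continuous (fun z => \int[leb]_(u in `[a, z]) f u)}.
Proof.
move=> ab cf; apply: (parameterized_integral_continuous ab).
by apply: continuous_compact_integrable => //; exact: segment_compact.
Qed.

Lemma primitive_derive f a b x : {within `[a, b], continuous f} -> a < x < b ->
  is_derive x 1 (fun z => \int[leb]_(u in `[a, z]) f u) (f x).
Proof.
move=> cf /andP[ax xb].
have fi : leb.-integrable `[a, b] (EFin \o f).
  by apply: continuous_compact_integrable => //; exact: segment_compact.
have cx : {for x, continuous f} by apply: (within_itv_for cf); rewrite ax.
have [d1 d2] := continuous_FTC1_closed xb fi ax cx.
by split; [exact: d1|rewrite -derive1E].
Qed.

Lemma integral_point f a : \int[leb]_(u in `[a, a]) f u = 0.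
Proof. by rewrite set_itv1 Rintegral_set1. Qed.

Lemma integral_le_increment f G (G' : R -> R) a b : a <= b ->
  {within `[a, b], continuous f} -> {within `[a, b], continuous G} ->
  (forall x, a < x < b -> is_derive x 1 G (G' x)) ->
  (forall x, a < x < b -> `|f x| <= G' x) ->
  `|\int[leb]_(u in `[a, b]) f u| <= G b - G a.
Proof.
move=> ab cf cG dG fG.
rewrite -[X in `|X|]subr0 -[X in _ - X](integral_point f a).
apply: (derive_le_increment (F := fun z => \int[leb]_(u in `[a, z]) f u) (F' := f)
   ab (primitive_continuous ab cf) cG _ dG fG) => x hx.
exact: primitive_derive hx.
Qed.

Lemma integral_increment f F a b : a <= b ->
  {within `[a, b], continuous f} -> {within `[a, b], continuous F} ->
  (forall x, a < x < b -> is_derive x 1 F (f x)) ->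
  \int[leb]_(u in `[a, b]) f u = F b - F a.
Proof.
move=> ab cf cF dF; apply/eqP; rewrite -subr_eq0 -normr_le0.
pose D z := \int[leb]_(u in `[a, z]) f u - F z.
have -> : \int[leb]_(u in `[a, b]) f u - (F b - F a) = D b - D a.
  by rewrite /D integral_point; ring.
have -> : 0 = cst 0 b - cst 0 a :> R by rewrite subrr.
apply: (derive_le_increment (F' := cst 0) (G' := cst 0)) => //.
- by move=> z; apply: cvgB; [exact: (primitive_continuous ab cf)|exact: cF].
- by move=> z; exact: cst_continuous.
- move=> x hx; have := is_deriveB (primitive_derive cf hx) (dF x hx).
  by move/is_derive_eq; apply; rewrite subrr.
- by move=> x _; rewrite normr0.
Qed.

Lemma integral_chasles f a b c : a <= b -> b <= c -> {within `[a, c], continuous f} ->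
  \int[leb]_(u in `[a, c]) f u = \int[leb]_(u in `[a, b]) f u + \int[leb]_(u in `[b, c]) f u.
Proof.
move=> ab bc cf; have ac := le_trans ab bc.
have cbc : {within `[b, c], continuous f}.
  by apply: continuous_subspaceW cf => u /=; rewrite !in_itv/= => /andP[bu ->]; rewrite (le_trans ab).
pose F z := \int[leb]_(u in `[a, z]) f u.
have cF : {within `[b, c], continuous F}.
  apply: continuous_subspaceW (primitive_continuous ac cf) => u /=.
  by rewrite !in_itv/= => /andP[bu ->]; rewrite (le_trans ab).
have dF x : b < x < c -> is_derive x 1 F (f x).
  move=> /andP[bx xc]; apply: (primitive_derive cf).
  by rewrite xc (le_lt_trans ab).
by have -> := @integral_increment f F b c bc cbc cF dF; rewrite addrC subrK.
Qed.

Lemma is_derive_atan x : is_derive x 1 atan (1 + x ^+ 2)^-1.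
Proof. exact: is_derive1_atan. Qed.

Lemma atan_bound x : `|atan x| <= pi / 2.
Proof. by rewrite ler_norml !ltW ?atan_ltpi2 ?atan_gtNpi2. Qed.

Lemma differentiation_integral (f f' : R -> R -> R) a b u v x K : a <= b -> u < x < v ->
  (forall z, u < z < v -> {within `[a, b], continuous (f z)}) ->
  (forall z y, u < z < v -> a <= y <= b -> is_derive z 1 (f ^~ y) (f' z y)) ->
  (forall z y, u < z < v -> a <= y <= b -> `|f' z y| <= K) ->
  is_derive x 1 (fun z => \int[leb]_(y in `[a, b]) f z y) (\int[leb]_(y in `[a, b]) f' x y).
Proof.
move=> ab uxv cf df hK.
have K0 : 0 <= K by apply: le_trans (hK x a uxv _); rewrite ?lexx.
have xin : `]u, v[%classic x by rewrite /= in_itv.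
have mB : measurable (`[a, b]%classic : set (measurableTypeR R)) by [].
have h1 z : `]u, v[%classic z -> leb.-integrable `[a, b] (EFin \o f z).
  rewrite /= in_itv/= => hz.
  by apply: continuous_compact_integrable; [exact: segment_compact|exact: cf].
have h2 z y : `]u, v[%classic z -> `[a, b]%classic y -> derivable (f ^~ y) z 1.
  by rewrite /= !in_itv/= => hz hy; have [] := df z y hz hy.
have h3 : leb.-integrable `[a, b] (EFin \o (fun=> K)).
  by apply: continuous_compact_integrable; [exact: segment_compact|move=> ?; exact: cst_continuous].
have pE z y : u < z < v -> a <= y <= b -> partial1of2 f z y = f' z y.
  by move=> hz hy; rewrite /partial1of2 derive1E; have [_] := df z y hz hy.
have h4 z y : `]u, v[%classic z -> `[a, b]%classic y -> `|partial1of2 f z y| <= K.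
  by rewrite /= !in_itv/= => hz hy; rewrite pE//; exact: hK.
have d1 := derivable_under_integral mB xin h1 h2 (fun _ => K0) h3 h4.
have d2 := differentiation_under_integral mB xin h1 h2 (fun _ => K0) h3 h4.
split; first exact: d1.
rewrite -derive1E d2; apply: eq_Rintegral => y; rewrite inE/= in_itv/= => hy.
exact: pE.
Qed.

End calculus.

(** * Slopes recovered from kernel averages *)

Section slopes.
Variable R : realType.
Local Notation leb := (@lebesgue_measure R).
Implicit Types (q u s e : R) (p : {poly R}) (n m : nat).

Lemma kern_continuous n p q u : q != 0 -> {for q, continuous (kern n p ^~ u)}.
Proof. by move=> q0; exact: is_derive1_continuous (kern_dq n p u q0). Qed.

Lemma kern_continuous_u n p q u : q != 0 -> {for u, continuous (kern n p q)}.
Proof. by move=> q0; exact: is_derive1_continuous (kern_du n p u q0). Qed.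

(** Decay of order m = n in (u/q)^2 overcomes the singular factor q^-n: away from u = 0 the kernel
    vanishes with q. *)
Lemma kern_small n p : exists2 K, 0 <= K & forall q u, 0 < q -> u != 0 ->
  `|kern n p q u| <= K * (q ^+ n / u ^+ (2 * n)).
Proof.
have [K K0 hK] := kern_bound n p n.
exists K => // q u q0 u0; apply: (le_trans (hK q u q0)).
rewrite ler_wpM2l//.
have uu : 0 < u ^+ 2 by rewrite exprn_even_gt0.
have -> : q ^+ n / u ^+ (2 * n) = (q ^+ n * ((u / q) ^+ 2) ^+ n)^-1.
  rewrite -exprMn exprM -exprVn -exprMn -[RHS]exprVn; apply: (congr1 (fun z => z ^+ n)); field.
  by rewrite u0 gt_eqF.
have uq : 0 < (u / q) ^+ 2 by rewrite exprn_even_gt0// mulf_neq0// invr_eq0 gt_eqF.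
rewrite lef_pV2 ?posrE ?mulr_gt0 ?(exprn_gt0 _ uq) ?(exprn_gt0 _ q0) ?(exprn_gt0 _ (addr_gt0 _ uq))//.
apply: ler_wpM2l; first by rewrite exprn_ge0 ?ltW.
by apply: lerXn2r; rewrite ?nnegrE ?lerDr ?addr_ge0 ?ltW.
Qed.

Lemma kern0 n p u : kern n.+1 p 0 u = 0.
Proof. by rewrite /kern exprS mul0r invr0 mulr0. Qed.

(** Since the inverse of 0 is 0, the kernel is 0 at q = 0; by [kern_small] this is also its limit
    when u is nonzero. *)
Lemma kern_within n p u (Q : R) : u != 0 -> {within `[0, Q], continuous (kern n.+1 p ^~ u)}.
Proof.
move=> u0; apply/subspace_continuousPe => q hq e e0.
move: hq; rewrite /= in_itv/= => /andP[q0 _].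
have [q00|qn0] := eqVneq q 0; last first.
  have /cvgrPdist_lt/(_ e e0) := @kern_continuous n.+1 p q u qn0.
  move=> [d /= d0 hd]; exists d => // z _ hz; rewrite distrC; apply: hd.
  by rewrite /= distrC.
rewrite q00 kern0.
have [K K0 hK] := kern_small n.+1 p.
pose C := K / u ^+ (2 * n.+1) + 1.
have uu : 0 < u ^+ (2 * n.+1) by rewrite exprn_even_gt0 ?mul2n ?odd_double// u0 orbT.
have C0 : 0 < C by rewrite /C ltr_wpDl// divr_ge0// ltW.
exists (Num.min 1 (e / C)); first by rewrite lt_min ltr01 divr_gt0.
move=> z /=; rewrite in_itv/= => /andP[z0 _]; rewrite !subr0 (ger0_norm z0) lt_min => /andP[z1 ze].
move: z0; rewrite le_eqVlt => /orP[/eqP<-|z0]; first by rewrite kern0 normr0.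
apply: (le_lt_trans (hK z u z0 u0)).
apply: (@le_lt_trans _ _ (C * z)); last by rewrite mulrC -ltr_pdivlMr.
rewrite mulrCA mulrC; apply: ler_pM; rewrite ?exprn_ge0 ?mulr_ge0 ?invr_ge0 ?(ltW uu) ?(ltW z0)//.
  by rewrite lerDl.
by rewrite exprS -[leRHS]mulr1 ler_wpM2l ?exprn_ile1// ltW.
Qed.

(** The third Hermite polynomial. *)
Definition poly3 : {poly R} := 'X^3 - 3%:R *: 'X.
Lemma poly3E s : poly3.[s] = s ^+ 3 - 3 * s.
Proof. by rewrite /poly3 hornerD hornerN hornerZ hornerXn hornerX. Qed.

Lemma poly3'E s : poly3^`().[s] = 3 * s ^+ 2 - 3.
Proof.
rewrite /poly3 derivB derivZ derivXn derivX hornerD hornerN hornerZ hornerMn hornerXn hornerC.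
by rewrite -mulr_natl mulr1.
Qed.

Lemma poly3''E s : poly3^`()^`().[s] = 6 * s.
Proof.
rewrite /poly3 derivB derivZ derivXn derivX derivB derivZ derivMn derivXn derivC.
rewrite hornerD hornerN hornerZ !hornerMn hornerXn hornerC -mulrnA mulr0 subr0 expr1.
by rewrite [RHS]mulr_natl.
Qed.

Lemma pduE p s : (pdu p).[s] = p^`().[s] - s * p.[s].
Proof. by rewrite /pdu hornerD hornerN hornerM hornerX. Qed.

Lemma pdu'E p s : (pdu p)^`().[s] = p^`()^`().[s] - (p.[s] + s * p^`().[s]).
Proof. by rewrite /pdu derivB derivM derivX mul1r !(hornerD, hornerN, hornerM, hornerX). Qed.

Lemma pdqE n p s : (pdq n p).[s] = s ^+ 2 * p.[s] - s * p^`().[s] - n%:R * p.[s].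
Proof. by rewrite /pdq !(hornerD, hornerN, hornerM, hornerZ, hornerX, hornerXn). Qed.

(* With [q] the square root of time, [phi] is a multiple of the space derivative of the
   heat kernel, [chi] its derivative in [q] and [psi] its derivative in time. *)
Definition phi : R -> R -> R := kern 2 'X.
Definition chi : R -> R -> R := kern 3 poly3.
Definition psi : R -> R -> R := kern 4 (2^-1 *: poly3).

Lemma phi_dq q u : q != 0 -> is_derive q 1 (phi ^~ u) (chi q u).
Proof.
move=> q0; have := kern_dq 2 'X u q0; move/is_derive_eq; apply.
rewrite /chi /kern poly3E pdqE derivX hornerX hornerC.
by apply: (congr1 (fun z => z * gauss (u / q) / q ^+ 3)); ring.
Qed.

Lemma chi_psi q u : chi q u = 2 * q * psi q u.
Proof.
rewrite /chi /psi /kern hornerZ poly3E; have [->|q0] := eqVneq q 0.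
  by rewrite !expr0n/= !invr0 !mulr0.
by field; rewrite q0.
Qed.

Definition psi1 : R -> R -> R := kern 5 (pdu (2^-1 *: poly3)).
Definition psi2 : R -> R -> R := kern 6 (pdu (pdu (2^-1 *: poly3))).

(** The heat equation in the variable q: d/dq is 2q d/dt, and d/dt is half the second derivative in
    u. *)
Lemma psi_dq q u : q != 0 -> is_derive q 1 (psi ^~ u) (q * psi2 q u).
Proof.
move=> q0; have := kern_dq 4 (2^-1 *: poly3) u q0; move/is_derive_eq; apply.
rewrite /psi2 /kern [q ^+ 6]exprS; set G := gauss _.
have -> : (pdq 4 (2^-1 *: poly3)).[u / q] = (pdu (pdu (2^-1 *: poly3))).[u / q].
  rewrite pdqE !pduE pdu'E !derivZ !hornerZ poly3E poly3'E poly3''E.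
  by field.
by field; rewrite q0.
Qed.

(** The polynomial is odd, so a factor e/q can be extracted. The resulting bound is a Poisson kernel
    in q, whose integral over the half-line does not depend on e. *)
Lemma chi_bound : exists2 K, 0 <= K & forall q e, 0 < q -> 0 <= e ->
  q ^+ 2 * `|chi q e| <= K * (e / (q ^+ 2 + e ^+ 2)).
Proof.
have [K K0 hK] := kern_bound 3 ('X^2 - 3%:R%:P : {poly R}) 1.
exists K => // q e q0 e0.
have -> : chi q e = e / q * kern 3 ('X^2 - 3%:R%:P) q e.
  by rewrite /chi /kern poly3E hornerD hornerN hornerXn hornerC; ring.
have eq0 : 0 <= e / q by rewrite divr_ge0 // ltW.
rewrite normrM (ger0_norm eq0) mulrA.
apply: (@le_trans _ _ (q ^+ 2 * (e / q) * (K / (q ^+ 3 * (1 + (e / q) ^+ 2) ^+ 1)))).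
  by rewrite ler_wpM2l ?hK// mulr_ge0// sqr_ge0.
rewrite le_eqVlt; apply/orP; left; apply/eqP; field.
by rewrite !gt_eqF// ltr_pwDl// ?exprn_gt0// sqr_ge0.
Qed.

Lemma is_derive_sqr q : is_derive q 1 (fun q : R => q ^+ 2) (2 * q).
Proof. 
have := is_deriveM (is_derive_id q 1) (is_derive_id q 1).
by move/is_derive_eq; apply; rewrite /GRing.scale /=; ring.
Qed.

Lemma chi_within e (Q : R) : 0 < e -> {within `[0, Q], continuous (chi ^~ e)}.
Proof. by move=> e0; apply: kern_within; rewrite gt_eqF. Qed.

(** Integrating by parts, the quantity is the integral of 2 q phi minus the end term Q^2 phi(Q, e).
    On [e/2, e] the integrand is at least 2 e exp(-2) / q^2, which contributes 2 exp(-2); the end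
    term is at most e/Q, hence at most exp(-2). So the mass does not degenerate as e tends to 0. *)
Lemma chi_mass (Q : R) : 0 < Q -> exists2 e0, 0 < e0 &
  forall e, 0 < e -> e < e0 -> expR (-2) <= - (\int[leb]_(q in `[0, Q]) (q ^+ 2 * chi q e)).
Proof.
move=> Q0; exists (Num.min Q (Q * expR (-2))); first by rewrite lt_min Q0 mulr_gt0 ?expR_gt0.
move=> e e0; rewrite lt_min => /andP[eQ eQ2].
have en0 : e != 0 by rewrite gt_eqF.
have cX (a b : R) (k : nat) : {within `[a, b], continuous (fun q : R => q ^+ k)}.
  by apply: continuous_subspaceT => q; exact: exprn_continuous.
have cphi : {within `[0, Q], continuous (phi ^~ e)} by exact: kern_within.
pose W q := 2 * q * phi q e.
have cW : {within `[0, Q], continuous W}.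
  move=> q; apply: (cvgM _ (cphi q)); apply: cvgM; first exact: cvg_cst.
  exact: (cX _ _ 1%N q).
have cV : {within `[0, Q], continuous (fun q => q ^+ 2 * phi q e)}.
  by move=> q; apply: cvgM; [exact: cX|exact: cphi].
have cC : {within `[0, Q], continuous (fun q => q ^+ 2 * chi q e)}.
  by move=> q; apply: cvgM; [exact: cX|exact: chi_within].
have phiE q : q != 0 -> W q = 2 * e / q ^+ 2 * gauss (e / q).
  by move=> q0; rewrite /W /phi /kern hornerX; field.
have W0 q : 0 <= q -> 0 <= W q.
  rewrite le_eqVlt => /orP[/eqP<-|q0]; first by rewrite /W mulr0 mul0r.
  by rewrite phiE ?gt_eqF// mulr_ge0 ?expR_ge0// divr_ge0 ?sqr_ge0// mulr_ge0// ltW.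
pose F z := \int[leb]_(q in `[0, z]) W q.
have cF : {within `[0, Q], continuous F} by exact: primitive_continuous (ltW Q0) cW.
have dF q : 0 < q < Q -> is_derive q 1 F (W q) by move=> hq; exact: primitive_derive hq.
have mono (a b : R) : 0 <= a -> a <= b -> b <= Q -> F a <= F b.
  move=> a0 ab bQ; rewrite -subr_ge0; apply: (le_trans (normr_ge0 (cst 0 b - cst 0 a : R))).
  have sub : `[a, b] `<=` `[0, Q]%classic.
    by move=> z /=; rewrite !in_itv/= => /andP[az zb]; rewrite (le_trans a0)//= (le_trans zb).
  apply: (derive_le_increment (F' := cst 0) (G' := W) ab).
  - by move=> z; exact: cst_continuous.
  - exact: continuous_subspaceW cF.
  - by move=> z /andP[az zb]; apply: dF; rewrite (le_lt_trans a0)//= (lt_le_trans zb).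
  - by move=> z /andP[az zb]; rewrite normr0 W0// (le_trans a0)// ltW.
have low : 2 * expR (-2) <= F e - F (e / 2).
  have e20 : 0 < e / 2 by rewrite divr_gt0.
  have ee : e / 2 <= e by lra.
  have sub : `[e / 2, e] `<=` `[0, Q]%classic.
    move=> z /=; rewrite !in_itv/= => /andP[az zb].
    by rewrite (le_trans (ltW e20))//= (le_trans zb)// ltW.
  pose G z : R := - (2 * e * expR (-2)) / z.
  have dG (z : R) : 0 < z -> is_derive z 1 G (2 * e * expR (-2) / z ^+ 2).
    move=> z0; have zn : z != 0 by rewrite gt_eqF.
    have := is_deriveM (is_derive_cst (- (2 * e * expR (-2))) z 1) (is_deriveV zn (is_derive_id z 1)).
    by move/is_derive_eq; apply; rewrite /GRing.scale /=; field.
  have -> : 2 * expR (-2) = G e - G (e / 2) by rewrite /G; field.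
  apply: (le_trans (ler_norm _)).
  apply: (derive_le_increment (F' := fun z => 2 * e * expR (-2) / z ^+ 2) (G' := W) ee).
  - apply: (is_derive_within_continuous (df := fun z => 2 * e * expR (-2) / z ^+ 2)) => z /andP[z1 _].
    by apply: dG; exact: lt_le_trans z1.
  - exact: continuous_subspaceW cF.
  - by move=> z /andP[z1 _]; apply: dG; exact: lt_trans z1.
  - by move=> z /andP[z1 z2]; apply: dF; rewrite (lt_trans e20)//= (lt_trans z2).
  - move=> z /andP[z1 z2]; have z0 := lt_trans e20 z1.
    have ez : (e / z) ^+ 2 / 2 <= 2.
      have : e / z <= 2 by rewrite ler_pdivrMr// mulrC -ler_pdivrMr// ltW.
      have : 0 <= e / z by rewrite divr_ge0 ?ltW.
      by move: (e / z) => y; nra.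
    rewrite ger0_norm; last by rewrite divr_ge0 ?sqr_ge0// !mulr_ge0 ?expR_ge0// ltW.
    rewrite phiE ?gt_eqF// mulrAC ler_wpM2l//; last by rewrite ler_expR lerN2.
    by rewrite divr_ge0 ?sqr_ge0// mulr_ge0// ltW.
have FE : - (\int[leb]_(q in `[0, Q]) (q ^+ 2 * chi q e)) = F Q - Q ^+ 2 * phi Q e.
  have dV q : 0 < q < Q -> is_derive q 1 (fun q => q ^+ 2 * phi q e) (W q + q ^+ 2 * chi q e).
    move=> /andP[q0 _].
    have d2 : is_derive q 1 (fun q : R => q ^+ 2) (2 * q) by exact: is_derive_sqr.
    have := is_deriveM d2 (phi_dq e (lt0r_neq0 q0)).
    by move/is_derive_eq; apply; rewrite /W /GRing.scale /=; ring.
  pose D q := F q - q ^+ 2 * phi q e.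
  have cD : {within `[0, Q], continuous (fun q => - D q)}.
    by move=> q; apply: cvgN; apply: cvgB; [exact: cF|exact: cV].
  have dD q : 0 < q < Q -> is_derive q 1 (fun q => - D q) (q ^+ 2 * chi q e).
    move=> hq; have := is_deriveN (is_deriveB (dF q hq) (dV q hq)).
    by move/is_derive_eq; apply; ring.
  rewrite (integral_increment (ltW Q0) cC cD dD) /D {2}/F integral_point expr0n /= mul0r.
  by ring.
have VQ : Q ^+ 2 * phi Q e <= expR (-2).
  have -> : Q ^+ 2 * phi Q e = e / Q * gauss (e / Q).
    by rewrite /phi /kern hornerX; field; rewrite gt_eqF.
  apply: (@le_trans _ _ (e / Q * 1)).
    apply: ler_wpM2l; first by rewrite divr_ge0 ?ltW.
    by rewrite /gauss -expR0 ler_expR oppr_le0 divr_ge0 ?sqr_ge0.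
  by rewrite mulr1 ler_pdivrMr// mulrC ltW.
have F0 : 0 <= F (e / 2).
  have := mono 0 (e / 2) (lexx 0); rewrite {1}/F integral_point; apply; first by rewrite divr_ge0 ?ltW.
  by rewrite (le_trans _ (ltW eQ))//; lra.
have FQ : F e <= F Q by exact: mono (ltW e0) (ltW eQ) (lexx Q).
by rewrite FE; lra.
Qed.

Definition smear (beta : R -> R) (Q e t : R) : R :=
  \int[leb]_(q in `[0, Q]) ((beta (t + q ^+ 2) - beta t) * chi q e).

Lemma smear_kernel_bound (K L e : R) : 0 < e -> 0 <= L -> 0 <= K ->
  (forall q, 0 < q -> q ^+ 2 * `|chi q e| <= K * (e / (q ^+ 2 + e ^+ 2))) ->
  forall q x, 0 <= q -> `|x| <= L * q ^+ 2 -> `|x * chi q e| <= L * (K / e).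
Proof.
move=> e0 L0 K0 hK q x; rewrite le_eqVlt => /orP[/eqP<-|q0] hx.
  by rewrite /chi kern0 mulr0 normr0 mulr_ge0// divr_ge0// ltW.
rewrite normrM; apply: (@le_trans _ _ (L * (q ^+ 2 * `|chi q e|))).
  by rewrite mulrA ler_wpM2r.
rewrite ler_wpM2l//; apply: (le_trans (hK q q0)); rewrite ler_wpM2l//.
have e2 : 0 < e ^+ 2 by rewrite exprn_gt0.
rewrite ler_pdivrMr; last by rewrite ltr_wpDl// sqr_ge0.
rewrite mulrDr -[X in _ + X]/(e^-1 * (e * e)) mulKf ?gt_eqF// lerDr.
by rewrite mulr_ge0 ?sqr_ge0// invr_ge0 ltW.
Qed.

(* [smear] is the derivative of an average of increments of a primitive of [beta], so the
   mean value theorem relates it to slopes of [beta]. *)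
Lemma slope_smear (beta : R -> R) (L K Q e a b t s : R) : 0 <= L -> 0 < Q -> 0 < e -> 0 <= K ->
  (forall x y, `|beta x - beta y| <= L * `|x - y|) ->
  (forall q, 0 < q -> q ^+ 2 * `|chi q e| <= K * (e / (q ^+ 2 + e ^+ 2))) ->
  a < t -> t < s -> s + Q ^+ 2 < b ->
  exists2 xi, t < xi < s &
   `|(\int[leb]_(q in `[0, Q]) (q ^+ 2 * chi q e)) * ((beta s - beta t) / (s - t))
     - smear beta Q e xi| <= 2 * L * K * Q * e / (s - t).
Proof.
move=> L0 Q0 e0 K0 lipb hK at_ ts sb.
have cb : continuous beta.
  move=> x; apply/cvgrPdist_le => z z0; near=> y.
  apply: (le_trans (lipb _ _)).
  apply: (@le_trans _ _ ((L + 1) * `|x - y|)); first by rewrite ler_wpM2r// lerDl.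
  rewrite mulrC -ler_pdivlMr; last by rewrite ltr_wpDl.
  near: y; apply: cvgr_dist_le; first exact: cvg_id.
  by rewrite divr_gt0// ltr_wpDl.
pose BB z := \int[leb]_(u in `[a, z]) beta u.
have cbw : {within `[a, b], continuous beta} by exact: continuous_subspaceT.
have dB (z : R) : a < z < b -> is_derive z 1 BB (beta z) by move=> hz; exact: primitive_derive hz.
(* A slightly larger interval, so that [Gam] has two-sided derivatives at [t] and at [s]. *)
pose t' := (a + t) / 2; pose s' := (s + (b - Q ^+ 2)) / 2.
have at' : a < t' by rewrite /t'; lra.
have t't : t' < t by rewrite /t'; lra.
have ss' : s < s' by rewrite /s'; lra.
have s'b : s' + Q ^+ 2 < b by rewrite /s'; move: (Q ^+ 2) sb => x sb; lra.
have inab (z q : R) : t' <= z <= s' -> 0 <= q <= Q -> a < z + q ^+ 2 < b.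
  move=> /andP[tz zs] /andP[q0 qQ].
  have : q ^+ 2 <= Q ^+ 2 by rewrite ler_sqr ?nnegrE// ltW.
  by have := sqr_ge0 q; move: (q ^+ 2) (Q ^+ 2) s'b => x y *; apply/andP; split; lra.
have inab0 (z : R) : t' <= z <= s' -> a < z < b.
  by move=> hz; have := @inab z 0 hz; rewrite expr0n/= addr0; apply; rewrite lexx ltW.
have increment (z q : R) : t' <= z <= s' -> 0 <= q <= Q ->
    `|BB (z + q ^+ 2) - BB z - beta z * q ^+ 2| <= L * q ^+ 2 * q ^+ 2.
  move=> hz hq; set h := q ^+ 2; have h0 : 0 <= h by exact: sqr_ge0.
  have /andP[az _] := inab0 z hz; have /andP[_ zb] := inab z q hz hq; rewrite -/h in zb.
  have zzh : z <= z + h by rewrite lerDl.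
  have din (y : R) : z <= y <= z + h -> is_derive y 1 (fun y => BB y - beta z * y) (beta y - beta z).
    move=> /andP[y1 y2]; have dby := dB y.
    have := is_deriveB (dby _) (is_deriveM (is_derive_cst (beta z) y 1) (is_derive_id y 1)).
    rewrite (lt_le_trans az y1) (le_lt_trans y2 zb) => /(_ isT).
    by move/is_derive_eq; apply; rewrite /GRing.scale /=; ring.
  have dL (y : R) : is_derive y 1 (fun y => L * h * y) (L * h).
    by apply: is_derive_eq; rewrite /GRing.scale /= mulr1; ring.
  have := @derive_le_increment _ (fun y => BB y - beta z * y) (fun y => L * h * y)
    (fun y => beta y - beta z) (fun=> L * h) z (z + h) zzh.
  have -> : BB (z + h) - beta z * (z + h) - (BB z - beta z * z) = BB (z + h) - BB z - beta z * h.
    by ring.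
  have -> : L * h * (z + h) - L * h * z = L * h * h by ring.
  apply.
  - exact: is_derive_within_continuous din.
  - by apply: (is_derive_within_continuous (df := fun=> L * h)).
  - by move=> y /andP[y1 y2]; apply: din; rewrite !ltW.
  - move=> y /andP[y1 y2]; apply: (le_trans (lipb _ _)); rewrite ler_wpM2l//.
    by rewrite ger0_norm ?subr_ge0 ?ltW// ltrBlDl.
pose Gam z := \int[leb]_(q in `[0, Q]) ((BB (z + q ^+ 2) - BB z) * chi q e).
have Qle := ltW Q0.
have cchi : {within `[0, Q], continuous (chi ^~ e)} by exact: chi_within.
have cBB (z : R) : t' <= z <= s' -> {within `[0, Q], continuous (fun q => BB (z + q ^+ 2))}.
  move=> hz; pose df q := beta (z + q ^+ 2) * (2 * q).
  apply: (is_derive_within_continuous (df := df)) => q hq.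
  have d2 : is_derive q 1 (fun q : R => z + q ^+ 2) (2 * q).
    have := is_deriveD (is_derive_cst z q 1) (is_derive_sqr q).
    by move/is_derive_eq; apply; rewrite add0r.
  have dBq := dB _ (inab z q hz hq).
  exact: (@is_derive1_comp R BB (fun q : R => z + q ^+ 2) q _ _ dBq d2).
have cX (k : nat) : {within `[0, Q], continuous (fun q : R => q ^+ k)}.
  by apply: continuous_subspaceT => q; exact: exprn_continuous.
have cG (z : R) : t' <= z <= s' ->
    {within `[0, Q], continuous (fun q => (BB (z + q ^+ 2) - BB z) * chi q e)}.
  move=> hz q; apply: (cvgM _ (cchi q)); apply: cvgB; [exact: cBB|exact: cvg_cst].
have dG (z : R) : t' < z < s' -> is_derive z 1 Gam (smear beta Q e z).
  move=> hz; apply: (differentiation_integral (f := fun z q => (BB (z + q ^+ 2) - BB z) * chi q e)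
    (f' := fun z q => (beta (z + q ^+ 2) - beta z) * chi q e) (K := L * (K / e)) Qle hz) => [y hy|y q hy hq|y q hy hq].
  - by apply: cG; have /andP[y1 y2] := hy; rewrite !ltW.
  - have hy' : t' <= y <= s' by have /andP[y1 y2] := hy; rewrite !ltW.
    have dsh : is_derive y 1 (fun y : R => y + q ^+ 2) 1.
      by apply: is_derive_eq; rewrite addr0.
    have dBq := dB _ (inab y q hy' hq).
    have d1 := @is_derive1_comp R BB (fun y : R => y + q ^+ 2) y _ _ dBq dsh.
    have d2 := dB y (inab0 y hy').
    have := is_deriveM (is_deriveB d1 d2) (is_derive_cst (chi q e) y 1).
    move/is_derive_eq; apply; rewrite /GRing.scale /=; ring.
  - have /andP[q0 qQ] := hq.
    apply: (smear_kernel_bound e0 L0 K0 hK) => //; apply: (le_trans (lipb _ _)).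
    by rewrite [y + _]addrC addrK ger0_norm ?sqr_ge0.
have dG' (z : R) : t <= z <= s -> is_derive z 1 Gam (smear beta Q e z).
  by move=> /andP[z1 z2]; apply: dG; rewrite (lt_le_trans t't)//= (le_lt_trans z2).
have dG'' (z : R) : z \in `]t, s[ -> is_derive z 1 Gam (smear beta Q e z).
  by rewrite in_itv/= => /andP[z1 z2]; apply: dG'; rewrite !ltW.
(* The derivative of [Gam] is [smear], so its slope over [t, s] is a value of [smear]; it remains to
   see that [Gam] is [m2 * beta] up to O(e). *)
have [xi xin E] := MVT ts dG'' (is_derive_within_continuous dG').
exists xi; first by move: xin; rewrite in_itv.
set m2 := \int[leb]_(q in `[0, Q]) (q ^+ 2 * chi q e).
have Gapp (z : R) : t <= z <= s -> `|Gam z - m2 * beta z| <= L * K * Q * e.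
  move=> /andP[z1 z2]; have hz : t' <= z <= s'.
    by rewrite (le_trans (ltW t't))//= (le_trans z2)// ltW.
  have cm : {within `[0, Q], continuous (fun q => q ^+ 2 * chi q e * beta z)}.
    by move=> q; apply: cvgM (cvg_cst _); apply: cvgM; [exact: cX|exact: cchi].
  have int (f : R -> R) : {within `[0, Q], continuous f} -> leb.-integrable `[0, Q] (EFin \o f).
    by move=> cf; apply: continuous_compact_integrable => //; exact: segment_compact.
  have cm0 : {within `[0, Q], continuous (fun q => q ^+ 2 * chi q e)}.
    by move=> q; apply: cvgM; [exact: cX|exact: cchi].
  rewrite /m2 -RintegralZr//; last exact: int.
  rewrite /Gam -RintegralB//; [|by apply: int; exact: cG|exact: int].
  have -> : L * K * Q * e = L * K * e * Q - L * K * e * 0 by ring.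
  apply: (integral_le_increment (G' := fun=> L * K * e)) => //.
  - by move=> q; apply: cvgB; [exact: cG|exact: cm].
  - by move=> q; apply: cvgM; [exact: cvg_cst|exact: (cX 1%N)].
  - move=> q _; have := is_deriveM (is_derive_cst (L * K * e) q 1) (is_derive_id q 1).
    by move/is_derive_eq; apply; rewrite /GRing.scale /=; ring.
  - move=> q /andP[q0 qQ].
    have -> : (BB (z + q ^+ 2) - BB z) * chi q e - q ^+ 2 * chi q e * beta z
        = (BB (z + q ^+ 2) - BB z - beta z * q ^+ 2) * chi q e by ring.
    rewrite normrM.
    (* The second-order remainder of the primitive is L q^4; one factor q^2 is spent on [chi], the
       other on the denominator q^2 + e^2, and a factor e survives. *)
    apply: (@le_trans _ _ (L * q ^+ 2 * (q ^+ 2 * `|chi q e|))).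
      by rewrite mulrA ler_wpM2r// increment// !ltW.
    apply: (@le_trans _ _ (L * q ^+ 2 * (K * (e / (q ^+ 2 + e ^+ 2))))).
      by rewrite ler_wpM2l ?hK// mulr_ge0// sqr_ge0.
    have den : 0 < q ^+ 2 + e ^+ 2 by rewrite addr_gt0 ?exprn_gt0.
    have -> : L * q ^+ 2 * (K * (e / (q ^+ 2 + e ^+ 2)))
        = L * K * e * (q ^+ 2 / (q ^+ 2 + e ^+ 2)) by ring.
    rewrite -[leRHS]mulr1; apply: ler_wpM2l; first by rewrite !mulr_ge0// ltW.
    by rewrite ler_pdivrMr// mul1r lerDl sqr_ge0.
have st : 0 < s - t by rewrite subr_gt0.
have G1 : `|Gam t - m2 * beta t| <= L * K * Q * e by apply: Gapp; rewrite lexx ltW.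
have G2 : `|Gam s - m2 * beta s| <= L * K * Q * e by apply: Gapp; rewrite lexx ltW.
rewrite ler_pdivlMr// -[X in _ * X](gtr0_norm st) -normrM mulrBl -E mulrA divfK ?gt_eqF//.
clear Gapp E; move: (m2) (Gam t) (Gam s) (beta t) (beta s) G1 G2 => m g1 g2 b1 b2 G1 G2.
have -> : m * (b2 - b1) - (g2 - g1) = (g1 - m * b1) - (g2 - m * b2) by ring.
apply: (le_trans (ler_normB _ _)).
have -> : 2 * L * K * Q * e = L * K * Q * e + L * K * Q * e by ring.
by apply: lerD; [exact: G1|exact: G2].
Unshelve. all: by end_near.
Qed.

(** The mass times a slope is within O(e) of a value of [smear]. With the two slopes fixed, e is
    sent to 0; the mass is at least exp(-2), whence the factor exp(2). *)
Lemma slopes_close (beta : R -> R) (L a b g : R) : 0 <= L ->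
  (forall x y, `|beta x - beta y| <= L * `|x - y|) ->
  (exists Q e0 : R, [/\ 0 < Q, 0 < e0 &
     forall e x y, 0 < e -> e < e0 -> a <= x <= b -> a <= y <= b ->
       `|smear beta Q e x - smear beta Q e y| <= g]) ->
  forall t s u v, a <= t -> t < s -> s <= b -> a <= u -> u < v -> v <= b ->
    `|(beta s - beta t) / (s - t) - (beta v - beta u) / (v - u)| <= g * expR 2.
Proof.
move=> L0 lipb [Q [e1 [Q0 e10 osc]]] t s u v a_t ts sb au uv vb.
have [K K0 hK] := chi_bound.
have [e2 e20 mass] := chi_mass Q0.
set A := _ / _; set A' := _ / _.
have ex2 : 0 < expR 2 :> R by exact: expR_gt0.
have st : 0 < s - t by rewrite subr_gt0.
have vu : 0 < v - u by rewrite subr_gt0.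
rewrite -ler_pdivrMr// -expRN; apply/ler_addgt0Pr => z z0.
pose C := 2 * L * K * Q * ((s - t)^-1 + (v - u)^-1).
have C0 : 0 <= C by rewrite !mulr_ge0 ?addr_ge0 ?invr_ge0// ltW.
pose e := Num.min (e1 / 2) (Num.min (e2 / 2) (z / (C + 1))).
have e0 : 0 < e by rewrite !lt_min !divr_gt0// ltr_wpDl.
have ee1 : e < e1 by apply: (@le_lt_trans _ _ (e1 / 2)); [rewrite ge_min lexx|lra].
have ee2 : e < e2 by apply: (@le_lt_trans _ _ (e2 / 2)); [rewrite !ge_min lexx orbT|lra].
have Ce : C * e <= z.
  apply: (@le_trans _ _ ((C + 1) * e)); first by rewrite ler_pM2r// lerDl.
  by rewrite mulrC -ler_pdivlMr ?ltr_wpDl// !ge_min lexx !orbT.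
have at1 : Num.min t u - 1 < t by rewrite ltrBlDr (@le_lt_trans _ _ t) ?ltrDl// ge_min lexx.
have au1 : Num.min t u - 1 < u by rewrite ltrBlDr (@le_lt_trans _ _ u) ?ltrDl// ge_min lexx orbT.
pose top := Num.max s v + Q ^+ 2 + 1.
have st1 : s + Q ^+ 2 < top by rewrite /top ltr_pwDr// lerD2r le_max lexx.
have vt1 : v + Q ^+ 2 < top by rewrite /top ltr_pwDr// lerD2r le_max lexx orbT.
have hKe q : 0 < q -> q ^+ 2 * `|chi q e| <= K * (e / (q ^+ 2 + e ^+ 2)).
  by move=> q0; apply: hK => //; exact: ltW.
have [x xin] := slope_smear L0 Q0 e0 K0 lipb hKe at1 ts st1.
have [y yin] := slope_smear L0 Q0 e0 K0 lipb hKe au1 uv vt1.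
have := mass e e0 ee2.
set m := \int[leb]_(q in `[0, Q]) _; rewrite -/A -/A' => m1 hy hx.
have hxy : `|smear beta Q e x - smear beta Q e y| <= g.
  apply: osc => //; [have /andP[x1 x2] := xin|have /andP[x1 x2] := yin]; apply/andP; split.
  - exact: le_trans a_t (ltW x1).
  - exact: le_trans (ltW x2) sb.
  - exact: le_trans au (ltW x1).
  - exact: le_trans (ltW x2) vb.
have m0 : 0 <= - m by apply: le_trans m1; exact: expR_ge0.
apply: (@le_trans _ _ (`|A - A'| * - m)); first by rewrite ler_wpM2l.
rewrite -[X in _ * X](ger0_norm m0) normrN mulrC -normrM.
have -> : m * (A - A') = (m * A - smear beta Q e x) - (m * A' - smear beta Q e y)
    + (smear beta Q e x - smear beta Q e y) by ring.
rewrite addrC [leRHS]addrC; apply: (le_trans (ler_normD _ _)); rewrite [leRHS]addrC.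
apply: lerD => //; apply: (le_trans (ler_normB _ _)); apply: le_trans Ce.
have -> : C * e = 2 * L * K * Q * e / (s - t) + 2 * L * K * Q * e / (v - u).
  by rewrite /C; ring.
exact: lerD.
Qed.

End slopes.

(** * Heat potentials with pole on the boundary *)

Section kernel_constant.
Variable R : realType.
Local Notation leb := (@lebesgue_measure R).
Implicit Types (q u v e : R) (p : {poly R}) (n m : nat).

Lemma kern_le n p : exists2 K, 0 <= K & forall q u, 0 < q -> `|kern n p q u| <= K * (q ^+ n)^-1.
Proof.
have [K K0 hK] := kern_bound n p 0; exists K => // q u q0.
by have := hK q u q0; rewrite expr0 mulr1.
Qed.

Lemma is_derive_linear (k x : R) : is_derive x 1 (fun z : R => k * z) k.
Proof.
have := is_deriveM (is_derive_cst k x 1) (is_derive_id x 1).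
by move/is_derive_eq; apply; rewrite /GRing.scale /=; ring.
Qed.

Lemma kern_lip n p : exists2 K, 0 <= K & forall q u v, 0 < q ->
  `|kern n p q u - kern n p q v| <= K * (q ^+ n.+1)^-1 * `|u - v|.
Proof.
have [K K0 hK] := kern_le n.+1 (pdu p); exists K => // q.
suff h u v : 0 < q -> v <= u ->
    `|kern n p q u - kern n p q v| <= K * (q ^+ n.+1)^-1 * (u - v).
  move=> u v q0; have [vu|uv] := leP v u; first by rewrite [`|u - v|]ger0_norm ?subr_ge0// h.
  by rewrite distrC [X in _ * X]distrC [X in _ * X]ger0_norm ?subr_ge0 ?h// ltW.
move=> q0 vu; have qn0 : q != 0 by rewrite gt_eqF.
rewrite mulrBr; set k := K * _.
have dG := is_derive_linear k.
apply: (@derive_le_increment _ (kern n p q) (fun z => k * z) (kern n.+1 (pdu p) q) (fun=> k)) => //.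
- by apply: (is_derive_within_continuous (df := kern n.+1 (pdu p) q)) => z _; exact: kern_du.
- by apply: (is_derive_within_continuous (df := fun=> k)).
- by move=> z _; exact: kern_du.
- by move=> z _; exact: hK.
Qed.

Record kernel_constant (K : R) : Prop := KernelConstant {
  kc_ge0 : 0 <= K;
  kc_chi : forall q u, 0 < q -> `|chi q u| <= K * (q ^+ 3 * (1 + (u / q) ^+ 2) ^+ 2)^-1;
  kc_chi_mass : forall q e, 0 < q -> 0 <= e -> q ^+ 2 * `|chi q e| <= K * (e / (q ^+ 2 + e ^+ 2));
  kc_phi_small : forall q u, 0 < q -> u != 0 -> `|phi q u| <= K * (q ^+ 2 / u ^+ 4);
  kc_psi_small : forall q u, 0 < q -> u != 0 -> `|psi q u| <= K * (q ^+ 4 / u ^+ 8);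
  kc_psi1_small : forall q u, 0 < q -> u != 0 -> `|psi1 q u| <= K * (q ^+ 5 / u ^+ 10);
  kc_phi_lip : forall q u v, 0 < q -> `|phi q u - phi q v| <= K * (q ^+ 3)^-1 * `|u - v|;
  kc_chi_lip : forall q u v, 0 < q -> `|chi q u - chi q v| <= K * (q ^+ 4)^-1 * `|u - v|;
  kc_psi_lip : forall q u v, 0 < q -> `|psi q u - psi q v| <= K * (q ^+ 5)^-1 * `|u - v|;
  kc_psi_le : forall q u, 0 < q -> `|psi q u| <= K * (q ^+ 4)^-1;
  kc_chi_le : forall q u, 0 < q -> `|chi q u| <= K * (q ^+ 3)^-1;
  kc_psi2_le : forall q u, 0 < q -> `|psi2 q u| <= K * (q ^+ 6)^-1 }.

Lemma kernel_constant_exists : exists K, kernel_constant K.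
Proof.
have [K1 K10 h1] := kern_bound 3 (poly3 R) 2.
have [K2 K20 h2] := chi_bound R.
have [K3 K30 h3] := kern_small 2 ('X : {poly R}).
have [K4 K40 h4] := kern_small 4 (2^-1 *: poly3 R).
have [K5 K50 h5] := kern_small 5 (pdu (2^-1 *: poly3 R)).
have [K6 K60 h6] := kern_lip 2 ('X : {poly R}).
have [K7 K70 h7] := kern_lip 3 (poly3 R).
have [K8 K80 h8] := kern_lip 4 (2^-1 *: poly3 R).
have [K9 K90 h9] := kern_le 4 (2^-1 *: poly3 R).
have [Ka Ka0 ha] := kern_le 3 (poly3 R).
have [Kb Kb0 hb] := kern_le 6 (pdu (pdu (2^-1 *: poly3 R))).
pose K := K1 + (K2 + (K3 + (K4 + (K5 + (K6 + (K7 + (K8 + (K9 + (Ka + Kb))))))))).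
have mono k c x : k <= K -> 0 <= c -> x <= k * c -> x <= K * c.
  by move=> kK c0 /le_trans; apply; rewrite ler_wpM2r.
have [l1 l2 l3 l4 l5] : [/\ K1 <= K, K2 <= K, K3 <= K, K4 <= K & K5 <= K].
  by rewrite /K; split; lra.
have l6 : K6 <= K by rewrite /K; lra.
have [l7 l8 l9 la lb] : [/\ K7 <= K, K8 <= K, K9 <= K, Ka <= K & Kb <= K].
  by rewrite /K; split; lra.
have iv (x : R) : 0 <= x -> 0 <= x^-1 by rewrite invr_ge0.
exists K; split.
- exact: le_trans K10 l1.
- move=> q u q0; apply: (mono _ _ _ l1); last exact: h1.
  by rewrite iv// mulr_ge0 ?exprn_ge0 ?addr_ge0 ?sqr_ge0// ltW.
- move=> q e q0 e0; apply: (mono _ _ _ l2); last exact: h2.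
  by rewrite divr_ge0// addr_ge0 ?sqr_ge0.
- move=> q u q0 u0; apply: (mono _ _ _ l3); last exact: h3.
  by rewrite divr_ge0 ?exprn_even_ge0// exprn_ge0 ?ltW.
- move=> q u q0 u0; apply: (mono _ _ _ l4); last exact: h4.
  by rewrite divr_ge0 ?exprn_even_ge0// exprn_ge0 ?ltW.
- move=> q u q0 u0; apply: (mono _ _ _ l5); last exact: h5.
  by apply: divr_ge0; [rewrite exprn_ge0 ?ltW|rewrite exprn_even_ge0].
- move=> q u v q0; rewrite -mulrA; apply: (mono _ _ _ l6); last by rewrite mulrA; exact: h6.
  by rewrite mulr_ge0// iv// exprn_ge0 ?ltW.
- move=> q u v q0; rewrite -mulrA; apply: (mono _ _ _ l7); last by rewrite mulrA; exact: h7.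
  by rewrite mulr_ge0// iv// exprn_ge0 ?ltW.
- move=> q u v q0; rewrite -mulrA; apply: (mono _ _ _ l8); last by rewrite mulrA; exact: h8.
  by rewrite mulr_ge0// iv// exprn_ge0 ?ltW.
- move=> q u q0; apply: (mono _ _ _ l9); last exact: h9.
  by rewrite iv// exprn_ge0 ?ltW.
- move=> q u q0; apply: (mono _ _ _ la); last exact: ha.
  by rewrite iv// exprn_ge0 ?ltW.
- move=> q u q0; apply: (mono _ _ _ lb); last exact: hb.
  by rewrite iv// exprn_ge0 ?ltW.
Qed.

Lemma Rintegral_bound (f : R -> R) (a b k : R) : a <= b -> {within `[a, b], continuous f} ->
  (forall x, a < x < b -> `|f x| <= k) -> `|\int[leb]_(x in `[a, b]) f x| <= k * (b - a).
Proof.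
move=> ab cf hk; rewrite mulrBr.
have dG := is_derive_linear k.
apply: (integral_le_increment (G := fun z => k * z) (G' := fun=> k)) => //.
by apply: (is_derive_within_continuous (df := fun=> k)).
Qed.

End kernel_constant.

(** The parts of the q-derivative of the potential that are bounded uniformly in e: the flux through
    x2, the mismatch of the sources, and the variation of the kernel near the free boundary. *)
Definition pole_constant (R : realType) (K M a : R) : R :=
  M * K * (a ^- 10 + a ^- 8) + M * (1 + M ^+ 2) * K * pi + M ^+ 3 * K.

Lemma pole_constant_ge0 (R : realType) (K M a : R) : 0 <= K -> 0 <= M -> 0 < a ->
  0 <= pole_constant K M a.
Proof.
move=> K0 M0 a0.
have ia (n : nat) : 0 <= a ^- n by rewrite invr_ge0 exprn_ge0 ?ltW.
have M2 : 0 <= 1 + M ^+ 2 by rewrite addr_ge0 ?sqr_ge0.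
have M3 : 0 <= M ^+ 3 by rewrite exprn_ge0.
have MK0 : 0 <= M * K by rewrite mulr_ge0.
have ia2 : 0 <= a ^- 10 + a ^- 8 by rewrite addr_ge0.
by apply: addr_ge0; [apply: addr_ge0|]; rewrite ?mulr_ge0 ?pi_ge0.
Qed.

(** * Green's identity and its error terms *)

Section pole.
Variable R : realType.
Local Notation leb := (@lebesgue_measure R).
Implicit Types (q e x : R).
Variables (K : R) (hK : kernel_constant K).
Variables (x1 x2 M a : R) (x12 : x1 < x2) (a0 : 0 < a) (M0 : 0 <= M).
Variables (S Sp : R -> R).
Hypothesis dS : forall x, x1 <= x <= x2 -> is_derive x 1 S (Sp x).
Hypothesis cSp : {within `[x1, x2], continuous Sp}.
Hypothesis SpM : forall x, x1 <= x <= x2 -> 0 <= Sp x <= M.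

(* In the coordinate [S x - S b0], the function [Y q x] (time being [q ^ 2])
   solves Y_t + Y_yy / 2 = - k above the moving boundary [bq]; here [Yq], [Yy] are its
   derivatives in q and y. *)
Record pole (Q1 b0 : R) (bq H : R -> R) (Y Yy Yq k : R -> R -> R) : Prop := Pole {
  pl_Q1 : 0 < Q1 <= 1;
  pl_b0 : x1 < b0 < x2;
  pl_a : a <= S x2 - S b0;
  pl_bq : forall q, 0 <= q <= Q1 -> x1 < bq q < x2;
  pl_bqL : forall q, 0 <= q <= Q1 -> `|S (bq q) - S b0| <= M * q ^+ 2;
  pl_cbq : {within `[0, Q1], continuous (fun q => S (bq q))};
  pl_cH : {within `[x1, x2], continuous H};
  pl_HM : forall x, x1 <= x <= x2 -> `|H x| <= M;
  pl_cY : forall q, 0 < q < Q1 -> {within `[x1, x2], continuous (Y q)};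
  pl_cYy : forall q, 0 < q < Q1 -> {within `[x1, x2], continuous (Yy q)};
  pl_cYq : forall q, 0 < q < Q1 -> {within `[x1, x2], continuous (Yq q)};
  pl_YM : forall q x, 0 < q < Q1 -> x1 <= x <= x2 ->
    [/\ `|Y q x| <= M, `|Yy q x| <= M & `|Yq q x| <= M];
  pl_dYq : forall q x, 0 < q < Q1 -> x1 <= x <= x2 -> is_derive q 1 (Y ^~ x) (Yq q x);
  pl_below : forall q x, 0 < q < Q1 -> x1 <= x <= bq q ->
    [/\ Y q x = 0, Yy q x = 0 & Yq q x = 0];
  pl_dY : forall q x, 0 < q < Q1 -> bq q < x < x2 -> is_derive x 1 (Y q) (Yy q x * Sp x);
  pl_dYy : forall q x, 0 < q < Q1 -> bq q < x < x2 ->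
    is_derive x 1 (Yy q) (- (Yq q x / q + 2 * k q x) * Sp x);
  pl_ck : forall q, 0 < q < Q1 -> {within `[bq q, x2], continuous (k q)};
  pl_kH : forall q x, 0 < q < Q1 -> bq q <= x <= x2 ->
    `|k q x - H x| <= M * (q ^+ 2 + (S x - S b0) ^+ 2) }.

Variables (Q1 b0 : R) (bq H : R -> R) (Y Yy Yq k : R -> R -> R).
Hypothesis hP : pole Q1 b0 bq H Y Yy Yq k.

Definition arg e x := S x - S b0 + e.
(** The first integral alone has a derivative containing the integral of k chi above the boundary,
    which for q beyond e is typically of size q^-2. The second compensates it with [H] in place of
    [k]; its lower limit is the fixed [b0], so the motion of the boundary survives as the only
    difference of domains. *)
Definition Epole e q :=
  \int[leb]_(x in `[x1, x2]) (Y q x * psi q (arg e x) * Sp x)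
  + \int[leb]_(x in `[b0, x2]) (H x * phi q (arg e x) * Sp x).
(** The flux in Green's identity for [Y] and the kernel. *)
Definition Wpole e q x := Y q x * psi1 q (arg e x) - Yy q x * psi q (arg e x).
Definition Ppole e q z := \int[leb]_(x in `[x1, z]) (H x * chi q (arg e x) * Sp x).

Lemma darg e x : x1 <= x <= x2 -> is_derive x 1 (arg e) (Sp x).
Proof.
move=> hx; have dSx := dS hx; rewrite /arg.
have := is_deriveD (is_deriveB dSx (is_derive_cst (S b0) x 1)) (is_derive_cst e x 1).
by move/is_derive_eq; apply; rewrite subr0 addr0.
Qed.

Lemma dkern n p e q x : 0 < q -> x1 <= x <= x2 ->
  is_derive x 1 (fun x => kern n p q (arg e x)) (kern n.+1 (pdu p) q (arg e x) * Sp x).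
Proof.
move=> q0 hx; have d1 := darg e hx.
by apply: (is_derive1_comp (kern_du n p (arg e x) (lt0r_neq0 q0)) d1).
Qed.

Lemma ckern n p e q : 0 < q -> {within `[x1, x2], continuous (fun x => kern n p q (arg e x))}.
Proof.
move=> q0.
apply: (is_derive_within_continuous (df := fun x => kern n.+1 (pdu p) q (arg e x) * Sp x)) => x.
exact: dkern.
Qed.

Lemma S_mono x y : x1 <= x -> x <= y -> y <= x2 -> S x <= S y.
Proof.
move=> xx xy yx; rewrite -subr_ge0; apply: (le_trans (normr_ge0 (cst 0 y - cst 0 x : R))).
have sub z : x <= z <= y -> x1 <= z <= x2.
  by move=> /andP[z1 z2]; rewrite (le_trans xx)//= (le_trans z2).
apply: (derive_le_increment (F' := cst 0) (G' := Sp) xy).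
- by move=> z; exact: cst_continuous.
- by apply: (is_derive_within_continuous (df := Sp)) => z hz; apply: dS; exact: sub.
- by move=> z /andP[z1 z2]; apply: dS; apply: sub; rewrite !ltW.
- by move=> z /andP[z1 z2]; rewrite normr0; have /andP[] : 0 <= Sp z <= M by apply/SpM/sub; rewrite !ltW.
Qed.

(** Since [Y] vanishes below the boundary, its integral runs over a fixed interval and is
    differentiated under the sign. [Y] and the kernel solve adjoint heat equations, and [Y], [Yy]
    vanish at [bq q]: of the fluxes only the one at x2 remains. *)
Lemma Epole_derive e q : 0 < q < Q1 ->
  is_derive q 1 (Epole e) (q * Wpole e q x2
    + \int[leb]_(x in `[bq q, x2]) ((H x - k q x) * chi q (arg e x) * Sp x)
    + (Ppole e q (bq q) - Ppole e q b0)).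
Proof.
move=> /andP[q0 qQ].
have /andP[x1b bx2] := pl_b0 hP.
have hq : 0 < q < Q1 by rewrite q0.
have q01 : 0 <= q <= Q1 by rewrite !ltW.
have /andP[x1q qx2] := pl_bq hP q01.
have K0 := kc_ge0 hK.
pose l := q / 2.
have l0 : 0 < l by rewrite /l divr_gt0.
have lq : l < q < Q1 by rewrite qQ /l; apply/andP; split => //; lra.
have inQ z : l < z < Q1 -> 0 < z < Q1 by move=> /andP[z1 ->]; rewrite (lt_trans l0).
have iv (n : nat) z : l < z < Q1 -> (z ^+ n)^-1 <= (l ^+ n)^-1.
  move=> /andP[z1 _]; rewrite lef_pV2 ?posrE ?exprn_gt0 ?(lt_trans l0 z1)//.
  by apply: lerXn2r; rewrite ?nnegrE ?ltW// (lt_trans l0).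
pose f' z x := (Yq z x * psi z (arg e x) + Y z x * (z * psi2 z (arg e x))) * Sp x.
have d1 : is_derive q 1 (fun q => \int[leb]_(x in `[x1, x2]) (Y q x * psi q (arg e x) * Sp x))
    (\int[leb]_(x in `[x1, x2]) f' q x).
  apply: (differentiation_integral (f := fun q x => Y q x * psi q (arg e x) * Sp x) (f' := f')
     (K := (M * (K * (l ^+ 4)^-1) + M * (1 * (K * (l ^+ 6)^-1))) * M) (ltW x12) lq).
  - move=> z hz x; have hz' := inQ z hz; have /andP[z0 _] := hz'.
    by apply: cvgM (@cSp x); apply: cvgM; [exact: (pl_cY hP)|exact: ckern].
  - move=> z x hz hx; have hz' := inQ z hz; have /andP[z0 _] := hz'.
    have := is_deriveM (is_deriveM (pl_dYq hP hz' hx) (psi_dq (arg e x) (lt0r_neq0 z0)))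
      (is_derive_cst (Sp x) z 1).
    by move/is_derive_eq; apply; rewrite /f' /GRing.scale /=; ring.
  - move=> z x hz hx; have hz' := inQ z hz; have /andP[z0 zQ] := hz'.
    have [Y1 Y2 Y3] := pl_YM hP hz' hx.
    have /andP[Sp0 SpMx] := SpM hx.
    have z1 : z <= 1 by have /andP[_] := pl_Q1 hP; apply: le_trans; exact: ltW.
    rewrite normrM [`|Sp x|]ger0_norm//; apply: ler_pM => //.
    apply: (le_trans (ler_normD _ _)); apply: lerD; rewrite normrM; apply: ler_pM => //.
      by apply: (le_trans (kc_psi_le hK _ z0)); rewrite ler_wpM2l// iv.
    rewrite normrM; apply: ler_pM => //; first by rewrite gtr0_norm.
    by apply: (le_trans (kc_psi2_le hK _ z0)); rewrite ler_wpM2l// iv.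
have sub : `[b0, x2] `<=` `[x1, x2]%classic.
  by move=> z /=; rewrite !in_itv/= => /andP[z1 ->]; rewrite (le_trans (ltW x1b)).
have d2 : is_derive q 1 (fun q => \int[leb]_(x in `[b0, x2]) (H x * phi q (arg e x) * Sp x))
    (\int[leb]_(x in `[b0, x2]) (H x * chi q (arg e x) * Sp x)).
  apply: (differentiation_integral (f := fun q x => H x * phi q (arg e x) * Sp x)
     (f' := fun q x => H x * chi q (arg e x) * Sp x)
     (K := M * (K * (l ^+ 3)^-1) * M) (ltW bx2) lq).
  - move=> z hz; have /andP[z0 _] := inQ z hz; apply: continuous_subspaceW sub _ => x.
    by apply: cvgM (@cSp x); apply: cvgM; [exact: (pl_cH hP)|exact: ckern].
  - move=> z x hz hx; have /andP[z0 _] := inQ z hz.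
    have := is_deriveM (is_deriveM (is_derive_cst (H x) z 1) (phi_dq (arg e x) (lt0r_neq0 z0)))
      (is_derive_cst (Sp x) z 1).
    by move/is_derive_eq; apply; rewrite /GRing.scale /=; ring.
  - move=> z x hz hx; have /andP[z0 zQ] := inQ z hz.
    have hx' : x1 <= x <= x2 by have := @sub x; rewrite /= !in_itv; exact.
    have /andP[Sp0 SpMx] := SpM hx'.
    rewrite normrM [`|Sp x|]ger0_norm//; apply: ler_pM => //; rewrite normrM; apply: ler_pM => //.
      exact: (pl_HM hP).
    by apply: (le_trans (kc_chi_le hK _ z0)); rewrite ler_wpM2l// iv.
have := is_deriveD d1 d2; move/is_derive_eq; apply.
have cHchi : {within `[x1, x2], continuous (fun x => H x * chi q (arg e x) * Sp x)}.
  by move=> x; apply: cvgM (@cSp x); apply: cvgM; [exact: (pl_cH hP)|exact: ckern].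
have cf' : {within `[x1, x2], continuous (f' q)}.
  move=> x; apply: cvgM (@cSp x); apply: cvgD; apply: cvgM.
  - exact: (pl_cYq hP).
  - exact: ckern.
  - exact: (pl_cY hP).
  - by apply: cvgM; [exact: cvg_cst|exact: ckern].
have weak (y : R) (f : R -> R) : x1 <= y -> {within `[x1, x2], continuous f} -> {within `[y, x2], continuous f}.
  move=> xy; apply: continuous_subspaceW => z /=; rewrite !in_itv/= => /andP[z1 ->].
  by rewrite (le_trans xy).
have weak' (y : R) (f : R -> R) : y <= x2 -> {within `[x1, x2], continuous f} -> {within `[x1, y], continuous f}.
  move=> xy; apply: continuous_subspaceW => z /=; rewrite !in_itv/= => /andP[-> z1].
  exact: le_trans xy.
have C1 (y : R) : x1 <= y -> y <= x2 ->
    \int[leb]_(x in `[y, x2]) (H x * chi q (arg e x) * Sp x) = Ppole e q x2 - Ppole e q y.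
  by move=> xy yx; rewrite /Ppole (integral_chasles xy yx cHchi) addrC addKr.
have C3 := integral_chasles (ltW x1q) (ltW qx2) cf'.
have C4 : \int[leb]_(x in `[x1, bq q]) f' q x = 0.
  rewrite -[RHS](subrr (0 : R)); have cc : {within `[x1, bq q], continuous (cst (0 : R))}.
    by move=> z; exact: cst_continuous.
  apply: (integral_increment (ltW x1q) (weak' _ _ (ltW qx2) cf') cc) => x /andP[z1 z2].
  rewrite /f'; have [|-> _ ->] := pl_below hP (x := x) hq; first by rewrite !ltW.
  by rewrite !mul0r addr0 mul0r; exact: is_derive_cst.
pose g x := k q x * chi q (arg e x) * Sp x.
have cg : {within `[bq q, x2], continuous g}.
  have c1 := weak _ _ (ltW x1q) cSp.
  have c2 := weak _ _ (ltW x1q) (@ckern 3 (poly3 R) e q q0).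
  by move=> x; apply: cvgM (c1 x); apply: cvgM (c2 x); exact: (pl_ck hP).
have cW : {within `[bq q, x2], continuous (Wpole e q)}.
  apply: weak (ltW x1q) _ => x; apply: cvgB; apply: cvgM.
  - exact: (pl_cY hP).
  - exact: ckern.
  - exact: (pl_cYy hP).
  - exact: ckern.
(* A primitive of the integrand above the boundary: in q times the derivative of the flux, the
   second derivatives are traded for q-derivatives and the source. *)
pose F x := q * Wpole e q x - \int[leb]_(z in `[bq q, x]) g z.
have C5 : \int[leb]_(x in `[bq q, x2]) f' q x = q * Wpole e q x2 - \int[leb]_(x in `[bq q, x2]) g x.
  have cF : {within `[bq q, x2], continuous F}.
    move=> x; apply: cvgB; first by apply: cvgM; [exact: cvg_cst|exact: cW].
    exact: (primitive_continuous (ltW qx2) cg).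
  have dF x : bq q < x < x2 -> is_derive x 1 F (f' q x).
    move=> hx; have dp := primitive_derive cg hx.
    have hx' : x1 <= x <= x2.
      by have /andP[h1 h2] := hx; rewrite (ltW h2) andbT; exact: le_trans (ltW x1q) (ltW h1).
    have e1 := @dkern 5 (pdu (2^-1 *: poly3 R)) e q x q0 hx'.
    have e2 := @dkern 4 (2^-1 *: poly3 R) e q x q0 hx'.
    have dW := is_deriveB (is_deriveM (pl_dY hP hq hx) e1) (is_deriveM (pl_dYy hP hq hx) e2).
    have := is_deriveB (is_deriveM (is_derive_cst q x 1) dW) dp.
    move/is_derive_eq; apply; rewrite /f' /g /GRing.scale /= chi_psi /psi /psi1 /psi2.
    by field; rewrite gt_eqF.
  rewrite (integral_increment (ltW qx2) (weak _ _ (ltW x1q) cf') cF dF) /F integral_point.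
  have [|Y0 Y1 _] := pl_below hP (x := bq q) hq; first by rewrite lexx ltW.
  by rewrite {2}/Wpole Y0 Y1 !mul0r subrr mulr0 subr0 subr0.
have C6 : \int[leb]_(x in `[bq q, x2]) ((H x - k q x) * chi q (arg e x) * Sp x)
    = \int[leb]_(x in `[bq q, x2]) (H x * chi q (arg e x) * Sp x) - \int[leb]_(x in `[bq q, x2]) g x.
  rewrite -RintegralB//.
  - by apply: eq_Rintegral => x _; rewrite /g; ring.
  - apply: continuous_compact_integrable; first exact: segment_compact.
    exact: weak (ltW x1q) cHchi.
  - by apply: continuous_compact_integrable; first exact: segment_compact.
rewrite C3 C4 C5 C6 (C1 (bq q)) ?(C1 b0) ?ltW// add0r.
by move: (Ppole _ _ _) (Ppole _ _ _) (Ppole _ _ _) (Wpole _ _ _) (Rintegral _ _ _) => *; ring.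
Qed.

Definition Epole' e q := q * Wpole e q x2
    + \int[leb]_(x in `[bq q, x2]) ((H x - k q x) * chi q (arg e x) * Sp x)
    + (Ppole e q (bq q) - Ppole e q b0).

(** The mismatch is quadratic in the parabolic distance, which cancels all but one power of 1 +
    (u/q)^2 in the bound on [chi]. What is left is the derivative of an arctangent in x, so the
    integral is at most a multiple of pi for every q and e. *)
Lemma source_bound e q : 0 < q < Q1 -> 0 <= e ->
  `|\int[leb]_(x in `[bq q, x2]) ((H x - k q x) * chi q (arg e x) * Sp x)|
    <= M * (1 + M ^+ 2) * K * pi.
Proof.
move=> hq e0; have /andP[q0 qQ] := hq.
have q01 : 0 <= q <= Q1 by rewrite !ltW.
have /andP[x1q qx2] := pl_bq hP q01.
have q1 : q <= 1 by have /andP[_] := pl_Q1 hP; apply: le_trans; exact: ltW.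
have qn0 : q != 0 by rewrite gt_eqF.
pose C := M * (1 + M ^+ 2) * K.
have C0 : 0 <= C by rewrite !mulr_ge0 ?(kc_ge0 hK)// addr_ge0// sqr_ge0.
have sub : `[bq q, x2] `<=` `[x1, x2]%classic.
  by move=> z /=; rewrite !in_itv/= => /andP[z1 ->]; rewrite (le_trans (ltW x1q)).
have inx x : bq q <= x <= x2 -> x1 <= x <= x2.
  by move=> /andP[z1 ->]; rewrite (le_trans (ltW x1q)).
have c1 := continuous_subspaceW sub cSp.
have c2 := continuous_subspaceW sub (@ckern 3 (poly3 R) e q q0).
have c3 := continuous_subspaceW sub (pl_cH hP).
have cf : {within `[bq q, x2], continuous (fun x => (H x - k q x) * chi q (arg e x) * Sp x)}.
  move=> x; apply: cvgM (c1 x); apply: cvgM (c2 x); apply: cvgB (c3 x) _.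
  exact: (pl_ck hP).
pose G x := C * atan (arg e x / q).
pose G' x := C * ((1 + (arg e x / q) ^+ 2)^-1 * (Sp x / q)).
have dG x : bq q <= x <= x2 -> is_derive x 1 G (G' x).
  move=> hx; have d1 := darg e (inx x hx).
  have d2 : is_derive x 1 (fun x => arg e x / q) (Sp x / q).
    have := is_deriveM d1 (is_derive_cst q^-1 x 1); move/is_derive_eq; apply.
    by rewrite /GRing.scale /= mulr0 add0r mulrC.
  have d3 := @is_derive1_comp R atan (fun x => arg e x / q) x _ _ (is_derive_atan (arg e x / q)) d2.
  have := is_deriveM (is_derive_cst C x 1) d3.
  by move/is_derive_eq; apply; rewrite /G' /GRing.scale /=; ring.
apply: (@le_trans _ _ (G x2 - G (bq q))).
  have dG' x : bq q < x < x2 -> is_derive x 1 G (G' x).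
    by move=> /andP[y1 y2]; apply: dG; rewrite !ltW.
  apply: (@integral_le_increment _ _ G G' (bq q) x2 (ltW qx2) cf (is_derive_within_continuous dG) dG').
  move=> x /andP[z1 z2].
  have hx : bq q <= x <= x2 by rewrite !ltW.
  have /andP[S0 SM] := SpM (inx x hx).
  have -> : G' x = C * ((1 + (arg e x / q) ^+ 2)^-1 / q) * Sp x by rewrite /G'; ring.
  rewrite normrM (ger0_norm S0) ler_wpM2r//.
  have hy : - (M * q ^+ 2) <= S x - S b0.
    have := pl_bqL hP q01; rewrite ler_norml => /andP[+ _] => /le_trans; apply.
    by rewrite lerD2r S_mono// ltW.
  (* The mismatch is measured by y, the kernel by u = y + e. They are comparable because y >= - M
     q^2 above the boundary and e >= 0. *)
  have yu : q ^+ 2 + (S x - S b0) ^+ 2 <= (1 + M ^+ 2) * (q ^+ 2 + arg e x ^+ 2).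
    have -> : arg e x = S x - S b0 + e by [].
    move: (S x - S b0) hy => y hy.
    have [y0|y0] := leP 0 y.
      have h1 : y ^+ 2 <= (y + e) ^+ 2 by rewrite ler_sqr ?nnegrE ?addr_ge0// lerDl.
      have := mulr_ge0 (sqr_ge0 M) (addr_ge0 (sqr_ge0 q) (sqr_ge0 (y + e))).
      by rewrite mulrDl mul1r; move: (y ^+ 2) (q ^+ 2) h1 => *; lra.
    have h1 : y ^+ 2 <= M ^+ 2 * q ^+ 2.
      rewrite -exprMn -sqrrN ler_sqr ?nnegrE ?oppr_ge0 ?mulr_ge0 ?(ltW y0) ?(ltW q0)//.
      rewrite lerNl; apply: (le_trans _ hy); rewrite lerN2 ler_wpM2l// expr2.
      by rewrite ler_piMr// ltW.
    have h2 := mulr_ge0 (sqr_ge0 M) (sqr_ge0 (y + e)); have h3 := sqr_ge0 (y + e).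
    rewrite mulrDl mul1r mulrDr.
    by move: (y ^+ 2) (q ^+ 2) ((y + e) ^+ 2) (M ^+ 2) h1 h2 h3 => *; lra.
  rewrite normrM; have hk := pl_kH hP hq hx; rewrite distrC in hk.
  set u := arg e x in yu *.
  apply: (@le_trans _ _ (M * ((1 + M ^+ 2) * (q ^+ 2 + u ^+ 2))
     * (K * (q ^+ 3 * (1 + (u / q) ^+ 2) ^+ 2)^-1))).
    by apply: ler_pM => //; [apply: (le_trans hk); rewrite ler_wpM2l|exact: (kc_chi hK)].
  have D0 : 0 < 1 + (u / q) ^+ 2 by rewrite ltr_pwDl// sqr_ge0.
  have -> : q ^+ 2 + u ^+ 2 = q ^+ 2 * (1 + (u / q) ^+ 2) by field.
  rewrite le_eqVlt; apply/orP; left; apply/eqP.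
  by move: (1 + (u / q) ^+ 2) D0 => D D0; rewrite /C; field; rewrite qn0 gt_eqF.
rewrite -mulrBr; apply: ler_wpM2l => //.
have := atan_bound (arg e x2 / q); have := atan_bound (arg e (bq q) / q).
by rewrite !ler_norml; move: (atan _) (atan _) => s t /andP[? ?] /andP[? ?]; lra.
Qed.

Lemma boundary_bound e q : 0 < q < Q1 -> 0 <= e ->
  `|q * Wpole e q x2| <= M * K * (a ^- 10 + a ^- 8).
Proof.
move=> hq e0; have /andP[q0 qQ] := hq.
have q1 : q <= 1 by have /andP[_] := pl_Q1 hP; apply: le_trans; exact: ltW.
have hx : x1 <= x2 <= x2 by rewrite lexx ltW.
have [Y1 Y2 _] := pl_YM hP hq hx.
have K0 := kc_ge0 hK.
have au : a <= arg e x2 by apply: (le_trans (pl_a hP)); rewrite lerDl.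
have u0 := lt_le_trans a0 au; have un0 : arg e x2 != 0 by rewrite gt_eqF.
have small (m n : nat) : q ^+ m / arg e x2 ^+ n <= a ^- n.
  rewrite -[leRHS]mul1r; apply: ler_pM; rewrite ?invr_ge0 ?exprn_ge0 ?exprn_ile1 ?(ltW q0) ?(ltW u0)//.
  by rewrite lef_pV2 ?posrE ?exprn_gt0//; apply: lerXn2r; rewrite ?nnegrE ?(ltW a0) ?(ltW u0).
rewrite normrM (gtr0_norm q0); apply: (@le_trans _ _ (1 * `|Wpole e q x2|)).
  by rewrite ler_wpM2r.
rewrite mul1r; apply: (le_trans (ler_normB _ _)); rewrite mulrDr; apply: lerD; rewrite normrM -mulrA;
  apply: ler_pM => //.
  by apply: (le_trans (kc_psi1_small hK q0 un0)); rewrite ler_wpM2l.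
by apply: (le_trans (kc_psi_small hK q0 un0)); rewrite ler_wpM2l.
Qed.

(** Between [b0] and [bq q] the kernel argument moves by at most M q^2, so [H] and [chi] may be
    frozen. The Lipschitz constant q^-4 of [chi] meets two factors q^2, that of the argument and
    that of the length of the interval. *)
Lemma free_boundary_bound e q w : 0 < q < Q1 -> 0 <= e ->
  (forall x, x1 <= x <= x2 -> `|S x - S b0| <= M * q ^+ 2 -> `|H x - H b0| <= w) ->
  `|Ppole e q (bq q) - Ppole e q b0 - H b0 * ((S (bq q) - S b0) * chi q e)|
    <= M * w * (q ^+ 2 * `|chi q e|) + M ^+ 3 * K.
Proof.
move=> hq e0 hw; have /andP[q0 qQ] := hq.
have q01 : 0 <= q <= Q1 by rewrite !ltW.
have /andP[x1q qx2] := pl_bq hP q01; have /andP[x1b bx2] := pl_b0 hP.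
have K0 := kc_ge0 hK.
have w0 : 0 <= w.
  have := hw b0; rewrite !subrr normr0; apply; first by rewrite !ltW.
  by rewrite mulr_ge0 ?sqr_ge0.
pose C := w * `|chi q e| + M * (K * (q ^+ 4)^-1 * (M * q ^+ 2)).
have C0 : 0 <= C.
  apply: addr_ge0; first by rewrite mulr_ge0.
  by rewrite !mulr_ge0 ?invr_ge0 ?exprn_ge0 ?(ltW q0).
have cf : {within `[x1, x2], continuous (fun x => H x * chi q (arg e x) * Sp x)}.
  by move=> x; apply: cvgM (@cSp x); apply: cvgM; [exact: (pl_cH hP)|exact: ckern].
have main u v : x1 < u -> u <= v -> v < x2 ->
    (forall x, u <= x <= v -> `|S x - S b0| <= M * q ^+ 2) ->
    `|Ppole e q v - Ppole e q u - H b0 * ((S v - S u) * chi q e)| <= C * (S v - S u).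
  move=> xu uv vx hS.
  have inx x : u <= x <= v -> x1 < x < x2.
    by move=> /andP[y1 y2]; rewrite (lt_le_trans xu)//= (le_lt_trans y2).
  pose F x := Ppole e q x - H b0 * chi q e * S x.
  pose F' x := H x * chi q (arg e x) * Sp x - H b0 * chi q e * Sp x.
  have dF x : u <= x <= v -> is_derive x 1 F (F' x).
    move=> hx; have hx' := inx x hx; have dp := primitive_derive cf hx'.
    have dSx : is_derive x 1 S (Sp x) by apply: dS; have /andP[y1 y2] := hx'; rewrite !ltW.
    have := is_deriveB dp (is_deriveM (is_derive_cst (H b0 * chi q e) x 1) dSx).
    by move/is_derive_eq; apply; rewrite /F' /GRing.scale /=; ring.
  have dG x : u <= x <= v -> is_derive x 1 (fun x => C * S x) (C * Sp x).
    move=> hx; have hx' := inx x hx.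
    have dSx : is_derive x 1 S (Sp x) by apply: dS; have /andP[y1 y2] := hx'; rewrite !ltW.
    have := is_deriveM (is_derive_cst C x 1) dSx.
    by move/is_derive_eq; apply; rewrite /GRing.scale /=; ring.
  have -> : Ppole e q v - Ppole e q u - H b0 * ((S v - S u) * chi q e) = F v - F u.
    by rewrite /F; ring.
  rewrite mulrBr.
  apply: (derive_le_increment (F' := F') (G' := fun x => C * Sp x) uv
    (is_derive_within_continuous dF) (is_derive_within_continuous dG)).
  - by move=> x /andP[y1 y2]; apply: dF; rewrite !ltW.
  - by move=> x /andP[y1 y2]; apply: dG; rewrite !ltW.
  - move=> x /andP[y1 y2]; have hx : u <= x <= v by rewrite !ltW.
    have hx' : x1 <= x <= x2 by have /andP[z1 z2] := inx x hx; rewrite !ltW.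
    have /andP[S0 SM] := SpM hx'.
    rewrite /F' -mulrBl normrM (ger0_norm S0) ler_wpM2r//.
    have -> : H x * chi q (arg e x) - H b0 * chi q e
      = (H x - H b0) * chi q e + H x * (chi q (arg e x) - chi q e) by ring.
    apply: (le_trans (ler_normD _ _)); apply: lerD; rewrite normrM.
      by rewrite ler_wpM2r// hw// hS.
    apply: ler_pM => //; first exact: (pl_HM hP).
    apply: (le_trans (kc_chi_lip hK _ _ q0)).
    rewrite ler_wpM2l ?mulr_ge0 ?invr_ge0 ?exprn_ge0 ?(ltW q0)//.
    by rewrite /arg addrK hS.
have fin z : 0 <= z -> z <= M * q ^+ 2 -> C * z <= M * w * (q ^+ 2 * `|chi q e|) + M ^+ 3 * K.
  move=> z0 zM; apply: (@le_trans _ _ (C * (M * q ^+ 2))); first exact: ler_wpM2l.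
  rewrite le_eqVlt; apply/orP; left; apply/eqP; rewrite /C; field.
  by rewrite gt_eqF.
have hL := pl_bqL hP q01.
have [bb|bb] := leP b0 (bq q).
  have mS x : b0 <= x <= bq q -> 0 <= S x - S b0 <= S (bq q) - S b0.
    move=> /andP[y1 y2]; rewrite subr_ge0 lerD2r !S_mono ?(ltW x1b)//.
    - exact: le_trans (ltW x1b) y1.
    - exact: ltW.
    - exact: le_trans y2 (ltW qx2).
  have s0 : 0 <= S (bq q) - S b0 by rewrite subr_ge0 S_mono// ltW.
  rewrite (ger0_norm s0) in hL.
  apply: (le_trans (main _ _ x1b bb qx2 _)); last exact: fin.
  by move=> x /mS/andP[y1 y2]; rewrite ger0_norm//; exact: le_trans hL.
have mS x : bq q <= x <= b0 -> 0 <= S b0 - S x <= S b0 - S (bq q).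
  move=> /andP[y1 y2]; rewrite subr_ge0 lerD2l lerN2 !S_mono ?(ltW x1q)//.
  - exact: le_trans y2 (ltW bx2).
  - exact: le_trans (ltW x1q) y1.
  - exact: ltW.
have s0 : 0 <= S b0 - S (bq q) by rewrite subr_ge0 S_mono// ltW.
rewrite distrC (ger0_norm s0) in hL.
have -> : Ppole e q (bq q) - Ppole e q b0 - H b0 * ((S (bq q) - S b0) * chi q e)
   = - (Ppole e q b0 - Ppole e q (bq q) - H b0 * ((S b0 - S (bq q)) * chi q e)) by ring.
rewrite normrN.
apply: (le_trans (main _ _ x1q (ltW bb) bx2 _)); last exact: fin.
by move=> x /mS/andP[y1 y2]; rewrite distrC ger0_norm//; exact: le_trans hL.
Qed.

Lemma Epole'_bound e q w : 0 < q < Q1 -> 0 < e ->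
  (forall x, x1 <= x <= x2 -> `|S x - S b0| <= M * q ^+ 2 -> `|H x - H b0| <= w) ->
  `|Epole' e q - H b0 * ((S (bq q) - S b0) * chi q e)|
   <= pole_constant K M a + M * w * K * (e / (q ^+ 2 + e ^+ 2)).
Proof.
move=> hq e0 hw; have /andP[q0 qQ] := hq.
have w0 : 0 <= w.
  have /andP[y1 y2] := pl_b0 hP; have := hw b0; rewrite !subrr normr0; apply; first by rewrite !ltW.
  by rewrite mulr_ge0 ?sqr_ge0.
have h1 := boundary_bound hq (ltW e0).
have h2 := source_bound hq (ltW e0).
have h3 := free_boundary_bound hq (ltW e0) hw.
have h4 : M * w * (q ^+ 2 * `|chi q e|) <= M * w * K * (e / (q ^+ 2 + e ^+ 2)).
  by rewrite -[leRHS]mulrA ler_wpM2l ?mulr_ge0// (kc_chi_mass hK)// ltW.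
rewrite /Epole' /pole_constant -addrA -addrA -[X in _ <= X]addrA -[X in _ <= X]addrA.
apply: (le_trans (ler_normD _ _)); apply: lerD h1 _.
apply: (le_trans (ler_normD _ _)); apply: lerD h2 _.
by apply: (le_trans h3); rewrite [leLHS]addrC lerD2l.
Qed.

(** For fixed e > 0 and small q the region where [Y] lives is at distance at least e/2 from the
    pole, where the kernel vanishes with q: the potential starts from 0. *)
Lemma Epole_small e : 0 < e -> exists C, exists2 d, 0 < d & forall q, 0 < q < Q1 -> q < d ->
  `|Epole e q| <= C * q.
Proof.
move=> e0; have K0 := kc_ge0 hK; have /andP[x1b bx2] := pl_b0 hP.
pose c := M * (K * (e / 2) ^- 8) * M * (x2 - x1) + M * (K * e ^- 4) * M * (x2 - b0).
exists c; exists (e / (2 * (M + 1))).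
  by rewrite divr_gt0// mulr_gt0// ltr_wpDl.
move=> q hq qd; have /andP[q0 qQ] := hq.
have q01 : 0 <= q <= Q1 by rewrite !ltW.
have q1 : q <= 1 by have /andP[_] := pl_Q1 hP; apply: le_trans; exact: ltW.
have /andP[x1q qx2] := pl_bq hP q01.
have e2 : 0 < e / 2 by rewrite divr_gt0.
have pq (n : nat) : (0 < n)%N -> q ^+ n <= q.
  by case: n => // n _; rewrite exprS ler_piMr ?exprn_ile1// ltW.
have dq : M * q ^+ 2 <= e / 2.
  apply: (@le_trans _ _ ((M + 1) * q)).
    by apply: ler_pM; rewrite ?sqr_ge0// ?lerDl// pq.
  move: qd; rewrite ltr_pdivlMr; last by rewrite mulr_gt0// ltr_wpDl.
  by move/ltW => h; rewrite ler_pdivlMr//; have -> : (M + 1) * q * 2 = q * (2 * (M + 1)) by ring.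
rewrite /c mulrDl; apply: (le_trans (ler_normD _ _)); apply: lerD.
- rewrite mulrAC; apply: Rintegral_bound; first exact: ltW.
    move=> x; apply: cvgM (@cSp x); apply: cvgM; [exact: (pl_cY hP)|exact: ckern].
  move=> x /andP[y1 y2]; have hx : x1 <= x <= x2 by rewrite !ltW.
  have /andP[S0 SM] := SpM hx.
  have [Y1 _ _] := pl_YM hP hq hx.
  rewrite normrM (ger0_norm S0) mulrAC; apply: ler_pM => //.
  have [xb|xb] := leP x (bq q).
    have [|-> _ _] := pl_below hP (x := x) hq; first by rewrite xb ltW.
    by rewrite mul0r normr0 !mulr_ge0 ?invr_ge0 ?exprn_ge0 ?(ltW q0) ?(ltW e2).
  have au : e / 2 <= arg e x.
    have := pl_bqL hP q01; rewrite ler_norml => /andP[h1 _].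
    have : S (bq q) <= S x by apply: S_mono; rewrite ?ltW.
    by rewrite /arg; lra.
  have u0 := lt_le_trans e2 au; have un0 : arg e x != 0 by rewrite gt_eqF.
  rewrite normrM -mulrA; apply: ler_pM => //.
  apply: (le_trans (kc_psi_small hK q0 un0)); rewrite -[leRHS]mulrA [_ * q]mulrC.
  apply: ler_wpM2l => //.
  apply: ler_pM; rewrite ?invr_ge0 ?exprn_ge0 ?(ltW q0) ?(ltW u0) ?pq//.
  by rewrite lef_pV2 ?posrE ?exprn_gt0//; apply: lerXn2r; rewrite ?nnegrE ?(ltW e2) ?(ltW u0).
- have sub : `[b0, x2] `<=` `[x1, x2]%classic.
    by move=> z /=; rewrite !in_itv/= => /andP[z1 ->]; rewrite (le_trans (ltW x1b)).
  rewrite mulrAC; apply: Rintegral_bound; first exact: ltW.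
    apply: continuous_subspaceW sub _ => x.
    apply: cvgM (@cSp x); apply: cvgM; [exact: (pl_cH hP)|exact: ckern].
  move=> x /andP[y1 y2]; have hx : x1 <= x <= x2 by rewrite (le_trans (ltW x1b)) ?ltW.
  have /andP[S0 SM] := SpM hx.
  rewrite normrM (ger0_norm S0) mulrAC; apply: ler_pM => //.
  have au : e <= arg e x.
    have : S b0 <= S x by apply: S_mono; rewrite ?ltW.
    by rewrite /arg; lra.
  have u0 := lt_le_trans e0 au; have un0 : arg e x != 0 by rewrite gt_eqF.
  rewrite normrM -mulrA; apply: ler_pM => //; first exact: (pl_HM hP).
  apply: (le_trans (kc_phi_small hK q0 un0)); rewrite -[leRHS]mulrA [_ * q]mulrC.
  apply: ler_wpM2l => //.
  apply: ler_pM; rewrite ?invr_ge0 ?exprn_ge0 ?(ltW q0) ?(ltW u0) ?pq//.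
  by rewrite lef_pV2 ?posrE ?exprn_gt0//; apply: lerXn2r; rewrite ?nnegrE ?(ltW e0) ?(ltW u0).
Qed.

(** At fixed positive q the kernel is Lipschitz in its argument, so the potential is O(e) close to
    the one with [e = 0]. The constant may blow up with q, as e is chosen after q. *)
Lemma Epole_shift e q : 0 < q < Q1 -> 0 <= e ->
  `|Epole e q - Epole 0 q| <= (M * (K * q ^- 5) * M * (x2 - x1) + M * (K * q ^- 3) * M * (x2 - b0)) * e.
Proof.
move=> hq e0; have /andP[q0 qQ] := hq; have K0 := kc_ge0 hK; have /andP[x1b bx2] := pl_b0 hP.
have sub : `[b0, x2] `<=` `[x1, x2]%classic.
  by move=> z /=; rewrite !in_itv/= => /andP[z1 ->]; rewrite (le_trans (ltW x1b)).
have int (u : R) (f : R -> R) : {within `[u, x2], continuous f} -> leb.-integrable `[u, x2] (EFin \o f).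
  by move=> cf; apply: continuous_compact_integrable => //; exact: segment_compact.
have c1 z : {within `[x1, x2], continuous (fun x => Y q x * psi q (arg z x) * Sp x)}.
  by move=> x; apply: cvgM (@cSp x); apply: cvgM; [exact: (pl_cY hP)|exact: ckern].
have c2 z : {within `[b0, x2], continuous (fun x => H x * phi q (arg z x) * Sp x)}.
  apply: continuous_subspaceW sub _ => x.
  by apply: cvgM (@cSp x); apply: cvgM; [exact: (pl_cH hP)|exact: ckern].
have argB x : `|arg e x - arg 0 x| = e.
  by rewrite /arg addr0 addrC addKr ger0_norm.
rewrite /Epole opprD addrACA mulrDl.
apply: (le_trans (ler_normD _ _)); apply: lerD.
- rewrite -RintegralB//; [|exact: int (c1 e)|exact: int (c1 0)].
  rewrite mulrAC; apply: Rintegral_bound; first exact: ltW.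
    by move=> x; apply: cvgB; exact: c1.
  move=> x /andP[y1 y2]; have hx : x1 <= x <= x2 by rewrite !ltW.
  have /andP[S0 SM] := SpM hx.
  have [Y1 _ _] := pl_YM hP hq hx.
  rewrite -mulrBl normrM (ger0_norm S0) mulrAC; apply: ler_pM => //.
  rewrite -mulrBr normrM -mulrA; apply: ler_pM => //.
  by apply: (le_trans (kc_psi_lip hK _ _ q0)); rewrite argB.
- rewrite -RintegralB//; [|exact: int (c2 e)|exact: int (c2 0)].
  rewrite mulrAC; apply: Rintegral_bound; first exact: ltW.
    by move=> x; apply: cvgB; exact: c2.
  move=> x /andP[y1 y2]; have hx : x1 <= x <= x2 by rewrite (le_trans (ltW x1b)) ?ltW.
  have /andP[S0 SM] := SpM hx.
  rewrite -mulrBl normrM (ger0_norm S0) mulrAC; apply: ler_pM => //.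
  rewrite -mulrBr normrM -mulrA; apply: ler_pM => //; first exact: (pl_HM hP).
  by apply: (le_trans (kc_phi_lip hK _ _ q0)); rewrite argB.
Qed.

(** Integrate [Epole'_bound] up to [Q]: the constant part yields a multiple of [Q] and the Poisson
    kernel at most pi, uniformly in e. [Epole_small] disposes of the lower end, which is sent to 0
    last. *)
Lemma pole_estimate e Q w : 0 < Q < Q1 -> 0 < e ->
  (forall x, x1 <= x <= x2 -> `|S x - S b0| <= M * Q ^+ 2 -> `|H x - H b0| <= w) ->
  `|Epole e Q - H b0 * \int[leb]_(q in `[0, Q]) ((S (bq q) - S b0) * chi q e)|
   <= pole_constant K M a * Q + M * w * K * pi.
Proof.
move=> /andP[Q0 QQ] e0 hw; have K0 := kc_ge0 hK; have /andP[x1b bx2] := pl_b0 hP.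
set C1 := pole_constant K M a.
have w0 : 0 <= w.
  have := hw b0; rewrite !subrr normr0; apply; first by rewrite !ltW.
  by rewrite mulr_ge0 ?sqr_ge0.
have C2 : 0 <= M * w * K by rewrite !mulr_ge0.
have h0 : `|H b0| <= M by apply: (pl_HM hP); rewrite !ltW.
pose f q := (S (bq q) - S b0) * chi q e.
have cf : {within `[0, Q], continuous f}.
  have sub : `[0, Q] `<=` `[0, Q1]%classic.
    by move=> z /=; rewrite !in_itv/= => /andP[-> z1]; exact: le_trans z1 (ltW QQ).
  have c1 := continuous_subspaceW sub (pl_cbq hP).
  have c2 := @chi_within R e Q e0.
  by move=> q; apply: cvgM (c2 q); apply: cvgB (c1 q) _; exact: cvg_cst.
pose D q := \int[leb]_(z in `[0, q]) f z.
pose Z q := Epole e q - H b0 * D q.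
(* The derivative of [atan (q / e)] is the Poisson kernel e / (q^2 + e^2). *)
pose G q := C1 * q + M * w * K * atan (q / e).
have inQ q : 0 < q <= Q -> 0 < q < Q1 by move=> /andP[-> qQ]; exact: le_lt_trans QQ.
have dE q : 0 < q <= Q -> is_derive q 1 (Epole e) (Epole' e q).
  by move=> hq; apply: Epole_derive; exact: inQ.
have dD q : 0 < q < Q -> is_derive q 1 D (f q) by move=> hq; exact: primitive_derive hq.
have cD := primitive_continuous (ltW Q0) cf.
have dZ q : 0 < q < Q -> is_derive q 1 Z (Epole' e q - H b0 * f q).
  move=> hq; have hq' : 0 < q <= Q by have /andP[-> y] := hq; exact: ltW.
  have := is_deriveB (dE q hq') (is_deriveM (is_derive_cst (H b0) q 1) (dD q hq)).
  by move/is_derive_eq; apply; rewrite /GRing.scale /= mulr0 addr0.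
have dG q : is_derive q 1 G (C1 + M * w * K * (e / (q ^+ 2 + e ^+ 2))).
  have d1 : is_derive q 1 (fun q : R => q / e) e^-1.
    have := is_deriveM (is_derive_id q 1) (is_derive_cst e^-1 q 1).
    by move/is_derive_eq; apply; rewrite /GRing.scale /= mulr0 add0r mulr1.
  have d2 := @is_derive1_comp R atan (fun q => q / e) q _ _ (is_derive_atan (q / e)) d1.
  have := is_deriveD (is_derive_linear C1 q) (is_deriveM (is_derive_cst (M * w * K) q 1) d2).
  move/is_derive_eq; apply; rewrite /GRing.scale /=; field.
  have den : 0 < q ^+ 2 + e ^+ 2 by rewrite ltr_wpDl ?sqr_ge0 ?exprn_gt0.
  by rewrite !gt_eqF.
have main q : 0 < q < Q -> `|Z Q - Z q| <= C1 * Q + M * w * K * pi.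
  move=> /andP[q0 qQ].
  apply: (@le_trans _ _ (G Q - G q)).
    have sub : `[q, Q] `<=` `[0, Q]%classic.
      by move=> z /=; rewrite !in_itv/= => /andP[y1 ->]; rewrite (le_trans (ltW q0)).
    have cE : {within `[q, Q], continuous (Epole e)}.
      apply: (is_derive_within_continuous (df := Epole' e)) => z /andP[y1 y2].
      by apply: dE; rewrite y2 andbT; exact: lt_le_trans y1.
    have cD' := continuous_subspaceW sub cD.
    have cZ : {within `[q, Q], continuous Z}.
      by move=> z; apply: cvgB (cE z) _; apply: cvgM (cD' z); exact: cvg_cst.
    have cG := is_derive_within_continuous (a := q) (b := Q) (fun z _ => dG z).
    have dZ' z : q < z < Q -> is_derive z 1 Z (Epole' e z - H b0 * f z).
      by move=> /andP[y1 y2]; apply: dZ; rewrite y2 (lt_trans q0).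
    apply: (@derive_le_increment _ Z G (fun z => Epole' e z - H b0 * f z) _ q Q (ltW qQ)
      cZ cG dZ' (fun z _ => dG z)) => z /andP[y1 y2].
    have z0 := lt_trans q0 y1.
    apply: Epole'_bound => //; first by apply: inQ; rewrite z0 ltW.
    move=> x hx hS; apply: hw => //; apply: (le_trans hS); rewrite ler_wpM2l//.
    by rewrite ler_sqr ?nnegrE ?(ltW y2)// ltW.
  have -> : G Q - G q = C1 * (Q - q) + M * w * K * (atan (Q / e) - atan (q / e)).
    by rewrite /G; ring.
  have C10 : 0 <= C1 by exact: pole_constant_ge0.
  apply: lerD; first by rewrite ler_wpM2l// gerBl ltW.
  rewrite ler_wpM2l//; have := atan_bound (Q / e); have := atan_bound (q / e).
  by rewrite !ler_norml; move: (atan _) (atan _) => s t /andP[? ?] /andP[? ?]; lra.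
have [C [d d0 hd]] := Epole_small e0.
have MK : 0 <= M * (K / e) by rewrite mulr_ge0// divr_ge0// ltW.
have Zsmall q : 0 < q < Q -> q < d -> `|Z q| <= (`|C| + M * (M * (K / e))) * q.
  move=> /andP[q0 qQ] qd; have hq : 0 < q < Q1 by apply: inQ; rewrite q0 ltW.
  rewrite mulrDl; apply: (le_trans (ler_normB _ _)); apply: lerD.
    by apply: (le_trans (hd q hq qd)); rewrite ler_wpM2r ?ler_norm// ltW.
  rewrite normrM -mulrA; apply: ler_pM => //.
  have -> : M * (K / e) * q = M * (K / e) * (q - 0) by rewrite subr0.
  apply: Rintegral_bound; first exact: ltW.
    apply: continuous_subspaceW cf => z /=; rewrite !in_itv/= => /andP[-> y].
    exact: le_trans y (ltW qQ).
  move=> z /andP[z0 zq]; apply: (smear_kernel_bound e0 M0 K0); last 2 first.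
  - exact: ltW.
  - by apply: (pl_bqL hP); rewrite !ltW// (lt_trans zq)// (lt_trans qQ).
  - by move=> z' z'0; apply: (kc_chi_mass hK) => //; exact: ltW.
apply/ler_addgt0Pr => z z0.
pose C3 := `|C| + M * (M * (K / e)).
have C30 : 0 <= C3 by rewrite addr_ge0// mulr_ge0.
pose q := Num.min (Q / 2) (Num.min (d / 2) (z / (C3 + 1))).
have q0 : 0 < q by rewrite !lt_min !divr_gt0// ltr_wpDl.
have qQ : q < Q by apply: (@le_lt_trans _ _ (Q / 2)); [rewrite ge_min lexx|lra].
have qd : q < d by apply: (@le_lt_trans _ _ (d / 2)); [rewrite !ge_min lexx orbT|lra].
have qz : C3 * q <= z.
  apply: (@le_trans _ _ ((C3 + 1) * q)); first by rewrite ler_pM2r// lerDl.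
  by rewrite mulrC -ler_pdivlMr ?ltr_wpDl// !ge_min lexx !orbT.
have hq : 0 < q < Q by rewrite q0.
rewrite -[leLHS]/(`|Z Q|) -[Z Q](subrK (Z q)).
apply: (le_trans (ler_normD _ _)); apply: lerD; first exact: main.
exact: le_trans (Zsmall q hq qd) qz.
Qed.

End pole.

(** * The localised variational equation *)

(** The algebra behind [pl_kH]: [d] is the distance to the pole and [d'] that to the moving
    boundary. The drift error times U_x is a product of two small factors and U is quadratic, so the
    total is quadratic in the parabolic distance. *)
Lemma product_error (R : realType) (N E ex dh dm ux sgx rr c uu q2 y d d' : R) :
  1 <= N -> 0 <= ex <= E -> 0 <= q2 <= 1 -> 0 <= y -> 0 <= d -> d <= N * y ->
  0 <= d' -> d' <= d + N * q2 -> `|dh| <= N * q2 -> `|dm| <= N * (q2 + d) ->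
  `|ux| <= N * d' -> `|sgx| <= N -> `|rr| <= N -> `|c| <= N -> `|uu| <= N * d' ^+ 2 ->
  `|ex * (dh + dm * sgx * ux - (rr + c ^+ 2 / 2) * uu)| <= 7 * E * N ^+ 5 * (q2 + y ^+ 2).
Proof.
move=> N1 /andP[ex0 exE] /andP[q0 q1] y0 d0 dy d'0 dd hdh hdm hux hsg hrr hc huu.
have N0 : 0 <= N := le_trans ler01 N1.
pose z := N * (q2 + y).
have z0 : 0 <= z by rewrite mulr_ge0// addr_ge0.
have Nq : q2 <= N * q2 by rewrite ler_peMl.
have z1 : q2 + d <= z by rewrite /z mulrDr; lra.
have z2 : d' <= z by rewrite /z mulrDr; lra.
have zz : z ^+ 2 <= 2 * N ^+ 2 * (q2 + y ^+ 2).
  have -> : 2 * N ^+ 2 * (q2 + y ^+ 2) = N ^+ 2 * (2 * (q2 + y ^+ 2)) by ring.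
  rewrite /z exprMn; apply: ler_wpM2l; first exact: sqr_ge0.
  have h : q2 ^+ 2 <= q2 by rewrite expr2 ler_piMr.
  have e1 : (q2 + y) ^+ 2 + (q2 - y) ^+ 2 = 2 * (q2 ^+ 2 + y ^+ 2) by ring.
  have := sqr_ge0 (q2 - y); move: ((q2 + y) ^+ 2) ((q2 - y) ^+ 2) (y ^+ 2) (q2 ^+ 2) h e1.
  by move=> A B C D *; lra.
have t1 : `|dm * sgx * ux| <= N ^+ 3 * z ^+ 2.
  rewrite !normrM; apply: (@le_trans _ _ (N * z * N * (N * z))); last first.
    by rewrite le_eqVlt; apply/orP; left; apply/eqP; ring.
  apply: ler_pM; [by rewrite mulr_ge0|by []|apply: ler_pM => //|].
  - by apply: (le_trans hdm); rewrite ler_wpM2l.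
  - by apply: (le_trans hux); rewrite ler_wpM2l.
have N2 : N <= N ^+ 2 by rewrite expr2 ler_peMl.
have t2 : `|(rr + c ^+ 2 / 2) * uu| <= 2 * N ^+ 3 * z ^+ 2.
  rewrite normrM; apply: (@le_trans _ _ (2 * N ^+ 2 * (N * z ^+ 2))); last first.
    by rewrite le_eqVlt; apply/orP; left; apply/eqP; ring.
  apply: ler_pM => //.
    have c2 : `|c ^+ 2 / 2| <= N ^+ 2.
      rewrite normrM normrX [`|_^-1|]ger0_norm// ler_pdivrMr//.
      apply: (@le_trans _ _ (N ^+ 2)); first by rewrite ler_sqr ?nnegrE.
      by rewrite ler_peMr ?sqr_ge0// ler1n.
    by apply: (le_trans (ler_normD _ _)); move: (N ^+ 2) (`|rr|) (`|_ / _|) N2 hrr c2 => *; lra.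
  apply: (le_trans huu); rewrite ler_wpM2l// ler_sqr ?nnegrE//.
have N5 : N <= N ^+ 5 by rewrite -[leLHS]expr1 ler_weXn2l.
have E0 : 0 <= E := le_trans ex0 exE.
have D0 : 0 <= q2 + y ^+ 2 by rewrite addr_ge0 ?sqr_ge0.
rewrite normrM (ger0_norm ex0); apply: (@le_trans _ _ (E * (7 * N ^+ 5 * (q2 + y ^+ 2)))); last first.
  by rewrite le_eqVlt; apply/orP; left; apply/eqP; ring.
apply: ler_pM => //; apply: (le_trans (ler_normB _ _)).
have t0 : `|dh + dm * sgx * ux| <= N * q2 + N ^+ 3 * z ^+ 2.
  by apply: (le_trans (ler_normD _ _)); exact: lerD.
have t3 : N ^+ 3 * z ^+ 2 <= 2 * N ^+ 5 * (q2 + y ^+ 2).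
  apply: (@le_trans _ _ (N ^+ 3 * (2 * N ^+ 2 * (q2 + y ^+ 2)))).
    by apply: ler_wpM2l zz; rewrite exprn_ge0.
  by rewrite le_eqVlt; apply/orP; left; apply/eqP; ring.
have t4 : N * q2 <= N ^+ 5 * (q2 + y ^+ 2).
  by apply: ler_pM => //; rewrite lerDl sqr_ge0.
have e3 : 2 * N ^+ 3 * z ^+ 2 = 2 * (N ^+ 3 * z ^+ 2) by ring.
have e5 : 2 * N ^+ 5 * (q2 + y ^+ 2) = 2 * (N ^+ 5 * (q2 + y ^+ 2)) by ring.
have -> : 7 * N ^+ 5 * (q2 + y ^+ 2) = 7 * (N ^+ 5 * (q2 + y ^+ 2)) by ring.
rewrite e3 in t2; rewrite e5 in t3.
move: (N ^+ 3 * z ^+ 2) (N ^+ 5 * (q2 + y ^+ 2)) (`|dh + _|) (`|_ * uu|) (N * q2) t0 t2 t3 t4.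
by move=> A B C D F *; lra.
Qed.

(** * The pole attached to a boundary point *)

Section box.
Variable R : realType.
Local Notation leb := (@lebesgue_measure R).
Implicit Types (q e x t s : R).

Lemma continuous_pair_comp (f : R * R -> R) (u v : R -> R) :
  continuous f -> continuous u -> continuous v -> continuous (fun z => f (u z, v z)).
Proof.
move=> cf cu cv z; apply: (continuous_comp (f := fun z => (u z, v z))); last exact: cf.
exact: continuous_pair.
Qed.

Lemma param_integral_continuous (f : R * R -> R) (a c : R) : a <= c -> continuous f ->
  continuous (fun t => \int[leb]_(x in `[a, c]) f (t, x)).
Proof.
move=> ac cf t.
have cid : continuous (fun z : R => z) by move=> z; exact: cvg_id.
have [K K0 hK] := @box_bounded R setT f (t - 1) (t + 1) a c
  (@continuous_subspaceT _ _ _ _ cf) (fun _ _ => I).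
have mD : measurable (`[a, c]%classic : set (measurableTypeR R)) by [].
apply: (@continuity_under_integral R _ (measurableTypeR R) leb (fun t x => f (t, x)) `[a, c] mD
  (t - 1) (t + 1) _ _ (fun=> K)).
- move=> x _; apply: continuous_compact_integrable; first exact: segment_compact.
  by apply: continuous_subspaceT; apply: continuous_pair_comp => // z; exact: cst_continuous.
- apply: aeW => y _ x _; exact: (continuous_pair_comp cf cid (@cst_continuous _ _ y)).
- apply: continuous_compact_integrable; first exact: segment_compact.
  by move=> z; exact: cst_continuous.
- move=> x; rewrite /= in_itv/= => /andP[h1 h2]; apply: aeW => y; rewrite /= in_itv/= => hy.
  by apply: hK => //; rewrite !ltW.
- by rewrite inE/= in_itv/= ltrBlDr !ltrDl ltr01.
Qed.

Lemma shift_sq_continuous (f : R -> R) t : continuous f -> continuous (fun q => f (t + q ^+ 2)).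
Proof.
move=> cf q; apply: (continuous_comp (f := fun q => t + q ^+ 2)); last exact: cf.
by apply: cvgD; [exact: cvg_cst|exact: exprn_continuous].
Qed.

Lemma exp_norm_le (u k : R) : `|u| <= k -> expR u <= expR k.
Proof. by move=> h; rewrite ler_expR; apply: le_trans h; exact: ler_norm. Qed.

(* The variational equation localised to [s0, s1] * [x1, x2]; all functions are continued
   outside by their values at the nearest point.  [m] is the drift mu / sg - sg' / 2 of the
   Lamperti transform. *)
Record fbox (N s0 s1 x1 x2 rho : R) (b : R -> R) (U Ut Ux h m mu r : R * R -> R)
    (sg sg1 : R -> R) : Prop := Fbox {
  fb_N : 1 <= N;
  fb_s : s0 < s1;
  fb_x : x1 < x2;
  fb_x1 : x2 - x1 <= 1;
  fb_rho : 0 < rho;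
  fb_b : forall t, x1 + rho <= b t <= x2 - rho;
  fb_bL : forall t s, `|b t - b s| <= N * `|t - s|;
  fb_c : [/\ continuous U, continuous Ut, continuous Ux, continuous h & continuous m];
  fb_cr : continuous r;
  fb_bd : forall p, [/\ `|U p| <= N, `|Ut p| <= N, `|Ux p| <= N, `|h p| <= N & `|m p| <= N];
  fb_rN : forall p, `|r p| <= N;
  fb_h0 : forall p, h p <= - N^-1;
  fb_dUt : forall t x, s0 < t < s1 -> x1 <= x <= x2 -> is_derive t 1 (fun t => U (t, x)) (Ut (t, x));
  fb_dUx : forall t x, s0 <= t <= s1 -> x1 < x < x2 -> is_derive x 1 (fun x => U (t, x)) (Ux (t, x));
  fb_below : forall t x, s0 < t < s1 -> x1 <= x <= b t ->
    [/\ U (t, x) = 0, Ux (t, x) = 0 & Ut (t, x) = 0];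
  fb_dUxx : forall t x, s0 < t < s1 -> b t < x < x2 ->
    let F := 2 / sg x ^+ 2 * (- h (t, x) - Ut (t, x) - mu (t, x) * Ux (t, x) + r (t, x) * U (t, x)) in
    is_derive x 1 (fun x => Ux (t, x)) F /\ `|F| <= N;
  fb_csg : continuous sg;
  fb_sg : forall x, N^-1 <= sg x <= N;
  fb_dsg : forall x, x1 < x < x2 -> is_derive x 1 sg (sg1 x);
  fb_mu : forall t x, s0 < t < s1 -> x1 < x < x2 -> mu (t, x) = sg x * m (t, x) + sg x * sg1 x / 2;
  fb_mL : forall t x s y, s0 <= t <= s1 -> x1 <= x <= x2 -> s0 <= s <= s1 -> x1 <= y <= x2 ->
    `|m (t, x) - m (s, y)| <= N * (`|t - s| + `|x - y|);
  fb_hL : forall t s x, s0 <= t <= s1 -> s0 <= s <= s1 -> x1 <= x <= x2 ->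
    `|h (t, x) - h (s, x)| <= N * `|t - s| }.

Variables (N s0 s1 x1 x2 rho : R) (b : R -> R) (U Ut Ux h m mu r : R * R -> R) (sg sg1 : R -> R).
Hypothesis fb : fbox N s0 s1 x1 x2 rho b U Ut Ux h m mu r sg sg1.

Let N0 : 0 < N := lt_le_trans ltr01 (fb_N fb).
Let sgp x : 0 < sg x.
Proof. by have /andP[+ _] := fb_sg fb x; apply: lt_le_trans; rewrite invr_gt0. Qed.

Definition Sp x := (sg x)^-1.
(** The Lamperti scale. Its origin x1 - 1 leaves room on the left, so that it has a two-sided
    derivative on all of [x1, x2]. *)
Definition S x := \int[leb]_(u in `[x1 - 1, x]) Sp u.

Lemma continuous_Sp : continuous Sp.
Proof. by move=> x; apply: cvgV; [rewrite gt_eqF|exact: (fb_csg fb)]. Qed.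

Lemma derive_S x : x1 - 1 < x < x2 + 1 -> is_derive x 1 S (Sp x).
Proof.
by apply: primitive_derive; apply: continuous_subspaceT; exact: continuous_Sp.
Qed.

Lemma derive_S_in x : x1 <= x <= x2 -> is_derive x 1 S (Sp x).
Proof. by move=> /andP[y1 y2]; apply: derive_S; lra. Qed.

Lemma Sp_bound x : 0 <= Sp x <= N.
Proof.
have /andP[y1 y2] := fb_sg fb x; rewrite invr_ge0 (ltW (sgp x))/=.
by rewrite -[leRHS]invrK lef_pV2 ?posrE ?invr_gt0.
Qed.

Lemma S_lip x y : x1 <= x <= x2 -> x1 <= y <= x2 -> `|S x - S y| <= N * `|x - y|.
Proof.
suff main u v : x1 <= u -> u <= v -> v <= x2 -> `|S v - S u| <= N * (v - u).
  move=> /andP[x1x xx2] /andP[x1y yx2]; have [xy|yx] := leP x y.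
    by rewrite distrC [`|x - y|]distrC [`|y - x|]ger0_norm ?subr_ge0// main.
  by rewrite [`|x - y|]ger0_norm ?subr_ge0 ?main// ltW.
move=> xu uv vx; rewrite mulrBr.
have inx z : u <= z <= v -> x1 <= z <= x2.
  by move=> /andP[y1 y2]; rewrite (le_trans xu)//= (le_trans y2).
have d z : u <= z <= v -> is_derive z 1 S (Sp z) by move=> /inx; exact: derive_S_in.
have dN z : u <= z <= v -> is_derive z 1 (fun z => N * z) N by move=> _; exact: is_derive_linear.
apply: (@derive_le_increment _ S (fun z => N * z) Sp (fun=> N) u v uv
  (is_derive_within_continuous d) (is_derive_within_continuous dN)).
- by move=> z /andP[y1 y2]; apply: d; rewrite !ltW.
- by move=> z _; exact: is_derive_linear.
- by move=> z _; have /andP[y1 y2] := Sp_bound z; rewrite ger0_norm.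
Qed.

(* [sg <= N] makes [S] expanding. *)
Lemma S_expand x y : x1 <= x <= x2 -> x1 <= y <= x2 -> `|x - y| <= N * `|S x - S y|.
Proof.
suff main u v : x1 <= u -> u <= v -> v <= x2 -> v - u <= N * (S v - S u).
  move=> /andP[x1x xx2] /andP[x1y yx2]; have [xy|yx] := leP x y.
    rewrite distrC [`|S x - S y|]distrC [`|y - x|]ger0_norm ?subr_ge0//.
    by apply: (le_trans (main _ _ x1x xy yx2)); rewrite ler_pM2l// ler_norm.
  rewrite [`|x - y|]ger0_norm ?subr_ge0 ?(ltW yx)//.
  by apply: (le_trans (main _ _ x1y (ltW yx) xx2)); rewrite ler_pM2l// ler_norm.
move=> xu uv vx; rewrite mulrBr; apply: (le_trans (ler_norm _)).
have inx z : u <= z <= v -> x1 <= z <= x2.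
  by move=> /andP[y1 y2]; rewrite (le_trans xu)//= (le_trans y2).
have d z : u <= z <= v -> is_derive z 1 (fun z => N * S z) (N * Sp z).
  move=> /inx/derive_S_in dz; have := is_deriveM (is_derive_cst N z 1) dz.
  by move/is_derive_eq; apply; rewrite /GRing.scale /=; ring.
have d1 z : u <= z <= v -> is_derive z 1 (fun z : R => z) 1 by move=> _; exact: is_derive_id.
apply: (@derive_le_increment _ (fun z => z) (fun z => N * S z) (fun=> 1) (fun z => N * Sp z) u v uv
  (is_derive_within_continuous d1) (is_derive_within_continuous d)).
- by move=> z /andP[y1 y2]; apply: d; rewrite !ltW.
- move=> z _; rewrite normr1 -ler_pdivrMr ?invr_gt0// div1r invrK.
  by have /andP[] := fb_sg fb z.
Qed.

Lemma continuous_b : continuous b.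
Proof.
move=> x; apply/cvgrPdist_le => z z0; near=> y.
apply: (le_trans (fb_bL fb _ _)); rewrite mulrC -ler_pdivlMr//.
near: y; apply: cvgr_dist_le; first exact: cvg_id.
by rewrite divr_gt0.
Unshelve. all: by end_near. Qed.

Lemma b_in t : x1 < b t < x2.
Proof. by have := fb_b fb t; have := fb_rho fb; move: (b t) => y; lra. Qed.

Lemma b_in_le t : x1 <= b t <= x2.
Proof. by have /andP[y1 y2] := b_in t; rewrite !ltW. Qed.

Lemma continuous_Sb : continuous (fun t => S (b t)).
Proof.
move=> t; apply: (continuous_comp (@continuous_b t)).
exact: is_derive1_continuous (derive_S_in (b_in_le t)).
Qed.

Lemma slice (f : R * R -> R) t : continuous f -> continuous (fun x => f (t, x)).
Proof.
move=> cf; apply: continuous_pair_comp => // z; [exact: cst_continuous|exact: cvg_id].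
Qed.

(** [U] and [Ux] vanish on the boundary and U_xx is bounded above it; integrating once and, in
    [U_small], twice gives linear and quadratic growth. *)
Lemma Ux_small t x : s0 < t < s1 -> b t <= x <= x2 -> `|Ux (t, x)| <= N * (x - b t).
Proof.
move=> ht /andP[bx xx2].
have [_ _ cUx _ _] := fb_c fb.
have /andP[x1b bx2] := b_in t.
have [|_ E _] := fb_below fb ht (x := b t); first by rewrite lexx ltW.
rewrite -[Ux (t, x)]subr0 -E mulrBr.
apply: (@derive_le_increment _ (fun x => Ux (t, x)) (fun z => N * z)
  (fun x => 2 / sg x ^+ 2 * (- h (t, x) - Ut (t, x) - mu (t, x) * Ux (t, x) + r (t, x) * U (t, x)))
  (fun=> N) _ _ bx).
- by apply: continuous_subspaceT; exact: slice.
- by apply: (is_derive_within_continuous (df := fun=> N)) => z _; exact: is_derive_linear.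
- move=> z /andP[z1 z2]; have [|+ _] := fb_dUxx fb ht (x := z); last exact.
  by rewrite z1 (lt_le_trans z2).
- by move=> z _; exact: is_derive_linear.
- move=> z /andP[z1 z2]; have [|_] := fb_dUxx fb ht (x := z); last exact.
  by rewrite z1 (lt_le_trans z2).
Qed.

Lemma U_small t x : s0 < t < s1 -> b t <= x <= x2 -> `|U (t, x)| <= N * (x - b t) ^+ 2.
Proof.
move=> ht /andP[bx xx2].
have [cU _ _ _ _] := fb_c fb.
have /andP[x1b bx2] := b_in t.
have [|E _ _] := fb_below fb ht (x := b t); first by rewrite lexx ltW.
rewrite -[U (t, x)]subr0 -E expr2 mulrA [X in _ <= X]mulrBr.
apply: (@derive_le_increment _ (fun x => U (t, x)) (fun z => N * (x - b t) * z)
  (fun x => Ux (t, x)) (fun=> N * (x - b t)) _ _ bx).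
- by apply: continuous_subspaceT; exact: slice.
- by apply: (is_derive_within_continuous (df := fun=> N * (x - b t))) => z _; exact: is_derive_linear.
- move=> z /andP[z1 z2]; apply: (fb_dUx fb).
    by have /andP[y1 y2] := ht; rewrite !ltW.
  by rewrite (lt_trans x1b)//= (lt_le_trans z2).
- by move=> z _; exact: is_derive_linear.
- move=> z /andP[z1 z2]; apply: (le_trans (Ux_small ht _)).
    by rewrite (ltW z1)/= (le_trans (ltW z2)).
  by rewrite ler_pM2l// lerD2r ltW.
Qed.

(** [Ebox] bounds [exf]: the drift is at most [N], and [S] varies by at most [N] over an interval of
    length at most 1. The 7 and the fifth power in [Mbox] come from [product_error]. *)
Definition Ebox := expR (N ^+ 2).
Definition Mbox := 7 * Ebox * N ^+ 5.
Definition ccf t := m (t, b t).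
(* Multiplying by [exf] cancels the drift at the pole [(t, b t)]. *)
Definition exf t x := expR (ccf t * (S x - S (b t))).
Definition Hf t x := exf t x * h (t, x).
Definition Yf t q x := exf t x * U (t + q ^+ 2, x).
Definition Yqf t q x := exf t x * (2 * q * Ut (t + q ^+ 2, x)).
Definition Yyf t q x := exf t x * (ccf t * U (t + q ^+ 2, x) + sg x * Ux (t + q ^+ 2, x)).
(** The source of the equation solved by [exf * U] in the scale coordinate: the drift enters through
    its difference with [ccf t], and the second derivative of the exponential adds [ccf t ^+ 2 / 2]
    to the rate. *)
Definition kf t q x := exf t x * (h (t + q ^+ 2, x)
  + (m (t + q ^+ 2, x) - ccf t) * sg x * Ux (t + q ^+ 2, x)
  - (r (t + q ^+ 2, x) + ccf t ^+ 2 / 2) * U (t + q ^+ 2, x)).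

Lemma Mbox_ge : [/\ N <= Mbox, N ^+ 2 <= Mbox, Ebox * N <= Mbox & 2 * Ebox * N ^+ 2 <= Mbox].
Proof.
have N1 := fb_N fb; have N00 := ltW N0.
have E1 : 1 <= Ebox by rewrite /Ebox -expR0 ler_expR sqr_ge0.
have n1 : N <= N ^+ 5 by rewrite -[leLHS]expr1 ler_weXn2l.
have n2 : N ^+ 2 <= N ^+ 5 by rewrite ler_weXn2l.
have n5 : 0 <= N ^+ 5 by rewrite exprn_ge0.
have a1 : N ^+ 5 <= Ebox * N ^+ 5 by rewrite ler_peMl.
have a2 : Ebox * N <= Ebox * N ^+ 5 by rewrite ler_wpM2l// expR_ge0.
have a3 : Ebox * N ^+ 2 <= Ebox * N ^+ 5 by rewrite ler_wpM2l// expR_ge0.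
have e1 : Mbox = 7 * (Ebox * N ^+ 5) by rewrite /Mbox; ring.
have e2 : 2 * Ebox * N ^+ 2 = 2 * (Ebox * N ^+ 2) by ring.
rewrite e1 e2; move: (Ebox * N ^+ 5) (Ebox * N) (Ebox * N ^+ 2) (N ^+ 5) (N ^+ 2) n1 n2 n5 a1 a2 a3.
by move=> A B C D F *; split; lra.
Qed.

Lemma exf_bound t x : x1 <= x <= x2 -> 0 <= exf t x <= Ebox.
Proof.
move=> hx; rewrite /exf expR_ge0/=; apply: exp_norm_le; rewrite normrM expr2.
have [_ _ _ _ hm] := fb_bd fb (t, b t).
apply: ler_pM => //; apply: (le_trans (S_lip hx (b_in_le t))).
rewrite -[leRHS]mulr1 ler_pM2l//; have := fb_x1 fb; have /andP[y1 y2] := b_in_le t.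
by have /andP[y3 y4] := hx; rewrite ler_norml; move: (b t) y1 y2 => *; apply/andP; split; lra.
Qed.

Lemma exf_derive t x : x1 <= x <= x2 -> is_derive x 1 (exf t) (ccf t * Sp x * exf t x).
Proof.
move=> hx; have dS := derive_S_in hx.
have d1 := is_deriveM (is_derive_cst (ccf t) x 1) (is_deriveB dS (is_derive_cst (S (b t)) x 1)).
have := @is_derive1_comp R expR _ x _ _ (is_derive_expR _) d1.
by move/is_derive_eq; apply; rewrite /exf /GRing.scale /=; ring.
Qed.

Lemma exf_continuous t : {within `[x1, x2], continuous (exf t)}.
Proof.
by apply: (is_derive_within_continuous (df := fun x => ccf t * Sp x * exf t x)) => x; exact: exf_derive.
Qed.

Lemma shift_in t q Q : s0 <= t -> t + Q ^+ 2 <= s1 -> 0 < q < Q -> s0 < t + q ^+ 2 < s1.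
Proof.
move=> st tQ /andP[q0 qQ]; have q2 : 0 < q ^+ 2 by rewrite exprn_gt0.
have qq : q ^+ 2 < Q ^+ 2 by rewrite ltr_sqr ?nnegrE ?ltW// (lt_trans q0).
by move: (q ^+ 2) (Q ^+ 2) q2 qq tQ => *; apply/andP; split; lra.
Qed.

Lemma pole_box t Q : s0 <= t -> 0 < Q <= 1 -> t + Q ^+ 2 <= s1 ->
  pole x1 x2 Mbox (rho / N) S Sp Q (b t) (fun q => b (t + q ^+ 2)) (Hf t) (Yf t) (Yyf t) (Yqf t) (kf t).
Proof.
move=> st hQ tQ.
have [cU cUt cUx ch cm] := fb_c fb.
have [M1 M2 M3 M4] := Mbox_ge.
have N1 := fb_N fb; have N00 := ltW N0.
have E0 : 0 <= Ebox by exact: expR_ge0.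
have inT q : 0 < q < Q -> s0 < t + q ^+ 2 < s1 by exact: shift_in.
have wsl (f : R * R -> R) u : continuous f -> {within `[x1, x2], continuous (fun x => f (u, x))}.
  by move=> cf; apply: continuous_subspaceT; exact: slice.
have wcs : {within `[x1, x2], continuous sg}.
  by apply: continuous_subspaceT; exact: (fb_csg fb).
have hcc : `|ccf t| <= N by have [_ _ _ _] := fb_bd fb (t, b t).
have bdE x z k : x1 <= x <= x2 -> `|z| <= k -> Ebox * k <= Mbox -> `|exf t x * z| <= Mbox.
  move=> hx hz; apply: le_trans; have /andP[ex0 exE] := exf_bound t hx.
  by rewrite normrM (ger0_norm ex0); apply: ler_pM.
have sgN x : `|sg x| <= N by have /andP[_] := fb_sg fb x; rewrite (gtr0_norm (sgp x)).
split.
- by [].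
- exact: b_in.
(* The boundary is at distance at least [rho] from [x2], and [S] expands lengths by at least 1/N. *)
- have /andP[_ hb2] := fb_b fb t; have bi := b_in_le t.
  have x2i : x1 <= x2 <= x2 by rewrite lexx ltW ?(fb_x fb).
  rewrite ler_pdivrMr// mulrC -[S x2 - S (b t)]ger0_norm.
    apply: le_trans (S_expand x2i bi); apply: le_trans (ler_norm _); rewrite lerBrDl -lerBrDr.
    exact: hb2.
  rewrite subr_ge0; have /andP[b1 b2] := bi.
  by apply: (S_mono derive_S_in (fun x _ => Sp_bound x)).
- by move=> q _; exact: b_in.
- move=> q _; apply: (le_trans (S_lip (b_in_le _) (b_in_le _))).
  apply: (@le_trans _ _ (N ^+ 2 * q ^+ 2)); last by rewrite ler_wpM2r ?sqr_ge0.
  rewrite [N ^+ 2]expr2 -mulrA ler_pM2l//; apply: (le_trans (fb_bL fb _ _)).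
  by rewrite addrAC subrr add0r ger0_norm ?sqr_ge0.
- by apply: continuous_subspaceT; exact: shift_sq_continuous continuous_Sb.
- move=> x; apply: cvgM; first exact: exf_continuous.
  exact: wsl.
- move=> x hx; apply: (bdE _ _ N) => //.
  by have [_ _ _ + _] := fb_bd fb (t, x).
- move=> q _ x; apply: cvgM; first exact: exf_continuous.
  exact: wsl.
- move=> q _ x; apply: cvgM; first exact: exf_continuous.
  apply: cvgD; first by apply: cvgM; [exact: cvg_cst|exact: wsl].
  by apply: cvgM; [exact: wcs|exact: wsl].
- move=> q _ x; apply: cvgM; first exact: exf_continuous.
  by apply: cvgM; [exact: cvg_cst|exact: wsl].
- move=> q x /andP[q0 qQ] hx; have [u1 u2 u3 _ _] := fb_bd fb (t + q ^+ 2, x).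
  have q1 : q <= 1 by have /andP[_] := hQ; apply: le_trans; exact: ltW.
  have e1 : Ebox * (2 * N ^+ 2) = 2 * Ebox * N ^+ 2 by ring.
  have N2 : N <= N ^+ 2 by rewrite expr2 ler_peMl.
  split.
  + exact: (bdE _ _ N).
  + apply: (bdE _ _ (2 * N ^+ 2)) => //; last by rewrite e1.
    apply: (le_trans (ler_normD _ _)); rewrite !normrM.
    have : `|ccf t| * `|U (t + q ^+ 2, x)| <= N * N by apply: ler_pM.
    have : `|sg x| * `|Ux (t + q ^+ 2, x)| <= N * N by apply: ler_pM.
    by rewrite [N ^+ 2]expr2; move: (_ * `|U _|) (_ * `|Ux _|) (N * N) => *; lra.
  + apply: (bdE _ _ (2 * N ^+ 2)) => //; last by rewrite e1.
    rewrite -[2 * q * _]mulrA normrM normr_nat ler_pM2l// normrM.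
    rewrite (gtr0_norm q0) -[leRHS]mul1r; apply: ler_pM => //; first exact: ltW.
    exact: le_trans N2.
- move=> q x hq hx; have d1 := fb_dUt fb (inT q hq) hx.
  have d2 : is_derive q 1 (fun q : R => t + q ^+ 2) (2 * q).
    have := is_deriveD (is_derive_cst t q 1) (is_derive_sqr q).
    by move/is_derive_eq; apply; rewrite add0r.
  have d3 := @is_derive1_comp R (fun s => U (s, x)) (fun q : R => t + q ^+ 2) q _ _ d1 d2.
  have := is_deriveM (is_derive_cst (exf t x) q 1) d3.
  by move/is_derive_eq; apply; rewrite /Yqf /GRing.scale /=; ring.
- move=> q x hq hx; have [z1 z2 z3] := fb_below fb (inT q hq) hx.
  by rewrite /Yf /Yyf /Yqf z1 z2 z3 !mulr0 addr0 mulr0.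
- move=> q x hq /andP[bx xx2]; have /andP[x1b bx2] := b_in (t + q ^+ 2).
  have hx : x1 <= x <= x2 by rewrite !ltW// (lt_trans x1b).
  have tle : s0 <= t + q ^+ 2 <= s1 by have /andP[z1 z2] := inT q hq; rewrite !ltW.
  have xin : x1 < x < x2 by rewrite xx2 (lt_trans x1b).
  have := is_deriveM (exf_derive t hx) (fb_dUx fb tle xin).
  move/is_derive_eq; apply; rewrite /Yyf /Sp /GRing.scale /=; field.
  by rewrite gt_eqF.
- move=> q x hq hbx; have /andP[bx xx2] := hbx; have /andP[x1b bx2] := b_in (t + q ^+ 2).
  have hx : x1 <= x <= x2 by rewrite !ltW// (lt_trans x1b).
  have tle : s0 <= t + q ^+ 2 <= s1 by have /andP[z1 z2] := inT q hq; rewrite !ltW.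
  have xin : x1 < x < x2 by rewrite xx2 (lt_trans x1b).
  have [dUxx _] := fb_dUxx fb (inT q hq) hbx.
  have dU := fb_dUx fb tle xin.
  have dsg := fb_dsg fb xin.
  have := is_deriveM (exf_derive t hx)
    (is_deriveD (is_deriveM (is_derive_cst (ccf t) x 1) dU) (is_deriveM dsg dUxx)).
  (* Writing [mu] as sg m + sg sg1 / 2 cancels the term that the derivative of [sg] produces in the
     scale coordinate. *)
  move/is_derive_eq; apply; rewrite /Yqf /kf /Sp (fb_mu fb (inT q hq) xin) /GRing.scale /=.
  have q0 : q != 0 by have /andP[q0 _] := hq; rewrite gt_eqF.
  have sg0 : sg x != 0 by rewrite gt_eqF.
  rewrite -[(_ + sg * _) x]/(ccf t * U (t + q ^+ 2, x) + sg x * Ux (t + q ^+ 2, x)).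
  move: (U _) (Ux _) (Ut _) (h _) (m _) (r _) (ccf t) (exf t x) (sg x) sg0 (sg1 x).
  by move=> u0 u1 u2 u3 u4 u5 u6 u7 u8 sg0 u9; field; rewrite q0 sg0.
- move=> q hq; have /andP[x1b bx2] := b_in (t + q ^+ 2).
  have sub : `[b (t + q ^+ 2), x2] `<=` `[x1, x2]%classic.
    by move=> z /=; rewrite !in_itv/= => /andP[z1 ->]; rewrite (le_trans (ltW x1b)).
  apply: continuous_subspaceW sub _ => x; apply: cvgM; first exact: exf_continuous.
  apply: cvgB; first apply: cvgD.
  + exact: wsl.
  + apply: cvgM (wsl _ _ cUx x); apply: cvgM (wcs x).
    by apply: cvgB (wsl _ _ cm x) _; exact: cvg_cst.
  + apply: cvgM (wsl _ _ cU x); apply: cvgD (wsl _ _ (fb_cr fb) x) _.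
    exact: cvg_cst.
- move=> q x hq hx; have /andP[bx xx2] := hx; have /andP[q0 qQ] := hq.
  have hx' : x1 <= x <= x2 by rewrite xx2 andbT; have /andP[y1 _] := b_in (t + q ^+ 2); exact: le_trans (ltW y1) bx.
  have q1 : q <= 1 by have /andP[_] := hQ; apply: le_trans; exact: ltW.
  have tle : s0 <= t + q ^+ 2 <= s1 by have /andP[z1 z2] := inT q hq; rewrite !ltW.
  have t01 : s0 <= t <= s1.
    by rewrite st; have /andP[_] := tle; apply: le_trans; rewrite lerDl sqr_ge0.
  have tt : `|t + q ^+ 2 - t| = q ^+ 2 by rewrite addrC addKr ger0_norm ?sqr_ge0.
  rewrite /kf /Hf -mulrBr -[(S x - _) ^+ 2]real_normK ?num_real//.
  have perm (z1 z2 z3 z4 : R) : z1 + z2 - z3 - z4 = z1 - z4 + z2 - z3 by ring.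
  rewrite perm.
  apply: (@product_error _ _ _ _ _ _ _ _ _ _ _ _ _ `|x - b t| (x - b (t + q ^+ 2))) => //.
  + exact: exf_bound.
  + by rewrite sqr_ge0 exprn_ile1// ltW.
  + exact: S_expand hx' (b_in_le t).
  + by rewrite subr_ge0.
  + have : b t - b (t + q ^+ 2) <= N * q ^+ 2.
      by apply: (le_trans (ler_norm _)); rewrite distrC -[X in _ <= N * X]tt; exact: (fb_bL fb).
    have := ler_norm (x - b t); move: (`|x - b t|) (b t) (b _) (N * _) => *; lra.
  + by rewrite -[X in _ <= N * X]tt; exact: (fb_hL fb).
  + rewrite -[X in _ <= N * (X + _)]tt; exact: (fb_mL fb tle hx' t01 (b_in_le t)).
  + exact: Ux_small (inT q hq) hx.
  + exact: (fb_rN fb).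
  + exact: U_small (inT q hq) hx.
Qed.

End box.

Lemma continuous_on_fst (R : realType) (f : R -> R) : continuous f -> continuous (fun p : R * R => f p.1).
Proof. by move=> cf p; apply: (continuous_comp (f := fst) (g := f)); [exact: cvg_fst|exact: cf]. Qed.

Lemma continuous_on_snd (R : realType) (f : R -> R) : continuous f -> continuous (fun p : R * R => f p.2).
Proof. by move=> cf p; apply: (continuous_comp (f := snd) (g := f)); [exact: cvg_snd|exact: cf]. Qed.

(** * Uniform closeness of short slopes *)

Section cauchy.
Variable R : realType.
Local Notation leb := (@lebesgue_measure R).
Implicit Types (q e x t s : R).
Variables (N s0 s1 x1 x2 rho : R) (b : R -> R) (U Ut Ux h m mu r : R * R -> R) (sg sg1 : R -> R).
Hypothesis fb : fbox N s0 s1 x1 x2 rho b U Ut Ux h m mu r sg sg1.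

Let N0 : 0 < N := lt_le_trans ltr01 (fb_N fb).
Let x12 : x1 < x2 := fb_x fb.
Local Notation S := (S x1 sg).
Local Notation Sp := (Sp sg).
Local Notation Mb := (Mbox N).

(** Where [sg] is close to [sg0], the scale is nearly affine of slope 1/sg0: this leads back from
    slopes of S(b) to slopes of b. *)
Lemma S_linear c w d sg0 x y :
  (forall z, x1 <= z <= x2 -> `|z - c| <= d -> `|sg z - sg0| <= w) ->
  x1 <= x <= x2 -> x1 <= y <= x2 -> `|x - c| <= d -> `|y - c| <= d ->
  `|(y - x) - sg0 * (S y - S x)| <= w * N * `|y - x|.
Proof.
move=> hw.
suff main u v : x1 <= u -> u <= v -> v <= x2 -> `|u - c| <= d -> `|v - c| <= d ->
    `|(v - u) - sg0 * (S v - S u)| <= w * N * (v - u).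
  move=> /andP[x1x xx2] /andP[x1y yx2] xc yc; have [xy|/ltW yx] := leP x y.
    by rewrite [`|y - x|]ger0_norm ?subr_ge0// main.
  rewrite -normrN opprB [`|y - x|]distrC [`|x - y|]ger0_norm ?subr_ge0//.
  have -> : sg0 * (S y - S x) - (y - x) = (x - y) - sg0 * (S x - S y) by ring.
  exact: main.
move=> xu uv vx uc vc.
pose F z := z - sg0 * S z.
have -> : v - u - sg0 * (S v - S u) = F v - F u by rewrite /F; ring.
rewrite mulrBr.
have inx z : u <= z <= v -> x1 <= z <= x2.
  by move=> /andP[y1 y2]; rewrite (le_trans xu)//= (le_trans y2).
have dF z : u <= z <= v -> is_derive z 1 F (1 - sg0 * Sp z).
  move=> /inx hz; have dS := derive_S_in fb hz.
  have := is_deriveB (is_derive_id z 1) (is_deriveM (is_derive_cst sg0 z 1) dS).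
  by move/is_derive_eq; apply; rewrite /GRing.scale /=; ring.
have dG z : u <= z <= v -> is_derive z 1 (fun z => w * N * z) (w * N).
  by move=> _; exact: is_derive_linear.
apply: (@derive_le_increment _ F (fun z => w * N * z) (fun z => 1 - sg0 * Sp z) (fun=> w * N) u v uv
  (is_derive_within_continuous dF) (is_derive_within_continuous dG)).
- by move=> z /andP[y1 y2]; apply: dF; rewrite !ltW.
- by move=> z _; exact: is_derive_linear.
- move=> z /andP[y1 y2]; have hz : u <= z <= v by rewrite !ltW.
  have sgz : 0 < sg z by have /andP[+ _] := fb_sg fb z; apply: lt_le_trans; rewrite invr_gt0.
  have -> : 1 - sg0 * Sp z = (sg z - sg0) * Sp z by rewrite /Sp; field; rewrite gt_eqF.
  have /andP[p0 pN] := Sp_bound fb z; rewrite normrM (ger0_norm p0); apply: ler_pM => //.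
  apply: hw; first exact: inx.
  by move: uc vc; rewrite !ler_norml => /andP[? ?] /andP[? ?]; apply/andP; split; lra.
Qed.

Lemma beta_lip t s : `|S (b t) - S (b s)| <= N ^+ 2 * `|t - s|.
Proof.
apply: (le_trans (S_lip fb (b_in_le fb t) (b_in_le fb s))).
by rewrite expr2 -mulrA ler_pM2l// (fb_bL fb).
Qed.

(** Trades a lower limit that moves with the boundary for a fixed one, so that continuity in time is
    that of a parameter integral. *)
Lemma integral_tail (f : R -> R) c : x1 <= c <= x2 -> {within `[x1, x2], continuous f} ->
  \int[leb]_(x in `[c, x2]) f x = \int[leb]_(x in `[x1, x2]) f (Num.max x c) - (c - x1) * f c.
Proof.
move=> /andP[xc cx] cf.
have cmax : continuous (fun x => Num.max x c).
  move=> x; have := @continuous_max _ _ id (cst c) x (fun A hA => hA) (@cst_continuous _ _ c x).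
  exact.
have cf' : {within `[x1, x2], continuous (fun x => f (Num.max x c))}.
  apply: subspace_continuousPe => x hx e e0.
  have hmx z : x1 <= z <= x2 -> x1 <= Num.max z c <= x2.
    by move=> /andP[y1 y2]; rewrite le_max y1 ge_max y2 cx.
  have hx' : `[x1, x2]%classic (Num.max x c).
    by rewrite /= in_itv/=; apply: hmx; move: hx; rewrite /= in_itv.
  have [d d0 hd] := subspace_cvg cf hx' e0.
  exists d => // y hy yx; apply: hd; first by rewrite /= in_itv/=; apply: hmx; move: hy; rewrite /= in_itv.
  apply: le_lt_trans yx; rewrite /Num.max.
  case: ifPn => h1; case: ifPn => h2; rewrite ?subrr ?normr0//.
    by rewrite -leNgt in h2; rewrite distrC [`|y - x|]distrC !ger0_norm; lra.
  by rewrite -leNgt in h1; rewrite !ger0_norm; lra.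
rewrite (integral_chasles xc cx cf').
have -> : \int[leb]_(u in `[x1, c]) f (Num.max u c) = (c - x1) * f c.
  transitivity (\int[leb]_(u in `[x1, c]) (cst (f c) u)).
    by apply: eq_Rintegral => x; rewrite inE/= in_itv/= => /andP[_ xc']; rewrite max_r.
  have cc : {within `[x1, c], continuous (cst (f c))} by move=> z; exact: cst_continuous.
  have dc z : x1 < z < c -> is_derive z 1 (fun z => f c * z) (cst (f c) z).
    by move=> _; exact: is_derive_linear.
  have cl : {within `[x1, c], continuous (fun z => f c * z)}.
    by apply: (is_derive_within_continuous (df := cst (f c))) => z _; exact: is_derive_linear.
  by rewrite (integral_increment xc cc cl dc); ring.
rewrite [X in X - _]addrC addrK; apply: eq_Rintegral => x; rewrite inE/= in_itv/= => /andP[cx' _].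
by rewrite max_l.
Qed.

Local Notation Sc x := (S (clamp x1 x2 x)).

Lemma continuous_Sc : continuous (fun x => Sc x).
Proof.
move=> x; apply: (continuous_comp (@continuous_clamp R x1 x2 x)).
exact: is_derive1_continuous (derive_S_in fb (clamp_in x (ltW x12))).
Qed.

Definition heat Q t := Epole x1 x2 S Sp (b t) (Hf x1 b h m sg t) (Yf x1 b U m sg t) 0 Q.

(** For a positive [Q] the kernel has no singularity, and once the limits are fixed by
    [integral_tail] the integrands are jointly continuous. *)
Lemma heat_continuous Q : 0 < Q -> continuous (heat Q).
Proof.
move=> Q0; have [cU _ _ ch cm] := fb_c fb.
have cfst : continuous (fst : R * R -> R) by move=> p; exact: cvg_fst.
have csnd : continuous (snd : R * R -> R) by move=> p; exact: cvg_snd.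
have cb := continuous_b fb.
have ccc : continuous (fun t => m (t, b t)).
  by apply: continuous_pair_comp => // z; exact: cvg_id.
pose ar (p : R * R) := Sc p.2 - S (b p.1).
have car : continuous ar.
  move=> p; apply: cvgB.
    exact: (continuous_on_snd continuous_Sc).
  exact: (continuous_on_fst (continuous_Sb fb)).
pose ex (p : R * R) := expR (m (p.1, b p.1) * ar p).
have cex : continuous ex.
  move=> p; apply: (continuous_comp (f := fun p => m (p.1, b p.1) * ar p)); last exact: continuous_expR.
  by apply: cvgM; [exact: (continuous_on_fst ccc)|exact: car].
have ck n (p : {poly R}) : continuous (fun z : R * R => kern n p Q (ar z)).
  move=> z; apply: (continuous_comp (car z)); apply: kern_continuous_u; rewrite gt_eqF//.
have cSp : continuous (fun z : R * R => Sp z.2).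
  exact: (continuous_on_snd (continuous_Sp fb)).
pose f1 (p : R * R) := ex p * U (p.1 + Q ^+ 2, p.2) * psi Q (ar p) * Sp p.2.
pose f2 (p : R * R) := ex p * h p * phi Q (ar p) * Sp p.2.
have c1 : continuous f1.
  move=> p; apply: cvgM (cSp p); apply: cvgM (ck _ _ p); apply: cvgM (cex p) _.
  apply: (continuous_comp (f := fun p : R * R => (p.1 + Q ^+ 2, p.2))); last exact: cU.
  apply: continuous_pair => // z; apply: cvgD; [exact: cfst|exact: cvg_cst].
have c2 : continuous f2.
  by move=> p; apply: cvgM (cSp p); apply: cvgM (ck _ _ p); apply: cvgM (cex p) (ch p).
pose f3 (p : R * R) := f2 (p.1, Num.max p.2 (b p.1)).
have c3 : continuous f3.
  move=> p; apply: (continuous_comp (f := fun p : R * R => (p.1, Num.max p.2 (b p.1)))); last exact: c2.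
  apply: continuous_pair => // z.
  have cb1 : {for z, continuous (fun z : R * R => b z.1)} by exact: (continuous_on_fst cb).
  exact: (@continuous_max _ _ snd (fun z : R * R => b z.1) z (csnd z) cb1).
have E : heat Q = fun t => \int[leb]_(x in `[x1, x2]) f1 (t, x)
    + (\int[leb]_(x in `[x1, x2]) f3 (t, x) - (b t - x1) * f2 (t, b t)).
  apply/funext => t; rewrite /heat /Epole; apply: (f_equal2 (fun y z => y + z)).
    apply: eq_Rintegral => x; rewrite inE/= in_itv/= => hx.
    by rewrite /f1 /Yf /ex /exf /ccf /arg /ar /= (clamp_id hx) addr0.
  have bi := b_in_le fb t.
  rewrite -(@integral_tail (fun x => f2 (t, x)) (b t) bi); last first.
    by apply: continuous_subspaceT; exact: slice.
  apply: eq_Rintegral => x; rewrite inE/= in_itv/= => /andP[y1 y2].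
  have hx : x1 <= x <= x2 by rewrite y2 andbT; have /andP[z1 _] := bi; exact: le_trans z1 y1.
  by rewrite /f2 /Hf /ex /exf /ccf /arg /ar /= (clamp_id hx) addr0.
rewrite E => t; apply: cvgD; first exact: (param_integral_continuous (ltW x12) c1).
apply: cvgB; first exact: (param_integral_continuous (ltW x12) c3).
apply: cvgM; first by apply: cvgB; [exact: cb|exact: cvg_cst].
by apply: (continuous_pair_comp c2) => // z; exact: cvg_id.
Qed.

Lemma source_modulus t0 w : 0 < w -> exists2 d, 0 < d &
  forall t x, `|t - t0| <= d -> x1 <= x <= x2 -> `|x - b t| <= d ->
    `|Hf x1 b h m sg t x - Hf x1 b h m sg t (b t)| <= w.
Proof.
move=> w0; have [_ _ _ ch cm] := fb_c fb.
have cb := continuous_b fb.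
have ccc : continuous (fun t => m (t, b t)).
  by apply: continuous_pair_comp => // z; exact: cvg_id.
pose HH (p : R * R) := expR (m (p.1, b p.1) * (Sc p.2 - S (b p.1))) * h p.
have cHH : continuous HH.
  move=> p; apply: cvgM (ch p).
  apply: (continuous_comp (f := fun p => m (p.1, b p.1) * (Sc p.2 - S (b p.1)))); last exact: continuous_expR.
  apply: cvgM; first exact: (continuous_on_fst ccc).
  apply: cvgB; first exact: (continuous_on_snd continuous_Sc).
  exact: (continuous_on_fst (continuous_Sb fb)).
have HE t x : x1 <= x <= x2 -> Hf x1 b h m sg t x = HH (t, x).
  by move=> hx; rewrite /Hf /exf /ccf /HH /= (clamp_id hx).
have w2 : 0 < w / 2 by rewrite divr_gt0.
have /cvgrPdist_le/(_ _ w2) := cHH (t0, b t0).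
move=> [[U1 U2] /= [[d1 /= d10 U1s] [d2 /= d20 U2s]] hU].
have N2 : 0 < 2 * (N + 1) by rewrite mulr_gt0// addr_gt0.
exists (Num.min (d1 / 2) (d2 / (2 * (N + 1)))); first by rewrite lt_min !divr_gt0.
move=> t x; rewrite !le_min => /andP[t1 t2] hx /andP[_ x2'].
have close y : x1 <= y <= x2 -> `|y - b t| <= d2 / (2 * (N + 1)) -> `|HH (t0, b t0) - HH (t, y)| <= w / 2.
  move=> hy yb; apply: (hU (t, y)); split => /=.
    apply: U1s => /=; rewrite distrC; apply: (le_lt_trans t1).
    by rewrite ltr_pdivrMr// ltr_pMr// ltr1n.
  apply: U2s => /=; rewrite distrC -(subrK (b t) y) -addrA.
  apply: (le_lt_trans (ler_normD _ _)).
  apply: (@le_lt_trans _ _ (d2 / (2 * (N + 1)) + N * (d2 / (2 * (N + 1))))).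
    apply: lerD => //; apply: (le_trans (fb_bL fb _ _)); by rewrite ler_pM2l.
  have -> : d2 / (2 * (N + 1)) + N * (d2 / (2 * (N + 1))) = d2 / 2.
    by field; rewrite gt_eqF// addr_gt0.
  by rewrite ltr_pdivrMr// ltr_pMr// ltr1n.
have bi := b_in_le fb t.
rewrite !HE// -(subrK (HH (t0, b t0)) (HH (t, x))) -addrA.
apply: (le_trans (ler_normD _ _)); have -> : w = w / 2 + w / 2 by field.
apply: lerD; first by rewrite distrC; exact: close.
by apply: close => //; rewrite subrr normr0 divr_ge0// ltW.
Qed.

(** [pole_estimate] identifies [smear] times h(t, b(t)) with the potential, hence with [heat Q] up
    to small errors, and the quotient of [heat Q] by h is continuous in t. The accuracy [w] is
    chosen first, then [Q], then [e0], whose constant [C3] contains negative powers of [Q]. *)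
Lemma smear_oscillation t0 g : s0 <= t0 < s1 -> 0 < g ->
  exists Q e0 d : R, [/\ 0 < Q, 0 < e0, 0 < d &
    forall e x y, 0 < e -> e < e0 -> s0 <= x <= s1 -> s0 <= y <= s1 ->
      `|x - t0| <= d -> `|y - t0| <= d ->
      `|smear (fun t => S (b t)) Q e x - smear (fun t => S (b t)) Q e y| <= g].
Proof.
move=> /andP[st ts] g0.
have [K hK] := kernel_constant_exists R; have K0 := kc_ge0 hK.
have N1 := fb_N fb.
have [M1 _ _ _] := Mbox_ge fb.
have M0 : 0 <= Mb := le_trans (ltW N0) M1.
pose a := rho / N; have a0 : 0 < a by rewrite divr_gt0// (fb_rho fb).
pose C1 := pole_constant K Mb a; have C10 : 0 <= C1 by exact: pole_constant_ge0.
pose C2 := Mb * K * pi; have C20 : 0 <= C2 by apply: mulr_ge0 (pi_ge0 _); exact: mulr_ge0.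
(* Budget: at each of the two points, three errors of g/8 and g/8 for the continuity of the main
   term. [N] bounds the inverse of |h|. *)
have frac c : 0 <= c -> 0 < g / (8 * N * (c + 1)) /\ N * (c * (g / (8 * N * (c + 1)))) <= g / 8.
  move=> c0; have c1 : 0 < c + 1 by rewrite ltr_wpDl.
  split; first by rewrite divr_gt0// !mulr_gt0.
  have -> : N * (c * (g / (8 * N * (c + 1)))) = g / 8 * (c / (c + 1)).
    by field; rewrite !gt_eqF.
  by rewrite ler_piMr ?divr_ge0 ?(ltW g0)// ler_pdivrMr// mul1r lerDl.
pose w := g / (8 * N * (C2 + 1)); have [w0 wN] := frac C2 C20.
have [d2 d20 hd2] := source_modulus t0 w0.
pose d1 := (s1 - t0) / 2; have d10 : 0 < d1 by rewrite /d1; lra.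
pose Qm := Num.min 1 d1.
have Qm0 : 0 < Qm by rewrite lt_min ltr01.
have Qm1 : Qm <= 1 by rewrite ge_min lexx.
have Qm2 : Qm ^+ 2 <= d1.
  apply: (@le_trans _ _ Qm); last by rewrite ge_min lexx orbT.
  by rewrite expr2 ler_piMr// ltW.
have NM : 0 < N * Mb + 1 by apply: ltr_wpDl => //; exact: mulr_ge0 (ltW N0) M0.
pose Q := Num.min (Qm / 2) (Num.min (d2 / (N * Mb + 1)) (g / (8 * N * (C1 + 1)))).
have [q0 qN] := frac C1 C10.
have Q0 : 0 < Q by rewrite !lt_min q0 andbT (divr_gt0 Qm0)// (divr_gt0 d20).
have QQm : Q < Qm by apply: (@le_lt_trans _ _ (Qm / 2)); [rewrite ge_min lexx|lra].
have Q1 : Q <= 1 := le_trans (ltW QQm) Qm1.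
have Qd2 : N * (Mb * Q ^+ 2) <= d2.
  have h1 : Q <= d2 / (N * Mb + 1) by rewrite !ge_min lexx orbT.
  rewrite ler_pdivlMr// in h1; apply: le_trans h1.
  rewrite mulrA mulrC; apply: ler_pM; [exact: sqr_ge0|exact: mulr_ge0 (ltW N0) M0| |by rewrite lerDl].
  by rewrite expr2 ler_piMr// ltW.
have QC1 : N * (C1 * Q) <= g / 8.
  by apply: le_trans qN; rewrite ler_pM2l// ler_wpM2l// !ge_min lexx !orbT.
pose C3 := Mb * (K * Q ^- 5) * Mb * (x2 - x1) + Mb * (K * Q ^- 3) * Mb * (x2 - x1).
have C30 : 0 <= C3.
  have tri (n : nat) : 0 <= Mb * (K * Q ^- n) * Mb * (x2 - x1).
    have z0 : 0 <= Q ^- n by rewrite invr_ge0 exprn_ge0 ?ltW.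
    have x0 : 0 <= x2 - x1 by rewrite subr_ge0 ltW.
    exact: (mulr_ge0 (mulr_ge0 (mulr_ge0 M0 (mulr_ge0 K0 z0)) M0) x0).
  exact: addr_ge0.
pose e0 := g / (8 * N * (C3 + 1)); have [e00 eN] := frac C3 C30.
pose A t := heat Q t / h (t, b t).
have hneg t : h (t, b t) < 0.
  by apply: (le_lt_trans (fb_h0 fb _)); rewrite oppr_lt0 invr_gt0.
have cA : continuous A.
  have [_ _ _ ch _] := fb_c fb; have cb := continuous_b fb.
  move=> t; apply: cvgM; first exact: heat_continuous.
  apply: cvgV; first by rewrite lt_eqF.
  by apply: (continuous_pair_comp ch) => // z; exact: cvg_id.
have g8 : 0 < g / 8 by rewrite divr_gt0.
have /cvgrPdist_le/(_ _ g8) [d3 /= d30 hd3] := cA t0.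
exists Q; exists e0; exists (Num.min d1 (Num.min d2 (d3 / 2))); split => //.
  by rewrite !lt_min d10 d20 divr_gt0.
have key e x : 0 < e -> e < e0 -> s0 <= x <= s1 -> `|x - t0| <= Num.min d1 (Num.min d2 (d3 / 2)) ->
    `|A x - smear (fun t => S (b t)) Q e x| <= 3 * (g / 8).
  move=> e_0 ee /andP[sx xs]; rewrite !le_min => /andP[xd1 /andP[xd2 _]].
  have xQ : x + Qm ^+ 2 <= s1.
    move: xd1; rewrite ler_norml => /andP[_]; rewrite /d1 in Qm2 *.
    by move: (Qm ^+ 2) Qm2 => *; lra.
  have Qm01 : 0 < Qm <= 1 by rewrite Qm0.
  have hp := pole_box fb sx Qm01 xQ.
  have Qin : 0 < Q < Qm by rewrite Q0.
  have hw z : x1 <= z <= x2 -> `|S z - S (b x)| <= Mb * Q ^+ 2 ->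
      `|Hf x1 b h m sg x z - Hf x1 b h m sg x (b x)| <= w.
    move=> hz hS; apply: hd2 => //; apply: (le_trans (S_expand fb hz (b_in_le fb x))).
    by apply: le_trans Qd2; rewrite ler_pM2l.
  have SpM z : x1 <= z <= x2 -> 0 <= Sp z <= Mb.
    by move=> _; have /andP[-> y] := Sp_bound fb z; exact: le_trans M1.
  have cSp : {within `[x1, x2], continuous Sp}.
    by apply: continuous_subspaceT; exact: (continuous_Sp fb).
  have est := pole_estimate hK x12 a0 M0 (derive_S_in fb) cSp SpM hp Qin e_0 hw.
  have shf := Epole_shift hK x12 (derive_S_in fb) cSp SpM hp Qin (ltW e_0).
  have h0 : Hf x1 b h m sg x (b x) = h (x, b x) by rewrite /Hf /exf subrr mulr0 expR0 mul1r.
  rewrite h0 in est; set Sm := (X in h (x, b x) * X) in est.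
  rewrite -[smear _ _ _ _]/Sm.
  have hinv : `|(h (x, b x))^-1| <= N.
    rewrite normfV -[leRHS]invrK lef_pV2 ?posrE ?invr_gt0 ?normr_gt0 ?lt_eqF//.
    by rewrite ltr0_norm// lerNr; exact: (fb_h0 fb).
  have -> : A x - Sm = (h (x, b x))^-1 * (heat Q x - h (x, b x) * Sm).
    by rewrite /A; field; rewrite lt_eqF.
  rewrite normrM; apply: (@le_trans _ _ (N * (C1 * Q + C2 * w + C3 * e))).
    apply: ler_pM => //; rewrite -(subrK (Epole x1 x2 S Sp (b x) (Hf x1 b h m sg x) (Yf x1 b U m sg x) e Q) (heat Q x)).
    rewrite -addrA addrC; apply: (le_trans (ler_normD _ _)); apply: lerD.
      by apply: (le_trans est); rewrite lerD2l /C2; rewrite le_eqVlt; apply/orP; left; apply/eqP; ring.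
    rewrite distrC; apply: (le_trans shf); rewrite ler_wpM2r ?(ltW e_0)// lerD2l.
    have z0 : 0 <= Q ^- 3 by rewrite invr_ge0 exprn_ge0 ?ltW.
    apply: (ler_wpM2l (mulr_ge0 (mulr_ge0 M0 (mulr_ge0 K0 z0)) M0)).
    by rewrite lerD2l lerN2; have /andP[] := b_in_le fb x.
  have h3 : N * (C3 * e) <= g / 8 by apply: le_trans eN; rewrite ler_pM2l// ler_wpM2l// ltW.
  rewrite !mulrDr; move: (N * (C1 * Q)) (N * (C2 * w)) (N * (C3 * e)) QC1 wN h3.
  by move=> z1 z2 z3 *; lra.
move=> e x y e_0 ee hx hy xt yt.
have Anear z : `|z - t0| <= Num.min d1 (Num.min d2 (d3 / 2)) -> `|A t0 - A z| <= g / 8.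
  rewrite !le_min => /andP[_ /andP[_ hz]]; apply: hd3 => /=; rewrite distrC.
  by apply: (le_lt_trans hz); rewrite ltr_pdivrMr// ltr_pMr// ltr1n.
have k1 := key e x e_0 ee hx xt; have k2 := key e y e_0 ee hy yt.
have k3 := Anear x xt; have k4 := Anear y yt.
move: k1 k2 k3 k4; move: (A x) (A y) (A t0) (smear _ _ _ x) (smear _ _ _ y) => u v z p q.
rewrite !ler_norml => /andP[? ?] /andP[? ?] /andP[? ?] /andP[? ?].
by apply/andP; split; lra.
Qed.

Lemma slopes_cauchy t0 g : s0 <= t0 < s1 -> 0 < g ->
  exists2 d, 0 < d & forall t s u v, s0 <= t -> t < s -> s <= s1 -> s0 <= u -> u < v -> v <= s1 ->
    `|t - t0| <= d -> `|s - t0| <= d -> `|u - t0| <= d -> `|v - t0| <= d ->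
    `|(b s - b t) / (s - t) - (b v - b u) / (v - u)| <= g.
Proof.
move=> ht0 g0; have N1 := fb_N fb.
(* Budget: g/2 for slopes of S(b), after the factors exp(2) from [slopes_close] and sg <= N, and g/4
   for each of the two linearisations of [S]. *)
pose g1 := g / (2 * N * expR 2).
have g10 : 0 < g1 by rewrite divr_gt0// !mulr_gt0 ?expR_gt0.
have [Q [e0 [d1 [Q0 e00 d10 osc]]]] := smear_oscillation ht0 g10.
pose w := g / (4 * N ^+ 2).
have w0 : 0 < w by rewrite divr_gt0// mulr_gt0// exprn_gt0.
have csg := fb_csg fb.
have /cvgrPdist_le/(_ _ w0) [d2 /= d20 hd2] := csg (b t0).
pose d := Num.min d1 (d2 / (2 * N)).
exists d; first by rewrite lt_min d10 divr_gt0// mulr_gt0.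
move=> t s u v s0t ts ss1 s0u uv vs1 td sd ud vd.
have hw z : x1 <= z <= x2 -> `|z - b t0| <= N * d -> `|sg z - sg (b t0)| <= w.
  move=> _ hz; rewrite distrC; apply: hd2 => /=; rewrite distrC; apply: (le_lt_trans hz).
  apply: (@le_lt_trans _ _ (N * (d2 / (2 * N)))); first by rewrite ler_pM2l// ge_min lexx orbT.
  have -> : N * (d2 / (2 * N)) = d2 / 2 by field; rewrite gt_eqF.
  lra.
have bd z : `|z - t0| <= d -> `|b z - b t0| <= N * d.
  by move=> hz; apply: (le_trans (fb_bL fb _ _)); rewrite ler_pM2l.
have lin y z : y < z -> `|y - t0| <= d -> `|z - t0| <= d ->
    `|(b z - b y) / (z - y) - sg (b t0) * ((S (b z) - S (b y)) / (z - y))| <= w * N ^+ 2.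
  move=> yz yd zd; have zy : 0 < z - y by rewrite subr_gt0.
  have := S_linear hw (b_in_le fb y) (b_in_le fb z) (bd y yd) (bd z zd).
  have -> : (b z - b y) / (z - y) - sg (b t0) * ((S (b z) - S (b y)) / (z - y))
    = (b z - b y - sg (b t0) * (S (b z) - S (b y))) / (z - y) by ring.
  rewrite normrM normfV (gtr0_norm zy) ler_pdivrMr// => /le_trans; apply.
  rewrite [N ^+ 2]expr2 mulrA -[leRHS]mulrA; apply: ler_wpM2l; first by rewrite mulr_ge0// ltW.
  by apply: (le_trans (fb_bL fb _ _)); rewrite ger0_norm// ltW.
have sub z y : `|z - t0| <= d -> `|y - t0| <= d -> `|z - t0| <= d1 /\ `|y - t0| <= d1.
  by move=> z1 z2; split; [apply: (le_trans z1)|apply: (le_trans z2)]; rewrite ge_min lexx.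
pose lo := Num.max s0 (t0 - d); pose hi := Num.min s1 (t0 + d).
have inw z : s0 <= z -> z <= s1 -> `|z - t0| <= d -> lo <= z <= hi.
  move=> z1 z2; rewrite ler_norml => /andP[z3 z4].
  by rewrite /lo /hi ge_max z1 le_min z2 /=; apply/andP; split; lra.
have outw z : lo <= z <= hi -> [/\ s0 <= z <= s1 & `|z - t0| <= d1].
  rewrite /lo /hi ge_max le_min => /andP[/andP[z1 z2] /andP[z3 z4]].
  split; first by rewrite z1.
  apply: (@le_trans _ _ d); last by rewrite ge_min lexx.
  by rewrite ler_norml; apply/andP; split; lra.
have osc' : exists Q e0 : R, [/\ 0 < Q, 0 < e0 &
     forall e x y, 0 < e -> e < e0 -> lo <= x <= hi -> lo <= y <= hi ->
       `|smear (fun t => S (b t)) Q e x - smear (fun t => S (b t)) Q e y| <= g1].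
  exists Q, e0; split => // e x y e_0 ee /outw[hx1 hx2] /outw[hy1 hy2].
  exact: osc.
have N20 : 0 <= N ^+ 2 by exact: sqr_ge0.
have /andP[lt th] := inw t s0t (le_trans (ltW ts) ss1) td.
have /andP[ls sh] := inw s (le_trans s0t (ltW ts)) ss1 sd.
have /andP[lu uh] := inw u s0u (le_trans (ltW uv) vs1) ud.
have /andP[lv vh] := inw v (le_trans s0u (ltW uv)) vs1 vd.
have cl := slopes_close N20 beta_lip osc' lt ts sh lu uv vh.
have l1 := lin t s ts td sd; have l2 := lin u v uv ud vd.
have /andP[sg0 sgN] := fb_sg fb (b t0).
have sgp : 0 <= sg (b t0) by apply: le_trans sg0; rewrite invr_ge0 ltW.
have wN : w * N ^+ 2 = g / 4 by rewrite /w; field; rewrite gt_eqF.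
have gN : N * (g1 * expR 2) = g / 2 by rewrite /g1; field; rewrite !gt_eqF ?expR_gt0.
have cl' : `|sg (b t0) * ((S (b s) - S (b t)) / (s - t)) - sg (b t0) * ((S (b v) - S (b u)) / (v - u))| <= g / 2.
  by rewrite -mulrBr normrM (ger0_norm sgp) -gN; apply: ler_pM.
rewrite wN in l1 l2.
move: l1 l2 cl'; move: (_ * ((S (b s) - _) / _)) (_ * ((S (b v) - _) / _)) ((b s - _) / _) ((b v - _) / _).
move=> p q p' q'; rewrite !ler_norml => /andP[? ?] /andP[? ?] /andP[? ?].
by apply/andP; split; lra.
Qed.

End cauchy.

(** * Second space derivative of the value function *)

Section derivatives.
Variable R : realType.
Implicit Types (f g G df : R -> R) (x y z e : R).

Lemma is_derive_quotient G x (l e : R) : is_derive x 1 G l -> 0 < e ->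
  exists2 n, 0 < n & forall h, h != 0 -> `|h| < n -> `|h^-1 * (G (x + h) - G x) - l| < e.
Proof.
move=> [exd <-] e0.
have /cvgrPdist_lt/(_ _ e0) : (fun h : R => h^-1 *: ((G \o shift x) (h *: 1) - G x)) @ 0^' --> 'D_1 G x.
  exact: exd.
move=> [n /= n0 hn]; exists n => // h h0 hlt.
have := hn h; rewrite /= sub0r normrN => /(_ hlt h0); rewrite distrC.
by rewrite /GRing.scale /= mulr1 [h + x]addrC.
Qed.

Lemma quotient_is_derive G x (l : R) :
  (forall e, 0 < e -> exists2 n, 0 < n &
     forall h, h != 0 -> `|h| < n -> `|h^-1 * (G (x + h) - G x) - l| <= e) ->
  is_derive x 1 G l.
Proof.
move=> H.
have c : (fun h : R => h^-1 *: ((G \o shift x) (h *: 1) - G x)) @ 0^' --> l.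
  apply/cvgrPdist_le => e e0; have [n n0 hn] := H e e0.
  exists n => // h /=; rewrite sub0r normrN => hlt h0; rewrite distrC.
  by rewrite /GRing.scale /= mulr1 [h + x]addrC; exact: hn.
by split; [exact: cvgP c|exact: cvg_lim c].
Qed.

Lemma is_derive_from_within (D : set R) f g x (l n : R) : is_derive_within D f x l -> 0 < n ->
  (forall y, `|y - x| < n -> D y /\ g y = f y) -> is_derive x 1 g l.
Proof.
move=> H n0 Dg; apply: quotient_is_derive => e e0.
move/cvgrPdist_le: H => /(_ _ e0); rewrite near_withinE => -[k /= k0 hk].
exists (Num.min k n); first by rewrite lt_min k0.
move=> h h0; rewrite lt_min => /andP[hk1 hn1].
have [|Dx ->] := Dg x; first by rewrite subrr normr0.
have [|Dxh ->] := Dg (x + h); first by rewrite addrC addKr.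
rewrite distrC; apply: hk => //=; first by rewrite sub0r normrN.
Qed.

(** If the inequality failed, subtracting from f the parabola m z^2 / 2 and a suitable line would
    give a function increasing at x and decreasing at y. Its interior maximum is a point where a
    parabola of second derivative m touches f from above, which is excluded. *)
Lemma convex_slope f df (m x y : R) : x < y ->
  (forall z, x <= z <= y -> is_derive z 1 f (df z)) ->
  (forall z d, x < z < y -> 0 < d ->
     ~ (forall v, `|v - z| <= d -> f v - f z - df z * (v - z) - m / 2 * (v - z) ^+ 2 <= 0)) ->
  m * (y - x) <= df y - df x.
Proof.
move=> xy dfd nomax; rewrite leNgt; apply/negP => lt.
have {}lt : df y - m * y < df x - m * x by lra.
(* Strictly between the two modified slopes, which fixes the signs of the derivative of [w] at both
   ends. *)
pose s := ((df y - m * y) + (df x - m * x)) / 2.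
have s1 : df y - m * y < s by rewrite /s; lra.
have s2 : s < df x - m * x by rewrite /s; lra.
pose w z := f z - m / 2 * z ^+ 2 - s * z.
have dw z : x <= z <= y -> is_derive z 1 w (df z - m * z - s).
  move=> hz; have d1 := dfd z hz.
  have := is_deriveB (is_deriveB d1 (is_deriveM (is_derive_cst (m / 2) z 1) (is_derive_sqr z)))
     (is_deriveM (is_derive_cst s z 1) (is_derive_id z 1)).
  by move/is_derive_eq; apply; rewrite /GRing.scale /=; field.
have [c] := EVT_max (ltW xy) (is_derive_within_continuous dw).
rewrite in_itv/= => cxy cmax.
have wmax z : x <= z <= y -> w z <= w c by move=> hz; apply: cmax; rewrite in_itv.
have cx : x < c.
  have /andP[xc _] := cxy; rewrite lt_neqAle xc andbT; apply/negP => /eqP E.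
  have xx : x <= x <= y by rewrite lexx ltW.
  have e0 : 0 < df x - m * x - s by lra.
  have [n n0 hn] := is_derive_quotient (dw x xx) e0.
  pose h := Num.min (n / 2) (y - x).
  have h0 : 0 < h by rewrite lt_min divr_gt0//= subr_gt0.
  have hlt : `|h| < n.
    rewrite gtr0_norm//; apply: (@le_lt_trans _ _ (n / 2)); first by rewrite ge_min lexx.
    by rewrite ltr_pdivrMr// ltr_pMr// ltr1n.
  have := hn h (lt0r_neq0 h0) hlt; rewrite ltr_norml => /andP[+ _].
  rewrite ltrBrDr addNr => hp.
  have hxy : x <= x + h <= y.
    rewrite lerDl ltW//= -lerBrDl ge_min lexx orbT//.
  have := wmax _ hxy; rewrite -E -subr_le0 -(pmulr_rle0 _ (_ : 0 < h^-1)) ?invr_gt0//.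
  by rewrite leNgt hp.
have cy : c < y.
  have /andP[_ yc] := cxy; rewrite lt_neqAle yc andbT; apply/negP => /eqP E.
  have yy : x <= y <= y by rewrite lexx ltW.
  have e0 : 0 < - (df y - m * y - s) by lra.
  have [n n0 hn] := is_derive_quotient (dw y yy) e0.
  pose h := Num.min (n / 2) (y - x).
  have h0 : 0 < h by rewrite lt_min divr_gt0//= subr_gt0.
  have hlt : `|- h| < n.
    rewrite normrN gtr0_norm//; apply: (@le_lt_trans _ _ (n / 2)); first by rewrite ge_min lexx.
    by rewrite ltr_pdivrMr// ltr_pMr// ltr1n.
  have hn0 : - h != 0 by rewrite oppr_eq0 gt_eqF.
  have := hn (- h) hn0 hlt; rewrite ltr_norml => /andP[_ +].
  rewrite ltrBlDr addNr => hp.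
  have hxy : x <= y - h <= y.
    by rewrite gerBl (ltW h0) andbT lerBrDr -lerBrDl ge_min lexx orbT.
  have := wmax _ hxy; rewrite E -subr_le0.
  rewrite invrN mulNr oppr_lt0 pmulr_rgt0 ?invr_gt0// in hp.
  by rewrite leNgt hp.
have cin : c \in `]x, y[ by rewrite in_itv/= cx.
have dc : is_derive c 1 w 0.
  apply: (derive1_at_max (ltW xy) _ cin).
    move=> z; rewrite in_itv/= => /andP[z1 z2].
    by have [] := dw z; rewrite ?ltW.
  by move=> z; rewrite in_itv/= => /andP[z1 z2]; apply: wmax; rewrite !ltW.
have dE : df c = s + m * c.
  have [_ E1] := dc; have [_] := dw c cxy; rewrite E1; lra.
pose d := Num.min (c - x) (y - c).
apply: (nomax c d); first by rewrite cx.
  by rewrite lt_min !subr_gt0 cx.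
move=> v; rewrite le_min => /andP[v1 v2].
have := wmax v; rewrite /w dE.
have -> : x <= v <= y.
  by move: v1 v2; rewrite !ler_norml => /andP[? ?] /andP[? ?]; apply/andP; split; lra.
move=> /(_ isT); rewrite -subr_ge0 -oppr_le0; apply: le_trans.
by rewrite le_eqVlt; apply/orP; left; apply/eqP; field.
Qed.

(* If the second-order parabolas touching [f] have second derivatives on the
   right side of [Phi], then f'' = Phi. *)
Lemma touching_derivative f df (Phi : R -> R) (a c : R) :
  (forall z, a < z < c -> is_derive z 1 f (df z)) ->
  (forall z, a < z < c -> {for z, continuous Phi}) ->
  (forall z M d, a < z < c -> 0 < d ->
     (forall v, `|v - z| <= d -> f v - f z - df z * (v - z) - M / 2 * (v - z) ^+ 2 <= 0) -> Phi z <= M) ->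
  (forall z M d, a < z < c -> 0 < d ->
     (forall v, `|v - z| <= d -> 0 <= f v - f z - df z * (v - z) - M / 2 * (v - z) ^+ 2) -> M <= Phi z) ->
  forall x, a < x < c -> is_derive x 1 df (Phi x).
Proof.
move=> dfd cPhi above below x0 /andP[ax xc].
apply: quotient_is_derive => e e0.
have e2 : 0 < e / 2 by rewrite divr_gt0.
have x0in : a < x0 < c by rewrite ax.
have /cvgrPdist_le/(_ _ e2) [n /= n0 hn] := cPhi x0 x0in.
pose k := Num.min n (Num.min (x0 - a) (c - x0)).
have k0 : 0 < k by rewrite !lt_min n0 !subr_gt0 ax.
have near z : `|z - x0| < k -> a < z < c /\ `|Phi z - Phi x0| <= e / 2.
  rewrite !lt_min => /andP[zn /andP[za zc]]; split.
    by move: za zc; rewrite !ltr_norml => /andP[? ?] /andP[? ?]; apply/andP; split; lra.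
  by rewrite distrC; apply: hn => /=; rewrite distrC.
(* Near [x0] a parabola of second derivative [Phi x0 - e] cannot touch from above, nor one of
   [Phi x0 + e] from below; [convex_slope] applies to f and to its opposite. *)
have main x y : x < y -> `|x - x0| < k -> `|y - x0| < k ->
    `|df y - df x - Phi x0 * (y - x)| <= e * (y - x).
  move=> xy xk yk.
  have btw z : x <= z <= y -> `|z - x0| < k.
    by move=> /andP[z1 z2]; move: xk yk; rewrite !ltr_norml => /andP[? ?] /andP[? ?]; apply/andP; split; lra.
  have dd z : x <= z <= y -> is_derive z 1 f (df z).
    by move=> hz; have [z1 _] := near z (btw z hz); exact: dfd.
  have lo : (Phi x0 - e) * (y - x) <= df y - df x.
    apply: (convex_slope xy dd) => z d /andP[z1 z2] d0 H.
    have zk : `|z - x0| < k by apply: btw; rewrite !ltW.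
    have [zac] := near z zk; have := above z _ d zac d0 H.
    by rewrite ler_norml => h1 /andP[h2 h3]; lra.
  have hi : - (Phi x0 + e) * (y - x) <= - df y - - df x.
    apply: (@convex_slope (fun z => - f z) (fun z => - df z) _ _ _ xy) => [z hz|z d /andP[z1 z2] d0 H].
      by have dz := dd z hz; exact: (is_deriveN dz).
    have zk : `|z - x0| < k by apply: btw; rewrite !ltW.
    have [zac] := near z zk; have := below z (Phi x0 + e) d zac d0.
    rewrite ler_norml => h1 /andP[h2 h3]; suff : Phi x0 + e <= Phi z by lra.
    apply: h1 => v hv; have := H v hv; rewrite -oppr_ge0.
    have -> : - (- f v - - f z - - df z * (v - z) - - (Phi x0 + e) / 2 * (v - z) ^+ 2)
      = f v - f z - df z * (v - z) - (Phi x0 + e) / 2 * (v - z) ^+ 2 by field.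
    by [].
  by rewrite ler_norml; apply/andP; split; lra.
exists k => // h hn0 hk.
have kk : `|x0 - x0| < k by rewrite subrr normr0.
have xhk : `|x0 + h - x0| < k by rewrite addrC addKr.
have [h0|h0|h0] := ltgtP h 0; last by rewrite h0 eqxx in hn0.
- have xlt : x0 + h < x0 by rewrite gtrDl.
  have := main _ _ xlt xhk kk.
  have -> : x0 - (x0 + h) = - h by ring.
  have -> : h^-1 * (df (x0 + h) - df x0) - Phi x0 = (- h)^-1 * (df x0 - df (x0 + h) - Phi x0 * - h).
    by field.
  have nh : 0 < - h by rewrite oppr_gt0.
  by rewrite normrM normfV (gtr0_norm nh) ler_pdivrMl// [_ * e]mulrC.
- have xlt : x0 < x0 + h by rewrite ltrDl.
  have := main _ _ xlt kk xhk.
  have -> : x0 + h - x0 = h by ring.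
  have -> : h^-1 * (df (x0 + h) - df x0) - Phi x0 = h^-1 * (df (x0 + h) - df x0 - Phi x0 * h).
    by field.
  by rewrite normrM normfV (gtr0_norm h0) ler_pdivrMl// [_ * e]mulrC.
Qed.

(** Passes from second differences of [D] to its second derivative. It bounds time increments of
    g_xx through those of g. *)
Lemma second_difference_bound (D D1 D2 : R -> R) x (n c : R) : 0 < n ->
  (forall z, `|z - x| < n -> is_derive z 1 D (D1 z)) ->
  (forall z, `|z - x| < n -> is_derive z 1 D1 (D2 z)) -> {for x, continuous D2} ->
  (forall k, 0 < k -> k < n -> `|D (x + k) - 2 * D x + D (x - k)| <= c * k ^+ 2) ->
  `|D2 x| <= c.
Proof.
move=> n0 d1 d2 cD2 hc; apply/ler_addgt0Pr => e e0.
have /cvgrPdist_le/(_ _ e0) [n' /= n'0 hn'] := cD2.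
pose k := Num.min n n' / 2.
have m0 : 0 < Num.min n n' by rewrite lt_min n0.
have k0 : 0 < k by rewrite divr_gt0.
have km : k < Num.min n n' by rewrite ltr_pdivrMr// ltr_pMr// ltr1n.
have [kn kn'] : k < n /\ k < n' by move: km; rewrite lt_min => /andP[].
have inn z : 0 <= z <= k -> [/\ `|x + z - x| < n, `|x - z - x| < n, `|x + z - x| < n' & `|x - z - x| < n'].
  move=> /andP[z0 zk]; have -> : x + z - x = z by ring.
  have -> : x - z - x = - z by ring.
  by rewrite normrN (ger0_norm z0) !(le_lt_trans zk).
have sh z : is_derive z 1 (fun z : R => x + z) 1.
  by have := is_deriveD (is_derive_cst x z 1) (is_derive_id z 1); move/is_derive_eq; apply; rewrite add0r.
have shN z : is_derive z 1 (fun z : R => x - z) (-1).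
  by have := is_deriveB (is_derive_cst x z 1) (is_derive_id z 1); move/is_derive_eq; apply; rewrite sub0r.
have W1 z : 0 <= z <= k -> `|D1 (x + z) - D1 (x - z) - 2 * D2 x * z| <= 2 * e * z.
  move=> /andP[z0 zk].
  pose F y := D1 (x + y) - D1 (x - y) - 2 * D2 x * y.
  have dF y : 0 <= y <= z -> is_derive y 1 F (D2 (x + y) + D2 (x - y) - 2 * D2 x).
    move=> /andP[y0 yz]; have [|i1 i2 _ _] := inn y; first by rewrite y0 (le_trans yz).
    have a1 := @is_derive1_comp R D1 (fun z => x + z) y _ _ (d2 _ i1) (sh y).
    have a2 := @is_derive1_comp R D1 (fun z => x - z) y _ _ (d2 _ i2) (shN y).
    have := is_deriveB (is_deriveB a1 a2) (is_derive_linear (2 * D2 x) y).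
    by move/is_derive_eq; apply; rewrite /GRing.scale /=; ring.
  have dL y : 0 <= y <= z -> is_derive y 1 (fun y => 2 * e * y) (2 * e) by move=> _; exact: is_derive_linear.
  have -> : D1 (x + z) - D1 (x - z) - 2 * D2 x * z = F z - F 0 by rewrite /F addr0 subr0; ring.
  have -> : 2 * e * z = 2 * e * z - 2 * e * 0 by ring.
  apply: (@derive_le_increment _ F (fun y => 2 * e * y) (fun y => D2 (x + y) + D2 (x - y) - 2 * D2 x)
    (fun=> 2 * e) 0 z z0 (is_derive_within_continuous dF) (is_derive_within_continuous dL)).
  - by move=> y /andP[y1 y2]; apply: dF; rewrite !ltW.
  - by move=> y _; exact: is_derive_linear.
  - move=> y /andP[y0 yz]; have [|_ _ i1 i2] := inn y; first by rewrite ltW//= (le_trans (ltW yz)).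
    have b1 : `|D2 x - D2 (x + y)| <= e by apply: hn' => /=; rewrite distrC.
    have b2 : `|D2 x - D2 (x - y)| <= e by apply: hn' => /=; rewrite distrC.
    move: b1 b2; move: (D2 x) (D2 _) (D2 _) => u v w; rewrite !ler_norml => /andP[? ?] /andP[? ?].
    by apply/andP; split; lra.
have W : `|D (x + k) - 2 * D x + D (x - k) - D2 x * k ^+ 2| <= e * k ^+ 2.
  pose F y := D (x + y) + D (x - y) - D2 x * y ^+ 2.
  have dF y : 0 <= y <= k -> is_derive y 1 F (D1 (x + y) - D1 (x - y) - 2 * D2 x * y).
    move=> hy; have [i1 i2 _ _] := inn y hy.
    have a1 := @is_derive1_comp R D (fun z => x + z) y _ _ (d1 _ i1) (sh y).
    have a2 := @is_derive1_comp R D (fun z => x - z) y _ _ (d1 _ i2) (shN y).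
    have := is_deriveB (is_deriveD a1 a2) (is_deriveM (is_derive_cst (D2 x) y 1) (is_derive_sqr y)).
    by move/is_derive_eq; apply; rewrite /GRing.scale /=; ring.
  have dL y : 0 <= y <= k -> is_derive y 1 (fun y => e * y ^+ 2) (2 * e * y).
    move=> _; have := is_deriveM (is_derive_cst e y 1) (is_derive_sqr y).
    by move/is_derive_eq; apply; rewrite /GRing.scale /=; ring.
  have -> : D (x + k) - 2 * D x + D (x - k) - D2 x * k ^+ 2 = F k - F 0.
    by rewrite /F addr0 subr0 expr0n /=; ring.
  have -> : e * k ^+ 2 = e * k ^+ 2 - e * 0 ^+ 2 by rewrite expr0n /=; ring.
  apply: (@derive_le_increment _ F (fun y => e * y ^+ 2) (fun y => D1 (x + y) - D1 (x - y) - 2 * D2 x * y)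
    (fun y => 2 * e * y) 0 k (ltW k0) (is_derive_within_continuous dF) (is_derive_within_continuous dL)).
  - by move=> y /andP[y1 y2]; apply: dF; rewrite !ltW.
  - by move=> y /andP[y1 y2]; apply: dL; rewrite !ltW.
  - by move=> y /andP[y1 y2]; apply: W1; rewrite !ltW.
have hk := hc k k0 kn.
have k2 : 0 < k ^+ 2 by rewrite exprn_gt0.
rewrite -(ler_pM2r k2) -[X in `|D2 x| * X](gtr0_norm k2) -normrM.
move: hk W; move: (D (x + k) - 2 * D x + D (x - k)) (D2 x * k ^+ 2) => u v.
rewrite mulrDl; move: (c * _) (e * _) => p q; rewrite !ler_norml => /andP[? ?] /andP[? ?].
by apply/andP; split; lra.
Qed.

Lemma first_difference_bound (D D1 : R -> R) x (n c : R) : 0 < n -> is_derive x 1 D (D1 x) ->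
  (forall k, 0 < k -> k < n -> `|D (x + k) - D x| <= c * k) -> `|D1 x| <= c.
Proof.
move=> n0 d1 hc; apply/ler_addgt0Pr => e e0.
have [n' n'0 hn'] := is_derive_quotient d1 e0.
pose k := Num.min n n' / 2.
have m0 : 0 < Num.min n n' by rewrite lt_min n0.
have k0 : 0 < k by rewrite divr_gt0.
have km : k < Num.min n n' by rewrite ltr_pdivrMr// ltr_pMr// ltr1n.
have [kn kn'] : k < n /\ k < n' by move: km; rewrite lt_min => /andP[].
have kk : `|k| < n' by rewrite gtr0_norm.
have := hn' k (lt0r_neq0 k0) kk; have := hc k k0 kn => h1 h2.
have {}h1 : `|k^-1 * (D (x + k) - D x)| <= c.
  by rewrite normrM normfV (gtr0_norm k0) ler_pdivrMl// mulrC.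
move: h1 h2; move: (k^-1 * _) (D1 x) => u v.
rewrite ltr_norml !ler_norml => /andP[? ?] /andP[? ?].
by apply/andP; split; lra.
Qed.

End derivatives.

(** * The value on the stopping set *)

Section stopped.
Variables (R : realType) (d : measure_display) (Omega : measurableType d)
  (P : probability Omega R) (B : R -> Omega -> R) (T : \bar R) (I : set R)
  (mu : R * R -> R) (sigma : R -> R)
  (X : R -> R -> R -> Omega -> R) (r g : R * R -> R) (b : R -> R).
Hypothesis hB : brownian_motion P B.
Hypothesis hX : forall t x, times T t -> I x ->
  strong_solution P B T I mu sigma t x (X t x).
Hypothesis hr : {within times T `*` setT, continuous r}.
Hypothesis hg : {within times T `*` setT, continuous g}.
Hypothesis hwp : well_posed P T I r g X.
Hypothesis hb : {within times T, continuous b}.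
Hypothesis hopt : forall t x, times T t -> I x ->
  optimal P T r g X t x (tau_star T b X t x).

(** From a point at or below the boundary [tau_star] is almost surely 0, and being optimal it gives
    the value. *)
Lemma stopped_value t x : times_before T t -> I x -> x <= b t -> value P T r g X (t, x) = g (t, x).
Proof.
move=> ht Ix xb; have [t0 tT] := ht.
have htt : times T t by split=> //; exact: ltW.
have mX t' x' v : 0 <= t' -> I x' -> t' <= v -> (v%:E <= T)%E -> measurable_fun setT (X t' x' v).
  move=> t'0 Ix' tv vT; have tT' : times T t' by split=> //; apply: le_trans vT; rewrite lee_fin.
  have [_ ad _ _] := hX tT' Ix'; move=> _ A mA; rewrite setTI.
  by apply: (bm_filtration_measurable hB); exact: ad.
have cX t' x' w : times T t' -> I x' -> {within [set v | t' <= v /\ (v%:E <= T)%E], continuous (fun v => X t' x' v w)}.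
  by move=> tT' Ix'; have [h _ _ _] := hX tT' Ix'; exact: h.
have [iE VE] := pay_value mX cX hr hg hwp hb hopt ht Ix.
have mp := measurable_payp mX cX hr hg hb ht t0 (lexx t) Ix.
have [_ _ st _] := hX htt Ix.
apply: EFin_inj; rewrite VE.
transitivity (\int[P]_w (cst (g (t, x))%:E w))%E; last first.
  by rewrite integral_cst// [X in (_ * X)%E](_ : _ = 1%E) ?mule1//; exact: probability_setT.
apply: ae_eq_integral => //; first exact/measurable_EFinP.
apply: filterS st => w Xw _ /=; congr (_%:E).
have tau0 : tau_path T b t (fun v => X t x v w) = 0%E.
  apply/eqP; rewrite eq_le tau_path_ge0 ?andbT.
    rewrite /tau_path ge_min; apply/orP; left; apply: ereal_inf_lbound.
    by exists 0 => //; split; rewrite ?addr0 ?Xw.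
  exact: tT.
by rewrite /pay_path tau0 /= integral_point oppr0 expR0 mul1r addr0 Xw.
Qed.

End stopped.

(** * Functions clamped to a box *)

Section localbox.
Variables (R : realType) (T : \bar R) (I : set R) (A : set (R * R)).
Variables (s0 s1 y1 y2 : R).
Hypotheses (s01 : s0 <= s1) (y12 : y1 <= y2).
Hypothesis boxA : `[s0, s1] `*` `[y1, y2] `<=` A.
Hypothesis AT : A `<=` times_before T `*` I.
Implicit Types (f : R * R -> R) (t x : R).

Definition clampp (p : R * R) : R * R := (clamp s0 s1 p.1, clamp y1 y2 p.2).
(** Composition with the nearest-point projection extends a function continuous on the box to the
    whole plane, with the same bounds and, inside, the same derivatives. *)
Definition cl f p := f (clampp p).

Lemma box_closure : `[s0, s1] `*` `[y1, y2] `<=` rel_closure T I A.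
Proof.
move=> p /boxA Ap; split; first exact: subset_closure.
by have [[h1 h2] h3] := AT Ap; split => //; split => //; exact: ltW.
Qed.

Lemma clampp_in p : (`[s0, s1] `*` `[y1, y2])%classic (clampp p).
Proof. by split; rewrite /= in_itv/=; exact: clamp_in. Qed.

Lemma clampp_id t x : s0 <= t <= s1 -> y1 <= x <= y2 -> clampp (t, x) = (t, x).
Proof. by move=> ht hx; rewrite /clampp /= !clamp_id. Qed.

Lemma clampp_idem p : clampp (clampp p) = clampp p.
Proof. by apply: clampp_id; exact: clamp_in. Qed.

Lemma cl_id f t x : s0 <= t <= s1 -> y1 <= x <= y2 -> cl f (t, x) = f (t, x).
Proof. by move=> ht hx; rewrite /cl clampp_id. Qed.

Lemma cl_continuous f : {within rel_closure T I A, continuous f} -> continuous (cl f).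
Proof.
move=> cf; apply: (continuous_clamp_box s01 y12).
exact: continuous_subspaceW box_closure cf.
Qed.

Lemma cl_bounded f : continuous f -> (forall p, f p = f (clampp p)) ->
  exists2 K, 0 < K & forall p, `|f p| <= K.
Proof.
move=> cf fE; have cf' : {within setT, continuous f} by exact: continuous_subspaceT.
have [K K0 hK] := @box_bounded R setT f s0 s1 y1 y2 cf' (fun _ _ => Logic.I).
by exists K => // p; rewrite fE; apply: hK; exact: clamp_in.
Qed.

Section cjk.
Variables (j k : nat) (f : R * R -> R) (ft fx : nat -> R * R -> R).
Hypothesis hC : Cjk T I A j k f ft fx.

Lemma cjk_t0 : cl (ft 0%N) = cl f.
Proof.
by apply/funext => p; have [h _ _ _ _] := hC; have [] := h (clampp p) (box_closure (clampp_in p)).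
Qed.

Lemma cjk_x0 : cl (fx 0%N) = cl f.
Proof.
by apply/funext => p; have [h _ _ _ _] := hC; have [] := h (clampp p) (box_closure (clampp_in p)).
Qed.

Lemma cjk_ct i : (i <= j)%N -> continuous (cl (ft i)).
Proof. by move=> ij; have [_ _ _ h _] := hC; apply: cl_continuous; exact: h. Qed.

Lemma cjk_cx i : (i <= k)%N -> continuous (cl (fx i)).
Proof. by move=> ij; have [_ _ _ _ h] := hC; apply: cl_continuous; exact: h. Qed.

Lemma cjk_dt i t x : (i < j)%N -> s0 < t < s1 -> y1 <= x <= y2 ->
  is_derive t 1 (fun t => cl (ft i) (t, x)) (cl (ft i.+1) (t, x)).
Proof.
move=> ij /andP[t1 t2] hx; have [_ h _ _ _] := hC.
have tin : s0 <= t <= s1 by rewrite !ltW.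
rewrite (cl_id _ tin hx).
have Atx : A (t, x) by apply: boxA; split; rewrite /= in_itv.
apply: (is_derive_from_within (h i (t, x) ij Atx) (n := Num.min (t - s0) (s1 - t))).
  by rewrite lt_min !subr_gt0 t1.
move=> y /=; rewrite lt_min !ltr_norml => /andP[/andP[? ?] /andP[? ?]].
have yin : s0 <= y <= s1 by apply/andP; split; lra.
by split; [apply: boxA; split; rewrite /= in_itv|rewrite (cl_id _ yin hx)].
Qed.

Lemma cjk_dx i t x : (i < k)%N -> s0 <= t <= s1 -> y1 < x < y2 ->
  is_derive x 1 (fun x => cl (fx i) (t, x)) (cl (fx i.+1) (t, x)).
Proof.
move=> ij ht /andP[x1 x2]; have [_ _ h _ _] := hC.
have xin : y1 <= x <= y2 by rewrite !ltW.
rewrite (cl_id _ ht xin).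
have Atx : A (t, x) by apply: boxA; split; rewrite /= in_itv.
apply: (is_derive_from_within (h i (t, x) ij Atx) (n := Num.min (x - y1) (y2 - x))).
  by rewrite lt_min !subr_gt0 x1.
move=> y /=; rewrite lt_min !ltr_norml => /andP[/andP[? ?] /andP[? ?]].
have yin : y1 <= y <= y2 by apply/andP; split; lra.
by split; [apply: boxA; split; rewrite /= in_itv|rewrite (cl_id _ ht yin)].
Qed.

End cjk.

Lemma one_variable_lip (F F' : R -> R) (a c K : R) : continuous F ->
  (forall x, a < x < c -> is_derive x 1 F (F' x)) -> (forall x, a < x < c -> `|F' x| <= K) ->
  forall x y, a <= x <= c -> a <= y <= c -> `|F x - F y| <= K * `|x - y|.
Proof.
move=> cF dF hK.
suff main x y : a <= x -> x <= y -> y <= c -> `|F y - F x| <= K * (y - x).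
  move=> x y /andP[ax xc] /andP[ay yc]; have [xy|/ltW yx] := leP x y.
    by rewrite distrC [X in _ * X]distrC [X in _ * X]ger0_norm ?subr_ge0 ?main.
  by rewrite [X in _ * X]ger0_norm ?subr_ge0 ?main.
move=> ax xy yc; rewrite mulrBr.
have cl' : {within `[x, y], continuous (fun z => K * z)}.
  by apply: (is_derive_within_continuous (df := fun=> K)) => z _; exact: is_derive_linear.
have ac z : x < z < y -> a < z < c by move=> /andP[z1 z2]; rewrite (le_lt_trans ax)//= (lt_le_trans z2).
apply: (@derive_le_increment _ F (fun z => K * z) F' (fun=> K) x y xy _ cl').
- exact: continuous_subspaceT.
- by move=> z /ac; exact: dF.
- by move=> z _; exact: is_derive_linear.
- by move=> z /ac; exact: hK.
Qed.

Lemma t_lip (F Ft : R * R -> R) (K : R) : continuous F ->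
  (forall t x, s0 < t < s1 -> y1 <= x <= y2 -> is_derive t 1 (fun t => F (t, x)) (Ft (t, x))) ->
  (forall p, `|Ft p| <= K) ->
  forall t s x, s0 <= t <= s1 -> s0 <= s <= s1 -> y1 <= x <= y2 -> `|F (t, x) - F (s, x)| <= K * `|t - s|.
Proof.
move=> cF dF hK t s x ht hs hx.
apply: (@one_variable_lip (fun t => F (t, x)) (fun t => Ft (t, x)) s0 s1) => //.
  by apply: continuous_pair_comp => // z; [exact: cvg_id|exact: cst_continuous].
by move=> z hz; exact: dF.
Qed.

Lemma x_lip (F Fx : R * R -> R) (K : R) : continuous F ->
  (forall t x, s0 <= t <= s1 -> y1 < x < y2 -> is_derive x 1 (fun x => F (t, x)) (Fx (t, x))) ->
  (forall p, `|Fx p| <= K) ->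
  forall t x y, s0 <= t <= s1 -> y1 <= x <= y2 -> y1 <= y <= y2 -> `|F (t, x) - F (t, y)| <= K * `|x - y|.
Proof.
move=> cF dF hK t x y ht hx hy.
apply: (@one_variable_lip (fun x => F (t, x)) (fun x => Fx (t, x)) y1 y2) => //.
  by apply: continuous_pair_comp => // z; [exact: cst_continuous|exact: cvg_id].
by move=> z hz; exact: dF.
Qed.

Lemma second_difference_le (f f1 f2 : R -> R) (x k K : R) : 0 <= k ->
  (forall z, `|z - x| <= k -> is_derive z 1 f (f1 z)) ->
  (forall z, `|z - x| <= k -> is_derive z 1 f1 (f2 z)) -> (forall z, `|z - x| <= k -> `|f2 z| <= K) ->
  `|f (x + k) - 2 * f x + f (x - k)| <= K * k ^+ 2.
Proof.
move=> k0 d1 d2 hK.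
have inn z : 0 <= z <= k -> `|x + z - x| <= k /\ `|x - z - x| <= k.
  move=> /andP[z0 zk]; have -> : x + z - x = z by ring.
  have -> : x - z - x = - z by ring.
  by rewrite normrN (ger0_norm z0).
have sh (z : R) : is_derive z 1 (fun z : R => x + z) 1.
  by have := is_deriveD (is_derive_cst x z 1) (is_derive_id z 1); move/is_derive_eq; apply; rewrite add0r.
have shN (z : R) : is_derive z 1 (fun z : R => x - z) (-1).
  by have := is_deriveB (is_derive_cst x z 1) (is_derive_id z 1); move/is_derive_eq; apply; rewrite sub0r.
have W1 z : 0 <= z <= k -> `|f1 (x + z) - f1 (x - z)| <= 2 * K * z.
  move=> /andP[z0 zk].
  pose F y := f1 (x + y) - f1 (x - y).
  have dF y : 0 <= y <= z -> is_derive y 1 F (f2 (x + y) + f2 (x - y)).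
    move=> /andP[y0 yz]; have [|i1 i2] := inn y; first by rewrite y0 (le_trans yz).
    have a1 := @is_derive1_comp R f1 (fun z => x + z) y _ _ (d2 _ i1) (sh y).
    have a2 := @is_derive1_comp R f1 (fun z => x - z) y _ _ (d2 _ i2) (shN y).
    by have := is_deriveB a1 a2; move/is_derive_eq; apply; ring.
  have dL y : 0 <= y <= z -> is_derive y 1 (fun y => 2 * K * y) (2 * K) by move=> _; exact: is_derive_linear.
  have -> : f1 (x + z) - f1 (x - z) = F z - F 0 by rewrite /F addr0 subr0; ring.
  have -> : 2 * K * z = 2 * K * z - 2 * K * 0 by ring.
  apply: (@derive_le_increment _ F (fun y => 2 * K * y) (fun y => f2 (x + y) + f2 (x - y))
    (fun=> 2 * K) 0 z z0 (is_derive_within_continuous dF) (is_derive_within_continuous dL)).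
  - by move=> y /andP[z1 z2]; apply: dF; rewrite !ltW.
  - by move=> y _; exact: is_derive_linear.
  - move=> y /andP[y0 yz]; have [|i1 i2] := inn y; first by rewrite ltW//= (le_trans (ltW yz)).
    by apply: (le_trans (ler_normD _ _)); have := hK _ i1; have := hK _ i2; lra.
pose F y := f (x + y) + f (x - y).
have dF y : 0 <= y <= k -> is_derive y 1 F (f1 (x + y) - f1 (x - y)).
  move=> hy; have [i1 i2] := inn y hy.
  have a1 := @is_derive1_comp R f (fun z => x + z) y _ _ (d1 _ i1) (sh y).
  have a2 := @is_derive1_comp R f (fun z => x - z) y _ _ (d1 _ i2) (shN y).
  by have := is_deriveD a1 a2; move/is_derive_eq; apply; ring.
have dL y : 0 <= y <= k -> is_derive y 1 (fun y => K * y ^+ 2) (2 * K * y).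
  move=> _; have := is_deriveM (is_derive_cst K y 1) (is_derive_sqr y).
  by move/is_derive_eq; apply; rewrite /GRing.scale /=; ring.
have -> : f (x + k) - 2 * f x + f (x - k) = F k - F 0 by rewrite /F addr0 subr0; ring.
have -> : K * k ^+ 2 = K * k ^+ 2 - K * 0 ^+ 2 by rewrite expr0n /=; ring.
apply: (@derive_le_increment _ F (fun y => K * y ^+ 2) (fun y => f1 (x + y) - f1 (x - y))
  (fun y => 2 * K * y) 0 k k0 (is_derive_within_continuous dF) (is_derive_within_continuous dL)).
- by move=> y /andP[z1 z2]; apply: dF; rewrite !ltW.
- by move=> y /andP[z1 z2]; apply: dL; rewrite !ltW.
- by move=> y /andP[z1 z2]; apply: W1; rewrite !ltW.
Qed.

End localbox.

(** * The equation above the boundary *)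

Section second.
Variables (R : realType) (d : measure_display) (Omega : measurableType d)
  (P : probability Omega R) (B : R -> Omega -> R) (T : \bar R) (I : set R)
  (mu : R * R -> R) (sigma : R -> R)
  (X : R -> R -> R -> Omega -> R) (r g : R * R -> R) (b : R -> R).
Hypothesis hB : brownian_motion P B.
Hypothesis mI : measurable I.
Hypothesis hX : forall t x, times T t -> I x ->
  strong_solution P B T I mu sigma t x (X t x).
Hypothesis hM : markov_family P T I X.
Hypothesis hr : {within times T `*` setT, continuous r}.
Hypothesis hg : {within times T `*` setT, continuous g}.
Hypothesis hwp : well_posed P T I r g X.
Hypothesis hv : {within times T `*` I, continuous (value P T r g X)}.
Hypothesis hb : {within times T, continuous b}.
Hypothesis hopt : forall t x, times T t -> I x ->
  optimal P T r g X t x (tau_star T b X t x).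
Local Notation V := (value P T r g X).
Variables (A : set (R * R)) (s0 s1 y1 y2 L : R) (vt vx : nat -> R * R -> R).
Hypotheses (s01 : s0 < s1) (y12 : y1 < y2) (s0ge : 0 <= s0) (s1T : (s1%:E < T)%E) (L0 : 0 <= L).
Hypothesis boxA : `[s0, s1] `*` `[y1, y2] `<=` A.
Hypothesis AT : A `<=` times_before T `*` I.
Hypothesis bL : forall u v, s0 <= u <= s1 -> s0 <= v <= s1 -> `|b u - b v| <= L * `|u - v|.
Hypothesis b_gt : forall u, s0 <= u <= s1 -> y1 < b u.
Hypothesis hCv : Cjk T I A 1 1 V vt vx.
Hypothesis cmu : {within rel_closure T I A, continuous mu}.
Hypothesis csigma : {within rel_closure T I A, continuous (fun p => sigma p.2)}.
Hypothesis sigma_gt0 : forall x, I x -> 0 < sigma x.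

Local Notation cl := (cl s0 s1 y1 y2).
Local Notation Vc := (cl V).
Local Notation Vt := (cl (vt 1%N)).
Local Notation Vx := (cl (vx 1%N)).
Local Notation Mu := (cl mu).
Local Notation Rc := (cl r).
Local Notation Sg := (cl (fun p => sigma p.2)).

(** The second derivative prescribed by V_t + sigma^2 V_xx / 2 + mu V_x - r V = 0. *)
Definition Phi_value (p : R * R) := 2 / Sg p ^+ 2 * (Rc p * Vc p - Vt p - Mu p * Vx p).

Let s01' := ltW s01. Let y12' := ltW y12.

Lemma box_I t x : s0 <= t <= s1 -> y1 <= x <= y2 -> times T t /\ I x.
Proof.
move=> ht hx; have [|[h1 h2] h3] := AT (boxA (_ : (`[s0, s1] `*` `[y1, y2])%classic (t, x))).
  by split; rewrite /= in_itv.
by split=> //; split=> //; exact: ltW.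
Qed.

Lemma Sg_gt0 p : 0 < Sg p.
Proof.
have [_ h] := box_I (clamp_in p.1 s01') (clamp_in p.2 y12').
exact: sigma_gt0.
Qed.

Lemma cl_r_continuous : continuous Rc.
Proof.
apply: (cl_continuous s01' y12' boxA AT); apply: continuous_subspaceW hr => p [_ [h _]].
by split.
Qed.

Lemma Phi_value_continuous : continuous Phi_value.
Proof.
have cSg := cl_continuous s01' y12' boxA AT csigma.
have cMu := cl_continuous s01' y12' boxA AT cmu.
have cVc : continuous Vc.
  by rewrite -(cjk_t0 s01' y12' boxA AT hCv); exact: (cjk_ct s01' y12' boxA AT hCv).
have cVt : continuous Vt by exact: (cjk_ct s01' y12' boxA AT hCv).
have cVx : continuous Vx by exact: (cjk_cx s01' y12' boxA AT hCv).
move=> p; apply: cvgM.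
  apply: cvgM; first exact: cvg_cst.
  apply: cvgV; first by rewrite gt_eqF// exprn_gt0// Sg_gt0.
  by apply: cvgM; exact: cSg.
apply: cvgB; last by apply: cvgM; [exact: cMu|exact: cVx].
apply: cvgB; last exact: cVt.
by apply: cvgM; [exact: cl_r_continuous|exact: cVc].
Qed.

Lemma touching_value (theta t z M dz : R) : theta = 1 \/ theta = -1 -> s0 < t < s1 -> b t < z < y2 ->
  0 < dz -> (forall v, `|v - z| <= dz ->
    0 <= theta * (Vc (t, v) - Vc (t, z) - Vx (t, z) * (v - z) - M / 2 * (v - z) ^+ 2)) ->
  theta * (Phi_value (t, z) - M) >= 0.
Proof.
move=> th ht hz dz0 H; have /andP[t1 t2] := ht; have /andP[bz zy] := hz.
have tin : s0 <= t <= s1 by rewrite !ltW.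
have yz : y1 < z := lt_trans (b_gt tin) bz.
have zin : y1 <= z <= y2 by rewrite !ltW.
have L1 : 0 < L + 1 by rewrite ltr_wpDl.
(* The last entry keeps the boundary below [z - d0] throughout [t, t + d0], by its Lipschitz
   bound. *)
pose d0 := Num.min (s1 - t) (Num.min (y2 - z) (Num.min (z - y1) ((z - b t) / (2 * (L + 1))))).
have d00 : 0 < d0 by rewrite !lt_min !subr_gt0 t2 zy yz divr_gt0 ?mulr_gt0// subr_gt0.
have dle : [/\ d0 <= s1 - t, d0 <= y2 - z, d0 <= z - y1 & d0 <= (z - b t) / (2 * (L + 1))].
  have : d0 <= d0 by []. by rewrite {2}/d0 !le_min => /andP[-> /andP[-> /andP[-> ->]]].
have [dl1 dl2 dl3 dl4] := dle.
have tbox u : t <= u <= t + d0 -> s0 <= u <= s1 by move=> /andP[u1 u2]; apply/andP; split; lra.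
have zbox y : `|y - z| <= d0 -> y1 <= y <= y2.
  by rewrite ler_norml => /andP[u1 u2]; apply/andP; split; lra.
have sub : `[t, t + d0] `*` `[z - d0, z + d0] `<=` rel_closure T I A.
  move=> [u y] [/=]; rewrite !in_itv/= => hu hy; apply: (box_closure boxA AT); split; rewrite /= in_itv/=.
    exact: tbox.
  by apply: zbox; rewrite ler_distl.
have boxI y : `|y - z| <= d0 -> I y by move=> /zbox hy; have [] := box_I tin hy.
have dT : ((t + d0)%:E < T)%E by apply: le_lt_trans s1T; rewrite lee_fin -lerBrDl.
have t0 : 0 <= t by apply: (le_trans s0ge); exact: ltW.
have b_lt v : t <= v <= t + d0 -> b v < z - d0.
  move=> hv'; have vb := bL (tbox v hv') tin.
  have vt' : `|v - t| <= d0 by have /andP[u1 u2] := hv'; rewrite ger0_norm ?subr_ge0// lerBlDl.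
  have h1 : b v - b t <= L * d0.
    by apply: (le_trans (ler_norm _)); apply: (le_trans vb); rewrite ler_wpM2l.
  have h2 : (L + 1) * d0 <= (z - b t) / 2.
    rewrite mulrC -ler_pdivlMr//; apply: (le_trans dl4).
    by rewrite le_eqVlt; apply/orP; left; apply/eqP; field; rewrite gt_eqF.
  by move: h1 h2; rewrite mulrDl mul1r; move: (L * d0) => q h1 h2; lra.
have cVt : continuous Vt by exact: (cjk_ct s01' y12' boxA AT hCv).
have cVc : continuous Vc.
  by rewrite -(cjk_t0 s01' y12' boxA AT hCv); exact: (cjk_ct s01' y12' boxA AT hCv).
have Vth e : 0 < e -> exists2 dl, 0 < dl & forall u y,
    t <= u <= t + dl -> `|y - z| <= dl ->
    `|V (u, y) - V (t, y) - Vt (t, z) * (u - t)| <= e * (u - t).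
  move=> e0; have cw : {within setT, continuous Vt} by exact: continuous_subspaceT.
  have [k k0 hk] := box_near cw (Logic.I : [set: R * R] (t, z)) e0.
  exists (Num.min k d0); first by rewrite lt_min k0.
  move=> u y /andP[tu]; rewrite -lerBlDl le_min => /andP[uk ud]; rewrite le_min => /andP[yk yd].
  have hy := zbox y yd; have hu : s0 <= u <= s1 by apply: tbox; rewrite tu -lerBlDl.
  rewrite -(cl_id V hu hy) -(cl_id V tin hy).
  pose F w := Vc (w, y) - Vt (t, z) * w.
  have -> : Vc (u, y) - Vc (t, y) - Vt (t, z) * (u - t) = F u - F t by rewrite /F; ring.
  rewrite mulrBr.
  have cF : {within `[t, u], continuous F}.
    apply: continuous_subspaceT => w; apply: cvgB.
      by apply: continuous_pair_comp => // q; [exact: cvg_id|exact: cst_continuous].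
    by apply: cvgM; [exact: cvg_cst|exact: cvg_id].
  have cE : {within `[t, u], continuous (fun w => e * w)}.
    by apply: (is_derive_within_continuous (df := fun=> e)) => w _; exact: is_derive_linear.
  apply: (@derive_le_increment _ F (fun w => e * w) (fun w => Vt (w, y) - Vt (t, z)) (fun=> e) t u tu cF cE).
  - move=> w /andP[w1 w2]; have hw : s0 < w < s1.
      by have /andP[_ u1] := hu; rewrite (lt_trans t1)//= (lt_le_trans w2).
    have := cjk_dt boxA hCv (isT : (0 < 1)%N) hw hy.
    rewrite (cjk_t0 s01' y12' boxA AT hCv) => dV.
    exact: is_deriveB dV (is_derive_linear (Vt (t, z)) w).
  - by move=> w _; exact: is_derive_linear.
  - move=> w /andP[w1 w2]; apply: hk => //; rewrite ltW//= -lerBlDl.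
    by apply: le_trans uk; rewrite lerD2r ltW.
have touch : exists2 dl, 0 < dl & forall y, `|y - z| <= dl ->
    0 <= theta * (V (t, y) - V (t, z) - Vx (t, z) * (y - z) - M / 2 * (y - z) ^+ 2).
  exists (Num.min dz d0); first by rewrite lt_min dz0.
  move=> y; rewrite le_min => /andP[h1 h2].
  by have := H y h1; rewrite (cl_id V tin (zbox y h2)) (cl_id V tin zin).
have := viscosity hB mI hX hM hr hg hwp hv hb hopt t0 d00 dT boxI b_lt
  (continuous_subspaceW sub cmu) (continuous_subspaceW sub csigma) Vth th touch.
rewrite -(cl_id V tin zin) -(cl_id r tin zin) -(cl_id mu tin zin).
have -> : sigma z = Sg (t, z) by rewrite (cl_id (fun p => sigma p.2) tin zin).
have S0 := Sg_gt0 (t, z).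
have -> : Phi_value (t, z) - M = - (2 / Sg (t, z) ^+ 2) * (Sg (t, z) ^+ 2 / 2 * M
    + Mu (t, z) * Vx (t, z) + Vt (t, z) - Rc (t, z) * Vc (t, z)).
  by rewrite /Phi_value; field; rewrite gt_eqF.
by rewrite mulrCA => h; rewrite mulNr oppr_ge0 mulr_ge0_le0// divr_ge0// sqr_ge0.
Qed.

Lemma value_second_derivative t x : s0 < t < s1 -> b t < x < y2 ->
  is_derive x 1 (fun x => Vx (t, x)) (Phi_value (t, x)).
Proof.
move=> ht; have tin : s0 <= t <= s1 by have /andP[h1 h2] := ht; rewrite !ltW.
apply: (@touching_derivative _ (fun x => Vc (t, x)) (fun x => Vx (t, x)) (fun x => Phi_value (t, x)) (b t) y2).
- move=> z /andP[bz zy]; have hz : y1 < z < y2 by rewrite zy (lt_trans (b_gt tin)).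
  have := cjk_dx boxA hCv (isT : (0 < 1)%N) tin hz.
  by rewrite (cjk_x0 s01' y12' boxA AT hCv).
- move=> z _; apply: (continuous_pair_comp Phi_value_continuous) => q; [exact: cst_continuous|exact: cvg_id].
- move=> z M dz hz dz0 H; have := @touching_value (-1) t z M dz (or_intror erefl) ht hz dz0.
  rewrite mulN1r oppr_ge0 subr_le0; apply => v hv'.
  by rewrite mulN1r oppr_ge0; exact: H.
- move=> z M dz hz dz0 H; have := @touching_value 1 t z M dz (or_introl erefl) ht hz dz0.
  rewrite mul1r subr_ge0; apply => v hv'.
  by rewrite mul1r; exact: H.
Qed.

End second.

Lemma clamp_lip (R : realType) (lo hi x y : R) : lo <= hi ->
  `|clamp lo hi x - clamp lo hi y| <= `|x - y|.
Proof.
move=> lohi.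
suff main (u v : R) : u <= v -> 0 <= clamp lo hi v - clamp lo hi u <= v - u.
  have [xy|/ltW yx] := leP x y.
    rewrite distrC [leRHS]distrC [leRHS]ger0_norm ?subr_ge0//.
    by have /andP[h1 h2] := main _ _ xy; rewrite ger0_norm.
  rewrite [leRHS]ger0_norm ?subr_ge0//.
  by have /andP[h1 h2] := main _ _ yx; rewrite ger0_norm.
move=> uv; rewrite /clamp; case: (leP v hi) => hv; case: (leP u hi) => hu;
  case: (leP lo v) => lv; case: (leP lo u) => lu; case: (leP lo hi) => lh;
  by apply/andP; split; lra.
Qed.

Lemma ball_between (R : realType) (p q u w : R) : `|w - u| < Num.min (u - p) (q - u) -> p < w < q.
Proof.
by rewrite lt_min !ltr_norml => /andP[/andP[? ?] /andP[? ?]]; apply/andP; split; lra.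
Qed.

Lemma common_bound (R : realType) (s : seq R) : exists2 N, 1 <= N & forall x, x \in s -> x <= N.
Proof.
elim: s => [|x s [N N1 hN]]; first by exists 1.
exists (Num.max N x); first by rewrite le_max N1.
move=> y; rewrite inE le_max => /orP[/eqP->|/hN->//]; by rewrite lexx orbT.
Qed.

(** * The localised problem for v - g *)

Section local.
Variables (R : realType) (d : measure_display) (Omega : measurableType d)
  (P : probability Omega R) (B : R -> Omega -> R) (T : \bar R) (I : set R)
  (mu : R * R -> R) (sigma : R -> R)
  (X : R -> R -> R -> Omega -> R) (r g : R * R -> R) (b : R -> R).
Hypothesis hB : brownian_motion P B.
Hypothesis mI : measurable I.
Hypothesis hX : forall t x, times T t -> I x ->
  strong_solution P B T I mu sigma t x (X t x).
Hypothesis hM : markov_family P T I X.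
Hypothesis hr : {within times T `*` setT, continuous r}.
Hypothesis hg : {within times T `*` setT, continuous g}.
Hypothesis hwp : well_posed P T I r g X.
Hypothesis hv : {within times T `*` I, continuous (value P T r g X)}.
Hypothesis hb : {within times T, continuous b}.
Hypothesis hopt : forall t x, times T t -> I x ->
  optimal P T r g X t x (tau_star T b X t x).
Local Notation V := (value P T r g X).
Variables (A : set (R * R)) (s0 s1 y1 y2 L : R) (vt vx : nat -> R * R -> R)
  (gt gx gtt gtx mut mux rt rx st sx : nat -> R * R -> R) (Ls cs x1 x2 rho : R).
Hypotheses (s01 : s0 < s1) (y12 : y1 < y2) (s0ge : 0 <= s0) (s1T : (s1%:E < T)%E) (L0 : 0 <= L).
Hypothesis boxA : `[s0, s1] `*` `[y1, y2] `<=` A.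
Hypothesis AT : A `<=` times_before T `*` I.
Hypothesis bL : forall u v, s0 <= u <= s1 -> s0 <= v <= s1 -> `|b u - b v| <= L * `|u - v|.
Hypothesis b_gt : forall u, s0 <= u <= s1 -> y1 < b u.
Hypothesis hCv : Cjk T I A 1 1 V vt vx.
Hypothesis sigma_gt0 : forall x, I x -> 0 < sigma x.

Hypothesis below : forall t x, s0 <= t <= s1 -> y1 <= x <= y2 -> x <= b t -> V (t, x) = g (t, x).
Hypothesis hCg : Cjk T I A 1 2 g gt gx.
Hypothesis hCgt : Cjk T I A 1 2 (gt 1%N) gtt gtx.
Hypothesis hneg : forall p, rel_closure T I A p ->
  gt 1%N p + (2^-1 * sigma p.2 ^+ 2 * gx 2%N p + mu p * gx 1%N p) - r p * g p < 0.
Hypothesis hCmu : Cjk T I A 1 1 mu mut mux.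
Hypothesis hCr : Cjk T I A 1 1 r rt rx.
Hypothesis hCs : Cjk T I A 1 1 (fun p => sigma p.2) st sx.
Hypothesis hLs : forall p q, rel_closure T I A p -> rel_closure T I A q ->
  `|sx 1%N p - sx 1%N q| <= Ls * `|p - q|.
Hypothesis cs0 : 0 < cs.
Hypothesis hcs : forall p, rel_closure T I A p -> cs <= sigma p.2.
Hypotheses (yx1 : y1 < x1) (x12 : x1 < x2) (xy2 : x2 < y2) (x21 : x2 - x1 <= 1) (rho0 : 0 < rho).
Hypothesis b_in : forall t, s0 <= t <= s1 -> x1 + rho <= b t <= x2 - rho.

Local Notation cl := (cl s0 s1 y1 y2).
Local Notation Vc := (cl V).
Local Notation Vt := (cl (vt 1%N)).
Local Notation Vx := (cl (vx 1%N)).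
Local Notation Gc := (cl g).
Local Notation Gt := (cl (gt 1%N)).
Local Notation Gx := (cl (gx 1%N)).
Local Notation Gxx := (cl (gx 2%N)).
Local Notation Mu := (cl mu).
Local Notation Rc := (cl r).
Local Notation Sg := (cl (fun p => sigma p.2)).
Local Notation SX := (cl (sx 1%N)).

Let s01' := ltW s01. Let y12' := ltW y12.
Let inbox t x : s0 <= t <= s1 -> x1 <= x <= x2 -> y1 < x < y2.
Proof. by move=> _ /andP[h1 h2]; rewrite (lt_le_trans yx1)//= (le_lt_trans h2). Qed.

Definition Uf p := Vc p - Gc p.
Definition Utf p := Vt p - Gt p.
Definition Uxf p := Vx p - Gx p.
Definition hf p := Gt p + (2^-1 * Sg p ^+ 2 * Gxx p + Mu p * Gx p) - Rc p * Gc p.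
(** [sigma] depends on space alone but its derivative is given as a function of both variables, so
    it is read at the time [s0]. *)
Definition SX0 (p : R * R) := SX (s0, p.2).
Definition mf p := Mu p / Sg p - SX0 p / 2.
Definition Ff p := 2 / Sg p ^+ 2 * (- hf p - Utf p - Mu p * Uxf p + Rc p * Uf p).

Let cw (f f' : R * R -> R) : (forall p, rel_closure T I A p -> f p = f' p) ->
  {within rel_closure T I A, continuous f} -> {within rel_closure T I A, continuous f'}.
Proof. by move=> E; apply: subspace_eq_continuous => p; rewrite inE => /E. Qed.

Let cmu : {within rel_closure T I A, continuous mu}.
Proof.
have [h _ _ c _] := hCmu; apply: cw (c 0%N isT) => p /h[]; exact.
Qed.

Let csigma : {within rel_closure T I A, continuous (fun p => sigma p.2)}.
Proof.
have [h _ _ c _] := hCs; apply: cw (c 0%N isT) => p /h[]; exact.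
Qed.

Let Sg_cs p : cs <= Sg p.
Proof. by apply: hcs; apply: (box_closure boxA AT); exact: clampp_in. Qed.

Let Sgp p : 0 < Sg p. Proof. exact: lt_le_trans cs0 (Sg_cs p). Qed.

Let cVc : continuous Vc.
Proof. by rewrite -(cjk_t0 s01' y12' boxA AT hCv); exact: (cjk_ct s01' y12' boxA AT hCv). Qed.
Let cGc : continuous Gc.
Proof. by rewrite -(cjk_t0 s01' y12' boxA AT hCg); exact: (cjk_ct s01' y12' boxA AT hCg). Qed.
Let cMu : continuous Mu. Proof. exact: (cl_continuous s01' y12' boxA AT cmu). Qed.
Let cSg : continuous Sg. Proof. exact: (cl_continuous s01' y12' boxA AT csigma). Qed.
Let cRc : continuous Rc. Proof. exact: (cl_r_continuous hr s01 y12 boxA AT). Qed.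
Let cVt : continuous Vt. Proof. exact: (cjk_ct s01' y12' boxA AT hCv). Qed.
Let cVx : continuous Vx. Proof. exact: (cjk_cx s01' y12' boxA AT hCv). Qed.
Let cGt : continuous Gt. Proof. exact: (cjk_ct s01' y12' boxA AT hCg). Qed.
Let cGx : continuous Gx. Proof. exact: (cjk_cx s01' y12' boxA AT hCg). Qed.
Let cGxx : continuous Gxx. Proof. exact: (cjk_cx s01' y12' boxA AT hCg). Qed.
Let cSX : continuous SX. Proof. exact: (cjk_cx s01' y12' boxA AT hCs). Qed.

Let idc (f : R * R -> R) p : cl f (clampp s0 s1 y1 y2 p) = cl f p.
Proof. by rewrite /cl clampp_idem. Qed.

Let chf : continuous hf.
Proof.
move=> p; apply: cvgB; last by apply: cvgM; [exact: cRc|exact: cGc].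
apply: cvgD; first exact: cGt.
apply: cvgD; last by apply: cvgM; [exact: cMu|exact: cGx].
apply: cvgM; last exact: cGxx.
by apply: cvgM; [exact: cvg_cst|apply: cvgM; exact: cSg].
Qed.

Let cSX0 : continuous SX0.
Proof.
have cSs : continuous (fun x => SX (s0, x)).
  by apply: continuous_pair_comp => // q; [exact: cst_continuous|exact: cvg_id].
by move=> p; apply: (continuous_comp (f := snd) (g := fun x => SX (s0, x))); [exact: cvg_snd|exact: cSs].
Qed.

Let cmf : continuous mf.
Proof.
move=> p; apply: cvgB; apply: cvgM; [exact: cMu| |exact: cSX0|exact: cvg_cst].
by apply: cvgV; [rewrite gt_eqF|exact: cSg].
Qed.

Let cFf : continuous Ff.
Proof.
move=> p; apply: cvgM.
  apply: cvgM; first exact: cvg_cst.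
  by apply: cvgV; [rewrite gt_eqF// exprn_gt0|apply: cvgM; exact: cSg].
apply: cvgD; last by apply: cvgM; [exact: cRc|apply: cvgB; [exact: cVc|exact: cGc]].
apply: cvgB; last by apply: cvgM; [exact: cMu|apply: cvgB; [exact: cVx|exact: cGx]].
by apply: cvgB; [apply: cvgN; exact: chf|apply: cvgB; [exact: cVt|exact: cGt]].
Qed.

Let hf_id p : hf p = hf (clampp s0 s1 y1 y2 p).
Proof. by rewrite /hf !idc. Qed.

Let SX0_id p : SX0 p = SX0 (clampp s0 s1 y1 y2 p).
Proof. by rewrite /SX0 /cl /clampp /= [clamp y1 y2 (clamp _ _ _)]clamp_id// clamp_in. Qed.

Let hf_neg p : hf p < 0.
Proof.
rewrite hf_id /hf !idc /cl; apply: hneg.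
by apply: (box_closure boxA AT); exact: clampp_in.
Qed.

Let bd := cl_bounded s01' y12'.

Lemma mf_lip : exists2 K, 0 < K & forall t x s y, s0 <= t <= s1 -> y1 <= x <= y2 ->
  s0 <= s <= s1 -> y1 <= y <= y2 -> `|mf (t, x) - mf (s, y)| <= K * (`|t - s| + `|x - y|).
Proof.
have [K1 K10 h1] := bd (cjk_ct s01' y12' boxA AT hCmu (isT : (1 <= 1)%N)) (fun p => esym (idc _ p)).
have [K2 K20 h2] := bd (cjk_cx s01' y12' boxA AT hCmu (isT : (1 <= 1)%N)) (fun p => esym (idc _ p)).
have [K3 K30 h3] := bd cSX (fun p => esym (idc _ p)).
have [K4 K40 h4] := bd cMu (fun p => esym (idc _ p)).
exists (K1 / cs + K2 / cs + K4 * K3 / cs ^+ 2 + `|Ls|).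
  by rewrite ltr_pwDl// !addr_gt0 ?divr_gt0 ?mulr_gt0 ?exprn_gt0.
move=> t x s y ht hx hs hy.
have dMt t' x' : s0 < t' < s1 -> y1 <= x' <= y2 -> is_derive t' 1 (fun t => Mu (t, x')) (cl (mut 1%N) (t', x')).
  move=> a1 a2; have := cjk_dt boxA hCmu (isT : (0 < 1)%N) a1 a2.
  by rewrite (cjk_t0 s01' y12' boxA AT hCmu).
have dMx t' x' : s0 <= t' <= s1 -> y1 < x' < y2 -> is_derive x' 1 (fun x => Mu (t', x)) (cl (mux 1%N) (t', x')).
  move=> a1 a2; have := cjk_dx boxA hCmu (isT : (0 < 1)%N) a1 a2.
  by rewrite (cjk_x0 s01' y12' boxA AT hCmu).
have dSx t' x' : s0 <= t' <= s1 -> y1 < x' < y2 -> is_derive x' 1 (fun x => Sg (t', x)) (SX (t', x')).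
  move=> a1 a2; have := cjk_dx boxA hCs (isT : (0 < 1)%N) a1 a2.
  by rewrite (cjk_x0 s01' y12' boxA AT hCs).
have l1 := t_lip cMu dMt h1 ht hs hx.
have l2 := x_lip cMu dMx h2 hs hx hy.
have l3 : `|Sg (t, x) - Sg (s, y)| <= K3 * `|x - y| := x_lip cSg dSx h3 hs hx hy.
have ls : `|SX0 (t, x) - SX0 (s, y)| <= `|Ls| * `|x - y|.
  have s0in : s0 <= s0 <= s1 by rewrite lexx.
  rewrite /SX0 /= (cl_id _ s0in hx) (cl_id _ s0in hy).
  have c1 : rel_closure T I A (s0, x) by apply: (box_closure boxA AT); split; rewrite /= in_itv.
  have c2 : rel_closure T I A (s0, y) by apply: (box_closure boxA AT); split; rewrite /= in_itv.
  apply: (le_trans (hLs c1 c2)); apply: (@le_trans _ _ (`|Ls| * `|(s0, x) - (s0, y)|)).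
    by rewrite ler_wpM2r// ler_norm.
  rewrite ler_wpM2l// prod_normE /= subrr normr0 ge_max lexx normr_ge0//.
have E : mf (t, x) - mf (s, y) = (Mu (t, x) - Mu (s, x)) / Sg (t, x) + (Mu (s, x) - Mu (s, y)) / Sg (t, x)
    + Mu (s, y) * (Sg (s, y) - Sg (t, x)) / (Sg (t, x) * Sg (s, y)) - (SX0 (t, x) - SX0 (s, y)) / 2.
  by rewrite /mf; field; rewrite !gt_eqF.
have iv p : `|(Sg p)^-1| <= cs^-1 by rewrite normfV gtr0_norm// lef_pV2 ?posrE.
have q1 : `|(Mu (t, x) - Mu (s, x)) / Sg (t, x)| <= K1 / cs * `|t - s|.
  by rewrite normrM mulrAC; apply: ler_pM.
have q2 : `|(Mu (s, x) - Mu (s, y)) / Sg (t, x)| <= K2 / cs * `|x - y|.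
  by rewrite normrM mulrAC; apply: ler_pM.
have q3 : `|Mu (s, y) * (Sg (s, y) - Sg (t, x)) / (Sg (t, x) * Sg (s, y))| <= K4 * K3 / cs ^+ 2 * `|x - y|.
  have -> : K4 * K3 / cs ^+ 2 * `|x - y| = K4 * (K3 * `|x - y|) * (cs^-1 * cs^-1).
    by field; rewrite gt_eqF.
  rewrite normrM; apply: ler_pM => //.
    by rewrite normrM; apply: ler_pM => //; rewrite distrC.
  by rewrite invfM normrM; apply: ler_pM.
have q4 : `|(SX0 (t, x) - SX0 (s, y)) / 2| <= `|Ls| * `|x - y|.
  rewrite normrM; apply: (le_trans _ ls); rewrite ler_piMr// normfV normr_nat invf_le1// ler1n//.
rewrite E; have k1 : 0 <= K1 / cs by rewrite divr_ge0// ltW.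
have k2 : 0 <= K2 / cs by rewrite divr_ge0// ltW.
have k3 : 0 <= K4 * K3 / cs ^+ 2 by rewrite divr_ge0 ?mulr_ge0 ?exprn_ge0 ?ltW.
move: q1 q2 q3 q4 k1 k2 k3 (normr_ge0 Ls) (normr_ge0 (t - s)) (normr_ge0 (x - y)).
move: (_ / Sg (t, x)) (_ / Sg (t, x)) (_ / (_ * _)) (_ / 2) (K1 / cs) (K2 / cs) (K4 * K3 / cs ^+ 2) (`|Ls|) => a1 a2 a3 a4 c1 c2 c3 c4.
move: (`|t - s|) (`|x - y|) => z1 z2 q1 q2 q3 q4 k1 k2 k3 k4 z10 z20.
apply: (le_trans (ler_normB _ _)); apply: (@le_trans _ _ (c1 * z1 + c2 * z2 + c3 * z2 + c4 * z2)).
  apply: lerD => //; apply: (le_trans (ler_normD _ _)); apply: lerD => //.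
  by apply: (le_trans (ler_normD _ _)); apply: lerD.
have -> : (c1 + c2 + c3 + c4) * (z1 + z2) = c1 * z1 + c2 * z2 + c3 * z2 + c4 * z2
   + (c1 * z2 + c2 * z1 + c3 * z1 + c4 * z1) by ring.
by rewrite lerDl !addr_ge0 ?mulr_ge0.
Qed.

Let dGt t x : s0 < t < s1 -> y1 <= x <= y2 -> is_derive t 1 (fun t => Gc (t, x)) (Gt (t, x)).
Proof.
move=> a1 a2; have := cjk_dt boxA hCg (isT : (0 < 1)%N) a1 a2.
by rewrite (cjk_t0 s01' y12' boxA AT hCg).
Qed.
Let dGx t x : s0 <= t <= s1 -> y1 < x < y2 -> is_derive x 1 (fun x => Gc (t, x)) (Gx (t, x)).
Proof.
move=> a1 a2; have := cjk_dx boxA hCg (isT : (0 < 2)%N) a1 a2.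
by rewrite (cjk_x0 s01' y12' boxA AT hCg).
Qed.
Let dGxx t x : s0 <= t <= s1 -> y1 < x < y2 -> is_derive x 1 (fun x => Gx (t, x)) (Gxx (t, x)).
Proof. by move=> a1 a2; exact: (cjk_dx boxA hCg (isT : (1 < 2)%N) a1 a2). Qed.
Let dGtx t x : s0 <= t <= s1 -> y1 < x < y2 -> is_derive x 1 (fun x => Gt (t, x)) (cl (gtx 1%N) (t, x)).
Proof.
move=> a1 a2; have := cjk_dx boxA hCgt (isT : (0 < 2)%N) a1 a2.
by rewrite (cjk_x0 s01' y12' boxA AT hCgt).
Qed.

Let ct (f : R * R -> R) y : continuous f -> continuous (fun u => f (u, y)).
Proof. by move=> cf; apply: (continuous_pair_comp cf) => // q; [exact: cvg_id|exact: cst_continuous]. Qed.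
Let cx (f : R * R -> R) t : continuous f -> continuous (fun y => f (t, y)).
Proof. by move=> cf; apply: (continuous_pair_comp cf) => // q; [exact: cst_continuous|exact: cvg_id]. Qed.

(** Assumption (A) gives space derivatives of the time derivative of g, not the reverse. A space
    difference of g is Lipschitz in time with a constant proportional to the step, and dividing by
    the step exchanges the order. *)
Lemma Gx_lip : exists2 K, 0 < K & forall t s x, s0 <= t <= s1 -> s0 <= s <= s1 -> y1 < x < y2 ->
  `|Gx (t, x) - Gx (s, x)| <= K * `|t - s|.
Proof.
have [K K0 hK] := bd (cjk_cx s01' y12' boxA AT hCgt (isT : (1 <= 2)%N)) (fun p => esym (idc _ p)).
exists K => // t s x ht hs hx; have /andP[x1' x2'] := hx.
apply: (@first_difference_bound _ (fun z => Gc (t, z) - Gc (s, z)) (fun z => Gx (t, z) - Gx (s, z)) x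
  (Num.min (x - y1) (y2 - x))).
- by rewrite lt_min !subr_gt0 x1'.
- by have d1 := dGx ht hx; have d2 := dGx hs hx; exact: is_deriveB d1 d2.
- move=> k k0; rewrite lt_min => /andP[k1 k2].
  have xk : y1 <= x + k <= y2 by apply/andP; split; lra.
  have xx : y1 <= x <= y2 by rewrite !ltW.
  have -> : Gc (t, x + k) - Gc (s, x + k) - (Gc (t, x) - Gc (s, x))
    = (Gc (t, x + k) - Gc (t, x)) - (Gc (s, x + k) - Gc (s, x)) by ring.
  rewrite mulrAC.
  apply: (@one_variable_lip _ (fun u => Gc (u, x + k) - Gc (u, x)) (fun u => Gt (u, x + k) - Gt (u, x)) s0 s1) => //.
  + have c1 y : continuous (fun u => Gc (u, y)) by exact: ct.
    by move=> u; apply: cvgB; exact: c1.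
  + by move=> u hu; have d1 := dGt hu xk; have d2 := dGt hu xx; exact: is_deriveB d1 d2.
  + move=> u /andP[u1 u2]; have hu : s0 <= u <= s1 by rewrite !ltW.
    apply: (le_trans (x_lip cGt dGtx hK hu xk xx)).
    by rewrite [x + k]addrC addrK gtr0_norm.
Qed.

(** The same exchange with second differences: those of g_t are of the order of the squared step,
    because g_t has a bounded second space derivative. *)
Lemma Gxx_lip : exists2 K, 0 < K & forall t s x, s0 <= t <= s1 -> s0 <= s <= s1 -> y1 < x < y2 ->
  `|Gxx (t, x) - Gxx (s, x)| <= K * `|t - s|.
Proof.
have [K K0 hK] := bd (cjk_cx s01' y12' boxA AT hCgt (isT : (2 <= 2)%N)) (fun p => esym (idc _ p)).
exists K => // t s x ht hs hx; have /andP[x1' x2'] := hx.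
pose n := Num.min (x - y1) (y2 - x).
have inn z : `|z - x| < n -> y1 < z < y2.
  by rewrite lt_min !ltr_norml => /andP[/andP[? ?] /andP[? ?]]; apply/andP; split; lra.
apply: (@second_difference_bound _ (fun z => Gc (t, z) - Gc (s, z)) (fun z => Gx (t, z) - Gx (s, z))
  (fun z => Gxx (t, z) - Gxx (s, z)) x n).
- by rewrite lt_min !subr_gt0 x1'.
- by move=> z /inn hz; have d1 := dGx ht hz; have d2 := dGx hs hz; exact: is_deriveB d1 d2.
- by move=> z /inn hz; have d1 := dGxx ht hz; have d2 := dGxx hs hz; exact: is_deriveB d1 d2.
- have c1 y : continuous (fun z => Gxx (y, z)) by exact: cx.
  by apply: cvgB; exact: c1.
- move=> k k0 kn; have innk z : `|z - x| <= k -> y1 < z < y2 by move=> hz; apply: inn; exact: le_lt_trans hz kn.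
  have xk : y1 <= x + k <= y2.
    have [|z1 z2] := andP (innk (x + k) _); last by rewrite !ltW.
    by rewrite addrC addKr gtr0_norm.
  have xmk : y1 <= x - k <= y2.
    have [|z1 z2] := andP (innk (x - k) _); last by rewrite !ltW.
    by rewrite addrC addKr normrN gtr0_norm.
  have xx : y1 <= x <= y2 by rewrite !ltW.
  have -> : Gc (t, x + k) - Gc (s, x + k) - 2 * (Gc (t, x) - Gc (s, x)) + (Gc (t, x - k) - Gc (s, x - k))
    = (Gc (t, x + k) - 2 * Gc (t, x) + Gc (t, x - k)) - (Gc (s, x + k) - 2 * Gc (s, x) + Gc (s, x - k)) by ring.
  rewrite mulrAC.
  apply: (@one_variable_lip _ (fun u => Gc (u, x + k) - 2 * Gc (u, x) + Gc (u, x - k))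
    (fun u => Gt (u, x + k) - 2 * Gt (u, x) + Gt (u, x - k)) s0 s1) => //.
  + have cs' y : continuous (fun u => Gc (u, y)) by exact: ct.
    move=> u; apply: cvgD; last exact: cs'.
    by apply: cvgB; [exact: cs'|apply: cvgM; [exact: cvg_cst|exact: cs']].
  + move=> u hu; have d1 := dGt hu xk; have d2 := dGt hu xx; have d3 := dGt hu xmk.
    have := is_deriveD (is_deriveB d1 (is_deriveM (is_derive_cst (2 : R) u 1) d2)) d3.
    by move/is_derive_eq; apply; rewrite /GRing.scale /=; ring.
  + move=> u /andP[u1 u2]; have hu : s0 <= u <= s1 by rewrite !ltW.
    apply: (@second_difference_le _ (fun z => Gt (u, z)) (fun z => cl (gtx 1%N) (u, z))
      (fun z => cl (gtx 2%N) (u, z)) x k K (ltW k0)) => z hz; last exact: hK.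
      by apply: dGtx => //; exact: innk.
    by apply: (cjk_dx boxA hCgt (isT : (1 < 2)%N) hu); exact: innk.
Qed.

Lemma hf_lip : exists2 K, 0 < K & forall t s x, s0 <= t <= s1 -> s0 <= s <= s1 -> y1 < x < y2 ->
  `|hf (t, x) - hf (s, x)| <= K * `|t - s|.
Proof.
have [Ka Ka0 ha] := Gx_lip; have [Kb Kb0 hb'] := Gxx_lip.
have [K1 K10 h1] := bd (cjk_ct s01' y12' boxA AT hCgt (isT : (1 <= 1)%N)) (fun p => esym (idc _ p)).
have [K2 K20 h2] := bd cGt (fun p => esym (idc _ p)).
have [K3 K30 h3] := bd (cjk_ct s01' y12' boxA AT hCmu (isT : (1 <= 1)%N)) (fun p => esym (idc _ p)).
have [K4 K40 h4] := bd (cjk_ct s01' y12' boxA AT hCr (isT : (1 <= 1)%N)) (fun p => esym (idc _ p)).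
have [B1 B10 c1] := bd cSg (fun p => esym (idc _ p)).
have [B2 B20 c2] := bd cMu (fun p => esym (idc _ p)).
have [B3 B30 c3] := bd cGx (fun p => esym (idc _ p)).
have [B4 B40 c4] := bd cRc (fun p => esym (idc _ p)).
have [B5 B50 c5] := bd cGc (fun p => esym (idc _ p)).
exists (K1 + (2^-1 * B1 ^+ 2 * Kb + (K3 * B3 + B2 * Ka)) + (K4 * B5 + B4 * K2)).
  by rewrite !addr_gt0 ?mulr_gt0 ?exprn_gt0 ?invr_gt0.
move=> t s x ht hs hx; have hx' : y1 <= x <= y2 by have /andP[z1 z2] := hx; rewrite !ltW.
have dGtt t' x' : s0 < t' < s1 -> y1 <= x' <= y2 -> is_derive t' 1 (fun t => Gt (t, x')) (cl (gtt 1%N) (t', x')).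
  move=> a1 a2; have := cjk_dt boxA hCgt (isT : (0 < 1)%N) a1 a2.
  by rewrite (cjk_t0 s01' y12' boxA AT hCgt).
have dMt t' x' : s0 < t' < s1 -> y1 <= x' <= y2 -> is_derive t' 1 (fun t => Mu (t, x')) (cl (mut 1%N) (t', x')).
  move=> a1 a2; have := cjk_dt boxA hCmu (isT : (0 < 1)%N) a1 a2.
  by rewrite (cjk_t0 s01' y12' boxA AT hCmu).
have dRt t' x' : s0 < t' < s1 -> y1 <= x' <= y2 -> is_derive t' 1 (fun t => Rc (t, x')) (cl (rt 1%N) (t', x')).
  move=> a1 a2; have := cjk_dt boxA hCr (isT : (0 < 1)%N) a1 a2.
  by rewrite (cjk_t0 s01' y12' boxA AT hCr).
have l1 := t_lip cGt dGtt h1 ht hs hx'.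
have l2 := t_lip cGc dGt h2 ht hs hx'.
have l3 := t_lip cMu dMt h3 ht hs hx'.
have l4 := t_lip cRc dRt h4 ht hs hx'.
have l5 := ha t s x ht hs hx. have l6 := hb' t s x ht hs hx.
have Sgts : Sg (t, x) = Sg (s, x) by [].
have b1 := c1 (t, x); have b2 := c2 (s, x); have b3 := c3 (t, x); have b4 := c4 (s, x); have b5 := c5 (t, x).
rewrite /hf -Sgts.
have b1' : `|2^-1 * Sg (t, x) ^+ 2| <= 2^-1 * B1 ^+ 2.
  rewrite normrM normrX ger0_norm ?invr_ge0// ler_pM2l ?invr_gt0//.
  by rewrite ler_sqr ?nnegrE// ltW.
move: b1' b2 b3 b4 b5 l1 l2 l3 l4 l5 l6; clear b1.
move: (2^-1 * Sg (t, x) ^+ 2) (2^-1 * B1 ^+ 2) (Gt (t, x)) (Gt (s, x)) (Gc (t, x)) (Gc (s, x)) (Mu (t, x)) (Mu (s, x)).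
move: (Gx (t, x)) (Gx (s, x)) (Gxx (t, x)) (Gxx (s, x)) (Rc (t, x)) (Rc (s, x)) (`|t - s|).
move=> gx1 gx2 gy1 gy2 r1 r2 z w w' g1 g2 e1 e2 m1 m2 b1 b2 b3 b4 b5 l1 l2 l3 l4 l5 l6.
have -> : g1 + (w * gy1 + m1 * gx1) - r1 * e1 - (g2 + (w * gy2 + m2 * gx2) - r2 * e2)
  = (g1 - g2) + (w * (gy1 - gy2) + ((m1 - m2) * gx1 + m2 * (gx1 - gx2))) - ((r1 - r2) * e1 + r2 * (e1 - e2)) by ring.
have pm (p q p' q' : R) : `|p| <= p' -> `|q| <= q' -> `|p * q| <= p' * q'.
  by move=> hp hq; rewrite normrM; apply: ler_pM.
have -> : (K1 + (w' * Kb + (K3 * B3 + B2 * Ka)) + (K4 * B5 + B4 * K2)) * z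
  = K1 * z + (w' * (Kb * z) + ((K3 * z) * B3 + B2 * (Ka * z))) + ((K4 * z) * B5 + B4 * (K2 * z)) by ring.
apply: (le_trans (ler_normB _ _)); apply: lerD.
  apply: (le_trans (ler_normD _ _)); apply: lerD => //.
  apply: (le_trans (ler_normD _ _)); apply: lerD; first exact: pm.
  by apply: (le_trans (ler_normD _ _)); apply: lerD; exact: pm.
by apply: (le_trans (ler_normD _ _)); apply: lerD; exact: pm.
Qed.

Let Vbelow t x : s0 <= t <= s1 -> y1 <= x <= y2 -> x <= b t -> Uf (t, x) = 0.
Proof. by move=> ht hx xb; rewrite /Uf (cl_id _ ht hx) (cl_id _ ht hx) below// subrr. Qed.

Let derive_zero (f : R -> R) (x l n : R) : is_derive x 1 f l -> 0 < n -> (forall z, `|z - x| < n -> f z = 0) -> l = 0.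
Proof.
move=> df n0 f0.
have near0 : \forall z \near x, f z = cst 0 z.
  by exists n => // z /= hz; rewrite f0// distrC.
have d0 : is_derive x 1 f 0 by apply: (near_eq_is_derive _ (is_derive_cst 0 x 1)); apply: filterS near0 => z ->.
by have [_ <-] := df; have [_ ->] := d0.
Qed.

Let left_limit_zero (f : R -> R) a c : a < c -> continuous f -> (forall z, a < z < c -> f z = 0) -> f c = 0.
Proof.
move=> ac cf f0; apply/eqP; rewrite -normr_le0; apply/ler_addgt0Pr => e e0; rewrite add0r.
have /cvgrPdist_le/(_ _ e0) [n /= n0 hn] := cf c.
pose z := Num.max ((a + c) / 2) (c - n / 2).
have n2 : 0 < n / 2 by rewrite divr_gt0.
have zac : a < z < c by rewrite lt_max gt_max; apply/andP; split; [apply/orP; left|apply/andP; split]; lra.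
have zn : `|c - z| < n.
  have : c - n / 2 <= z by rewrite le_max lexx orbT.
  by have /andP[_ zc] := zac; rewrite gtr0_norm ?subr_gt0// => h; lra.
by have := hn z zn; rewrite /= (f0 z zac) subr0.
Qed.

Lemma fbox_exists : exists N, fbox N s0 s1 x1 x2 rho (fun t => b (clamp s0 s1 t))
  Uf Utf Uxf hf mf mu Rc (fun x => Sg (s0, x)) (fun x => SX (s0, x)).
Proof.
have cUf : continuous Uf by move=> p; apply: cvgB; [exact: cVc|exact: cGc].
have cUtf : continuous Utf by move=> p; apply: cvgB; [exact: cVt|exact: cGt].
have cUxf : continuous Uxf by move=> p; apply: cvgB; [exact: cVx|exact: cGx].
have chi' : continuous (fun p => (hf p)^-1) by move=> p; apply: cvgV; [rewrite lt_eqF|exact: chf].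
have [B1 B10 c1] := bd cUf (fun p => esym (f_equal2 (fun a b => a - b) (idc _ p) (idc _ p))).
have [B2 B20 c2] := bd cUtf (fun p => esym (f_equal2 (fun a b => a - b) (idc _ p) (idc _ p))).
have [B3 B30 c3] := bd cUxf (fun p => esym (f_equal2 (fun a b => a - b) (idc _ p) (idc _ p))).
have [B4 B40 c4] := bd chf hf_id.
have mf_id p : mf p = mf (clampp s0 s1 y1 y2 p) by rewrite /mf !idc -SX0_id.
have [B5 B50 c5] := bd cmf mf_id.
have [B6 B60 c6] := bd cRc (fun p => esym (idc _ p)).
have [B7 B70 c7] := bd chi' (fun p => f_equal GRing.inv (hf_id p)).
have Ff_id p : Ff p = Ff (clampp s0 s1 y1 y2 p) by rewrite /Ff /Utf /Uxf /Uf -hf_id !idc.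
have [B8 B80 c8] := bd cFf Ff_id.
have [B9 B90 c9] := bd cSg (fun p => esym (idc _ p)).
have [Km Km0 lm] := mf_lip.
have [Kh Kh0 lh] := hf_lip.
have ics : 0 < cs^-1 by rewrite invr_gt0.
(* One constant for all bounds. The inverse of [cs] is included for the ellipticity, and the bound
   on 1/h for the strict negativity of h. *)
have [N n0 hN] := common_bound [:: L; B1; B2; B3; B4; B5; B6; B7; B8; B9; Km; Kh; cs^-1].
have [n1 n2 n3] : [/\ L <= N, B1 <= N & B2 <= N] by split; apply: hN; rewrite !inE eqxx ?orbT.
have [n4 n5 n6 n7] : [/\ B3 <= N, B4 <= N, B5 <= N & B6 <= N].
  by split; apply: hN; rewrite !inE eqxx ?orbT.
have [n8 n9 na nb] : [/\ B7 <= N, B8 <= N, B9 <= N & Km <= N].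
  by split; apply: hN; rewrite !inE eqxx ?orbT.
have [nc nd] : Kh <= N /\ cs^-1 <= N by split; apply: hN; rewrite !inE eqxx ?orbT.
have N0 : 0 < N := lt_le_trans ltr01 n0.
have cin t : s0 <= clamp s0 s1 t <= s1 by exact: clamp_in.
have s0in : s0 <= s0 <= s1 by rewrite lexx.
have wide x : x1 <= x <= x2 -> y1 <= x <= y2.
  by move=> /(inbox s0in)/andP[h1 h2]; rewrite !ltW.
have ctin t : s0 < t < s1 -> s0 <= t <= s1 by move=> /andP[h1 h2]; rewrite !ltW.
have dU t x : s0 <= t <= s1 -> y1 < x < y2 -> is_derive x 1 (fun x => Uf (t, x)) (Uxf (t, x)).
  move=> ht hx; have d1 := cjk_dx boxA hCv (isT : (0 < 1)%N) ht hx.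
  rewrite (cjk_x0 s01' y12' boxA AT hCv) in d1.
  by have d2 := dGx ht hx; exact: is_deriveB d1 d2.
have dUt t x : s0 < t < s1 -> y1 <= x <= y2 -> is_derive t 1 (fun t => Uf (t, x)) (Utf (t, x)).
  move=> ht hx; have d1 := cjk_dt boxA hCv (isT : (0 < 1)%N) ht hx.
  rewrite (cjk_t0 s01' y12' boxA AT hCv) in d1.
  by have d2 := dGt ht hx; exact: is_deriveB d1 d2.
have bcl t : s0 <= t <= s1 -> b (clamp s0 s1 t) = b t by move=> ht; rewrite clamp_id.
have bi t : s0 <= t <= s1 -> x1 < b t < x2.
  move=> /b_in/andP[h1 h2]; apply/andP; split; first by apply: lt_le_trans h1; rewrite ltrDl.
  by apply: (le_lt_trans h2); rewrite gtrBl.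
(* Strictly below the boundary U vanishes on a neighbourhood, hence so do its derivatives; on the
   boundary they vanish as limits from the left. *)
have below_x t x : s0 < t < s1 -> y1 < x < b t -> Uxf (t, x) = 0.
  move=> ht /andP[x1' xb]; have tin := ctin t ht; have /andP[_ bx2] := bi t tin.
  have hx : y1 < x < y2 by rewrite x1' (lt_trans xb)// (lt_trans bx2).
  apply: (derive_zero (dU t x tin hx) (n := Num.min (x - y1) (b t - x))).
    by rewrite lt_min !subr_gt0 x1'.
  move=> z /ball_between/andP[z1 z2]; apply: Vbelow => //; last exact: ltW.
  by rewrite ltW//= ltW// (lt_trans z2)// (lt_trans bx2).
have below_t t x : s0 < t < s1 -> y1 <= x < b t -> Utf (t, x) = 0.
  move=> ht /andP[x1' xb]; have tin := ctin t ht; have /andP[_ bx2] := bi t tin.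
  have hx : y1 <= x <= y2 by rewrite x1' !ltW// (lt_trans xb)// (lt_trans bx2).
  have /andP[t1 t2] := ht; have Lp : 0 < L + 1 by rewrite ltr_wpDl.
  (* At a fixed x below b(t), the Lipschitz bound keeps x below the boundary for times this close to
     [t]. *)
  apply: (derive_zero (dUt t x ht hx) (n := Num.min (Num.min (t - s0) (s1 - t)) ((b t - x) / (L + 1)))).
    by rewrite !lt_min !subr_gt0 t1 t2 divr_gt0// subr_gt0.
  move=> z; rewrite !lt_min => /andP[/andP[z1 z2] z3].
  have zin : s0 <= z <= s1.
    by apply: ctin; apply: (@ball_between _ _ _ t); rewrite lt_min z1.
  apply: Vbelow => //; have := bL tin zin; rewrite distrC [`|t - z|]distrC => h.
  have h2 : L * `|z - t| <= b t - x.
    apply: (@le_trans _ _ ((L + 1) * `|z - t|)); first by rewrite ler_wpM2r// lerDl.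
    by rewrite mulrC -ler_pdivlMr// ltW.
  rewrite -subr_ge0; have := le_trans h h2; rewrite ler_norml => /andP[+ _].
  by rewrite opprB lerBrDr subrK subr_ge0.
notypeclasses refine (ex_intro _ N (Fbox _ _ _ _ _ _ _ _ _ _ _ _ _ _ _ _ _ _ _ _ _ _)).
- exact: n0.
- exact: s01.
- exact: x12.
- exact: x21.
- exact: rho0.
- by move=> t; exact: b_in.
- move=> t s; apply: (le_trans (bL (cin t) (cin s))); apply: ler_pM => //.
  by apply: clamp_lip; exact: ltW.
- by split; [exact: cUf|exact: cUtf|exact: cUxf|exact: chf|exact: cmf].
- exact: cRc.
- move=> p; split.
  + exact: le_trans (c1 p) n2.
  + exact: le_trans (c2 p) n3.
  + exact: le_trans (c3 p) n4.
  + exact: le_trans (c4 p) n5.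
  + exact: le_trans (c5 p) n6.
- by move=> p; exact: le_trans (c6 p) n7.
- move=> p; have h0 := hf_neg p; rewrite lerNr; have := le_trans (c7 p) n8.
  rewrite normfV (ltr0_norm h0) => h; have nh : 0 < - hf p by rewrite oppr_gt0.
  by rewrite -[leRHS]invrK lef_pV2 ?posrE ?invr_gt0.
- by move=> t x ht /wide; exact: dUt.
- by move=> t x ht hx; apply: dU => //; apply: (inbox ht); have /andP[h1 h2] := hx; rewrite !ltW.
- move=> t x ht; rewrite (bcl t (ctin t ht)) => /andP[x1' xb].
  have tin := ctin t ht; have /andP[xb1 bx2] := bi t tin.
  have hx : y1 <= x <= y2 by apply: wide; rewrite x1' (le_trans xb)// ltW.
  have yx : y1 < x := lt_le_trans yx1 x1'.
  split; first exact: Vbelow.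
    move: xb; rewrite le_eqVlt => /orP[/eqP E|xb]; last by apply: below_x; rewrite // yx.
    apply: (@left_limit_zero (fun z => Uxf (t, z)) y1 x yx); first exact: cx.
    by move=> z hz; apply: below_x => //; rewrite -E.
  move: xb; rewrite le_eqVlt => /orP[/eqP E|xb]; last by apply: below_t; rewrite // ltW.
  apply: (@left_limit_zero (fun z => Utf (t, z)) y1 x yx); first exact: cx.
  by move=> z /andP[z1 z2]; apply: below_t => //; rewrite -E z2 ltW.
- move=> t x ht; rewrite (bcl t (ctin t ht)) => /andP[bx xx2] F.
  have tin := ctin t ht; have /andP[xb1 bx2] := bi t tin.
  have hx : y1 < x < y2 by rewrite (lt_trans yx1) ?(lt_trans xb1)//= (lt_trans xx2).
  have hx' : y1 <= x <= y2 by have /andP[h1 h2] := hx; rewrite !ltW.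
  have FE : F = Ff (t, x) by rewrite /F /Ff (cl_id mu tin hx').
  split; last by rewrite FE; exact: le_trans (c8 _) n9.
  have hbx : b t < x < y2 by rewrite bx (lt_trans xx2).
  have d1 := value_second_derivative hB mI hX hM hr hg hwp hv hb hopt s01 y12 s0ge s1T L0 boxA AT bL b_gt
     hCv cmu csigma sigma_gt0 ht hbx.
  have d2 := dGxx tin hx.
  have := is_deriveB d1 d2; move/is_derive_eq; apply.
  have S0 := Sgp (t, x).
  by rewrite FE /Ff /Phi_value /hf /Utf /Uxf /Uf; field; rewrite gt_eqF.
- exact: cx.
- move=> x; rewrite (le_trans _ (Sg_cs _)) /=; last by rewrite -[leRHS]invrK lef_pV2 ?posrE ?invr_gt0.
  by apply: (le_trans (ler_norm _)); exact: le_trans (c9 _) na.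
- move=> x hx; have hx' : y1 < x < y2 by apply: (inbox s0in); have /andP[h1 h2] := hx; rewrite !ltW.
  have := cjk_dx boxA hCs (isT : (0 < 1)%N) s0in hx'.
  by rewrite (cjk_x0 s01' y12' boxA AT hCs).
- move=> t x ht hx; have hx' : y1 <= x <= y2 by apply: wide; have /andP[h1 h2] := hx; rewrite !ltW.
  rewrite /mf /SX0 /= (cl_id mu (ctin t ht) hx') -[Sg (s0, x)]/(Sg (t, x)).
  by have S0 := Sgp (t, x); field; rewrite gt_eqF.
- move=> t x s y ht hx hs hy; apply: (le_trans (lm _ _ _ _ ht (wide _ hx) hs (wide _ hy))).
  by apply: ler_wpM2r nb; rewrite addr_ge0.
- move=> t s x ht hs hx; apply: (le_trans (lh t s x ht hs (inbox ht hx))).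
  exact: ler_wpM2r nc.
Qed.

End local.

(** * Differentiability of the boundary *)

Section final.
Variables (R : realType) (d : measure_display) (Omega : measurableType d)
  (P : probability Omega R) (B : R -> Omega -> R) (T : \bar R) (I : set R)
  (mu : R * R -> R) (sigma : R -> R)
  (X : R -> R -> R -> Omega -> R) (r g : R * R -> R) (b : R -> R).
Hypothesis hB : brownian_motion P B.
Hypothesis hIopen : open I.
Hypothesis hsigma : forall x, I x -> 0 < sigma x.
Hypothesis hX : forall t x, times T t -> I x ->
  unique_strong_solution P B T I mu sigma t x (X t x).
Hypothesis hM : markov_family P T I X.
Hypothesis hr : {within times T `*` setT, continuous r}.
Hypothesis hg : {within times T `*` setT, continuous g}.
Hypothesis hwp : well_posed P T I r g X.
Hypothesis hv : {within times T `*` I, continuous (value P T r g X)}.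
Hypothesis hb : {within times T, continuous b}.
Hypothesis hopt : forall t x, times T t -> I x ->
  optimal P T r g X t x (tau_star T b X t x).
Hypothesis hA : assumption_A T I mu sigma r g (value P T r g X) b.
Variables (T1 L : R).
Hypotheses (hT1T : (T1%:E < T)%E) (L0 : 0 <= L).
Hypothesis bL : forall u v, 0 <= u <= T1 -> 0 <= v <= T1 -> `|b u - b v| <= L * `|u - v|.

Lemma local_slopes t0 e : 0 <= t0 < T1 -> 0 < e -> exists2 dl, 0 < dl &
  forall t s u v, 0 <= t -> t < s -> s < T1 -> 0 <= u -> u < v -> v < T1 ->
    `|t - t0| <= dl -> `|s - t0| <= dl -> `|u - t0| <= dl -> `|v - t0| <= dl ->
    `|(b s - b t) / (s - t) - (b v - b u) / (v - u)| <= e.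
Proof.
move=> /andP[t00 t0T] e0.
have tb0 : times_before T t0 by split=> //; apply: lt_trans hT1T; rewrite lte_fin.
have [A /= [[[_ [W [oW AW]]] cAT At0] [[vt [vx hCv]] [gt [gx [hCg [gtt [gtx hCgt]] hneg]]]
  [al [mut [mux [rt [rx [_ hCmu hCr _]]]]]] [st [sx [hCs [Ls hLs] [cs [cs0 hcs]]]]]]]] := hA tb0.
have AT : A `<=` times_before T `*` I by rewrite AW => p [].
have Wt0 : W (t0, b t0) by move: At0; rewrite AW => -[].
have Ib0 : I (b t0) by have [_ h] := AT _ At0.
have nW : nbhs (t0, b t0) W by exact: open_nbhs_nbhs.
have nI : nbhs (b t0) I by exact: open_nbhs_nbhs.
move: nW nI => [[U1 U2] /= [[d1 /= d10 U1s] [d2 /= d20 U2s]] hU] [d3 /= d30 I3].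
(* Half the height of the box on which Assumption (A) is used; the inner interval [x1, x2] then has
   length [ee], at most 1. *)
pose ee := Num.min 2^-1 (Num.min (d2 / 2) (d3 / 2)).
have ee0 : 0 < ee by rewrite !lt_min invr_gt0 ltr0n (divr_gt0 d20)// (divr_gt0 d30).
have [ee1 ee2 ee3] : [/\ ee <= 2^-1, ee <= d2 / 2 & ee <= d3 / 2].
  have : ee <= ee by []. by rewrite {2}/ee !le_min => /andP[-> /andP[-> ->]].
(* The last entry limits the displacement of b to [ee / 4], which is also the margin left to [x1]
   and [x2]. *)
pose dt := Num.min (d1 / 2) (Num.min (T1 - t0) (ee / (4 * (L + 1)))).
have L1 : 0 < L + 1 by rewrite ltr_wpDl.
have dt0 : 0 < dt by rewrite !lt_min (divr_gt0 d10)// subr_gt0 t0T divr_gt0// mulr_gt0.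
have [dt1 dt2 dt3] : [/\ dt <= d1 / 2, dt <= T1 - t0 & dt <= ee / (4 * (L + 1))].
  have : dt <= dt by []. by rewrite {2}/dt !le_min => /andP[-> /andP[-> ->]].
(* For [t0 = 0] the box starts at [t0]. This is harmless, as the kernel looks only at later
   times. *)
pose s0 := Num.max 0 (t0 - dt); pose s1 := t0 + dt.
have s0t0 : s0 <= t0 by rewrite ge_max t00 gerBl ltW.
have t0s1 : t0 < s1 by rewrite ltrDl.
have s01 : s0 < s1 := le_lt_trans s0t0 t0s1.
have s0ge : 0 <= s0 by rewrite le_max lexx.
have s1T1 : s1 <= T1 by rewrite /s1 -lerBrDl.
have s1T : (s1%:E < T)%E by apply: le_lt_trans hT1T; rewrite lee_fin.
have near t : s0 <= t <= s1 -> `|t - t0| <= dt.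
  rewrite /s0 /s1 ge_max => /andP[/andP[_ h1] h2].
  by rewrite ler_distl h1.
have inT t : s0 <= t <= s1 -> 0 <= t <= T1.
  by move=> /andP[h1 h2]; rewrite (le_trans s0ge)//= (le_trans h2).
pose y1 := b t0 - ee; pose y2 := b t0 + ee.
pose x1 := b t0 - ee / 2; pose x2 := b t0 + ee / 2.
have y12 : y1 < y2 by rewrite /y1 /y2; lra.
have yx1 : y1 < x1 by rewrite /y1 /x1; lra.
have x12 : x1 < x2 by rewrite /x1 /x2; lra.
have xy2 : x2 < y2 by rewrite /x2 /y2; lra.
have x21 : x2 - x1 <= 1.
  have -> : x2 - x1 = ee by rewrite /x1 /x2; field.
  by apply: (le_trans ee1); rewrite invf_le1// ler1n.
have rho0 : 0 < ee / 4 by rewrite divr_gt0.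
have bL' u v : s0 <= u <= s1 -> s0 <= v <= s1 -> `|b u - b v| <= L * `|u - v|.
  by move=> hu hv'; apply: bL; exact: inT.
have b_in t : s0 <= t <= s1 -> x1 + ee / 4 <= b t <= x2 - ee / 4.
  move=> ht; have ht0 : s0 <= t0 <= s1 by rewrite s0t0 ltW.
  have h1 := bL' t t0 ht ht0.
  have h2 : L * `|t - t0| <= ee / 4.
    apply: (@le_trans _ _ ((L + 1) * (ee / (4 * (L + 1))))).
      apply: ler_pM => //; first by rewrite lerDl.
      exact: le_trans (near t ht) dt3.
    by rewrite le_eqVlt; apply/orP; left; apply/eqP; field; rewrite gt_eqF.
  move: (le_trans h1 h2); rewrite ler_norml /x1 /x2 => /andP[? ?].
  by apply/andP; split; lra.
have boxA : `[s0, s1] `*` `[y1, y2] `<=` A.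
  move=> [t x] [/=]; rewrite !in_itv/= => ht hx.
  have hxn : `|b t0 - x| <= ee by rewrite distrC ler_distl.
  rewrite AW; split.
    apply: hU; split => /=.
      apply: U1s => /=; rewrite distrC; apply: (le_lt_trans (near t ht)).
      by apply: (le_lt_trans dt1); rewrite ltr_pdivrMr// ltr_pMr// ltr1n.
    apply: U2s => /=; apply: (le_lt_trans hxn); apply: (le_lt_trans ee2).
    by rewrite ltr_pdivrMr// ltr_pMr// ltr1n.
  have /andP[z1 z2] := inT t ht; split; first split=> //=.
    by apply: le_lt_trans hT1T; rewrite lee_fin.
  apply: I3 => /=; apply: (le_lt_trans hxn); apply: (le_lt_trans ee3).
  by rewrite ltr_pdivrMr// ltr_pMr// ltr1n.
have hX' t x : times T t -> I x -> strong_solution P B T I mu sigma t x (X t x).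
  by move=> ht hx; have [] := hX ht hx.
have below t x : s0 <= t <= s1 -> y1 <= x <= y2 -> x <= b t -> value P T r g X (t, x) = g (t, x).
  move=> ht hx xb; have [tbt Ix] : times_before T t /\ I x.
    by have [] := AT (t, x) (boxA _ (conj _ _)); rewrite /= ?in_itv.
  exact: (stopped_value hB hX' hr hg hwp hb hopt tbt Ix xb).
have mI : measurable I by exact: open_measurable.
have b_gt u : s0 <= u <= s1 -> y1 < b u.
  by move=> /b_in/andP[h1 _]; apply: lt_le_trans h1; apply: (lt_trans yx1); rewrite ltrDl.
have hLs' p q : rel_closure T I A p -> rel_closure T I A q -> `|sx 1%N p - sx 1%N q| <= Ls * `|p - q|.
  by move=> hp hq; exact: (hLs (p, q) (conj hp hq)).
have [N hN] := fbox_exists hB mI hX' hM hr hg hwp hv hb hopt s01 y12 s0ge s1T L0 boxA AT bL' b_gt hCv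
  hsigma below hCg hCgt hneg hCmu hCr hCs hLs' cs0 hcs yx1 x12 xy2 x21 rho0 b_in.
have t0in : s0 <= t0 < s1 by rewrite s0t0.
have [k k0 hk] := slopes_cauchy hN t0in e0.
exists (Num.min k dt); first by rewrite lt_min k0.
have inw t : 0 <= t -> `|t - t0| <= Num.min k dt -> s0 <= t <= s1 /\ `|t - t0| <= k.
  move=> t_0; rewrite le_min => /andP[-> h]; split => //.
  by rewrite /s0 /s1 ge_max t_0; move: h; rewrite ler_distl.
move=> t s u v t_0 ts _ u_0 uv _ td sd ud vd.
have [tin tk] := inw t t_0 td; have [sin sk] := inw s (le_trans t_0 (ltW ts)) sd.
have [uin uk] := inw u u_0 ud; have [vin vk] := inw v (le_trans u_0 (ltW uv)) vd.
have /andP[a1 a2] := tin; have /andP[a3 a4] := sin.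
have /andP[a5 a6] := uin; have /andP[a7 a8] := vin.
have := hk t s u v a1 ts a4 a5 uv a8 tk sk uk vk.
by rewrite !clamp_id.
Qed.

Local Notation D := (`[0, T1[%classic : set R).
Let quo (t h : R) := h^-1 * (b (t + h) - b t).

Let DE t : D t <-> 0 <= t < T1. Proof. by rewrite /= in_itv. Qed.

Lemma local_quotients t0 e : D t0 -> 0 < e -> exists2 dl, 0 < dl &
  forall t h s k, D t -> D (t + h) -> D s -> D (s + k) -> `|t - t0| <= dl -> `|s - t0| <= dl ->
    h != 0 -> k != 0 -> `|h| <= dl -> `|k| <= dl -> `|quo t h - quo s k| <= e.
Proof.
move=> /DE ht0 e0; have [dl dl0 hdl] := local_slopes ht0 e0.
exists (dl / 2); first by rewrite divr_gt0.
have half : dl / 2 <= dl by lra.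
have slope t h : D t -> D (t + h) -> `|t - t0| <= dl / 2 -> h != 0 -> `|h| <= dl / 2 ->
    exists a c, [/\ 0 <= a, a < c, c < T1, `|a - t0| <= dl & `|c - t0| <= dl]
      /\ quo t h = (b c - b a) / (c - a).
  move=> /DE/andP[t1 t2] /DE/andP[t3 t4] td h0 hd.
  have thd : `|t + h - t0| <= dl.
    rewrite addrAC; apply: (le_trans (ler_normD _ _)).
    by rewrite [leRHS](_ : dl = dl / 2 + dl / 2); [exact: lerD|lra].
  have td' := le_trans td half.
  have [hlt|hgt|h00] := ltgtP h 0; last by rewrite h00 eqxx in h0.
    exists (t + h), t; split; first by split; rewrite // gtrDl.
    by rewrite /quo -[b t - _]opprB -[t - _]opprB [t + h - t]addrAC subrr add0r invrN mulrNN mulrC.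
  exists t, (t + h); split; first by split; rewrite // ltrDl.
  by rewrite /quo [t + h - t]addrAC subrr add0r mulrC.
move=> t h s k Dt Dth Ds Dsk td sd h0 k0 hd kd.
have [a [c [[a1 a2 a3 a4 a5] ->]]] := slope t h Dt Dth td h0 hd.
have [a' [c' [[a1' a2' a3' a4' a5'] ->]]] := slope s k Ds Dsk sd k0 kd.
exact: hdl.
Qed.

Lemma small_increment t n : D t -> 0 < n -> exists h, [/\ 0 < h, h < n & D (t + h)].
Proof.
move=> /DE/andP[t1 t2] n0; exists (Num.min (n / 2) ((T1 - t) / 2)).
have m0 : 0 < Num.min (n / 2) ((T1 - t) / 2) by rewrite lt_min !divr_gt0// subr_gt0.
split => //; first by apply: (@le_lt_trans _ _ (n / 2)); [rewrite ge_min lexx|lra].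
apply/DE; rewrite addr_ge0 ?(ltW m0)//= -ltrBrDl.
apply: (@le_lt_trans _ _ ((T1 - t) / 2)); first by rewrite ge_min lexx orbT.
by rewrite ltr_pdivrMr// ltr_pMr ?subr_gt0// ltr1n.
Qed.

Lemma derivative_exists t : D t -> exists l, is_derive_within D b t l.
Proof.
move=> Dt; pose F := within [set h | D (t + h)] (0 : R)^'.
have pF : ProperFilter F.
  apply: Build_ProperFilter_ex => Q [n /= n0 hn].
  have [h [h0 hlt Dh]] := small_increment Dt n0.
  exists h; apply: hn => //=; last by rewrite gt_eqF.
  by rewrite sub0r normrN gtr0_norm.
have cF : cauchy (quo t @ F).
  apply: cauchy_exP => e e0; have e2 : 0 < e / 2 by rewrite divr_gt0.
  have [n n0 hn] := local_quotients Dt e2.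
  have [k [k0 klt Dk]] := small_increment Dt n0.
  exists (quo t k); exists n => // h /=; rewrite sub0r normrN => hlt h0 Dh.
  rewrite /ball /=; apply: (@le_lt_trans _ _ (e / 2)); last by rewrite ltr_pdivrMr// ltr_pMr// ltr1n.
  by apply: (hn t k t h) => //; rewrite ?subrr ?normr0 ?(ltW n0) ?(ltW hlt) ?gt_eqF ?(gtr0_norm k0) ?(ltW klt).
by exists (lim (quo t @ F)); exact: (@cauchy_cvg R (quo t @ F)).
Qed.

(** [local_quotients] compares difference quotients at distinct points, so it gives the Cauchy
    criterion at a point and, in the limit of short steps, the continuity of the derivative. *)
Lemma boundary_C1 : C1_on D b.
Proof.
have der t : exists l, D t -> is_derive_within D b t l.
  have [Dt|nDt] := pselect (D t); last by exists 0.
  by have [l hl] := derivative_exists Dt; exists l.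
have [f' hf'] := choice der.
exists f'; split => // .
have approx t e n : D t -> 0 < e -> 0 < n -> exists h, [/\ 0 < h, h < n, D (t + h) & `|quo t h - f' t| <= e].
  move=> Dt e0 n0; have := hf' t Dt; rewrite /is_derive_within => /cvgrPdist_le/(_ e e0).
  move=> [k /= k0 hk]; have m0 : 0 < Num.min n k by rewrite lt_min n0.
  have [h [h0 + Dh]] := small_increment Dt m0; rewrite lt_min => /andP[hn hlt].
  exists h; split => //; rewrite distrC; apply: hk => //=; last by rewrite gt_eqF.
  by rewrite sub0r normrN gtr0_norm.
apply: subspace_continuousPe => t Dt e e0.
have e4 : 0 < e / 4 by rewrite divr_gt0.
have [n n0 hn] := local_quotients Dt e4.
exists n => // s Ds st.
have [h [h0 hlt Dh hq]] := approx t _ _ Dt e4 n0.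
have [k [k0 klt Dk kq]] := approx s _ _ Ds e4 n0.
have q : `|quo s k - quo t h| <= e / 4.
  apply: (hn s k t h) => //; rewrite ?subrr ?normr0 ?(ltW n0) ?gt_eqF ?(gtr0_norm k0) ?(gtr0_norm h0) ?(ltW klt) ?(ltW hlt)//.
  exact: ltW.
move: hq kq q; move: (quo t h) (quo s k) (f' t) (f' s) => a1 a2 a3 a4.
rewrite !ler_norml ltr_norml => /andP[? ?] /andP[? ?] /andP[? ?].
by apply/andP; split; lra.
Qed.

End final.

Theorem theorem2p4
  (R : realType) (d : measure_display) (Omega : measurableType d)
  (P : probability Omega R) (hP : measure_is_complete P)
  (B : R -> Omega -> R) (hB : brownian_motion P B)
  (T : \bar R) (hT : (0 < T)%E)
  (I : set R) (hIopen : open I) (hIitv : is_interval I)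
  (mu : R * R -> R) (sigma : R -> R) (hsigma : forall x, I x -> 0 < sigma x)
  (X : R -> R -> R -> Omega -> R)
  (hX : forall t x, times T t -> I x ->
     unique_strong_solution P B T I mu sigma t x (X t x))
  (hXmarkov : markov_family P T I X)
  (r g : R * R -> R)
  (hr : {within times T `*` setT, continuous r})
  (hg : {within times T `*` setT, continuous g})
  (hwp : well_posed P T I r g X)
  (hv : {within times T `*` I, continuous (value P T r g X)})
  (b : R -> R)
  (hbI : forall t, times T t -> I (b t))
  (hb : {within times T, continuous b})
  (hopt : forall t x, times T t -> I x ->
     optimal P T r g X t x (tau_star T b X t x))
  (hC : [set p | (times_before T `*` I) p /\ g p < value P T r g X p]
        = [set p | (times_before T `*` I) p /\ b p.1 < p.2])
  (hA : assumption_A T I mu sigma r g (value P T r g X) b)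
  (T1 : R) (hT1 : 0 < T1) (hT1T : (T1%:E < T)%E)
  (hLip : exists L : R, L.-lipschitz_(`[0, T1]) b) :
  C1_on `[0, T1[ b.
Proof.
have [L hL] := hLip.
(* The Lipschitz condition puts no sign on its constant, so the absolute value is used. *)
apply: (@boundary_C1 _ _ _ P B T I mu sigma X r g b) (normr_ge0 L) _ => //.
move=> u v hu hv'; apply: (le_trans (hL (u, v) _)); first by split; rewrite /= in_itv.
by rewrite ler_wpM2r ?ler_norm.
Qed.
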